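(* For every $t\ge 0$ and every $x\in\mathbb{R}$, $$U_N(t,x)\to U(t,x),\qquad N\to\infty,$$ almost surely, where $$U(t,x)=\int_{\mathbb{R}}\rho(t,x-y)U_0(y)\,dy+\int_0^t dZ(s)\int_{\mathbb{R}}\rho(t-s,x-y)\sigma(s,y)\,dy$$ is the mild solution of the Cauchy problem $$d_tU(t,x)=\tfrac12\frac{\partial^2}{\partial x^2}U(t,x)\,dt+\sigma(t,x)\,dZ(t),\quad t>0,\ x\in\mathbb{R},\qquad U(0,x)=U_0(x),$$ and $$U_N(t,x)=\int_{\mathbb{R}}\rho(t,x-y)U_0(y)\,dy+\int_0^t dZ_N(s)\int_{\mathbb{R}}\rho(t-s,x-y)\sigma(s,y)\,dy,\qquad N\ge1.$$ The integrals with respect to $Z$ and $Z_N$ are pathwise fractional integrals, and for $t=0$ one sets $U(0,x)=U_N(0,x)=U_0(x)$.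
   Context: Parameters: $\alpha\in(1,2)$, $H\in(1/2,1)$, $\gamma\in(1/2,1)$, $\eta>0$. Coefficients: $U_0:\mathbb{R}\to\mathbb{R}$ is bounded and measurable; $\sigma:[0,\infty)\times\mathbb{R}\to\mathbb{R}$ is bounded and, for some constant $C$, satisfies $|\sigma(t_1,x_1)-\sigma(t_2,x_2)|\le C(|t_1-t_2|^\gamma+|x_1-x_2|^\gamma)$ for all $t_1,t_2\ge 0$, $x_1,x_2\in\mathbb{R}$. Both are deterministic. The heat kernel is $\rho(t,x)=(2\pi t)^{-1/2}\exp\{-|x|^2/(2t)\}$, $t>0$, $x\in\mathbb{R}$. Kernel of the noise: $f(t,x)=\dfrac{e^{itx}-1}{|x|^{1/\alpha+H}}$ for $t\ge0$, $x\neq0$. LePage data: $\varphi(x)=K_\eta|x|^{-1}\bigl(\bigl|\log|x|\bigr|+1\bigr)^{-1-\eta}$, a probability density on $\mathbb{R}$ with normalizing constant $K_\eta$. The following three families are independent of each other: $\{\Gamma_k,k\ge1\}$, the sequence of arrival times of a Poisson process with unit intensity; $\{\xi_k,k\ge1\}$, independent random variables with density $\varphi$; $\{g_k,k\ge1\}$, independent complex-valued rotationally invariant (hence centered) Gaussian random variables with $\mathsf{E}[|\operatorname{Re}g_k|^\alpha]=1$. The probability space is assumed to be a product $(\Omega_\Gamma\otimes\Omega_\xi\otimes\Omega_g,\mathcal F_\Gamma\otimes\mathcal F_\xi\otimes\mathcal F_g,\mathsf P_\Gamma\otimes\mathsf P_\xi\otimes\mathsf P_g)$, with $\Gamma_k,\xi_k,g_k$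 depending only on the first, second and third coordinate, respectively. Put $C_\alpha=\left(\frac{1-\alpha}{\Gamma(2-\alpha)\cos(\pi\alpha/2)}\right)^{1/\alpha}$ (here $\Gamma(\cdot)$ is the gamma function). The process $Z$ (a real harmonizable fractional stable process with Hurst parameter $H$ and stability index $\alpha$) is given by its LePage series $$Z(t)=C_\alpha\operatorname{Re}\sum_{k\ge1}\Gamma_k^{-1/\alpha}\varphi(\xi_k)^{-1/\alpha}f(t,\xi_k)g_k,\qquad t\ge0,$$ where the series converges almost surely for every $t\ge0$. It has the same finite-dimensional distributions as $\operatorname{Re}\int_{\mathbb{R}}f(t,x)M(dx)$, where $M$ is a complex rotationally invariant symmetric $\alpha$-stable random measure on $\mathbb{R}$ with Lebesgue control measure. $Z$ has a continuous modification, and $Z$ itself is assumed to be continuous; it is known that its paths are almost surely locally Hölder continuous of any order in $(0,H)$. The approximations are $$Z_N(t)=C_\alpha\operatorname{Re}\sum_{k=1}^N\Gamma_k^{-1/\alpha}\varphi(\xi_k)^{-1/\alpha}f(t,\xi_k)g_k .$$ Fractional integral: for $\beta\in(0,1)$ and functions $p,q:[a,b]\to\mathbb{R}$, on $(a,b)$ let $$(D_{a+}^{\beta}p)(x)=\frac{1}{\Gamma(1-\beta)}\Bigl(\frac{p(x)}{(x-a)^\beta}+\beta\int_a^x\frac{p(x)-p(u)}{(x-u)^{1+\beta}}du\Bigr),$$ $$(D_{b-}^{1-\beta}q)(x)=\frac{1}{\Gamma(\beta)}\Bigl(\frac{q(x)}{(b-x)^{1-\beta}}+(1-\beta)\int_x^b\frac{q(x)-q(u)}{(u-x)^{2-\beta}}du\Bigr).$$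 If for some $\beta\in(0,1)$ these derivatives exist with $D_{a+}^\beta p\in L^1[a,b]$ and $D_{b-}^{1-\beta}q_{b-}\in L^\infty[a,b]$, where $q_{b-}(x)=q(x)-q(b)$, then the fractional integral is $\int_a^bp(x)\,dq(x)=-\int_a^b(D_{a+}^\beta p)(x)(D_{b-}^{1-\beta}q_{b-})(x)\,dx$. In the claim, for $t>0$, it is applied on $[0,t]$ with $p(s)=\int_{\mathbb{R}}\rho(t-s,x-y)\sigma(s,y)\,dy$ for $s<t$ and $p(t)=\sigma(t,x)$, and $q=Z$ or $q=Z_N$. *)

(* Defs.v *)
(* MathComp / MathComp-Analysis, over an arbitrary [R : realType]. *)
From HB Require Import structures.
From mathcomp Require Import all_boot all_order all_algebra finmap.
From mathcomp Require Import all_classical all_reals all_analysis.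
From mathcomp.real_closed Require Import complex.

Set Implicit Arguments.
Unset Strict Implicit.
Unset Printing Implicit Defensive.

Import Order.TTheory GRing.Theory Num.Theory.
Import numFieldNormedType.Exports.

Local Open Scope classical_set_scope.
Local Open Scope ring_scope.
Local Open Scope complex_scope.

Definition gamma_fun (R : realType) (z : R) : R :=
  \int[@lebesgue_measure R]_(x in `]0, +oo[) (x `^ (z - 1) * expR (- x)).

(** * Probability *)

Definition mutually_independent (R : realType) (d d' : measure_display)
    (T : measurableType d) (T' : measurableType d') (P : probability T R)
    (I : choiceType) (X : I -> T -> T') : Prop :=
  forall (J : {fset I}) (A : I -> set T'), (forall i, measurable (A i)) ->
    P (\bigcap_(i in [set` J]) (X i @^-1` A i)) =
    (\prod_(i <- J) P (X i @^-1` A i))%E.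

Definition has_density (R : realType) (d : measure_display)
    (T : measurableType d) (P : probability T R) (X : {RV P >-> R})
    (h : R -> R) : Prop :=
  forall A : set R, measurable A ->
    distribution P X A = (\int[@lebesgue_measure R]_(x in A) (h x)%:E)%E.

(* Poisson process of intensity [lambda], observed at times [t >= 0]. *)
Definition poisson_process (R : realType) (d : measure_display)
    (T : measurableType d) (P : probability T R) (lambda : R)
    (N : R -> T -> nat) : Prop :=
  [/\ forall t : R, 0 <= t -> measurable_fun [set: T] (N t),
      forall w, N 0 w = 0%N,
      forall w, (forall s t : R, 0 <= s -> s <= t -> (N s w <= N t w)%N) /\
                (forall t : R, 0 <= t -> \forall u \near t^'+, N u w = N t w),
      forall s : nat -> R, 0 <= s 0%N -> (forall i, s i <= s i.+1) ->
        mutually_independent P (fun i w => (N (s i.+1) w - N (s i) w)%N) &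
      forall s t : R, 0 <= s -> s < t -> forall k : nat,
        P [set w | (N t w - N s w)%N = k] =
        (poisson_pmf (lambda * (t - s)) k)%:E].

(* Sequences are indexed from 0: [G k] is the (k+1)-st arrival time. *)
Definition poisson_arrival_times (R : realType) (d : measure_display)
    (T : measurableType d) (P : probability T R) (lambda : R)
    (G : nat -> T -> R) : Prop :=
  exists2 N : R -> T -> nat, poisson_process P lambda N &
    {ae P, forall w, forall k,
       G k w = inf [set t : R | 0 <= t /\ (k < N t w)%N]}.

(* Degenerate (constant) laws are Gaussian; [normal_prob] is only meaningful
   for a positive standard deviation. *)
Definition gaussian (R : realType) (d : measure_display)
    (T : measurableType d) (P : probability T R) (X : T -> R) : Prop :=
  exists m : R,
    {ae P, forall w, X w = m} \/
    (exists2 s : R, 0 < s & forall A : set R, measurable A ->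
       P (X @^-1` A) = normal_prob m s A).

(* [R[i]] carries no sigma-algebra in the library: complex random variables
   are handled through their real and imaginary parts. *)
Definition RtoR2 (R : realType) (z : R[i]) : R * R :=
  (complex.Re z, complex.Im z).

Definition complex_rv (R : realType) (d : measure_display)
    (T : measurableType d) (g : T -> R[i]) : Prop :=
  measurable_fun [set: T] (@RtoR2 R \o g).

Definition complex_gaussian (R : realType) (d : measure_display)
    (T : measurableType d) (P : probability T R) (g : T -> R[i]) : Prop :=
  forall a b : R,
    gaussian P (fun w => a * complex.Re (g w) + b * complex.Im (g w)).

Definition cis (R : realType) (theta : R) : R[i] := cos theta +i* sin theta.

Definition rotationally_invariant (R : realType) (d : measure_display)
    (T : measurableType d) (P : probability T R) (g : T -> R[i]) : Prop :=
  forall (theta : R) (A : set (R * R)), measurable A ->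
    P ((fun w => RtoR2 (cis theta * g w)) @^-1` A) =
    P ((fun w => RtoR2 (g w)) @^-1` A).

(** * The LePage series *)

Definition noise_kernel (R : realType) (alpha H t x : R) : R[i] :=
  (cis (t * x) - 1) / (`|x| `^ (alpha^-1 + H))%:C.

Definition phi_unnormalized (R : realType) (eta x : R) : R :=
  `|x|^-1 * (`|ln `|x| | + 1) `^ (- 1 - eta).

Definition K_norm (R : realType) (eta : R) : R :=
  (\int[@lebesgue_measure R]_x phi_unnormalized eta x)^-1.

Definition phi (R : realType) (eta x : R) : R :=
  K_norm eta * phi_unnormalized eta x.

Definition C_stable (R : realType) (alpha : R) : R :=
  ((1 - alpha) / (gamma_fun (2 - alpha) * cos (pi * alpha / 2))) `^ alpha^-1.

(* Partial sums of the series; the sample space is a product, and the three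
   families depend on one coordinate each. *)
Definition lepage_sum (R : realType) (T1 T2 T3 : Type) (alpha H eta : R)
    (G : nat -> T1 -> R) (xi : nat -> T2 -> R) (g : nat -> T3 -> R[i])
    (n : nat) (t : R) (w : T1 * T2 * T3) : R :=
  C_stable alpha * complex.Re (\sum_(k < n)
    (G k w.1.1 `^ (- alpha^-1) * phi eta (xi k w.1.2) `^ (- alpha^-1))%:C
      * noise_kernel alpha H t (xi k w.1.2) * g k w.2).

(** * Pathwise fractional integral *)

Definition left_fderiv (R : realType) (beta a : R) (p : R -> R) (x : R) : R :=
  (gamma_fun (1 - beta))^-1 *
  (p x / (x - a) `^ beta +
   beta * \int[@lebesgue_measure R]_(u in `]a, x[)
            ((p x - p u) / (x - u) `^ (1 + beta))).

Definition right_fderiv (R : realType) (beta b : R) (q : R -> R) (x : R) : R :=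
  (gamma_fun (1 - beta))^-1 *
  (q x / (b - x) `^ beta +
   beta * \int[@lebesgue_measure R]_(u in `]x, b[)
            ((q x - q u) / (u - x) `^ (1 + beta))).

(* Existence of the derivatives at every point of ]a, b[: the defining
   integrals, which default to 0 in the library, converge. *)
Definition left_fderivable (R : realType) (beta a b : R) (p : R -> R) : Prop :=
  forall x, a < x < b -> (@lebesgue_measure R).-integrable `]a, x[
    (fun u => ((p x - p u) / (x - u) `^ (1 + beta))%:E).

Definition right_fderivable (R : realType) (beta a b : R) (q : R -> R) : Prop :=
  forall x, a < x < b -> (@lebesgue_measure R).-integrable `]x, b[
    (fun u => ((q x - q u) / (u - x) `^ (1 + beta))%:E).

Definition essentially_bounded (R : realType) (D : set R) (h : R -> R) : Prop :=
  measurable_fun D h /\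
  exists M : R, {ae @lebesgue_measure R, forall x, D x -> `|h x| <= M}.

Definition frac_admissible (R : realType) (a b : R) (p q : R -> R)
    (beta : R) : Prop :=
  let qb x := q x - q b in
  [/\ 0 < beta < 1,
      left_fderivable beta a b p,
      right_fderivable (1 - beta) a b qb,
      (@lebesgue_measure R).-integrable `[a, b]
        (fun x => (left_fderiv beta a p x)%:E) &
      essentially_bounded `[a, b] (right_fderiv (1 - beta) b qb)].

Definition frac_integrable (R : realType) (a b : R) (p q : R -> R) : Prop :=
  exists beta, frac_admissible a b p q beta.

(* The order is any admissible one: for continuous [p] and [q] the value does
   not depend on it. Without an admissible order the value is meaningless, so
   it has to be used together with [frac_integrable]. *)
Definition frac_integral (R : realType) (a b : R) (p q : R -> R) : R :=
  let beta := xget 2^-1 [set beta | frac_admissible a b p q beta] in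
  - \int[@lebesgue_measure R]_(x in `[a, b])
      (left_fderiv beta a p x *
       right_fderiv (1 - beta) b (fun y => q y - q b) x).

(** * Mild solution *)

Definition heat_kernel (R : realType) (t x : R) : R :=
  (2 * pi * t) `^ (- 2^-1) * expR (- (`|x| ^+ 2) / (2 * t)).

Definition mild_integrand (R : realType) (sigma : R -> R -> R) (t x s : R) : R :=
  if s < t then
    \int[@lebesgue_measure R]_y (heat_kernel (t - s) (x - y) * sigma s y)
  else sigma t x.

(* Mild solution of dU = (1/2) U_xx dt + sigma dq, U(0, .) = U0, for a
   deterministic driving path [q]. *)
Definition mild_solution (R : realType) (U0 : R -> R) (sigma : R -> R -> R)
    (q : R -> R) (t x : R) : R :=
  if t == 0 then U0 x else
  \int[@lebesgue_measure R]_y (heat_kernel t (x - y) * U0 y)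
  + frac_integral 0 t (mild_integrand sigma t x) q.

(* Main.v *)
(** The partial sums Z_N are almost surely Hoelder of one order theta > 1/2 with
a constant that does not depend on N.  Conditionally on (Gamma_k, xi_k) their
increments are sums of independent centered Gaussian variables with variances at
most c Gamma_k^(-2/alpha) |s - r|^(2H'), H' < H, and sum_k Gamma_k^(-2/alpha) is
finite because alpha < 2; Moricz's maximal inequality for high moments and dyadic
chaining give the uniform Hoelder constant.  Hence Z obeys the same bound,
Z_N -> Z pointwise, and the right derivatives of order 1/2 converge boundedly.
Since gamma > 1/2, the integrand has an integrable left derivative of order 1/2,
and dominated convergence settles the integrals of order 1/2.

The integral may however be computed with any admissible order, so its value has
to be independent of the order: it is the limit, as e -> 0, of
  e^-1 int_0^t p(s) (q(min(s + e, t)) - q(s)) ds.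
This rests on the duality Gamma(b) int p f = int (D^b p) (adj f) for bounded f,
where adj f y = int_{x > y} (x - y)^(b-1) f x dx.  When D^b p is only integrable,
the inequality Gamma(b) p <= sup_k I^b v_k, for an increasing sequence of bounded
functions v_k that eventually dominates D^b p near each point and is almost equal
to it in L^1 (Vitali-Caratheodory), follows from a maximum principle: at a minimum
of I^b v_k - Gamma(b) p the truncated Marchaud derivative has a sign. *)
Require Import Defs.
From HB Require Import structures.
From mathcomp Require Import all_boot all_order all_algebra finmap.
From mathcomp Require Import all_classical all_reals all_analysis.
From mathcomp.real_closed Require Import complex.
From mathcomp Require Import measurable_realfun ring lra.

Set Implicit Arguments.
Unset Strict Implicit.
Unset Printing Implicit Defensive.

Import Order.TTheory GRing.Theory Num.Theory.
Import numFieldNormedType.Exports.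

Local Open Scope classical_set_scope.
Local Open Scope ring_scope.

(** An admissible order only provides a derivative that exists at every point of the interval and is
    integrable; nothing says that [p] is its fractional integral. Recovering [p] is the analogue of
    integrating back an everywhere finite, integrable derivative: existence almost everywhere would
    leave room for a singular part, as for the fractional integral of a singular measure. This is
    why a maximum principle at a single point enters. The other factor has a bounded derivative, so
    that the duality inverts it outright; fractional integrals of orders [b] and [1 - b] compose to
    an ordinary primitive, and increments of [q] become difference quotients. The order 1/2 suits
    both factors: it lies below [gamma], and its complement, again 1/2, lies below the Hoelder
    exponent of the paths. The series converges at each time outside a null set that depends on the
    time; this is used at dyadic times only, and the uniform Hoelder constant carries it to all
    times. The law of the [g k] enters through a crude exponential moment bound whose constant comes
    from the normalised absolute moment. *)

Section lebesgue_integral_toolbox.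
Context {R : realType}.
Notation mu := (@lebesgue_measure R).
Implicit Types (f : R -> \bar R) (h : R * R -> R).

(** * Lebesgue integrals on the line: affine substitution, Fubini and Tonelli for real integrands *)

Lemma measurable_affine (a b : R) : measurable_fun setT (fun x : R => a * x + b).
Proof. by apply: measurable_funD => //; exact: measurable_funM. Qed.

(** By uniqueness of Lebesgue measure it suffices to compare the rescaled image measure on the
    intervals []c, d]]. For negative [a] the preimage is closed on the left instead, with the same
    length. *)
Lemma lebesgue_measure_affine (a b : R) (A : set R) : a != 0 -> measurable A ->
  mu A = (`|a|%:E * mu ((fun x : R => (a * x + b)%R) @^-1` A))%E.
Proof.
move=> a0 mA.
have na : 0 <= `|a| by [].
pose m := mscale (NngNum na) (pushforward mu (fun x : R => a * x + b : measurableTypeR R)).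
have -> : (`|a|%:E * mu ((fun x : R => (a * x + b)%R) @^-1` A))%E = m (measurable_affine a b) A by [].
apply: (lebesgue_measure_unique (mu := m (measurable_affine a b))) => //.
move=> _ [[c d] _ <-] /=.
change (mu `]c, d]%classic = (`|a|%:E * mu ((fun x : R => (a * x + b)%R) @^-1` `]c, d]%classic))%E).
have [agt|alt|a00] := ltgtP 0 a; last by rewrite -a00 eqxx in a0.
- have -> : (fun x : R => a * x + b) @^-1` `]c, d]%classic = [set` `](c - b) / a, (d - b) / a]].
    apply/seteqP; split => x /=; rewrite !in_itv/= ltr_pdivrMr// ler_pdivlMr// ltrBlDr lerBrDr (mulrC x)//.
  rewrite !lebesgue_measure_itv/= !lte_fin ltr_pM2r ?invr_gt0// ltrD2r.
  case: ifPn => cd; last by rewrite mule0.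
  rewrite -EFinB -EFinB -EFinM gtr0_norm// -mulrBl mulrC divfK ?gt_eqF//.
  by congr EFin; rewrite opprB addrA subrK.
- have -> : (fun x : R => a * x + b) @^-1` `]c, d]%classic = [set` `[(d - b) / a, (c - b) / a[].
    apply/seteqP; split => x /=; rewrite !in_itv/= ltr_ndivlMr// ler_ndivrMr// ltrBlDr lerBrDr (mulrC x) andbC//.
  rewrite !lebesgue_measure_itv/= !lte_fin ltr_nM2r ?invr_lt0// ltrD2r.
  case: ifPn => cd; last by rewrite mule0.
  rewrite -EFinB -EFinB -EFinM ltr0_norm// -mulrBl mulNr mulrC divfK ?lt_eqF//.
  by congr EFin; rewrite !opprB addrA subrK.
Qed.

Lemma ge0_integral_affine (a b : R) f : a != 0 -> measurable_fun setT f ->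
  (forall x, 0 <= f x)%E ->
  (\int[mu]_x f (a * x + b)%R = (`|a|^-1)%:E * \int[mu]_x f x)%E.
Proof.
move=> a0 mf f0.
have na : 0 <= `|a| by [].
have mp := measurable_affine a b.
pose m := mscale (NngNum na) (pushforward mu (fun x : R => a * x + b : measurableTypeR R)).
have -> : (\int[mu]_x f x = \int[m mp]_x f x)%E.
  by apply: eq_measure_integral => A mA _; exact: lebesgue_measure_affine.
rewrite ge0_integral_mscale//=.
rewrite ge0_integral_pushforward// preimage_setT muleA -EFinM mulVf ?normr_eq0// mul1e.
by apply: eq_integral.
Qed.

(** Positive and negative parts are transformed separately. Multiplication by [|a|^-1] keeps an
    infinite part infinite, so that both sides take the default value 0 together. *)
Lemma Rintegral_affine (a b : R) (g : R -> R) : a != 0 -> measurable_fun setT g ->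
  \int[mu]_x g (a * x + b) = `|a|^-1 * \int[mu]_x g x.
Proof.
move=> a0 mg; rewrite /Rintegral.
rewrite integralE [in RHS]integralE.
have mg' : measurable_fun setT (EFin \o g) by exact/measurable_EFinP.
have e1 : (\int[mu]_x ((fun x0 : R => (g (a * x0 + b)%R)%:E)^\+ x) = (`|a|^-1)%:E * \int[mu]_x ((EFin \o g)^\+ x))%E.
  rewrite -(@ge0_integral_affine a b (EFin \o g)^\+%E a0)//.
    apply: eq_integral => x _.
    by rewrite !funeposE.
  exact: measurable_funepos.
have e2 : (\int[mu]_x ((fun x0 : R => (g (a * x0 + b)%R)%:E)^\- x) = (`|a|^-1)%:E * \int[mu]_x ((EFin \o g)^\- x))%E.
  rewrite -(@ge0_integral_affine a b (EFin \o g)^\-%E a0)//.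
    by apply: eq_integral => x _; rewrite !funenegE.
  exact: measurable_funeneg.
rewrite e1 e2.
have ap : (0 < `|a|^-1)%R by rewrite invr_gt0 normr_gt0.
rewrite /=; set P := (\int[mu]_x _)%E; set Q := (\int[mu]_x _)%E.
have P0 : (0 <= P)%E by exact: integral_ge0.
have Q0 : (0 <= Q)%E by exact: integral_ge0.
have ay : (`|a|^-1%:E * +oo = +oo :> \bar R)%E by rewrite gt0_muley// lte_fin.
move: P Q P0 Q0 => [P| |] [Q| |] //= P0 Q0; rewrite ?ay /= ?mulr0//.
by rewrite mulrBr.
Qed.

Lemma measurable_fun_Rintegral2 h : measurable_fun setT h ->
  measurable_fun setT (fun x => \int[mu]_y h (x, y)).
Proof.
move=> mh; have mh' : measurable_fun setT (EFin \o h) by exact/measurable_EFinP.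
apply: (measurableT_comp (@fine_measurable _ _ _)) => //.
under eq_fun do rewrite integralE.
apply: emeasurable_funB.
- rewrite [X in measurable_fun _ X](_ : _ = fubini_F mu (EFin \o h)^\+%E); last first.
    by apply/funext => x; apply: eq_integral => y _; rewrite !funeposE.
  by apply: measurable_fun_fubini_tonelli_F => //; exact: measurable_funepos.
- rewrite [X in measurable_fun _ X](_ : _ = fubini_F mu (EFin \o h)^\-%E); last first.
    by apply/funext => x; apply: eq_integral => y _; rewrite !funenegE.
  by apply: measurable_fun_fubini_tonelli_F => //; exact: measurable_funeneg.
Qed.

(** The inner real integrals agree with the extended ones where the section is integrable, which is
    almost everywhere; hence the detour through almost everywhere equality on both sides. *)
Lemma Rintegral_fubini h : measurable_fun setT h ->
  (\int[mu]_x \int[mu]_y `|h (x, y)|%:E < +oo)%E ->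
  \int[mu]_x \int[mu]_y h (x, y) = \int[mu]_y \int[mu]_x h (x, y).
Proof.
move=> mh hfin; have mh' : measurable_fun setT (EFin \o h) by exact/measurable_EFinP.
have ih : (mu \x mu)%E.-integrable setT (EFin \o h) by apply/integrable12ltyP.
rewrite /Rintegral; congr fine.
transitivity (\int[mu]_x \int[mu]_y (h (x, y))%:E)%E.
  apply: ae_eq_integral => //.
  - by apply/measurable_EFinP; exact: (measurable_fun_Rintegral2 mh).
  - exact: (measurable_fubini_F ih).
  - have := ae_integrable1 ih; apply: filterS => x ix _ /=.
    by rewrite fineK//; exact: integrable_fin_num.
etransitivity; first exact: (Fubini ih).
apply: ae_eq_integral => //.
- exact: (measurable_fubini_G ih).
- apply/measurable_EFinP.
  have mh2 : measurable_fun setT (fun z : R * R => h (z.2, z.1)).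
    by apply: (measurableT_comp mh); exact: measurable_swap.
  exact: (measurable_fun_Rintegral2 mh2).
- have := ae_integrable2 ih; apply: filterS => x ix _ /=.
  by rewrite fineK//; exact: integrable_fin_num.
Qed.

Lemma lebesgue_tonelli (F : R -> R -> \bar R) :
  measurable_fun setT (fun z : R * R => F z.1 z.2) -> (forall x y, 0 <= F x y)%E ->
  (\int[mu]_x \int[mu]_y F x y = \int[mu]_y \int[mu]_x F x y)%E.
Proof.
move=> mF F0; have F0' z : (0 <= (fun z : R * R => F z.1 z.2) z)%E by exact: F0.
have := fubini_tonelli (m1 := mu) (m2 := mu) _ mF F0'.
exact.
Qed.

Lemma measurable_lebesgue_integral2 (F : R -> R -> \bar R) :
  measurable_fun setT (fun z : R * R => F z.1 z.2) -> (forall x y, 0 <= F x y)%E ->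
  measurable_fun setT (fun x => \int[mu]_y F x y)%E.
Proof.
move=> mF F0; have F0' z : (0 <= (fun z : R * R => F z.1 z.2) z)%E by exact: F0.
exact: (measurable_fun_fubini_tonelli_F (m2 := mu) _ mF F0').
Qed.

Lemma measurable_invr d (T : measurableType d) (D : set T) (h' : T -> R) :
  measurable_fun D h' -> measurable_fun D (fun x => (h' x)^-1).
Proof.
(* The identity also holds where [h'] vanishes, since the inverse of 0 is 0; it reduces the claim to
   a real power of a square. *)
move=> mh; have -> : (fun x => (h' x)^-1) = (fun x => h' x * (h' x ^+ 2) `^ (-1)).
  apply/funext => x; rewrite powR_inv1 ?sqr_ge0// expr2 invfM mulrA.
  by have [->|x0] := eqVneq (h' x) 0; rewrite ?invr0 ?mul0r// divff// mul1r.
apply: measurable_funM => //.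
apply: (measurableT_comp (@measurable_powR _ _)).
exact: measurable_funX.
Qed.

Lemma integral_EFinZ (k : R) (f g : R -> R) : 0 <= k -> measurable_fun setT f ->
  (forall x, 0 <= f x) -> (forall x, g x = k * f x) ->
  (\int[mu]_x (g x)%:E = k%:E * \int[mu]_x (f x)%:E)%E.
Proof.
move=> k0 mf f0 gE.
transitivity (\int[mu]_x (k%:E * (f x)%:E))%E.
  by apply: eq_integral => x _; rewrite gE EFinM.
apply: ge0_integralZl_EFin => //.
- by move=> x _; rewrite lee_fin.
- by apply/measurable_EFinP.
Qed.

Lemma le_integral_EFin (f g : R -> R) : measurable_fun setT f -> measurable_fun setT g ->
  (forall x, 0 <= f x <= g x) -> (\int[mu]_x (f x)%:E <= \int[mu]_x (g x)%:E)%E.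
Proof.
move=> mf mg fg; apply: ge0_le_integral => //.
- by move=> x _; rewrite lee_fin; have /andP[] := fg x.
- by apply/measurable_EFinP.
- by apply/measurable_EFinP.
- by move=> x _; rewrite lee_fin; have /andP[] := fg x.
Qed.

Lemma integral_EFinD (f g h : R -> R) : measurable_fun setT f -> measurable_fun setT g ->
  (forall x, 0 <= f x) -> (forall x, 0 <= g x) -> (forall x, h x = f x + g x) ->
  (\int[mu]_x (h x)%:E = \int[mu]_x (f x)%:E + \int[mu]_x (g x)%:E)%E.
Proof.
move=> mf mg f0 g0 hE.
transitivity (\int[mu]_x ((f x)%:E + (g x)%:E))%E.
  by apply: eq_integral => x _; rewrite hE EFinD.
apply: ge0_integralD => //.
- by move=> x _; rewrite lee_fin.
- by apply/measurable_EFinP.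
- by move=> x _; rewrite lee_fin.
- by apply/measurable_EFinP.
Qed.

Lemma integral_EFin_indic (D : set R) (f : R -> R) :
  (\int[mu]_(x in D) (f x)%:E = \int[mu]_x (f x * \1_D x)%:E)%E.
Proof.
rewrite integral_mkcond; apply: eq_integral => x _; rewrite patchE indicE.
by case: ifPn; rewrite ?mulr1 ?mulr0.
Qed.

Lemma Rintegral_indic (D : set R) (f : R -> R) :
  \int[mu]_(x in D) f x = \int[mu]_x (f x * \1_D x).
Proof. by rewrite /Rintegral integral_EFin_indic. Qed.

Lemma indic_itv (i : interval R) x : \1_[set` i] x = (x \in i)%:R :> R.
Proof. by rewrite indicE mem_setE. Qed.

End lebesgue_integral_toolbox.

(** * The fundamental theorem of calculus for nonnegative integrands with endpoint singularities *)

Section fundamental_theorem.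
Context {R : realType}.
Notation mu := (@lebesgue_measure R).

(** Monotone convergence along an exhaustion by compact intervals: the integrand may blow up at
    either endpoint as long as the antiderivative has one-sided limits there. *)
Lemma ge0_FTC_itvoo (f F : R -> R) (a b A B : R) : a < b ->
  (forall x, a < x < b -> 0 <= f x) ->
  (forall x, a < x < b -> {for x, continuous f}) ->
  (forall x, a < x < b -> is_derive x (1 : R) F (f x)) ->
  F x @[x --> a^'+] --> A -> F x @[x --> b^'-] --> B ->
  (\int[mu]_(x in `]a, b[) (f x)%:E = (B - A)%:E)%E.
Proof.
move=> ab f0 cf dF FA FB.
(* The denominators start at 3 so that [a + e n < b - e n] already for the first [n]. *)
pose e n := (b - a) / n.+3%:R.
have ba : 0 < b - a by rewrite subr_gt0.
have e0 n : 0 < e n by rewrite divr_gt0.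
have ele n : e n <= (b - a) / 3.
  by rewrite ler_pM2l// lef_pV2 ?posrE// ler_nat.
have emono n m : (n <= m)%N -> e m <= e n.
  by move=> nm; rewrite ler_pM2l// lef_pV2 ?posrE// ler_nat !ltnS.
have eto : e n @[n --> \oo] --> (0 : R).
  rewrite -[X in _ --> X](mulr0 (b - a)).
  apply: cvgMr.
  have := @cvg_harmonic R; rewrite -(cvg_shiftn 2) => h.
  by under eq_fun do rewrite -addn2.
pose I n : set R := [set` Interval (BLeft (a + e n)) (BRight (b - e n))].
have IP n x : I n x <-> a + e n <= x /\ x <= b - e n.
  by rewrite /I/= in_itv/=; split => [/andP[]|[-> ->]].
have IE : \bigcup_n I n = `]a, b[%classic.
  apply/seteqP; split => [x [n _]|x] /=; rewrite !in_itv/=.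
    by move=> /IP[h1 h2]; have := e0 n; move=> ?; apply/andP; split; lra.
  move=> /andP[ax xb].
  have m0 : 0 < Num.min (x - a) (b - x) by rewrite lt_min !subr_gt0 ax xb.
  move/cvgrPdist_lt : eto => /(_ _ m0) [n _ /(_ n (leqnn n))]/=.
  rewrite sub0r normrN gtr0_norm// lt_min => /andP[h1 h2].
  by exists n => //; apply/IP; split; lra.
have sub n x : a + e n <= x -> x <= b - e n -> a < x < b.
  by move=> h1 h2; have := e0 n; move=> ?; apply/andP; split; lra.
have mf : measurable_fun (\bigcup_n I n) f.
  rewrite IE; apply: open_continuous_measurable_fun => // x; rewrite inE/= in_itv/=.
  exact: cf.
have intI n : (\int[mu]_(x in I n) (f x)%:E = (F (b - e n) - F (a + e n))%:E)%E.
  rewrite EFinB; apply: continuous_FTC2.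
  - by have := ele n; move: ba; lra.
  - apply: continuous_in_subspaceT => x; rewrite inE/= in_itv/= => /andP[h1 h2].
    exact: cf (sub _ _ h1 h2).
  - split.
    + move=> x; rewrite in_itv/= => /andP[/ltW h1 /ltW h2].
      by have [] := dF x (sub _ _ h1 h2).
    + have h : a < a + e n < b by have := ele n; have := e0 n; move: ba => ? ? ?; apply/andP; split; lra.
      have [/derivable1_diffP/differentiable_continuous c _] := dF _ h.
      exact: cvg_at_right_filter c.
    + have h : a < b - e n < b by have := ele n; have := e0 n; move: ba => ? ? ?; apply/andP; split; lra.
      have [/derivable1_diffP/differentiable_continuous c _] := dF _ h.
      exact: cvg_at_left_filter c.
  - move=> x; rewrite in_itv/= => /andP[/ltW h1 /ltW h2].
    have d := dF x (sub _ _ h1 h2).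
    by rewrite derive1E; exact: derive_val.
have c1 : (\int[mu]_(x in I n) (f x)%:E)%E @[n --> \oo] --> (\int[mu]_(x in `]a, b[) (f x)%:E)%E.
  rewrite -IE; apply: ge0_nondecreasing_set_cvg_integral.
  - move=> n m nm; apply/subsetPset => x /IP[h1 h2]; apply/IP.
    by have := emono _ _ nm; move=> ?; split; lra.
  - by move=> i; exact: measurable_itv.
  - move=> i; apply/measurable_EFinP; apply: measurable_funS mf => //.
      by apply: bigcup_measurable => k _; exact: measurable_itv.
    by move=> x Ix; exists i.
  - move=> i x /IP[h1 h2]; rewrite lee_fin f0//.
    exact: sub h1 h2.
have c2 : (\int[mu]_(x in I n) (f x)%:E)%E @[n --> \oo] --> (B - A)%:E.
  under eq_fun do rewrite intI.
  apply: cvg_EFin; first exact: nearW.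
  have cb : b - e n @[n --> \oo] --> b.
    by rewrite -[X in _ --> X]subr0; apply: cvgB => //; exact: cvg_cst.
  have ca : a + e n @[n --> \oo] --> a.
    by rewrite -[X in _ --> X]addr0; apply: cvgD => //; exact: cvg_cst.
  apply: cvgB.
    by move/cvg_at_leftP : FB; apply; split => // n; rewrite ltrBlDr ltrDl.
  by move/cvg_at_rightP : FA; apply; split => // n; rewrite ltrDl.
exact: (cvg_unique _ c1 c2).
Qed.

End fundamental_theorem.

(** * The kernel of fractional integration, gamma and beta integrals *)

Section riesz_kernel.
Context {R : realType}.
Notation mu := (@lebesgue_measure R).
Implicit Types b s x : R.

(** The Riemann-Liouville kernel of order [b] without the factor [1 / gamma_fun b]. The cut-off at 0
    encodes the range of integration, so that fractional integrals become convolutions on the whole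
    line. *)
Definition riesz b s : R := if 0 < s then s `^ (b - 1) else 0.

Lemma riesz_ge0 b s : 0 <= riesz b s.
Proof. by rewrite /riesz; case: ifP => // _; exact: powR_ge0. Qed.

Lemma rieszE b s : 0 < s -> riesz b s = s `^ (b - 1).
Proof. by rewrite /riesz => ->. Qed.

Lemma riesz_le0 b s : s <= 0 -> riesz b s = 0.
Proof. by rewrite /riesz ltNge => ->. Qed.

Lemma gt0_powRD x a b : 0 < x -> x `^ (a + b) = x `^ a * x `^ b.
Proof. by move=> x0; rewrite powRD// (gt_eqF x0) implybT. Qed.

Lemma measurable_riesz b : measurable_fun setT (riesz b).
Proof.
apply: measurable_fun_ifT => //.
exact: measurable_fun_ltr.
Qed.

Lemma continuous_powR_gt0 b x : 0 < x -> {for x, continuous (fun s => s `^ b)}.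
Proof.
move=> x0; have [d _] := is_derive1_powR b x0.
exact/differentiable_continuous/derivable1_diffP.
Qed.

Lemma integral_riesz b x : 0 < b -> 0 <= x ->
  (\int[mu]_(s in `]0%R, x[) (s `^ (b - 1))%:E = (x `^ b / b)%:E)%E.
Proof.
move=> b0; rewrite le_eqVlt => /predU1P[<-|x0].
  by rewrite set_itv_ge ?integral_set0 ?bnd_simp// powR0 ?gt_eqF// mul0r.
have d s : 0 < s < x -> is_derive s (1 : R) (fun s => s `^ b / b) (s `^ (b - 1)).
  move=> /andP[s0 _]; have d := is_derive1_powR b s0.
  have e : b^-1 *: (b * s `^ (b - 1)) = s `^ (b - 1).
    by rewrite /GRing.scale /= mulKf// gt_eqF.
  rewrite -e; have := is_deriveZ b^-1 d.
  by rewrite (_ : b^-1 \*: _ = fun s => s `^ b / b)//; apply/funext => y; rewrite /= mulrC.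
rewrite -[in RHS](subr0 (x `^ b / b)).
apply: (ge0_FTC_itvoo x0 _ _ d).
- by move=> s _; exact: powR_ge0.
- by move=> s /andP[s0 _]; exact: continuous_powR_gt0.
- rewrite -[X in _ --> X](mul0r b^-1); apply: cvgMl; exact: powR_cvg0.
- apply: cvgMl; apply: cvg_at_left_filter; exact: continuous_powR_gt0.
Qed.

(** The gamma integral is kept as an extended real because its finiteness comes only in
    [egamma_fin], from the finiteness of a product. *)
Definition egamma b : \bar R := (\int[mu]_s (riesz b s * expR (- s))%:E)%E.

Lemma egamma_ge0 b : (0 <= egamma b)%E.
Proof.
by apply: integral_ge0 => s _; rewrite lee_fin mulr_ge0 ?riesz_ge0 ?expR_ge0.
Qed.

Lemma gamma_funE b : gamma_fun b = fine (egamma b).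
Proof.
rewrite /gamma_fun Rintegral_mkcond /Rintegral; congr fine.
apply: eq_integral => s _; congr EFin; rewrite patchE mem_setE in_itv/= andbT /riesz.
by case: ifPn; rewrite ?mul0r.
Qed.

Lemma measurable_laplace b x : measurable_fun setT (fun s => riesz b s * expR (- (x * s))).
Proof.
apply: measurable_funM; first exact: measurable_riesz.
by do 2 apply: measurableT_comp => //.
Qed.

Lemma rieszM b x s : 0 < x -> riesz b (x * s) = x `^ (b - 1) * riesz b s.
Proof.
move=> x0; rewrite /riesz pmulr_rgt0//; case: ifPn => s0; last by rewrite mulr0.
by rewrite powRM// ltW.
Qed.

Lemma integral_laplace b x : 0 < x ->
  (\int[mu]_s (riesz b s * expR (- (x * s)))%:E = (x `^ (- b))%:E * egamma b)%E.
Proof.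
move=> x0.
pose f s := (riesz b s * expR (- s))%:E.
have mf : measurable_fun setT f.
  apply/measurable_EFinP; have := measurable_laplace b 1.
  by under eq_fun do rewrite mul1r.
have f0 s : (0 <= f s)%E by rewrite lee_fin mulr_ge0 ?riesz_ge0 ?expR_ge0.
have := ge0_integral_affine 0 (lt0r_neq0 x0) mf f0.
rewrite -/(egamma b) gtr0_norm// => e.
transitivity ((x `^ (1 - b))%:E * \int[mu]_s f (x * s + 0)%R)%E.
  rewrite -(ge0_integralZl_EFin _ _ _ _ (powR_ge0 x (1 - b)))//.
    apply: eq_integral => s _; rewrite /f addr0 -EFinM; congr EFin.
    rewrite rieszM// !mulrA -gt0_powRD//.
    by rewrite addrA subrK subrr powRr0 mul1r.
  apply: measurableT_comp => //; exact: measurable_affine.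
rewrite e muleA -EFinM; congr (_%:E * _)%E.
by rewrite -powR_inv1 ?ltW// -gt0_powRD//; congr powR; ring.
Qed.

Lemma egamma1 : egamma 1 = 1%E.
Proof.
rewrite -(@integral_exponential_pdf R 1 ltr01).
transitivity (\int[mu]_(x in `]0%R, +oo[) (exponential_pdf 1 x)%:E)%E.
  rewrite integral_mkcond; apply: eq_integral => x _.
  rewrite patchE mem_setE in_itv/= andbT /riesz; case: ifPn => x0; last by rewrite mul0r.
  by rewrite exponential_pdfE ?ltW// subrr powRr0 !mul1r mulN1r.
rewrite integral_itv_obnd_cbnd; last first.
  by apply/measurable_EFinP; apply: measurable_funTS; exact: measurable_exponential_pdf.
rewrite integral_mkcond; apply: eq_integral => x _.
rewrite patchE mem_setE in_itv/= andbT; case: ifPn => // ; rewrite -ltNge => x0.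
by rewrite lt0_exponential_pdf.
Qed.

(** This is the beta integral B(b, 1 - b), carried from ]0, 1[ to the half-line by substitution. It
    will be the total mass of the kernels [kap]. *)
Definition ebeta b : \bar R := (\int[mu]_s (riesz b s / (1 + s))%:E)%E.

Lemma measurable_resolvent b x : measurable_fun setT (fun s => riesz b s / (x + s)).
Proof.
apply: measurable_funM; first exact: measurable_riesz.
by apply: measurable_invr; exact: measurable_funD.
Qed.

Lemma resolvent_ge0 b x s : 0 <= x -> 0 <= riesz b s / (x + s).
Proof.
rewrite /riesz; case: ifPn => s0 x0; last by rewrite mul0r.
by rewrite divr_ge0 ?powR_ge0 ?addr_ge0 // ltW.
Qed.

(** For s > 0, 1 / (1 + s) is the integral of exp(- (1 + s) x) over x > 0. After Tonelli the
    integral in s is a Laplace transform of the kernel, and what remains in x is a gamma integral of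
    order 1 - b. *)
Lemma ebetaE b : ebeta b = (egamma b * egamma (1 - b))%E.
Proof.
pose F (z : R * R) := (riesz b z.1 * (riesz 1 z.2 * expR (- ((1 + z.1) * z.2))))%:E.
have mF : measurable_fun setT F.
  apply/measurable_EFinP; apply: measurable_funM.
    by apply: measurableT_comp; first exact: measurable_riesz.
  apply: measurable_funM; first by apply: measurableT_comp; first exact: measurable_riesz.
  apply: measurableT_comp => //; apply: measurableT_comp => //.
  by apply: measurable_funM => //; exact: measurable_funD.
have F0 z : (0 <= F z)%E by rewrite lee_fin !mulr_ge0 ?riesz_ge0 ?expR_ge0.
transitivity (\int[mu]_s \int[mu]_x F (s, x))%E.
  apply: eq_integral => s _; rewrite /F/=.
  under eq_integral do rewrite EFinM.
  rewrite ge0_integralZl_EFin//; last 3 first.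
  - by move=> x _; rewrite lee_fin mulr_ge0 ?riesz_ge0 ?expR_ge0.
  - by apply/measurable_EFinP; exact: measurable_laplace.
  - exact: riesz_ge0.
  have [s0|s0] := ltP 0 s; last by rewrite riesz_le0// mul0r mul0e.
  have s1 : 0 < 1 + s by rewrite addr_gt0.
  by rewrite integral_laplace// egamma1 mule1 -EFinM powR_inv1 ?ltW.
rewrite (lebesgue_tonelli (F := fun s x => F (s, x)))//.
transitivity (\int[mu]_x ((egamma b) * (riesz (1 - b) x * expR (- x))%:E))%E; last first.
  rewrite ge0_integralZl//.
  - apply/measurable_EFinP; have := measurable_laplace (1 - b) 1.
    by under eq_fun do rewrite mul1r.
  - by move=> x _; rewrite lee_fin mulr_ge0 ?riesz_ge0 ?expR_ge0.
  - exact: egamma_ge0.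
apply: eq_integral => x _.
have [x0|x0] := ltP 0 x; last first.
  rewrite [riesz (1 - b) x]riesz_le0// mul0r mule0.
  by apply: integral0_eq => y _; rewrite /F/= [riesz 1 x]riesz_le0// mul0r mulr0.
transitivity ((expR (- x))%:E * \int[mu]_y (riesz b y * expR (- (x * y)))%:E)%E.
  transitivity (\int[mu]_y (expR (- x) * (riesz b y * expR (- (x * y))))%:E)%E.
    apply: eq_integral => y _; rewrite /F/= [riesz 1 x]rieszE// subrr powRr0 mul1r.
    congr EFin; rewrite mulrCA; congr (_ * _).
    by rewrite -expRD; congr expR; ring.
  apply: (@integral_EFinZ _ _ (fun y => riesz b y * expR (- (x * y)))).
  - exact: expR_ge0.
  - exact: measurable_laplace.
  - by move=> y; rewrite mulr_ge0 ?riesz_ge0 ?expR_ge0.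
  - by [].
rewrite integral_laplace// rieszE// addrAC subrr add0r EFinM.
by rewrite muleA muleC; congr (_ * _)%E; exact: muleC.
Qed.

Lemma integral_powR_tail b (c : R) : b < 1 -> 0 < c ->
  (\int[mu]_(x in `]c, +oo[) (x `^ (b - 2))%:E <= (c `^ (b - 1) / (1 - b))%:E)%E.
Proof.
move=> b1 c0.
have d s : 0 < s -> is_derive s (1 : R) (fun s => (b - 1)^-1 * s `^ (b - 1)) (s `^ (b - 2)).
  move=> s0; have d := is_derive1_powR (b - 1) s0.
  have e : (b - 1)^-1 *: ((b - 1) * s `^ (b - 1 - 1)) = s `^ (b - 2).
    rewrite /GRing.scale /= mulKf; last by rewrite subr_eq0 lt_eqF.
    by congr powR; ring.
  by rewrite -e; exact: is_deriveZ.
have tail n : (\int[mu]_(x in `]c, (c + n%:R)%R[) (x `^ (b - 2))%:E <= (c `^ (b - 1) / (1 - b))%:E)%E.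
  have rhs0 : 0 <= c `^ (b - 1) / (1 - b) by rewrite divr_ge0 ?powR_ge0// subr_ge0 ltW.
  case: n => [|n]; first by rewrite set_itv_ge ?integral_set0 ?lee_fin// bnd_simp addr0 ltxx.
  have d' s : c < s < c + n.+1%:R -> is_derive s (1 : R) (fun s => (b - 1)^-1 * s `^ (b - 1)) (s `^ (b - 2)).
    by move=> /andP[s0 _]; apply: d; exact: lt_trans s0.
  have n1 : c < c + n.+1%:R :> R by rewrite ltrDl.
  have n0 : 0 < c + n.+1%:R by exact: lt_trans n1.
  rewrite (ge0_FTC_itvoo n1 _ _ d' (A := (b - 1)^-1 * c `^ (b - 1)) (B := (b - 1)^-1 * (c + n.+1%:R) `^ (b - 1))).
  - rewrite lee_fin -mulrBr -(opprB 1 b) invrN mulNr -mulrN opprB mulrC.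
    apply: ler_wpM2r; first by rewrite invr_ge0 subr_ge0 ltW.
    by rewrite opprB gerBl powR_ge0.
  - by move=> s _; exact: powR_ge0.
  - by move=> s /andP[s0 _]; apply: continuous_powR_gt0; rewrite (lt_trans _ s0).
  - by apply: cvgMr; apply: cvg_at_right_filter; exact: continuous_powR_gt0.
  - by apply: cvgMr; apply: cvg_at_left_filter; apply: continuous_powR_gt0.
pose I n : set R := [set` Interval (BRight c) (BLeft (c + n%:R))].
have IE : `]c, +oo[%classic = \bigcup_n I n.
  apply/seteqP; split => x /=; rewrite !in_itv/= ?andbT.
    move=> cx; exists (Num.truncn (x - c)).+1 => //=.
    by rewrite /I/= in_itv/= cx/= -ltrBlDl truncnS_gt.
  by move=> [n _]; rewrite /I/= in_itv/= => /andP[].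
have cI : (\int[mu]_(x in I n) (x `^ (b - 2))%:E)%E @[n --> \oo] --> (\int[mu]_(x in `]c, +oo[) (x `^ (b - 2))%:E)%E.
  rewrite IE; apply: ge0_nondecreasing_set_cvg_integral.
  - move=> n m nm; apply/subsetPset; apply: subset_itvl; rewrite bnd_simp lerD2l ler_nat//.
  - by move=> i; exact: measurable_itv.
  - by move=> i; apply/measurable_EFinP; apply: measurable_funTS; exact: measurable_powR.
  - by move=> i x _; rewrite lee_fin powR_ge0.
rewrite -(cvg_lim _ cI)//; apply: lime_le; last exact: nearW.
by apply/cvg_ex; eexists; exact: cI.
Qed.

(** From above, the integrand is compared with s^(b-1) near 0 and with s^(b-2) at infinity, on
    ranges that overlap; from below, 1 / (1 + s) is at least 1/2 on ]0, 1[. *)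
Lemma ebeta_fin b : 0 < b < 1 -> (0 < ebeta b < +oo)%E.
Proof.
move=> /andP[b0 b1].
have m1 : measurable_fun setT (fun s => riesz b s / (1 + s)) by exact: measurable_resolvent.
apply/andP; split.
  apply: (@lt_le_trans _ _ (2^-1 * (1 `^ b / b))%:E).
    by rewrite lte_fin powR1 mulr_gt0// divr_gt0.
  rewrite EFinM -(integral_riesz b0 ler01) integral_EFin_indic.
  rewrite -(@integral_EFinZ _ _ _ (fun y => 2^-1 * (y `^ (b - 1) * \1_`]0, 1[ y)))//.
  - apply: le_integral_EFin => //.
    + by apply: measurable_funM => //; apply: measurable_funM.
    + move=> s; rewrite indic_itv in_itv/=; case: (boolP (0 < s < 1)) => [/andP[s0 s1]|_]; last first.
        by rewrite !mulr0 lexx resolvent_ge0.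
      rewrite mulr1 mulr_ge0 ?powR_ge0//= rieszE// mulrC ler_wpM2l ?powR_ge0//.
      by rewrite lef_pV2 ?posrE; lra.
  - by apply: measurable_funM.
  - by move=> y; rewrite mulr_ge0 ?powR_ge0.
have e1 : (ebeta b <= \int[mu]_(x in `]0%R, 2%R[) (x `^ (b - 1))%:E + \int[mu]_(x in `]1%R, +oo[) (x `^ (b - 2))%:E)%E.
  rewrite (integral_EFin_indic `]0, 2[%classic) (integral_EFin_indic `]1, +oo[%classic).
  rewrite -(@integral_EFinD _ _ _ (fun s => s `^ (b - 1) * \1_`]0, 2[ s + s `^ (b - 2) * \1_`]1, +oo[ s)).
  - apply: le_integral_EFin => //.
      by apply: measurable_funD; apply: measurable_funM.
    move=> s; rewrite resolvent_ge0// !indic_itv !in_itv/= andbT /riesz.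
    have [s0|] := ltP 0 s; last by rewrite mul0r addr_ge0// mulr_ge0 ?powR_ge0.
    have [s2|s2] := ltP s 2.
      rewrite mulr1 ler_wpDr// ?mulr_ge0 ?powR_ge0//.
      by rewrite ler_piMr ?powR_ge0// invf_le1; lra.
    rewrite mulr0 add0r (_ : 1 < s); last by lra.
    rewrite mulr1 (_ : b - 1 = 1 + (b - 2)); last by ring.
    rewrite (gt0_powRD 1 (b - 2) s0) (powRr1 (ltW s0)) mulrAC ler_piMl ?powR_ge0//.
    by rewrite ler_pdivrMr; lra.
  - by apply: measurable_funM.
  - by apply: measurable_funM.
  - by move=> s; rewrite mulr_ge0 ?powR_ge0.
  - by move=> s; rewrite mulr_ge0 ?powR_ge0.
  - by [].
apply: le_lt_trans e1 _; rewrite integral_riesz//.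
apply: lte_add_pinfty; first by rewrite ltry.
by apply: le_lt_trans (integral_powR_tail b1 ltr01) _; rewrite ltry.
Qed.

(** Two nonnegative extended reals whose product lies strictly between 0 and [+oo] do so themselves,
    because [0 * +oo] is 0. The product here is [ebeta b]. *)
Lemma egamma_fin b : 0 < b < 1 -> (0 < egamma b < +oo)%E.
Proof.
move=> /ebeta_fin; rewrite ebetaE.
move: (egamma_ge0 b) (egamma_ge0 (1 - b)).
case: (egamma b) => [x| |]; case: (egamma (1 - b)) => [y| |]//=; rewrite ?lee_fin => x0 y0.
- rewrite -EFinM !lte_fin !ltry !andbT => xy; have [//|xn|x00] := ltgtP 0 x.
    by move: x0; rewrite leNgt xn.
  by move: xy; rewrite -x00 mul0r ltxx.
- move: x0; rewrite le_eqVlt => /predU1P[<-|x0]; first by rewrite mul0e ltxx.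
  by rewrite gt0_muley// => /andP[_]; rewrite ltxx.
- move: y0; rewrite le_eqVlt => /predU1P[<-|y0]; first by rewrite mule0 => /andP[/lt_eqF]; rewrite eqxx.
  by rewrite gt0_mulye// => /andP[_]; rewrite ltxx.
Qed.

Lemma gamma_fun_gt0 b : 0 < b < 1 -> 0 < gamma_fun b.
Proof.
by move=> /egamma_fin h; rewrite gamma_funE fine_gt0.
Qed.

Lemma ebeta_gamma b : 0 < b < 1 -> ebeta b = (gamma_fun b * gamma_fun (1 - b))%:E.
Proof.
move=> b01; have b01' : 0 < 1 - b < 1 by move: b01 => /andP[? ?]; apply/andP; split; lra.
rewrite ebetaE !gamma_funE EFinM !fineK// ge0_fin_numE ?egamma_ge0//.
- by have /andP[] := egamma_fin b01'.
- by have /andP[] := egamma_fin b01.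
Qed.

End riesz_kernel.

(** * Fractional integrals of bounded functions and their truncated Marchaud derivatives *)

Section riemann_liouville.
Context {R : realType}.
Notation mu := (@lebesgue_measure R).
Implicit Types (b e s x y u : R) (v : R -> R).

Lemma integrable_scale (D : set R) (k : R) (f : R -> R) : measurable D ->
  mu.-integrable D (EFin \o f) -> mu.-integrable D (EFin \o (fun x => k * f x)).
Proof.
move=> mD fi; apply: (@eq_integrable _ _ _ mu _ mD (fun x => k%:E * (f x)%:E)%E).
  by move=> x _; rewrite /= EFinM.
exact: integrableZl.
Qed.

Lemma integral_indic_itvoo (x1 x2 : R) : x1 <= x2 ->
  (\int[mu]_u (\1_`]x1, x2[ u : R)%:E = (x2 - x1)%:E)%E.
Proof.
move=> x12; transitivity (mu `]x1, x2[%classic); first by rewrite integral_indic// setIT.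
rewrite lebesgue_measure_itv/= lte_fin; case: ltP => [|x21]; first by rewrite EFinB.
by congr EFin; apply/eqP; rewrite eq_sym subr_eq0 eq_le x12 x21.
Qed.

Lemma integral_riesz_shift b s e : 0 < b -> 0 < s -> 0 < e ->
  (\int[mu]_(r in `]0%R, s[) (r `^ (b - 1) * (s - r + e) `^ (- 1 - b))%:E =
   ((s / e) `^ b / (b * (s + e)))%:E)%E.
Proof.
move=> b0 s0 e0; pose c := s + e.
have c0 : 0 < c by rewrite addr_gt0.
(* The antiderivative comes from (r / (c - r))^b, whose derivative is b c r^(b-1) (c - r)^(-1-b). *)
pose F r := (b * c)^-1 * (r `^ b * (c - r) `^ (- b)).
have cpos r : r < s -> 0 < c - r by rewrite /c; lra.
have dF r : 0 < r < s -> is_derive r (1 : R) F (r `^ (b - 1) * (s - r + e) `^ (- 1 - b)).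
  move=> /andP[r0 rs]; have cr := cpos _ rs.
  have d1 := is_derive1_powR b r0.
  have dc : is_derive r (1 : R) (fun r : R => c - r) (- 1).
    rewrite -(sub0r 1).
    exact: (is_deriveB (is_derive_cst c r 1) (is_derive_id r 1)).
  have d2' := is_derive1_powR (- b) cr.
  have d2 := is_derive1_comp (g := fun r : R => c - r) d2' dc.
  have d3 := is_deriveM d1 d2.
  have d4 := is_deriveZ (b * c)^-1 d3.
  apply: (is_derive_eq (f := F) d4).
  rewrite /GRing.scale /= (_ : s - r + e = c - r); last by rewrite /c; ring.
  rewrite (_ : - b - 1 = - 1 - b); last by ring.
  have -> : (c - r) `^ (- b) = (c - r) * (c - r) `^ (-1 - b).
    rewrite -[X in X * _](powRr1 (ltW cr)) -gt0_powRD//; congr powR; ring.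
  have -> : r `^ b = r * r `^ (b - 1).
    by rewrite -[X in X * _](powRr1 (ltW r0)) -gt0_powRD//; congr powR; ring.
  by field; rewrite !gt_eqF.
have cF r : 0 < r -> r < c -> {for r, continuous F}.
  move=> r0 rc; apply: continuousM; first exact: cst_continuous.
  apply: continuousM; first exact: continuous_powR_gt0.
  apply: (@continuous_comp _ _ _ (fun r : R => c - r) (fun t : R => t `^ (- b))).
    by apply: continuousB; [exact: cst_continuous|exact: cvg_id].
  by apply: continuous_powR_gt0; rewrite subr_gt0.
rewrite (ge0_FTC_itvoo s0 _ _ dF (A := 0) (B := F s)).
- congr EFin; rewrite subr0 /F /c [s + e - s]addrAC subrr add0r.
  by rewrite mulrC powRM ?invr_ge0 ?(ltW s0) ?(ltW e0)// powRN -[e^-1]powR_inv1 ?(ltW e0)// -powRrM mulN1r powRN.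
- by move=> r _; rewrite mulr_ge0 ?powR_ge0.
- move=> r /andP[r0 rs]; apply: continuousM; first exact: continuous_powR_gt0.
  apply: (@continuous_comp _ _ _ (fun r : R => s - r + e) (fun t : R => t `^ (- 1 - b))).
    apply: continuousD; last exact: cst_continuous.
    by apply: continuousB; [exact: cst_continuous|exact: cvg_id].
  by apply: continuous_powR_gt0; lra.
- rewrite -[X in _ --> X](mulr0 (b * c)^-1); apply: cvgMr.
  rewrite -[X in _ --> X](mul0r ((c - 0) `^ (- b))); apply: cvgM; first exact: powR_cvg0.
  apply: cvg_at_right_filter.
  apply: (@continuous_comp _ _ _ (fun r : R => c - r) (fun t : R => t `^ (- b)) 0).
    by apply: continuousB; [exact: cst_continuous|exact: cvg_id].
  by apply: continuous_powR_gt0; rewrite subr0.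
- by apply: cvg_at_left_filter; apply: cF => //; rewrite /c ltrDl.
Qed.

Lemma measurable_riesz_conv b x : measurable_fun setT (fun y => riesz b (x - y)).
Proof.
apply: (measurableT_comp (@measurable_riesz _ b)).
exact: measurable_funB.
Qed.

Lemma measurable_riesz_conv2 b : measurable_fun setT (fun z : R * R => riesz b (z.1 - z.2)).
Proof.
apply: (measurableT_comp (@measurable_riesz _ b)).
exact: measurable_funB.
Qed.

Lemma integral_riesz_indic b a x : 0 < b ->
  (\int[mu]_y (riesz b (x - y) * \1_`]a, +oo[ y)%:E =
   (if a < x then (x - a) `^ b / b else 0)%:E)%E.
Proof.
move=> b0.
pose f s := (riesz b s * \1_`]a, +oo[ (x - s))%:E.
have mf : measurable_fun setT f.
  apply/measurable_EFinP; apply: measurable_funM; first exact: measurable_riesz.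
  by apply: measurableT_comp => //; exact: measurable_funB.
have f0 s : (0 <= f s)%E by rewrite lee_fin mulr_ge0 ?riesz_ge0.
have N1 : (-1 : R) != 0 by rewrite oppr_eq0 oner_eq0.
have := ge0_integral_affine x N1 mf f0.
rewrite normrN1 invr1 mul1e => e.
transitivity (\int[mu]_y f (-1 * y + x)%R)%E.
  by apply: eq_integral => y _; rewrite /f mulN1r (addrC (- y)) subKr.
rewrite e /f; case: ltP => ax.
  rewrite -integral_riesz ?subr_ge0 ?(ltW ax)//.
  rewrite (integral_EFin_indic `]0, x - a[%classic).
  apply: eq_integral => s _; congr EFin.
  have E : (a < x - s)%R = (s < x - a)%R :> bool by rewrite ltrBrDr [RHS]ltrBrDr addrC.
  rewrite !indic_itv !in_itv/= andbT E /riesz.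
  by case: ltP => s0; rewrite /= ?mul0r ?mulr0.
apply: integral0_eq => s _; congr EFin.
rewrite indic_itv in_itv/= andbT /riesz; case: ltP => s0; last by rewrite mul0r.
by rewrite (_ : (a < x - s) = false) ?mulr0//; apply/negbTE; rewrite -leNgt; lra.
Qed.

Lemma integrable_riesz_indic b a x : 0 < b ->
  mu.-integrable setT (EFin \o (fun y => riesz b (x - y) * \1_`]a, +oo[ y)).
Proof.
move=> b0; apply/integrableP; split.
  by apply/measurable_EFinP; apply: measurable_funM => //; exact: measurable_riesz_conv.
rewrite (_ : (\int[mu]_y _)%E = \int[mu]_y (riesz b (x - y) * \1_`]a, +oo[ y)%:E)%E.
  by rewrite integral_riesz_indic// ltry.
by apply: eq_integral => y _; rewrite /= ger0_norm// mulr_ge0 ?riesz_ge0.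
Qed.

Definition rliou b v x : R := \int[mu]_y (riesz b (x - y) * v y).

(** An approximate identity up to normalisation: the dilation by [e] of the integrand of [ebeta],
    with the same mass for every [e], and with mass of order e^(1-b) beyond any fixed distance. *)
Definition kap b e s : R := e `^ (1 - b) * (riesz b s / (e + s)).

Lemma kap_ge0 b e s : 0 <= e -> 0 <= kap b e s.
Proof. by move=> e0; rewrite mulr_ge0 ?powR_ge0// resolvent_ge0. Qed.

Lemma measurable_kap b e : measurable_fun setT (kap b e).
Proof. by apply: measurable_funM => //; exact: measurable_resolvent. Qed.

Lemma integral_kap b e : 0 < e -> (\int[mu]_s (kap b e s)%:E = ebeta b)%E.
Proof.
move=> e0; pose f s := (riesz b s / (1 + s))%:E.
have mf : measurable_fun setT f by apply/measurable_EFinP; exact: measurable_resolvent.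
have f0 s : (0 <= f s)%E by rewrite lee_fin resolvent_ge0.
have ie0 : e^-1 != 0 by rewrite invr_eq0 gt_eqF.
have := ge0_integral_affine 0 ie0 mf f0.
rewrite gtr0_norm ?invr_gt0// invrK => E.
transitivity ((e^-1)%:E * \int[mu]_s f (e^-1 * s + 0)%R)%E; last first.
  by rewrite E muleA -EFinM mulVf ?gt_eqF// mul1e.
rewrite -(@integral_EFinZ _ _ (fun s => riesz b (e^-1 * s + 0) / (1 + (e^-1 * s + 0))) (kap b e))//.
- by rewrite invr_ge0 ltW.
- by apply: (measurableT_comp (@measurable_resolvent _ b 1)); exact: measurable_affine.
- by move=> s; exact: resolvent_ge0.
- move=> s; rewrite addr0 rieszM ?invr_gt0// /kap.
  have -> : 1 + e^-1 * s = e^-1 * (e + s) by rewrite mulrDr mulVf ?gt_eqF.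
  have -> : e^-1 `^ (b - 1) = e `^ (1 - b).
    by rewrite -(powR_inv1 (ltW e0)) -powRrM mulN1r opprB.
  rewrite invfM invrK; have e1 : e != 0 by rewrite gt_eqF.
  transitivity (e^-1 * e * (e `^ (1 - b) * (riesz b s / (e + s)))); first by rewrite mulVf// mul1r.
  ring.
Qed.

Lemma integral_kap_tail b e c : b < 1 -> 0 < c -> 0 < e ->
  (\int[mu]_s (kap b e s * \1_`]c, +oo[ s)%:E <= (e `^ (1 - b) * (c `^ (b - 1) / (1 - b)))%:E)%E.
Proof.
move=> b1 c0 e0; rewrite EFinM.
apply: (@le_trans _ _ ((e `^ (1 - b))%:E * \int[mu]_(x in `]c, +oo[) (x `^ (b - 2))%:E)%E); last first.
  by rewrite lee_wpmul2l ?lee_fin ?powR_ge0// integral_powR_tail.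
rewrite (integral_EFin_indic `]c, +oo[%classic).
rewrite -(@integral_EFinZ _ _ (fun s => s `^ (b - 2) * \1_`]c, +oo[ s)
  (fun s => e `^ (1 - b) * (s `^ (b - 2) * \1_`]c, +oo[ s)))//.
- apply: le_integral_EFin.
  + by apply: measurable_funM => //; exact: measurable_kap.
  + by apply: measurable_funM => //; apply: measurable_funM.
  + move=> s; rewrite mulr_ge0 ?kap_ge0 ?(ltW e0)//=.
    rewrite indic_itv in_itv/= andbT; case: ltP => cs; rewrite ?mulr0// !mulr1.
    have s0 : 0 < s by exact: lt_trans cs.
    rewrite /kap ler_wpM2l ?powR_ge0// rieszE// ler_pdivrMr ?addr_gt0//.
    rewrite (_ : b - 1 = 1 + (b - 2)); last by ring.
    rewrite (gt0_powRD 1 (b - 2) s0) (powRr1 (ltW s0)) mulrC ler_wpM2l ?powR_ge0//.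
    by rewrite lerDr ltW.
- exact: powR_ge0.
- by apply: measurable_funM.
- by move=> s; rewrite mulr_ge0 ?powR_ge0.
Qed.

Section bounded_source.
Variables (b : R) (v : R -> R) (M : R).
Hypotheses (b01 : 0 < b < 1) (mv : measurable_fun setT v)
  (vM : forall y, `|v y| <= M) (v0 : forall y, y <= 0 -> v y = 0).
Let b0 : 0 < b. Proof. by case/andP: b01. Qed.
Let b1 : b < 1. Proof. by case/andP: b01. Qed.
Let M0 : 0 <= M. Proof. exact: le_trans (vM 0). Qed.

Lemma norm_source_le k y : 0 <= k -> `|k * v y| <= M * (k * \1_`]0, +oo[ y).
Proof.
move=> k0; rewrite normrM ger0_norm// indic_itv in_itv/= andbT.
case: ltP => y0; first by rewrite mulr1 mulrC ler_wpM2r.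
by rewrite v0// normr0 !mulr0.
Qed.

Lemma integrable_rliou x : mu.-integrable setT (EFin \o (fun y => riesz b (x - y) * v y)).
Proof.
apply: (@le_integrable _ _ _ mu _ measurableT _ (fun y => (M%:E * (riesz b (x - y) * \1_`]0, +oo[ y)%:E)%E)) => //.
- by apply/measurable_EFinP; apply: measurable_funM => //; exact: measurable_riesz_conv.
- move=> y _; rewrite -EFinM /= lee_fin.
  by apply: (le_trans (norm_source_le y (riesz_ge0 _ _))); exact: ler_norm.
- by apply: integrableZl => //; exact: integrable_riesz_indic.
Qed.

Lemma le_abs_integral_rliou k x : 0 <= k ->
  (\int[mu]_y `|k * (riesz b (x - y) * v y)|%:E <=
    (k * (M * if (0 < x)%R then x `^ b / b else 0))%:E)%E.
Proof.
move=> k0; have := integral_riesz_indic 0 x b0; rewrite subr0 => E.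
rewrite EFinM (EFinM M) -E.
rewrite -(@integral_EFinZ _ M (fun y => riesz b (x - y) * \1_`]0, +oo[ y)
   (fun y => M * (riesz b (x - y) * \1_`]0, +oo[ y)))//; last 2 first.
- by apply: measurable_funM => //; exact: measurable_riesz_conv.
- by move=> y; rewrite mulr_ge0 ?riesz_ge0.
rewrite -(@integral_EFinZ _ k (fun y => M * (riesz b (x - y) * \1_`]0, +oo[ y))
   (fun y => k * (M * (riesz b (x - y) * \1_`]0, +oo[ y))))//.
- apply: le_integral_EFin.
  + apply: measurableT_comp => //; apply: measurable_funM => //.
    by apply: measurable_funM => //; exact: measurable_riesz_conv.
  + do 2 apply: measurable_funM => //.
    by apply: measurable_funM => //; exact: measurable_riesz_conv.
  + move=> y; rewrite normr_ge0/= normrM (ger0_norm k0) ler_wpM2l//.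
    exact: norm_source_le (riesz_ge0 _ _).
- apply: measurable_funM => //.
  by apply: measurable_funM => //; exact: measurable_riesz_conv.
- by move=> y; rewrite !mulr_ge0 ?riesz_ge0.
Qed.

(** The translation u = r + y leads back to [integral_riesz_shift] at s = x - y. *)
Lemma integral_riesz_truncated x e y : 0 < e -> 0 < y ->
  (\int[mu]_u (\1_`]0, x[ u * (x - u + e) `^ (- 1 - b) * riesz b (u - y))%:E =
   (if (y < x)%R then ((x - y) / e) `^ b / (b * (x - y + e)) else 0)%:E)%E.
Proof.
move=> e0 y0.
pose f u := (\1_`]0, x[ u * (x - u + e) `^ (- 1 - b) * riesz b (u - y))%:E.
have mf : measurable_fun setT f.
  apply/measurable_EFinP; apply: measurable_funM; last first.
    by apply: (measurableT_comp (@measurable_riesz _ b)); exact: measurable_funB.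
  apply: measurable_funM => //; apply: (measurableT_comp (@measurable_powR _ _)).
  by apply: measurable_funD => //; exact: measurable_funB.
have f0 s : (0 <= f s)%E by rewrite lee_fin !mulr_ge0 ?powR_ge0 ?riesz_ge0.
have := ge0_integral_affine y (oner_neq0 R) mf f0.
rewrite normr1 invr1 mul1e => <-.
case: ltP => yx.
  rewrite -integral_riesz_shift ?subr_gt0// (integral_EFin_indic `]0, x - y[%classic).
  apply: eq_integral => r _; rewrite /f mul1r addrK; congr EFin.
  rewrite !indic_itv !in_itv/= ltrBrDr /riesz.
  rewrite (_ : x - (r + y) + e = x - y - r + e); last by ring.
  case: (ltP 0 r) => r0; last by rewrite !mulr0.
  by rewrite addr_gt0//=; ring.
apply: integral0_eq => r _; rewrite /f mul1r addrK; congr EFin.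
rewrite indic_itv in_itv/= /riesz; case: (ltP 0 r) => r0; last by rewrite mulr0.
by rewrite (_ : (r + y < x) = false) ?andbF ?mul0r//; apply/negbTE; rewrite -leNgt; lra.
Qed.

Lemma kap_le e s : 0 < e -> kap b e s <= e `^ (- b) * riesz b s.
Proof.
move=> e0; rewrite /kap /riesz; case: ltP => s0; last by rewrite mul0r !mulr0.
rewrite mulrCA mulrC; apply: ler_wpM2r; first exact: powR_ge0.
rewrite ler_pdivrMr ?addr_gt0// addrC (gt0_powRD _ _ e0) (powRr1 (ltW e0)).
by apply: ler_wpM2l; [exact: powR_ge0|rewrite lerDl ltW].
Qed.

Lemma integrable_kap x e : 0 < e ->
  mu.-integrable setT (EFin \o (fun y => kap b e (x - y) * v y)).
Proof.
move=> e0.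
apply: (@le_integrable _ _ _ mu _ measurableT _ (fun y => ((e `^ (- b))%:E * (riesz b (x - y) * v y)%:E)%E)) => //.
- apply/measurable_EFinP; apply: measurable_funM => //.
  apply: (measurableT_comp (@measurable_kap b e)); exact: measurable_funB.
- move=> y _; rewrite -EFinM [X in (X <= _)%E]/= lee_fin mulrA !(normrM _ (v y)).
  apply: ler_wpM2r => //.
  rewrite (ger0_norm (kap_ge0 _ _ (ltW e0))) ger0_norm ?mulr_ge0 ?powR_ge0 ?riesz_ge0//.
  exact: kap_le.
- by apply: integrableZl => //; exact: integrable_rliou.
Qed.

(* The cut-off [(r + e)^(-1-b)] of the singularity [r^(-1-b)] is chosen so that
   the truncated Marchaud derivative of a fractional integral is again an
   average with an explicit nonnegative kernel, namely [kap b e]. *)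
Lemma truncated_marchaud_rliou x e : 0 < x -> 0 < e ->
  rliou b v x * (e `^ (- b) / b) -
    \int[mu]_(u in `]0, x[) (rliou b v u * (x - u + e) `^ (- 1 - b)) =
  b^-1 * \int[mu]_y (kap b e (x - y) * v y).
Proof.
move=> x0 e0.
pose J u := \1_`]0, x[ u * (x - u + e) `^ (- 1 - b).
have mJ : measurable_fun setT J.
  apply: measurable_funM => //; apply: (measurableT_comp (@measurable_powR _ _)).
  by apply: measurable_funD => //; exact: measurable_funB.
have J0 u : 0 <= J u by rewrite mulr_ge0 ?powR_ge0.
pose h (z : R * R) := J z.1 * (riesz b (z.1 - z.2) * v z.2).
have mh : measurable_fun setT h.
  apply: measurable_funM; first exact: measurableT_comp.
  by apply: measurable_funM; [exact: measurable_riesz_conv2|exact: measurableT_comp].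
have hfin : (\int[mu]_u \int[mu]_y `|h (u, y)|%:E < +oo)%E.
  (* On the range of [u] the cut-off is at most e^(-1-b), and the fractional integral of [|v|] is at
     most M x^b / b. *)
  pose C := e `^ (- 1 - b) * (M * (x `^ b / b)).
  have C0 : 0 <= C by rewrite !mulr_ge0 ?powR_ge0// invr_ge0 ltW.
  apply: (@le_lt_trans _ _ (\int[mu]_u (C * \1_`]0, x[ u)%:E)%E); last first.
    rewrite (@integral_EFinZ _ C (\1_`]0, x[ : R -> R))//.
    by rewrite integral_indic_itvoo ?(ltW x0)// -EFinM ltry.
  apply: ge0_le_integral => //.
  - by move=> u _; apply: integral_ge0 => y _.
  - have mh' : measurable_fun setT (fun z : R * R => `|h (z.1, z.2)|%:E).
      by apply/measurable_EFinP; apply: measurableT_comp => //; exact: mh.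
    exact: (measurable_lebesgue_integral2 (F := fun u y => `|h (u, y)|%:E) mh').
  - by apply/measurable_EFinP; exact: measurable_funM.
  - move=> u _; apply: (le_trans (le_abs_integral_rliou u (J0 u))); rewrite lee_fin.
    rewrite /J indic_itv in_itv/=; case: (ltP 0 u) => u0; last by rewrite !mul0r mulr0.
    case: (ltP u x) => ux; last by rewrite !mul0r mulr0.
    rewrite mul1r mulr1 /C ler_pM ?powR_ge0//.
    + by rewrite !mulr_ge0 ?powR_ge0// invr_ge0 ltW.
    + rewrite -[X in X `^ _]opprK; have eu : e <= x - u + e by lra.
      rewrite opprK -!(opprD 1 b) !powRN lef_pV2 ?posrE ?powR_gt0//; last by lra.
      move: (x - u + e) eu => t eu.
      have t0 : 0 <= t by exact: le_trans (ltW e0) eu.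
      apply: ge0_ler_powR => //; last by rewrite nnegrE ltW.
      by rewrite addr_ge0// ltW.
    + rewrite ler_wpM2l// ler_wpM2r ?invr_ge0 ?(ltW b0)//.
      by apply: ge0_ler_powR; rewrite ?nnegrE ?(ltW u0) ?(ltW ux) ?(ltW x0) ?(ltW b0).
have -> : \int[mu]_(u in `]0, x[) (rliou b v u * (x - u + e) `^ (- 1 - b)) =
    \int[mu]_u \int[mu]_y h (u, y).
  rewrite Rintegral_indic; apply: eq_Rintegral => u _.
  rewrite /h/= RintegralZl//; last exact: integrable_rliou.
  by rewrite -/(rliou b v u) /J; ring.
rewrite Rintegral_fubini//.
(* With s = x - y the two contributions combine through 1 - s / (s + e) = e / (s + e), which
   produces the kernel [kap]. *)
have -> : \int[mu]_y \int[mu]_u h (u, y) =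
    \int[mu]_y ((e `^ (- b) / b) * (riesz b (x - y) * v y) - b^-1 * (kap b e (x - y) * v y)).
  apply: eq_Rintegral => y _; rewrite /h/=.
  have [y0|y0] := leP y 0.
    rewrite v0// !mulr0 subr0 (_ : \int[mu]_u _ = \int[mu]_(u in setT) 0); last first.
      by apply: eq_Rintegral => u _; rewrite !mulr0.
    by rewrite Rintegral_cst// mul0r.
  have it := integral_riesz_truncated x e0 y0.
  have -> : \int[mu]_u (J u * (riesz b (u - y) * v y)) =
      \int[mu]_u (J u * riesz b (u - y)) * v y.
    rewrite -RintegralZr//; first by apply: eq_Rintegral => u _; rewrite mulrA.
    apply/integrableP; split.
      apply/measurable_EFinP; apply: measurable_funM => //.
      by apply: (measurableT_comp (@measurable_riesz _ b)); exact: measurable_funB.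
    rewrite (_ : (\int[mu]_u _)%E = \int[mu]_u (J u * riesz b (u - y))%:E)%E.
      by rewrite it ltry.
    by apply: eq_integral => u _; rewrite /= ger0_norm// mulr_ge0 ?riesz_ge0.
  have -> : \int[mu]_u (J u * riesz b (u - y)) =
      if y < x then ((x - y) / e) `^ b / (b * (x - y + e)) else 0.
    by rewrite /Rintegral it.
  rewrite /kap /riesz subr_gt0.
  case: ltP => yx; last by rewrite !(mul0r, mulr0) subr0.
  have xy0 : 0 < x - y by rewrite subr_gt0.
  rewrite powRM ?(ltW xy0) ?invr_ge0 ?(ltW e0)// -[e^-1]powR_inv1 ?(ltW e0)// -powRrM mulN1r.
  have -> : e `^ (1 - b) = e * e `^ (- b).
    by rewrite (gt0_powRD _ _ e0) powRr1// ltW.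
  have -> : (x - y) `^ b = (x - y) * (x - y) `^ (b - 1).
    by rewrite -[X in X * _](powRr1 (ltW xy0)) -gt0_powRD//; congr powR; ring.
  field; rewrite !gt_eqF//; lra.
rewrite RintegralB//; last 2 first.
- by apply: integrable_scale => //; exact: integrable_rliou.
- by apply: integrable_scale => //; exact: integrable_kap.
rewrite !RintegralZl//; [|exact: integrable_kap|exact: integrable_rliou].
by rewrite -/(rliou b v x) mulrC subKr.
Qed.

End bounded_source.

End riemann_liouville.

(** * Integrability and dominated convergence for real-valued functions *)

Section real_integrable.
Context d (T : measurableType d) (R : realType) (m : {measure set T -> \bar R})
  (D : set T).
Hypothesis mD : measurable D.
Implicit Types f g : T -> R.

Lemma integrable_addr f g : m.-integrable D (EFin \o f) -> m.-integrable D (EFin \o g) ->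
  m.-integrable D (EFin \o (fun x => f x + g x)).
Proof.
move=> mf mg; apply: (@eq_integrable _ _ _ m _ mD ((EFin \o f) \+ (EFin \o g))%E) => //.
exact: integrableD.
Qed.

Lemma integrable_subr f g : m.-integrable D (EFin \o f) -> m.-integrable D (EFin \o g) ->
  m.-integrable D (EFin \o (fun x => f x - g x)).
Proof.
move=> mf mg; apply: (@eq_integrable _ _ _ m _ mD ((EFin \o f) \- (EFin \o g))%E) => //.
exact: integrableB.
Qed.

Lemma integrable_scaler k f : m.-integrable D (EFin \o f) ->
  m.-integrable D (EFin \o (fun x => k * f x)).
Proof.
move=> mf; apply: (@eq_integrable _ _ _ m _ mD (fun x => k%:E * (EFin \o f) x)%E) => //.
exact: integrableZl.
Qed.

Lemma integrable_normr f : m.-integrable D (EFin \o f) ->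
  m.-integrable D (EFin \o (fun x => `|f x|)).
Proof. by move=> mf; exact: integrable_norm. Qed.

Lemma integrable_ler f g : measurable_fun D f -> (forall x, D x -> `|f x| <= g x) ->
  m.-integrable D (EFin \o g) -> m.-integrable D (EFin \o f).
Proof.
move=> mf fg ig; have mE : measurable_fun D (EFin \o f) by exact/measurable_EFinP.
apply: (@le_integrable _ _ _ m _ mD (EFin \o f) (EFin \o g) mE _ ig).
by move=> x Dx; rewrite /= lee_fin (le_trans (fg _ Dx))// ler_norm.
Qed.

Lemma integrable_boundedr f M : (m D < +oo)%E -> measurable_fun D f ->
  (forall x, D x -> `|f x| <= M) -> m.-integrable D (EFin \o f).
Proof.
move=> mDoo mf fM; apply: (integrable_ler (g := cst M)) => //.
apply/integrableP; split; first exact/measurable_EFinP.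
rewrite (eq_integral (cst `|M|%:E))// integral_cst// lte_mul_pinfty//.
Qed.

Lemma integrable_sumr k (F : nat -> T -> R) : (forall i, m.-integrable D (EFin \o F i)) ->
  m.-integrable D (EFin \o (fun x => \sum_(i < k) F i x)).
Proof.
move=> iF; elim: k => [|k IH].
  rewrite (_ : _ \o _ = cst 0%E); first exact: integrable0.
  by apply/funext => x /=; rewrite big_ord0.
rewrite (_ : _ \o _ = EFin \o (fun x => \sum_(i < k) F i x + F k x)).
  exact: integrable_addr.
by apply/funext => x /=; rewrite big_ord_recr.
Qed.

Lemma Rintegral_sumr k (F : nat -> T -> R) : (forall i, m.-integrable D (EFin \o F i)) ->
  \int[m]_(x in D) (\sum_(i < k) F i x) = \sum_(i < k) \int[m]_(x in D) F i x.
Proof.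
move=> iF; elim: k => [|k IH].
  rewrite big_ord0 (_ : (fun x => _) = cst 0) ?Rintegral_cst// ?mul0r//.
  by apply/funext => x; rewrite big_ord0.
rewrite big_ord_recr/= -IH -RintegralD//; last exact: integrable_sumr.
by congr Rintegral; apply/funext => x; rewrite big_ord_recr.
Qed.

Lemma ge0_integral_addr f g : measurable_fun D f -> measurable_fun D g ->
  (forall x, D x -> 0 <= f x) -> (forall x, D x -> 0 <= g x) ->
  (\int[m]_(x in D) (f x + g x)%:E = \int[m]_(x in D) (f x)%:E + \int[m]_(x in D) (g x)%:E)%E.
Proof.
move=> mf mg f0 g0; rewrite -ge0_integralD//; try exact/measurable_EFinP;
  by move=> x Dx; rewrite lee_fin; [exact: f0|exact: g0].
Qed.

Lemma ge0_integral_scaler k f : 0 <= k -> measurable_fun D f ->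
  (forall x, D x -> 0 <= f x) ->
  (\int[m]_(x in D) (k * f x)%:E = k%:E * \int[m]_(x in D) (f x)%:E)%E.
Proof.
move=> k0 mf f0; rewrite -ge0_integralZl_EFin//; first exact/measurable_EFinP.
Qed.

Lemma ge0_le_integralr f g : measurable_fun D f -> measurable_fun D g ->
  (forall x, D x -> 0 <= f x) -> (forall x, D x -> f x <= g x) ->
  (\int[m]_(x in D) (f x)%:E <= \int[m]_(x in D) (g x)%:E)%E.
Proof.
move=> mf mg f0 fg; apply: ge0_le_integral => //; try exact/measurable_EFinP;
  by move=> x Dx; rewrite lee_fin ?f0// (le_trans (f0 x Dx))// fg.
Qed.

Lemma dominated_cvg_Rintegral (f : nat -> T -> R) g (u : T -> R) :
  (forall n, measurable_fun D (f n)) -> measurable_fun D g ->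
  {ae m, forall x, D x -> f n x @[n --> \oo] --> g x} ->
  m.-integrable D (EFin \o u) -> {ae m, forall x n, D x -> `|f n x| <= u x} ->
  \int[m]_(x in D) f n x @[n --> \oo] --> \int[m]_(x in D) g x.
Proof.
move=> mf mg fg iu fu.
have mf' n : measurable_fun D (EFin \o f n) by exact/measurable_EFinP.
have mg' : measurable_fun D (EFin \o g) by exact/measurable_EFinP.
have h1 : {ae m, forall x, D x -> (EFin \o f n) x @[n --> \oo] --> (EFin \o g) x}.
  by apply: filterS fg => x h Dx; apply: cvg_EFin; [exact: nearW|exact: h].
have h2 : {ae m, forall x n, D x -> (`|(EFin \o f n) x| <= (EFin \o u) x)%E}.
  by apply: filterS fu => x h n Dx; rewrite /= lee_fin; exact: h.
have [ig _ cv] := @dominated_convergence _ _ _ m _ mD _ _ _ mf' mg' h1 iu h2.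
by apply: fine_cvg; rewrite fineK//; exact: integrable_fin_num.
Qed.

End real_integrable.

Arguments integrable_addr {d T R} m {D} mD.
Arguments integrable_subr {d T R} m {D} mD.
Arguments integrable_scaler {d T R} m {D} mD.
Arguments integrable_normr {d T R} m {D}.
Arguments integrable_ler {d T R} m {D} mD.
Arguments integrable_boundedr {d T R} m {D} mD.
Arguments integrable_sumr {d T R} m {D} mD.
Arguments Rintegral_sumr {d T R} m {D} mD.
Arguments ge0_integral_addr {d T R} m {D} mD.
Arguments ge0_integral_scaler {d T R} m {D} mD.
Arguments ge0_le_integralr {d T R} m {D} mD.
Arguments dominated_cvg_Rintegral {d T R} m {D} mD.

(** * Hoelder continuity of fractional integrals of bounded functions *)

Section continuity.
Context {R : realType}.
Notation mu := (@lebesgue_measure R).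
Implicit Types (b e x y u : R).

Lemma hoelder_continuous (f : R -> R) (K c : R) : 0 < c ->
  (forall x y, x <= y -> `|f y - f x| <= K * (y - x) `^ c) -> continuous f.
Proof.
move=> c0 fK x; apply/cvgrPdist_lt => e e0.
have K0 : 0 <= K.
  have := fK 0 1 ler01; rewrite subr0 powR1 mulr1.
  by apply: le_trans.
pose d := (e / (K + 1)) `^ c^-1.
have K1 : 0 < K + 1 by rewrite ltr_wpDl.
have d0 : 0 < d by rewrite powR_gt0// divr_gt0.
near=> y.
have h : `|f x - f y| <= K * `|x - y| `^ c.
  have [xy|yx] := leP x y; last by rewrite [X in _ * X `^ _]gtr0_norm ?subr_gt0//; exact: (fK _ _ (ltW yx)).
  by rewrite distrC [X in _ * X `^ _]distrC [X in _ * X `^ _]ger0_norm ?subr_ge0//; exact: fK.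
apply: (le_lt_trans h).
have hd : `|x - y| < d by near: y; exact: (nbhsx_ballx x d d0).
have : `|x - y| `^ c <= e / (K + 1).
  have -> : e / (K + 1) = d `^ c.
    by rewrite -powRrM mulVf ?gt_eqF// powRr1// divr_ge0// ltW.
  by apply: ge0_ler_powR; rewrite ?nnegrE// ltW.
move=> hc; apply: (@le_lt_trans _ _ (K * (e / (K + 1)))); first exact: ler_wpM2l.
by rewrite mulrA ltr_pdivrMr// mulrC ltr_pM2l// ltrDl.
Unshelve. all: by end_near. Qed.

Lemma integral_riesz_indic_closed b a x : 0 < b ->
  (\int[mu]_y (riesz b (x - y) * \1_`[a, +oo[ y)%:E =
   (if a < x then (x - a) `^ b / b else 0)%:E)%E.
Proof.
move=> b0; rewrite -integral_riesz_indic//.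
rewrite -(integral_EFin_indic `[a, +oo[%classic) -(integral_EFin_indic `]a, +oo[%classic).
rewrite integral_itv_obnd_cbnd//.
by apply/measurable_EFinP; apply: measurable_funTS; exact: measurable_riesz_conv.
Qed.

Lemma integrable_riesz_indic_closed b a x : 0 < b ->
  mu.-integrable setT (EFin \o (fun y => riesz b (x - y) * \1_`[a, +oo[ y)).
Proof.
move=> b0; apply/integrableP; split.
  by apply/measurable_EFinP; apply: measurable_funM => //; exact: measurable_riesz_conv.
rewrite (_ : (\int[mu]_y _)%E = \int[mu]_y (riesz b (x - y) * \1_`[a, +oo[ y)%:E)%E.
  by rewrite integral_riesz_indic_closed// ltry.
by apply: eq_integral => y _; rewrite /= ger0_norm// mulr_ge0 ?riesz_ge0.
Qed.

Lemma rliou_le0 b (v : R -> R) x : (forall y, y <= 0 -> v y = 0) -> x <= 0 -> rliou b v x = 0.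
Proof.
move=> v0 x0; rewrite /rliou (_ : \int[mu]_y _ = \int[mu]_(y in setT) 0).
  by rewrite Rintegral_cst// mul0r.
apply: eq_Rintegral => y _; have [y0|y0] := leP y 0; first by rewrite v0// mulr0.
by rewrite riesz_le0 ?mul0r// subr_le0; apply: le_trans x0 (ltW y0).
Qed.

Section bounded_source.
Variables (b : R) (v : R -> R) (M : R).
Hypotheses (b01 : 0 < b < 1) (mv : measurable_fun setT v)
  (vM : forall y, `|v y| <= M) (v0 : forall y, y <= 0 -> v y = 0).
Let b0 : 0 < b. Proof. by case/andP: b01. Qed.
Let b1 : b < 1. Proof. by case/andP: b01. Qed.
Let M0 : 0 <= M. Proof. exact: le_trans (vM 0). Qed.

(** The increment of the kernel is at most A - B + 2 C in absolute value: for y < x the kernel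
    decreases in its argument because b < 1, so the bound is A - B, and from x on only B = C is
    left. All three integrals are explicit, and x^b - x'^b is dropped as nonpositive. *)
Lemma rliou_hoelder_ge0 x x' : 0 <= x -> x <= x' ->
  `|rliou b v x' - rliou b v x| <= 2 * M / b * (x' - x) `^ b.
Proof.
move=> x0; rewrite le_eqVlt => /predU1P[->|xx']; first by rewrite !subrr normr0 mulr_ge0 ?powR_ge0// divr_ge0 ?mulr_ge0// ltW.
have x'0 : 0 < x' by exact: le_lt_trans xx'.
pose A y := riesz b (x - y) * \1_`]0, +oo[ y.
pose B y := riesz b (x' - y) * \1_`]0, +oo[ y.
pose C y := riesz b (x' - y) * \1_`[x, +oo[ y.
have iA : mu.-integrable setT (EFin \o A) by exact: integrable_riesz_indic.
have iB : mu.-integrable setT (EFin \o B) by exact: integrable_riesz_indic.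
have iC : mu.-integrable setT (EFin \o C) by exact: integrable_riesz_indic_closed.
have iAB : mu.-integrable setT (EFin \o (fun y => A y - B y)).
  by apply: (@eq_integrable _ _ _ mu _ measurableT ((EFin \o A) \- (EFin \o B))%E) => //; exact: integrableB.
have i2C : mu.-integrable setT (EFin \o (fun y => 2 * C y)) by exact: integrable_scale.
have iD : mu.-integrable setT (EFin \o (fun y => A y - B y + 2 * C y)).
  by apply: (@eq_integrable _ _ _ mu _ measurableT ((EFin \o (fun y => (A y - B y)%R)) \+ (EFin \o (fun y => (2 * C y)%R)))%E) => //; exact: integrableD.
have i1 := integrable_rliou b01 mv vM v0 x.
have i2 := integrable_rliou b01 mv vM v0 x'.
have i12 : mu.-integrable setT (EFin \o (fun y => riesz b (x' - y) * v y - riesz b (x - y) * v y)).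
  by apply: (@eq_integrable _ _ _ mu _ measurableT ((EFin \o (fun y => (riesz b (x' - y) * v y)%R)) \- (EFin \o (fun y => (riesz b (x - y) * v y)%R)))%E) => //; exact: integrableB.
have iMD : mu.-integrable setT (EFin \o (fun y => M * (A y - B y + 2 * C y))) by exact: integrable_scale.
rewrite /rliou -RintegralB//.
apply: (le_trans (le_normr_Rintegral _ i12)) => //.
apply: (@le_trans _ _ (\int[mu]_y (M * (A y - B y + 2 * C y)))).
  apply: le_Rintegral => //; first exact: integrable_norm.
  move=> y _; rewrite -mulrBl normrM mulrC /A /B /C !indic_itv !in_itv/= !andbT.
  have [y0|y0] := leP y 0.
    by rewrite v0// normr0 mul0r mulr_ge0// !mulr0 subrr add0r !mulr_ge0 ?riesz_ge0.
  apply: ler_pM => //; rewrite !mulr1.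
  have [yx|xy] := ltP y x.
    rewrite !mulr0 addr0.
    rewrite distrC ger0_norm// subr_ge0 /riesz !subr_gt0 yx (lt_trans yx xx').
    rewrite -(opprB 1 b) !powRN lef_pV2 ?posrE ?powR_gt0 ?subr_gt0 ?(lt_trans yx xx')//.
    apply: ge0_ler_powR; rewrite ?nnegrE ?subr_ge0 ?(ltW yx) ?(ltW b1) ?(ltW (lt_trans yx xx'))//.
    by rewrite lerD2r ltW.
  rewrite mulr1 (riesz_le0 b (s := x - y)) ?subr_le0// subr0 sub0r ger0_norm ?riesz_ge0//.
  by rewrite mulr2n mulrDl mul1r addKr.
rewrite RintegralZl// RintegralD// RintegralB// RintegralZl//.
have -> : \int[mu]_y A y = x `^ b / b.
  rewrite /Rintegral integral_riesz_indic// subr0.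
  case: ltP => //= x00; have -> : x = 0 by apply/eqP; rewrite eq_le x0 x00.
  by rewrite powR0 ?gt_eqF// mul0r.
have -> : \int[mu]_y B y = x' `^ b / b by rewrite /Rintegral integral_riesz_indic// subr0 x'0.
have -> : \int[mu]_y C y = (x' - x) `^ b / b by rewrite /Rintegral integral_riesz_indic_closed// xx'.
have : x `^ b / b <= x' `^ b / b.
  rewrite ler_wpM2r ?invr_ge0 ?(ltW b0)//.
  by apply: ge0_ler_powR; rewrite ?nnegrE ?(ltW x'0) ?(ltW b0) ?(ltW xx').
move=> hh; rewrite [leRHS](_ : _ = M * (2 * ((x' - x) `^ b / b))); last by ring.
by apply: ler_wpM2l => //; rewrite gerDr subr_le0.
Qed.

Lemma continuous_rliou : continuous (rliou b v).
Proof.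
apply: (@hoelder_continuous _ (2 * M / b) b b0) => x y xy.
have K0 : 0 <= 2 * M / b by rewrite divr_ge0 ?mulr_ge0// ltW.
have [x0|x0] := leP 0 x; first exact: rliou_hoelder_ge0.
rewrite [rliou b v x]rliou_le0 ?(ltW x0)//.
have [y0|y0] := leP y 0; first by rewrite rliou_le0// subrr normr0 mulr_ge0 ?powR_ge0.
have := rliou_hoelder_ge0 (lexx 0) (ltW y0).
rewrite [rliou b v 0]rliou_le0// => h; apply: (le_trans h).
rewrite ler_wpM2l//; apply: ge0_ler_powR; rewrite ?nnegrE ?subr_ge0 ?(ltW y0) ?(ltW b0)//.
by rewrite lerD2l lerN2 ltW.
Qed.

End bounded_source.

Lemma le_rliou b (v v' : R -> R) (M M' : R) x : 0 < b < 1 ->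
  measurable_fun setT v -> (forall y, `|v y| <= M) -> (forall y, y <= 0 -> v y = 0) ->
  measurable_fun setT v' -> (forall y, `|v' y| <= M') -> (forall y, y <= 0 -> v' y = 0) ->
  (forall y, v y <= v' y) -> rliou b v x <= rliou b v' x.
Proof.
move=> b01 mv vM v0 mv' vM' v0' vv'; apply: le_Rintegral => //.
- exact: (integrable_rliou b01 mv vM v0).
- exact: (integrable_rliou b01 mv' vM' v0').
- by move=> y _; rewrite ler_wpM2l ?riesz_ge0.
Qed.

End continuity.

(** * Approximation of an integrable function by increasing sequences of bounded functions *)

Section vitali_caratheodory.
Context {R : realType}.
Notation mu := (@lebesgue_measure R).

(** The sum counts multiples of [eta], from 0 on, that lie below [s]; for s > 0 there are at most s
    / eta + 1 of them. *)
Lemma sum_layers_le (eta s : R) (k : nat) : 0 < eta ->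
  eta * \sum_(i < k) ((i%:R * eta < s)%R%:R : R) <= Num.max s 0 + eta.
Proof.
move=> eta0.
have bound j : eta * \sum_(i < j) ((i%:R * eta < s)%R%:R : R) <= eta * j%:R.
  rewrite ler_pM2l//; apply: (@le_trans _ _ (\sum_(i < j) 1)).
    by apply: ler_sum => i _; rewrite lern1 leq_b1.
  by rewrite sumr_const card_ord.
elim: k => [|k IH]; first by rewrite big_ord0 mulr0 addr_ge0 ?(ltW eta0)// le_max lexx orbT.
have [ks|ks] := ltP (k%:R * eta) s.
  apply: (le_trans (bound k.+1)); rewrite -natr1 mulrDr mulr1 lerD2r mulrC.
  by rewrite (le_trans (ltW ks))// le_max lexx.
by rewrite big_ord_recr/= ltNge ks/= addr0.
Qed.

(** The domination of [h] is asked on the left of each point only, which is all that a kernel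
    supported on the positive half-line sees. A fixed [v k] may fall below [h]; what has to be small
    in the mean is its excess over [h]. *)
Lemma vitali_caratheodory (X : R) (h : R -> R) (eps : R) : 0 < X -> 0 < eps ->
  mu.-integrable `]0, X[ (EFin \o h) ->
  exists (n : R) (v : nat -> R -> R),
  [/\ 0 <= n /\ (forall k, measurable_fun setT (v k)),
      forall k, exists M : R, forall y, `|v k y| <= M,
      (forall k y, y <= 0 -> v k y = 0) /\
      (forall k y, v k y <= v k.+1 y) /\ (forall k y, - n <= v k y),
      forall x, 0 < x < X -> exists j d, 0 < d /\ forall y, x - d < y <= x -> h x <= v j y &
      forall k, mu.-integrable `]0, X[ (EFin \o (fun y => Num.max (v k y - h y) 0)) /\
        \int[mu]_(y in `]0, X[) Num.max (v k y - h y) 0 <= eps].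
Proof.
move=> X0 eps0 ih.
have mD : measurable (`]0, X[%classic : set R) by exact: measurable_itv.
have mh : measurable_fun `]0, X[ h by apply/measurable_EFinP; exact: measurable_int ih.
have muD : mu `]0, X[%classic = X%:E by rewrite lebesgue_measure_itv/= lte_fin X0 oppr0 adde0.
have muDoo : (mu `]0%R, X[%classic < +oo)%E by rewrite muD ltry.
pose hn (n : nat) y := Num.max (h y) (- n%:R).
have mhn n : measurable_fun `]0, X[ (hn n) by apply: measurable_maxr.
have hn_le n y : `|hn n y| <= `|h y|.
  rewrite /hn; have [hy|hy] := leP (h y) (- n%:R); last by [].
  rewrite normrN normr_nat.
  have hy0 : h y <= 0 by apply: le_trans hy _; rewrite oppr_le0.
  by rewrite ler0_norm// lerNr.
have ihn n : mu.-integrable `]0, X[ (EFin \o hn n).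
  have mE : measurable_fun `]0, X[ (EFin \o hn n) by exact/measurable_EFinP.
  apply: (@le_integrable _ _ _ mu _ mD (EFin \o hn n) (EFin \o h) mE _ ih).
  by move=> y _; rewrite /= lee_fin.
have [n0 hn0] : exists n, \int[mu]_(y in `]0, X[) hn n y <= \int[mu]_(y in `]0, X[) h y + eps / 3.
  have h1 : {ae mu, forall y, `]0, X[%classic y -> (EFin \o hn k) y @[k --> \oo] --> (EFin \o h) y}.
    apply: aeW => y _; apply: cvg_near_cst.
    exists (Num.truncn `|h y|).+1 => // k /= hk; congr (_%:E); rewrite /hn max_l//.
    rewrite lerNl (le_trans (ler_norm _))// normrN.
    by rewrite (le_trans (ltW (truncnS_gt _)))// ler_nat.
  have h2 : {ae mu, forall y k, `]0, X[%classic y -> (`|(EFin \o hn k) y| <= (EFin \o (fun y => `|h y|)%R) y)%E}.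
    by apply: aeW => y k _; rewrite /= lee_fin.
  have [_ _ cv] := @dominated_convergence _ _ _ mu _ mD (fun n => EFin \o hn n) (EFin \o h)
    (EFin \o (fun y => `|h y|)) (fun n => (measurable_EFinP _ _).2 (mhn n)) ((measurable_EFinP _ _).2 mh)
    h1 (integrable_norm ih) h2.
  have ifin := @integrable_fin_num _ _ _ mu _ mD _ ih.
  have cv' : \int[mu]_(y in `]0, X[) hn k y @[k --> \oo] --> \int[mu]_(y in `]0, X[) h y.
    by apply: fine_cvg; rewrite fineK.
  have e30 : 0 < eps / 3 by rewrite divr_gt0.
  have /cvgrPdist_lt/(_ _ e30) [k _ /(_ k (leqnn k))] := cv'.
  by rewrite ltr_distl => /andP[? _]; exists k; lra.
pose n : R := n0%:R.
(* The error is split into thirds: the truncation of [h] from below at [- n], one layer of height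
   [eta] over an interval of length [X], and the enlargement of the layers to open sets, of total
   measure at most 1. *)
pose eta := Num.min (eps / 3) (eps / (3 * X)).
have e3 : 0 < eps / 3 by rewrite divr_gt0.
have eta0 : 0 < eta by rewrite lt_min e3/= divr_gt0// mulr_gt0.
pose E (i : nat) : set R := [set y | (0 < y < X) && (i%:R * eta < h y + n)].
have mE i : measurable (E i).
  have -> : E i = `]0, X[%classic `&` (fun y => i%:R * eta < h y + n) @^-1` [set true].
    by apply/seteqP; split => y; rewrite /E/= in_itv/= => /andP.
  by apply: measurable_fun_ltr => //; apply: measurable_funD.
have muE i : (mu (E i) < +oo)%E.
  apply: (@le_lt_trans _ _ (mu `]0, X[%classic)); last by rewrite muD ltry.
  by apply: le_measure; rewrite ?inE//; [exact: mE|move=> y /= /andP[+ _]; rewrite in_itv].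
have i2 i : 0 < 2^-1 ^+ i.+1 :> R by rewrite exprn_gt0// invr_gt0.
(* Outer regularity with summable errors. Openness of the enlarged layers is what extends the
   domination from a point to a neighbourhood. *)
have exO : forall i, exists V : set R, [/\ open V, E i `<=` V & (mu (V `\` E i) < (2^-1 ^+ i.+1)%:E)%E].
  move=> i; have [V [? ? ?]] := lebesgue_regularity_outer (mE i) (muE i) (i2 i); by exists V.
have [U OP] := choice exO.
have mUE i : measurable (U i `\` E i).
  by apply: measurableD => //; have [oU _ _] := OP i; exact: open_measurable.
have mO i : measurable (U i) by have [oO _ _] := OP i; exact: open_measurable.
pose s (k : nat) y : R := \sum_(i < k) \1_(U i) y.
pose v k y : R := (- n + eta * s k y) * \1_`]0, +oo[ y.
have s0 k y : 0 <= s k y by apply: sumr_ge0 => i _.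
have sk k y : s k y <= k%:R.
  apply: (@le_trans _ _ (\sum_(i < k) 1)); last by rewrite sumr_const card_ord.
  by apply: ler_sum => i _; rewrite indicE lern1 leq_b1.
have n00 : 0 <= n by [].
have mv k : measurable_fun setT (v k).
  apply: measurable_funM => //; apply: measurable_funD => //.
  by apply: measurable_funM => //; apply: measurable_sum => i; exact: measurable_indic.
have vbd k : exists M, forall y, `|v k y| <= M.
  exists (n + eta * k%:R) => y; rewrite /v indic_itv in_itv/= andbT.
  case: (0 < y); last by rewrite mulr0 normr0 addr_ge0// mulr_ge0 ?(ltW eta0).
  rewrite mulr1 (le_trans (ler_normD _ _))// normrN (ger0_norm n00) lerD2l.
  by rewrite ger0_norm ?mulr_ge0 ?(ltW eta0)// ler_pM2l.
exists n, v; split => //.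
- split; last split.
  + by move=> k y y0; rewrite /v indic_itv in_itv/= andbT ltNge y0 mulr0.
  + move=> k y; rewrite /v ler_wpM2r ?indicE ?ler0n// lerD2l ler_pM2l// /s big_ord_recr/= lerDl.
    by rewrite indicE ler0n.
  + move=> k y; rewrite /v indic_itv in_itv/= andbT; case: (0 < y); last by rewrite mulr0 oppr_le0.
    by rewrite mulr1 lerDl mulr_ge0 ?(ltW eta0).
- move=> x /andP[x0 xX].
  pose j := (Num.truncn (`|h x + n| / eta)).+1.
  have jP : h x + n <= eta * j%:R.
    rewrite mulrC -ler_pdivrMr//; apply: le_trans (ltW (truncnS_gt _)).
    by rewrite ler_pM2r ?invr_gt0// ler_norm.
  (* Minimality of [l] puts [x] into every layer of index below [l]; these finitely many open layers
     then share a neighbourhood of [x]. *)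
  have [l lj] : exists l : nat, h x + n <= eta * l%:R /\ forall i, (i < l)%N -> E i x.
    have ex : exists l : nat, h x + n <= eta * l%:R by exists j.
    case: (ex_minnP ex) => l lP lmin; exists l; split => // i il.
    rewrite /E /= x0 xX/= ltNge; apply/negP => hi.
    by have := lmin i; rewrite mulrC hi => /(_ isT); rewrite leqNgt il.
  have : \forall y \near x, forall i, (i < l)%N -> U i y.
    move: (proj2 lj); elim: (l) => [|l' IH] hE; first by apply/nbhs_ballP; exists 1 => //= y _ i.
    have [oO EO _] := OP l'.
    have h1 : \forall y \near x, U l' y by apply: open_nbhs_nbhs; split => //; apply: EO; exact: hE.
    have h2 := IH (fun i il => hE i (ltnW il)).
    near=> y => i; rewrite ltnS leq_eqVlt => /predU1P[->|il]; first by near: y.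
    by move: i il; near: y.
  move=> /nbhs_ballP[d /= d0 hd]; exists l, (Num.min d x); split; first by rewrite lt_min d0.
  move=> y /andP[yl yx].
  have mx : Num.min d x <= x by rewrite ge_min lexx orbT.
  have y0 : 0 < y by lra.
  have yd : Num.min d x <= d by rewrite ge_min lexx.
  have hy : ball x d y by rewrite /ball/= ger0_norm ?subr_ge0//; lra.
  have -> : v l y = - n + eta * l%:R.
    rewrite /v indic_itv in_itv/= andbT y0 mulr1; congr (_ + _ * _).
    rewrite /s -[in RHS](card_ord l) -sumr_const; apply: eq_bigr => i _.
    by rewrite indicE mem_set//; apply: hd.
  by have := proj1 lj; lra.
- move=> k.
  pose r y : R := \sum_(i < k) \1_(U i `\` E i) y.
  have ir (i : nat) : mu.-integrable `]0, X[ (EFin \o (\1_(U i `\` E i) : R -> R)).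
    apply: (integrable_boundedr mu mD _ 1) => //.
      by apply: measurable_funTS; apply: measurable_indic; exact: mUE.
    by move=> y _; rewrite indicE ger0_norm ?ler0n// lern1 leq_b1.
  have i1 (a : R) : mu.-integrable `]0, X[ (EFin \o (fun _ : R => a)).
    by apply: (integrable_boundedr mu mD _ `|a|).
  have ivk : mu.-integrable `]0, X[ (EFin \o v k).
    have [M vM] := vbd k.
    apply: (integrable_boundedr mu mD _ M) => //.
    by apply: measurable_funTS; exact: mv.
  have isr : mu.-integrable `]0, X[ (EFin \o (fun y => \sum_(i < k) \1_(U i `\` E i) y)).
    by apply: (integrable_sumr mu mD k (fun i : nat => \1_(U i `\` E i))).
  have isr' : mu.-integrable `]0, X[ (EFin \o (fun y => eta * \sum_(i < k) \1_(U i `\` E i) y)).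
    exact: (integrable_scaler mu mD).
  have i3 : mu.-integrable `]0, X[ (EFin \o (fun y => eta + eta * \sum_(i < k) \1_(U i `\` E i) y)).
    exact: (integrable_addr mu mD).
  have ihh : mu.-integrable `]0, X[ (EFin \o (fun y => hn n0 y - h y)).
    exact: (integrable_subr mu mD).
  have i4 : mu.-integrable `]0, X[ (EFin \o (fun y => (hn n0 y - h y) + (eta + eta * \sum_(i < k) \1_(U i `\` E i) y))).
    exact: (integrable_addr mu mD).
  have ivh : mu.-integrable `]0, X[ (EFin \o (fun y => v k y - h y)).
    exact: (integrable_subr mu mD).
  have imax : mu.-integrable `]0, X[ (EFin \o (fun y => Num.max (v k y - h y) 0)).
    apply: (integrable_ler mu mD _ (fun y => `|v k y - h y|)).
    - apply: measurable_maxr => //; apply: measurable_funB => //.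
      by apply: measurable_funTS; exact: mv.
    - move=> y _; rewrite ger0_norm; last by rewrite le_max lexx orbT.
      by rewrite ge_max ler_norm normr_ge0.
    - exact: (integrable_normr mu).
  split=> //.
  apply: (@le_trans _ _ (\int[mu]_(y in `]0, X[) ((hn n0 y - h y) + (eta + eta * \sum_(i < k) \1_(U i `\` E i) y)))).
    apply: le_Rintegral => // y; rewrite /= in_itv/= => /andP[y0 yX].
    have hnh : h y <= hn n0 y by rewrite /hn le_max lexx.
    have er : 0 <= eta + eta * \sum_(i < k) \1_(U i `\` E i) y.
      rewrite addr_ge0 ?(ltW eta0)// mulr_ge0 ?(ltW eta0)// sumr_ge0// => i _.
    rewrite ge_max; apply/andP; split; last by lra.
    rewrite /v indic_itv in_itv/= andbT y0 mulr1 /s.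
    have -> : \sum_(i < k) \1_(U i) y = \sum_(i < k) ((i%:R * eta < h y + n)%R%:R : R) + \sum_(i < k) \1_(U i `\` E i) y.
      rewrite -big_split/=; apply: eq_bigr => i _; rewrite !indicE in_setD.
      have [_ EO _] := OP i; have -> : (y \in E i) = (i%:R * eta < h y + n).
        by apply/idP/idP; rewrite inE /E/= y0 yX.
      case: ltP => hi /=; last by rewrite andbT add0r.
      by rewrite mem_set ?addr0//; apply: EO; rewrite /E/= y0 yX hi.
    have := sum_layers_le (h y + n) k eta0; rewrite mulrDr /hn -/n.
    have -> : Num.max (h y + n) 0 = Num.max (h y) (- n) + n by rewrite addr_maxl addNr.
    lra.
  rewrite RintegralD// RintegralB// RintegralD// RintegralZl// (Rintegral_sumr mu mD k (fun i : nat => \1_(U i `\` E i)))// Rintegral_cst//.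
  have -> : fine (mu `]0, X[%classic) = X by rewrite muD.
  have hs : \sum_(i < k) \int[mu]_(y in `]0, X[) \1_(U i `\` E i) y <= 1.
    apply: (@le_trans _ _ (\sum_(i < k) 2^-1 ^+ i.+1)).
      apply: ler_sum => i _; have [_ _ hO] := OP i.
      rewrite /Rintegral integral_indic//; last exact: mUE.
      have hle : (mu ((U i `\` E i) `&` `]0%R, X[) <= (2^-1 ^+ i.+1)%:E)%E.
        apply: le_trans (ltW hO); apply: le_measure; rewrite ?inE//; last exact: mUE.
        by apply: measurableI => //; exact: mUE.
      have hfin : mu ((U i `\` E i) `&` `]0%R, X[) \is a fin_num.
        by rewrite ge0_fin_numE// (le_lt_trans hle)// ltry.
      by rewrite -lee_fin fineK.
    have -> : \sum_(i < k) 2^-1 ^+ i.+1 = 1 - 2^-1 ^+ k :> R.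
      elim: (k) => [|j IH]; first by rewrite big_ord0 expr0 subrr.
      rewrite big_ord_recr/= IH exprS; lra.
    by rewrite gerBl exprn_ge0// invr_ge0.
  have heta1 : eta * X <= eps / 3.
    have : eta <= eps / (3 * X) by rewrite ge_min lexx orbT.
    by rewrite ler_pdivlMr ?mulr_gt0// mulrCA => ?; rewrite ler_pdivlMr// mulrC.
  have heta2 : eta * \sum_(i < k) \int[mu]_(y in `]0, X[) \1_(U i `\` E i) y <= eps / 3.
    have : eta <= eps / 3 by rewrite ge_min lexx.
    by apply: le_trans; rewrite -[leRHS]mulr1 ler_pM2l.
  move: hn0 heta1 heta2; move: (\int[mu]_(y in `]0, X[) h y) (\int[mu]_(y in `]0, X[) hn n0 y) => I0 I1.
  set J1 := eta * \sum_(i < k) _; move: J1 (eta * X) => J1 J0; lra.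
Unshelve. all: by end_near. Qed.

End vitali_caratheodory.

(** * The cut-off Marchaud derivative and its limit *)

Section marchaud.
Context {R : realType}.
Notation mu := (@lebesgue_measure R).
Implicit Types (b e x y u : R).

Lemma integral_cutoff b x e : b != 0 -> 0 < x -> 0 < e ->
  (\int[mu]_(u in `]0%R, x[) ((x - u + e) `^ (- 1 - b))%:E =
   ((e `^ (- b) - (x + e) `^ (- b)) / b)%:E)%E.
Proof.
move=> b0 x0 e0; pose F u := b^-1 * (x + e - u) `^ (- b).
have cF r : r < x + e -> {for r, continuous (fun r => (x + e - r) `^ (- b))}.
  move=> rc.
  apply: (@continuous_comp _ _ _ (fun r : R => x + e - r) (fun t : R => t `^ (- b))).
    by apply: continuousB; [exact: cst_continuous|exact: cvg_id].
  by apply: continuous_powR_gt0; rewrite subr_gt0.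
have dF u : 0 < u < x -> is_derive u (1 : R) F ((x - u + e) `^ (- 1 - b)).
  move=> /andP[u0 ux]; have cu : 0 < x + e - u by lra.
  have dc : is_derive u (1 : R) (fun r : R => x + e - r) (- 1).
    rewrite -(sub0r 1).
    exact: (is_deriveB (is_derive_cst (x + e) u 1) (is_derive_id u 1)).
  have d1 := is_derive1_powR (- b) cu.
  have d2 := is_derive1_comp (g := fun r : R => x + e - r) d1 dc.
  have d4 := is_deriveZ b^-1 d2.
  apply: (is_derive_eq (f := F) d4).
  rewrite /GRing.scale /= (_ : x - u + e = x + e - u); last by ring.
  rewrite (_ : - b - 1 = - 1 - b); last by ring.
  by field.
rewrite (ge0_FTC_itvoo x0 _ _ dF (A := b^-1 * (x + e) `^ (- b)) (B := b^-1 * e `^ (- b))).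
- by congr EFin; rewrite -mulrBr mulrC.
- by move=> u _; exact: powR_ge0.
- move=> u /andP[u0 ux].
  apply: (@continuous_comp _ _ _ (fun r : R => x - r + e) (fun t : R => t `^ (- 1 - b))).
    apply: continuousD; last exact: cst_continuous.
    by apply: continuousB; [exact: cst_continuous|exact: cvg_id].
  by apply: continuous_powR_gt0; lra.
- apply: cvgMr; apply: cvg_at_right_filter.
  have h : 0 < x + e by rewrite addr_gt0.
  by have := cF 0 h; rewrite /prop_for /continuous_at subr0.
- apply: cvgMr; apply: cvg_at_left_filter.
  have h : x < x + e by rewrite ltrDl.
  by have := cF x h; rewrite /prop_for /continuous_at addrAC subrr add0r.
Qed.

Lemma measurable_cutoff b x e (D : set R) : measurable_fun D (fun u => (x - u + e) `^ (- 1 - b)).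
Proof.
apply: measurable_funTS; apply: (measurableT_comp (@measurable_powR _ _)).
by apply: measurable_funD => //; exact: measurable_funB.
Qed.

Lemma muoo x : (mu `]0%R, x[ < +oo)%E.
Proof. by rewrite lebesgue_measure_itv/=; case: ifPn => _; rewrite -?EFinB ltry. Qed.

Lemma cutoff_le b x e u : 0 <= b -> 0 < e -> u < x -> (x - u + e) `^ (- 1 - b) <= e `^ (- 1 - b).
Proof.
move=> b0 e0 ux; rewrite -opprD !powRN lef_pV2 ?posrE ?powR_gt0//; last by lra.
by apply: ge0_ler_powR; rewrite ?nnegrE; lra.
Qed.

Lemma integrable_cutoff b x e (q : R -> R) M : 0 <= b -> 0 < e ->
  measurable_fun `]0, x[ q -> (forall y, 0 < y < x -> `|q y| <= M) ->
  mu.-integrable `]0, x[ (EFin \o (fun u => q u * (x - u + e) `^ (- 1 - b))).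
Proof.
move=> b0 e0 mq qM.
have mD : measurable (`]0, x[%classic : set R) by exact: measurable_itv.
have h := muoo x.
apply: (integrable_boundedr mu mD _ (M * e `^ (- 1 - b))) => //.
  by apply: measurable_funM => //; exact: measurable_cutoff.
move=> u; rewrite /= in_itv/= => /andP[u0 ux].
rewrite normrM [X in _ * X]ger0_norm ?powR_ge0//; apply: ler_pM => //; first exact: powR_ge0.
  by apply: qM; rewrite u0.
exact: cutoff_le.
Qed.

Lemma integrable_cutoff1 b x e : 0 <= b -> 0 < e ->
  mu.-integrable `]0, x[ (EFin \o (fun u => (x - u + e) `^ (- 1 - b))).
Proof.
move=> b0 e0; have := @integrable_cutoff b x e (fun => 1) 1 b0 e0.
rewrite (_ : (fun u => 1 * _) = (fun u => (x - u + e) `^ (- 1 - b))); last first.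
  by apply/funext => u; rewrite mul1r.
by apply => // y _; rewrite normr1.
Qed.

(** The cut-off integral of the constant [q x] is added and subtracted. The divergent terms e^(-b)
    cancel, and the difference [q x - q u] that remains survives the limit e -> 0. *)
Lemma cutoff_compensated b x e (q : R -> R) M : 0 < b -> 0 < x -> 0 < e ->
  measurable_fun `]0, x[ q -> (forall y, 0 < y < x -> `|q y| <= M) ->
  q x * (e `^ (- b) / b) - \int[mu]_(u in `]0, x[) (q u * (x - u + e) `^ (- 1 - b)) =
  q x * (x + e) `^ (- b) / b + \int[mu]_(u in `]0, x[) ((q x - q u) * (x - u + e) `^ (- 1 - b)).
Proof.
move=> b0 x0 e0 mq qM.
have mD : measurable (`]0, x[%classic : set R) by exact: measurable_itv.
have i1 := integrable_cutoff (ltW b0) e0 mq qM.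
have i2 : mu.-integrable `]0, x[ (EFin \o (fun u => q x * (x - u + e) `^ (- 1 - b))).
  by apply: (@integrable_cutoff _ _ _ (fun => q x) `|q x|); rewrite ?(ltW b0).
have -> : \int[mu]_(u in `]0, x[) ((q x - q u) * (x - u + e) `^ (- 1 - b)) =
   \int[mu]_(u in `]0, x[) (q x * (x - u + e) `^ (- 1 - b) - q u * (x - u + e) `^ (- 1 - b)).
  by apply: eq_Rintegral => u _; rewrite mulrBl.
rewrite RintegralB//.
have i3 : mu.-integrable `]0, x[ (EFin \o (fun u => (x - u + e) `^ (- 1 - b))).
  apply: integrable_cutoff1 => //; exact: ltW.
have cE : \int[mu]_(u in `]0, x[) ((x - u + e) `^ (- 1 - b)) = (e `^ (- b) - (x + e) `^ (- b)) / b.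
  by rewrite /Rintegral integral_cutoff ?gt_eqF.
rewrite RintegralZl// cE; ring.
Qed.

Lemma cvg_powR_harmonic b x : 0 < x -> (x + harmonic i) `^ b @[i --> \oo] --> x `^ b.
Proof.
move=> x0; have c := @continuous_powR_gt0 _ b _ x0.
have cu : x + harmonic i @[i --> \oo] --> x.
  rewrite -[X in _ --> X]addr0; apply: cvgD; first exact: cvg_cst.
  exact: cvg_harmonic.
by apply: (@continuous_cvg _ R R (nbhs \oo) _ (fun i : nat => x + harmonic i) (fun y : R => y `^ b) x).
Qed.

(** The cut-off power is at most the singular one, so the integrand of the Marchaud derivative
    itself dominates. The cut-off runs through [harmonic i], that is 1 / (i + 1). *)
Lemma cvg_cutoff b x (q : R -> R) : 0 < b -> measurable_fun `]0, x[ q ->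
  mu.-integrable `]0, x[ (EFin \o (fun u => (q x - q u) / (x - u) `^ (1 + b))) ->
  \int[mu]_(u in `]0, x[) ((q x - q u) * (x - u + harmonic i) `^ (- 1 - b)) @[i --> \oo] -->
  \int[mu]_(u in `]0, x[) ((q x - q u) / (x - u) `^ (1 + b)).
Proof.
move=> b0 mq iq.
have mD : measurable (`]0, x[%classic : set R) by exact: measurable_itv.
pose f i u := (q x - q u) * (x - u + harmonic i) `^ (- 1 - b).
pose g u := (q x - q u) / (x - u) `^ (1 + b).
have mf i : measurable_fun `]0, x[ (f i).
  by apply: measurable_funM; [exact: measurable_funB|exact: measurable_cutoff].
have mg : measurable_fun `]0, x[ g by apply/measurable_EFinP; exact: measurable_int iq.
apply: (dominated_cvg_Rintegral mu mD f g (fun u => `|g u|)) => //.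
- apply: aeW => u; rewrite /= in_itv/= => /andP[u0 ux].
  apply: cvgMr; rewrite -powRN opprD.
  by apply: cvg_powR_harmonic; rewrite subr_gt0.
- exact: (integrable_normr mu).
- apply: aeW => u i; rewrite /= in_itv/= => /andP[u0 ux]; rewrite /f /g !normrM.
  apply: ler_wpM2l => //; rewrite ger0_norm ?powR_ge0// -powRN ger0_norm ?powR_ge0// opprD.
  have xu : 0 < x - u by rewrite subr_gt0.
  have hi := @harmonic_ge0 R i.
  have xui : 0 < x - u + harmonic i by exact: ltr_wpDr.
  rewrite -opprD !powRN lef_pV2 ?posrE; last 2 first.
  - exact: powR_gt0.
  - exact: powR_gt0.
  by apply: ge0_ler_powR; rewrite ?nnegrE ?(ltW xu) ?(ltW xui) ?lerDl// addr_ge0// ltW.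
Qed.

End marchaud.

(** * The maximum principle for Marchaud derivatives *)

Section max_principle.
Context {R : realType}.
Notation mu := (@lebesgue_measure R).
Variables (b : R) (p h : R -> R) (X Mp : R).
Hypotheses (b01 : 0 < b < 1) (cp : continuous p) (pM : forall x, `|p x| <= Mp)
  (p0 : p 0 = 0) (X0 : 0 < X)
  (ip : forall x, 0 < x <= X -> mu.-integrable `]0, x[ (EFin \o (fun u => (p x - p u) / (x - u) `^ (1 + b))))
  (hE : forall x, 0 < x <= X -> gamma_fun (1 - b) * h x =
     p x / x `^ b + b * \int[mu]_(u in `]0, x[) ((p x - p u) / (x - u) `^ (1 + b))).
Variables (n : R) (v : nat -> R -> R).
Hypotheses (n0 : 0 <= n) (mv : forall k, measurable_fun setT (v k))
  (vM : forall k, exists M : R, forall y, `|v k y| <= M)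
  (v0 : forall k y, y <= 0 -> v k y = 0)
  (vmono : forall k y, v k y <= v k.+1 y)
  (vn : forall k y, - n <= v k y)
  (vh : forall x, 0 < x <= X -> exists j d, 0 < d /\ forall y, x - d < y <= x -> h x <= v j y).
Let b0 : 0 < b. Proof. by case/andP: b01. Qed.
Let b1 : b < 1. Proof. by case/andP: b01. Qed.
Let Gb : R := gamma_fun b.
Let Gb0 : 0 < Gb. Proof. exact: gamma_fun_gt0. Qed.

Let vmono' j k y : (j <= k)%N -> v j y <= v k y.
Proof.
move=> /subnKC <-; elim: (k - j)%N => [|i IH]; first by rewrite addn0.
by rewrite addnS (le_trans IH).
Qed.

Let integral_kap_shift x e : 0 < e -> \int[mu]_y kap b e (x - y) = Gb * gamma_fun (1 - b).
Proof.
move=> e0; transitivity (\int[mu]_y kap b e (-1 * y + x)).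
  by apply: eq_Rintegral => y _; rewrite mulN1r addrC.
rewrite (@Rintegral_affine _ (-1) x (kap b e)) ?oppr_eq0 ?oner_eq0//; last exact: measurable_kap.
by rewrite normrN1 invr1 mul1r /Rintegral integral_kap// ebeta_gamma.
Qed.

Let integrable_kap_shift x e : 0 < e -> mu.-integrable setT (EFin \o (fun y => kap b e (x - y))).
Proof.
move=> e0; have mk : measurable_fun setT (fun y : R => kap b e (x - y)).
  by apply: (measurableT_comp (@measurable_kap _ b e)); exact: measurable_funB.
apply/integrableP; split; first exact/measurable_EFinP.
rewrite (_ : (\int[mu]_y _)%E = (\int[mu]_y (EFin \o kap b e) (-1 * y + x)%R)%E); last first.
  by apply: eq_integral => y _; rewrite /= ger0_norm ?kap_ge0 ?(ltW e0)// mulN1r addrC.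
rewrite (@ge0_integral_affine _ (-1) x (EFin \o kap b e)) ?oppr_eq0 ?oner_eq0//.
- by rewrite normrN1 invr1 mul1e /= integral_kap//; have /andP[] := ebeta_fin b01.
- by apply/measurable_EFinP; exact: measurable_kap.
- by move=> y; rewrite lee_fin kap_ge0 ?ltW.
Qed.

Let kap_tail_shift x e d : 0 < e -> 0 < d ->
  mu.-integrable setT (EFin \o (fun y => kap b e (x - y) * \1_`]d, +oo[ (x - y))) /\
  \int[mu]_y (kap b e (x - y) * \1_`]d, +oo[ (x - y)) <= e `^ (1 - b) * (d `^ (b - 1) / (1 - b)).
Proof.
move=> e0 d0; pose f s : R := kap b e s * \1_`]d, +oo[ s.
have mf : measurable_fun setT f by apply: measurable_funM => //; exact: measurable_kap.
have f0 s : 0 <= f s by rewrite mulr_ge0 ?kap_ge0// ltW.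
have mfx : measurable_fun setT (fun y : R => f (x - y)).
  by apply: (measurableT_comp mf); exact: measurable_funB.
have bnd : (\int[mu]_y (f (x - y))%:E <= (e `^ (1 - b) * (d `^ (b - 1) / (1 - b)))%:E)%E.
  rewrite (_ : (\int[mu]_y _)%E = (\int[mu]_y (EFin \o f) (-1 * y + x)%R)%E); last first.
    by apply: eq_integral => y _; rewrite /= mulN1r addrC.
  rewrite (@ge0_integral_affine _ (-1) x (EFin \o f)) ?oppr_eq0 ?oner_eq0//.
  - by rewrite normrN1 invr1 mul1e; exact: integral_kap_tail.
  - exact/measurable_EFinP.
have pos : (0 <= \int[mu]_y (f (x - y))%:E)%E by apply: integral_ge0 => y _; rewrite lee_fin.
have fin : (\int[mu]_y (f (x - y))%:E)%E \is a fin_num.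
  by rewrite ge0_fin_numE// (le_lt_trans bnd)// ltry.
split; last by rewrite -lee_fin /Rintegral fineK.
apply/integrableP; split; first exact/measurable_EFinP.
rewrite (_ : (\int[mu]_y _)%E = \int[mu]_y (f (x - y))%:E)%E; first by rewrite (le_lt_trans bnd)// ltry.
by apply: eq_integral => y _; rewrite /= ger0_norm//; exact: f0.
Qed.

(** Within distance [d] on the left of [x] the source is at least [c]. Farther away it is at least
    [- n], hence at least c - (n + |c|), and there [kap] has a mass of order e^(1-b) only. *)
Let integral_kap_ge j x e d c : 0 < e -> 0 < d ->
  (forall y, x - d <= y < x -> c <= v j y) ->
  c * (Gb * gamma_fun (1 - b)) - (n + `|c|) * (e `^ (1 - b) * (d `^ (b - 1) / (1 - b))) <=
  \int[mu]_y (kap b e (x - y) * v j y).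
Proof.
move=> e0 d0 hc; have [it bt] := kap_tail_shift x e0 d0.
have ik := integrable_kap_shift x e0.
have [M hM] := vM j.
have ikv := integrable_kap b01 (mv j) hM (v0 j) x e0.
have i1 := integrable_scaler mu measurableT c _ ik.
have i2 := integrable_scaler mu measurableT (n + `|c|) _ it.
apply: (@le_trans _ _ (\int[mu]_y (c * kap b e (x - y) - (n + `|c|) * (kap b e (x - y) * \1_`]d, +oo[ (x - y))))).
  rewrite RintegralB// RintegralZl// RintegralZl// integral_kap_shift// lerD2l lerN2.
  by apply: ler_wpM2l => //; rewrite addr_ge0.
apply: le_Rintegral => //; first exact: (integrable_subr mu measurableT).
move=> y _; set k := kap b e (x - y).
have k0 : 0 <= k by rewrite kap_ge0// ltW.
rewrite (_ : c * k - _ = k * (c - (n + `|c|) * \1_`]d, +oo[ (x - y))); last by ring.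
rewrite indic_itv in_itv/= andbT.
have [xy|yx] := leP x y; first by rewrite /k /kap riesz_le0 ?subr_le0// mul0r mulr0 !mul0r.
apply: ler_wpM2l => //; have [dxy|xyd] := ltP d (x - y); last first.
  by rewrite mulr0 subr0; apply: hc; rewrite yx andbT lerBlDr -lerBlDl.
rewrite mulr1 opprD addrA; apply: le_trans (vn j y).
by have := ler_norm c; lra.
Qed.

(** If the claim fails, the functions [w k], increasing in [k], have negative minima that stay away
    from 0. At a cluster point [x0] of the minimum points every [w k] is at most the supremum [m] of
    the minima, which makes its truncated derivative there at most about m (x0 + e)^(-b). Passing to
    the limit first in [k], then in [e], gives 0 <= m x0^(-b), against m < 0. *)
Lemma max_principle c : (forall k, rliou b (v k) X <= c) -> Gb * p X <= c.
Proof.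
move=> hc; rewrite leNgt; apply/negP => cX.
pose w k x := rliou b (v k) x - Gb * p x.
have cw k : continuous (w k).
  have [M hM] := vM k.
  move=> x; apply: continuousB; first exact: (continuous_rliou b01 (mv k) hM (v0 k)).
  by apply: continuousM; [exact: cst_continuous|exact: cp].
have wmono j k x : (j <= k)%N -> w j x <= w k x.
  move=> jk; have [M hM] := vM j; have [M' hM'] := vM k.
  rewrite lerD2r; apply: (@le_rliou _ b _ _ M M') => // y; [exact: v0|exact: v0|exact: vmono'].
have exm k : exists2 x, x \in `[0, X] & forall t, t \in `[0, X] -> w k x <= w k t.
  by apply: (EVT_min (ltW X0)); apply: continuous_subspaceT; exact: cw.
pose xm k := s2val (cid2 (exm k)).
have xmX k : xm k \in `[0, X] by rewrite /xm; case: cid2.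
have xmmin k t : t \in `[0, X] -> w k (xm k) <= w k t by rewrite /xm; case: cid2 => ? ? h1 /=; exact: h1.
pose m := sup (range (fun k => w k (xm k))).
have XX : X \in `[0, X] by rewrite in_itv/= lexx ltW.
have ubm k : w k (xm k) <= c - Gb * p X.
  by apply: (le_trans (xmmin k X XX)); rewrite lerD2r.
have hs : has_sup (range (fun k => w k (xm k))).
  split; first by exists (w 0%N (xm 0%N)), 0%N.
  by exists (c - Gb * p X) => _ [k _ <-].
have m0 : m < 0.
  apply: (@le_lt_trans _ _ (c - Gb * p X)); last by rewrite subr_lt0.
  apply: ge_sup; first by case: hs.
  by move=> _ [k _ <-].
have lem k : w k (xm k) <= m by apply: (sup_upper_bound hs); exists k.
have [x0 [x0X clx]] : `[0, X]%classic `&` cluster (xm @ \oo) !=set0.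
  by apply: (@segment_compact _ 0 X (xm @ \oo)); exists 0%N => // k _; exact: xmX.
(* If [w j] exceeded [m] at [x0], it would do so near [x0], hence at some [xm k] with k >= j, and by
   monotonicity the minimum of [w k] would exceed [m]. *)
have wm j : w j x0 <= m.
  rewrite leNgt; apply/negP => mw.
  have oB : nbhs x0 [set x | m < w j x].
    have /cvgrPdist_lt := cw j x0; move=> /(_ (w j x0 - m)); rewrite subr_gt0 => /(_ mw).
    apply: filterS => x /=; rewrite ltr_distlC => /andP[+ _].
    by rewrite opprB addrC subrK.
  have [y [[k /= jk] ]] := clx [set x | exists k, (j <= k)%N /\ x = xm k] _ (ex_intro2 _ _ j I (fun k jk => ex_intro _ k (conj jk erefl))) oB.
  rewrite /= (proj2 jk) => mwj.
  by have := le_trans (wmono j k (xm k) (proj1 jk)) (lem k); rewrite leNgt mwj.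
(* Every [w k] vanishes at 0, whereas [w 0] is at most m < 0 at [x0]. *)
have x00 : 0 < x0.
  rewrite lt_neqAle; move: x0X; rewrite /= in_itv/= => /andP[-> _]; rewrite andbT eq_sym.
  apply/eqP => x0E; have := wm 0%N; rewrite x0E /w p0 mulr0 subr0 rliou_le0 ?lexx//; last exact: v0.
  by rewrite leNgt m0.
have x0X' : 0 < x0 <= X by move: x0X; rewrite x00 /= in_itv/= => /andP[].
have [j [d [d0 hd]]] := vh x0X'.
have mp : measurable_fun `]0, x0[ p.
  by apply: measurable_funTS; exact: continuous_measurable_fun.
have mD : measurable (`]0, x0[%classic : set R) by exact: measurable_itv.
pose A e := p x0 * (x0 + e) `^ (- b) / b + \int[mu]_(u in `]0, x0[) ((p x0 - p u) * (x0 - u + e) `^ (- 1 - b)).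
(* Here [e] is fixed and the index large. With E = e^(-b) and F = (x0 + e)^(-b), b times the mass of
   the cut-off kernel is E - F; then [w l x0 <= m] and [w l >= m - eps / E] on the interval bound
   the truncated derivative of [w l] by m F + eps. *)
have key e : 0 < e -> \int[mu]_y (kap b e (x0 - y) * v j y) <=
   m * (x0 + e) `^ (- b) + b * Gb * A e.
  move=> e0; apply/ler_addgt0Pr => eps eps0.
  have eb : 0 < e `^ (- b) by rewrite powR_gt0.
  have [_ [k _ <-]] := sup_adherent (divr_gt0 eps0 eb) hs; rewrite -/m => hk.
  pose l := maxn j k.
  have [M hM] := vM l.
  have hl : m - eps / e `^ (- b) <= w l (xm l).
    apply: (le_trans (ltW hk)).
    apply: (le_trans (xmmin k (xm l) (xmX l))); apply: wmono; exact: leq_maxr.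
  apply: (@le_trans _ _ (\int[mu]_y (kap b e (x0 - y) * v l y))).
    have [M' hM'] := vM j.
    apply: le_Rintegral => //.
    - exact: (integrable_kap b01 (mv j) hM' (v0 j)).
    - exact: (integrable_kap b01 (mv l) hM (v0 l)).
    - move=> y _; apply: ler_wpM2l; first by rewrite kap_ge0// ltW.
      by apply: vmono'; exact: leq_maxl.
  have := truncated_marchaud_rliou b01 (mv l) hM (v0 l) x00 e0.
  move=> /(congr1 (fun z => b * z)); rewrite mulVKf ?gt_eqF// => <-.
  have rE u : rliou b (v l) u = w l u + Gb * p u by rewrite /w subrK.
  have [Mw hMw] : exists Mw, forall y, 0 < y < x0 -> `|w l y| <= Mw.
    have := @EVT_max _ (fun y => `|w l y|) 0 X (ltW X0) _.
    case; first by apply: continuous_subspaceT => y; apply: continuous_comp; [exact: cw|exact: norm_continuous].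
    move=> y _ hy; exists `|w l y| => z /andP[z0 zx].
    apply: hy; rewrite in_itv/= (ltW z0) (le_trans (ltW zx))//; by case/andP: x0X'.
  have mw : measurable_fun `]0, x0[ (w l).
    by apply: measurable_funTS; apply: continuous_measurable_fun; exact: cw.
  have iw := integrable_cutoff (ltW b0) e0 mw hMw.
  have ipc := integrable_cutoff (ltW b0) e0 mp (fun y _ => pM y).
  have ipG := integrable_scaler mu mD Gb _ ipc.
  have -> : \int[mu]_(u in `]0, x0[) (rliou b (v l) u * (x0 - u + e) `^ (- 1 - b)) =
     \int[mu]_(u in `]0, x0[) (w l u * (x0 - u + e) `^ (- 1 - b)) +
     Gb * \int[mu]_(u in `]0, x0[) (p u * (x0 - u + e) `^ (- 1 - b)).
    rewrite -RintegralZl// -RintegralD//; apply: eq_Rintegral => u _.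
    by rewrite rE mulrDl mulrA.
  have AE := cutoff_compensated b0 x00 e0 mp (fun y _ => pM y).
  rewrite rE -/(A e) in AE *.
  have wJ : w l (xm l) * ((e `^ (- b) - (x0 + e) `^ (- b)) / b) <=
      \int[mu]_(u in `]0, x0[) (w l u * (x0 - u + e) `^ (- 1 - b)).
    have -> : (e `^ (- b) - (x0 + e) `^ (- b)) / b = \int[mu]_(u in `]0, x0[) ((x0 - u + e) `^ (- 1 - b)).
      by rewrite /Rintegral integral_cutoff ?gt_eqF.
    have i3 : mu.-integrable `]0, x0[ (EFin \o (fun u => (x0 - u + e) `^ (- 1 - b))).
      apply: integrable_cutoff1 => //; exact: ltW.
    rewrite -RintegralZl//; apply: le_Rintegral => //; first exact: (integrable_scaler mu mD).
    move=> u; rewrite /= in_itv/= => /andP[u0 ux]; apply: ler_wpM2r; first exact: powR_ge0.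
    apply: xmmin; rewrite in_itv/= (ltW u0) (le_trans (ltW ux))//; by case/andP: x0X'.
  set I1 := \int[mu]_(u in `]0, x0[) (w l u * _) in wJ *.
  set I2 := \int[mu]_(u in `]0, x0[) (p u * _) in AE *.
  have wl := wm l.
  set E := e `^ (- b) in eb hl wJ AE *; set F := (x0 + e) `^ (- b) in wJ *.
  have FE : F <= E.
    rewrite /F /E !powRN lef_pV2 ?posrE ?powR_gt0 ?addr_gt0//.
    by apply: ge0_ler_powR; rewrite ?nnegrE ?addr_ge0 ?(ltW b0) ?(ltW x00) ?(ltW e0)// lerDr ltW.
  have F0 : 0 <= F by exact: powR_ge0.
  rewrite (_ : b * _ = w l x0 * E - b * I1 + b * Gb * (p x0 * (E / b) - I2)); last first.
    by field; rewrite gt_eqF.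
  rewrite AE; move: (b * Gb * A e) => BA.
  have h1 : w l x0 * E <= m * E by rewrite ler_pM2r.
  have h2 : w l (xm l) * (E - F) <= b * I1.
    by move: wJ; rewrite mulrA ler_pdivrMr// [b * _]mulrC.
  have h3 : (m - eps / E) * (E - F) <= w l (xm l) * (E - F) by rewrite ler_wpM2r// subr_ge0.
  have h4 : eps / E * (E - F) <= eps.
    rewrite -[leRHS](divfK (lt0r_neq0 eb)); apply: ler_wpM2l.
      by rewrite divr_ge0// ltW.
    by rewrite gerBl.
  move: h1 h2 h3 h4; generalize (w l x0) (w l (xm l)) I1 m E F => *; lra.
have lim1 : (fun i => h x0 * (Gb * gamma_fun (1 - b)) -
    (n + `|h x0|) * (harmonic i `^ (1 - b) * ((d / 2) `^ (b - 1) / (1 - b)))) @ \oo --> h x0 * (Gb * gamma_fun (1 - b)).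
  rewrite -[X in _ --> X]subr0; apply: cvgB; first exact: cvg_cst.
  rewrite -(mulr0 (n + `|h x0|)); apply: cvgMr.
  rewrite -(mul0r ((d / 2) `^ (b - 1) / (1 - b))); apply: cvgMl.
  have b1' : 0 < 1 - b by rewrite subr_gt0.
  have cc : (fun x : R => x `^ (1 - b)) x @[x --> 0^'+] --> (0 : R) by exact: powR_cvg0.
  by move/cvg_at_rightP : cc => /(_ harmonic); apply; split; [exact: harmonic_gt0|exact: cvg_harmonic].
have lim2 : (fun i => m * (x0 + harmonic i) `^ (- b) + b * Gb * A (harmonic i)) @ \oo -->
    m * x0 `^ (- b) + b * Gb * (p x0 * x0 `^ (- b) / b + \int[mu]_(u in `]0, x0[) ((p x0 - p u) / (x0 - u) `^ (1 + b))).
  have cpow := @cvg_powR_harmonic R (- b) _ x00.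
  apply: cvgD; first by apply: cvgMr.
  apply: cvgMr; apply: cvgD; last exact: (cvg_cutoff b0 mp (ip x0X')).
  by apply: cvgMl; apply: cvgMr.
have : h x0 * (Gb * gamma_fun (1 - b)) <= m * x0 `^ (- b) + b * Gb * (p x0 * x0 `^ (- b) / b + \int[mu]_(u in `]0, x0[) ((p x0 - p u) / (x0 - u) `^ (1 + b))).
  apply: (ler_cvg_to lim1 lim2); apply: nearW => i.
  apply: le_trans (key _ (harmonic_gt0 i)).
  (* Halving [d] puts the closed range of [integral_kap_ge] inside the half-open range where [v j]
     dominates [h x0]. *)
  have d2 : 0 < d / 2 by rewrite divr_gt0.
  apply: integral_kap_ge => //; first exact: harmonic_gt0.
  by move=> y /andP[y1 y2]; apply: hd; rewrite (ltW y2) andbT; lra.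
have := hE x0X'; rewrite -powRN.
set I := \int[mu]_(_ in _) _ => hh.
have -> : h x0 * (Gb * gamma_fun (1 - b)) = Gb * (gamma_fun (1 - b) * h x0) by ring.
rewrite hh.
have -> : Gb * (p x0 * x0 `^ (- b) + b * I) = b * Gb * (p x0 * x0 `^ (- b) / b + I).
  by field; rewrite gt_eqF.
rewrite lerDr leNgt => /negP; apply.
by rewrite nmulr_rlt0// powR_gt0.
Qed.

End max_principle.

(** * The convolution of the kernels of orders b and 1 - b *)

Section beta_convolution.
Context {R : realType}.
Notation mu := (@lebesgue_measure R).
Implicit Types (b d s u x y : R).

Lemma mule_injr (k : R) (x y : \bar R) : k != 0 -> (k%:E * x = k%:E * y)%E -> x = y.
Proof.
move=> k0 /(congr1 (fun z => (k^-1)%:E * z)%E).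
by rewrite !muleA -!EFinM mulVf// !mul1e.
Qed.

Definition riesz_conv b d : \bar R := (\int[mu]_s (riesz b s * riesz (1 - b) (d - s))%:E)%E.

Lemma measurable_riesz_conv3 b d : measurable_fun setT (fun s => riesz b s * riesz (1 - b) (d - s)).
Proof. by apply: measurable_funM; [exact: measurable_riesz|exact: measurable_riesz_conv]. Qed.

Lemma riesz_conv_le0 b d : d <= 0 -> riesz_conv b d = 0%E.
Proof.
move=> d0; apply: integral0_eq => s _; congr EFin.
have [s0|s0] := leP s 0; first by rewrite riesz_le0// mul0r.
by rewrite (@riesz_le0 _ (1 - b)) ?mulr0// subr_le0 (le_trans d0)// ltW.
Qed.

(** Scaling: the exponents b - 1 and - b add up to -1, which cancels the Jacobian. *)
Lemma riesz_conv_gt0 b d : 0 < d -> riesz_conv b d = riesz_conv b 1.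
Proof.
move=> d0; have d0' : d != 0 by rewrite gt_eqF.
have m' : measurable_fun setT (fun s => (riesz b s * riesz (1 - b) (d - s))%:E).
  by apply/measurable_EFinP; exact: measurable_riesz_conv3.
have pos s : (0 <= (riesz b s * riesz (1 - b) (d - s))%:E)%E by rewrite lee_fin mulr_ge0 ?riesz_ge0.
have h := ge0_integral_affine 0 d0' m' pos.
have h1 : (\int[mu]_x (riesz b (d * x + 0) * riesz (1 - b) (d - (d * x + 0)))%:E = d^-1%:E * riesz_conv b 1%R)%E.
  apply: (integral_EFinZ _ (measurable_riesz_conv3 b 1)) => [|x|x]; first by rewrite invr_ge0 ltW.
    by rewrite mulr_ge0 ?riesz_ge0.
  rewrite addr0 rieszM// -{2}(mulr1 d) -mulrBr rieszM// mulrACA -gt0_powRD//.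
  by rewrite (_ : b - 1 + (1 - b - 1) = -1) ?powR_inv1 ?ltW//; ring.
have nd : `|d| = d by rewrite gtr0_norm.
apply: (@mule_injr d^-1); first by rewrite invr_eq0.
etransitivity; last exact: h1.
by etransitivity; last (symmetry; exact: h); rewrite nd.
Qed.

(** The convolution is constant on the positive half-line, and the constant is read off from the
    Laplace transform at 1: that of a constant is the constant itself, and that of a convolution is
    a product of two gamma integrals. *)
Lemma integral_riesz_riesz b d : 0 < b < 1 ->
  (\int[mu]_s (riesz b s * riesz (1 - b) (d - s))%:E = if (0 < d)%R then ebeta b else 0)%E.
Proof.
move=> b01; pose c d := riesz_conv b d.
have mc := measurable_riesz_conv3 b.
have lap : (\int[mu]_d (c d * (expR (- d))%:E) = egamma b * egamma (1 - b))%E.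
  pose F d s := (riesz b s * riesz (1 - b) (d - s) * expR (- d))%:E.
  have mF : measurable_fun setT (fun z : R * R => F z.1 z.2).
    apply/measurable_EFinP; apply: measurable_funM; last first.
      by do 2 apply: measurableT_comp => //.
    apply: measurable_funM; last exact: (measurable_riesz_conv2 (1 - b)).
    by apply: (measurableT_comp (@measurable_riesz R b)).
  have F0 d' s : (0 <= F d' s)%E by rewrite lee_fin !mulr_ge0 ?riesz_ge0 ?expR_ge0.
  transitivity (\int[mu]_d \int[mu]_s F d s)%E.
    apply: eq_integral => d' _; rewrite /c muleC; symmetry.
    apply: (integral_EFinZ (expR_ge0 _) (mc d')) => s; first by rewrite mulr_ge0 ?riesz_ge0.
    by rewrite mulrC.
  rewrite lebesgue_tonelli//.
  have inner s : (\int[mu]_d F d s = (riesz b s * expR (- s))%:E * egamma (1 - b))%E.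
    have mg : measurable_fun setT (fun x => riesz (1 - b) x * expR (- x)).
      apply: measurable_funM; first exact: measurable_riesz.
      by do 2 apply: measurableT_comp => //.
    have h := @ge0_integral_affine R 1 (- s) (fun x => (riesz (1 - b) x * expR (- x))%:E) (oner_neq0 _).
    rewrite normr1 invr1 mul1e -/(egamma _) in h; rewrite -h; last 2 first.
    - exact/measurable_EFinP.
    - by move=> x; rewrite lee_fin mulr_ge0 ?riesz_ge0 ?expR_ge0.
    apply: integral_EFinZ => [||x|x].
    - by rewrite mulr_ge0 ?riesz_ge0 ?expR_ge0.
    - by apply: (measurableT_comp mg); exact: measurable_affine.
    - by rewrite mulr_ge0 ?riesz_ge0 ?expR_ge0.
    - rewrite mul1r [RHS]mulrACA -expRD; congr (_ * expR _); ring.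
  under eq_integral do rewrite inner.
  rewrite -muleC -ge0_integralZl//; last 3 first.
  - apply/measurable_EFinP; apply: measurable_funM; first exact: measurable_riesz.
    by do 2 apply: measurableT_comp => //.
  - by move=> s _; rewrite lee_fin mulr_ge0 ?riesz_ge0 ?expR_ge0.
  - exact: egamma_ge0.
  by apply: eq_integral => s _; rewrite muleC.
have c1 : riesz_conv b 1 = ebeta b.
  rewrite ebetaE -lap -[LHS]mule1 -egamma1 /egamma -ge0_integralZl//; last 3 first.
  - apply/measurable_EFinP; apply: measurable_funM; first exact: measurable_riesz.
    by do 2 apply: measurableT_comp => //.
  - by move=> s _; rewrite lee_fin mulr_ge0 ?riesz_ge0 ?expR_ge0.
  - by apply: integral_ge0 => s _; rewrite lee_fin mulr_ge0 ?riesz_ge0.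
  apply: eq_integral => s _; rewrite EFinM muleA; congr (_ * _)%E.
  have [s0|s0] := ltP 0 s; first by rewrite rieszE// subrr powRr0 mule1 /c riesz_conv_gt0.
  by rewrite riesz_le0// mule0 /c riesz_conv_le0.
rewrite -/(riesz_conv b d); case: ltP => d0; last exact: riesz_conv_le0.
by rewrite riesz_conv_gt0.
Qed.

Lemma integral_riesz_riesz_shift b u y : 0 < b < 1 ->
  (\int[mu]_x (riesz b (x - y) * riesz (1 - b) (u - x))%:E = if (y < u)%R then ebeta b else 0)%E.
Proof.
move=> b01; rewrite -subr_gt0 -(integral_riesz_riesz (u - y) b01).
have mc d' : measurable_fun setT (fun s => riesz b s * riesz (1 - b) (d' - s)).
  by apply: measurable_funM; [exact: measurable_riesz|exact: measurable_riesz_conv].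
have h := @ge0_integral_affine R 1 (- y) (fun s => (riesz b s * riesz (1 - b) (u - y - s))%:E) (oner_neq0 _).
rewrite normr1 invr1 mul1e in h; rewrite -h; last 2 first.
- exact/measurable_EFinP.
- by move=> s; rewrite lee_fin mulr_ge0 ?riesz_ge0.
apply: eq_integral => x _; congr EFin; rewrite mul1r; congr (_ * riesz _ _); ring.
Qed.

End beta_convolution.

(** * The adjoint of fractional integration on bounded test functions *)

Section fractional_adjoint.
Context {R : realType}.
Notation mu := (@lebesgue_measure R).
Variables (b T : R).
Hypotheses (b01 : 0 < b < 1) (T0 : 0 < T).
Let b0 : 0 < b. Proof. by case/andP: b01. Qed.

Definition supported (phi : R -> R) : Prop :=
  measurable_fun setT phi /\ (exists M, forall x, `|phi x| <= M) /\
  forall x, ~~ (0 < x < T) -> phi x = 0.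

(** The right-sided Riemann-Liouville integral, again without the gamma factor. *)
Definition adj (phi : R -> R) (y : R) : R := \int[mu]_x (riesz b (x - y) * phi x).

Lemma measurable_riesz_adj (y : R) : measurable_fun setT (fun x : R => riesz b (x - y)).
Proof. by apply: (measurableT_comp (@measurable_riesz _ b)); exact: measurable_funB. Qed.

(** The reflection x -> T - x exchanges the two sides; continuity and integrability are inherited
    from [rliou] in this way. *)
Lemma adjE phi y : measurable_fun setT phi -> adj phi y = rliou b (fun z => phi (T - z)) (T - y).
Proof.
move=> mphi; have h := @Rintegral_affine R (-1) T (fun x => riesz b (x - y) * phi x).
rewrite oppr_eq0 oner_eq0 normrN1 invr1 mul1r in h; rewrite /adj -h//; last first.
  by apply: measurable_funM => //; exact: measurable_riesz_adj.
apply: eq_Rintegral => z _; rewrite mulN1r; congr (riesz _ _ * phi _); ring.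
Qed.

Lemma supported_reflect phi : supported phi -> supported (fun z => phi (T - z)).
Proof.
move=> [mphi [[M hM] s]]; split; last split.
- by apply: (measurableT_comp mphi); exact: measurable_funB.
- by exists M => x; exact: hM.
- by move=> x hx; apply: s; apply: contra hx => /andP[? ?]; apply/andP; split; lra.
Qed.

Lemma supported_source phi : supported phi -> forall y, y <= 0 -> phi y = 0.
Proof. by move=> [_ [_ s]] y y0; apply: s; rewrite ltNge y0. Qed.

Lemma integrable_adj phi y : supported phi ->
  mu.-integrable setT (EFin \o (fun x => riesz b (x - y) * phi x)).
Proof.
move=> sphi; have [mphi [[M hM] s]] := sphi; have sr := supported_reflect sphi.
have M0 : 0 <= M by exact: le_trans (hM 0).
have mf : measurable_fun setT (fun x : R => riesz b (x - y) * phi x).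
  by apply: measurable_funM => //; exact: measurable_riesz_adj.
apply/integrableP; split; first exact/measurable_EFinP.
have h := @ge0_integral_affine R (-1) T (fun x => `|riesz b (x - y) * phi x|%:E).
rewrite oppr_eq0 oner_eq0 normrN1 invr1 mul1e in h; rewrite /= -h//; last first.
  by apply/measurable_EFinP; apply: measurableT_comp.
have ir := integrable_rliou b01 (proj1 sr) (fun x => hM (T - x)) (supported_source sr) (T - y).
have /integrableP[_] := ir; apply: le_lt_trans.
rewrite le_eqVlt; apply/orP; left; apply/eqP.
by apply: eq_integral => z _; rewrite /= mulN1r; congr (`|riesz _ _ * phi _|%:E); ring.
Qed.

Lemma continuous_adj phi : supported phi -> continuous (adj phi).
Proof.
move=> sphi; have [mphi [[M hM] s]] := sphi; have sr := supported_reflect sphi.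
have -> : adj phi = (fun y => rliou b (fun z => phi (T - z)) (T - y)) by apply/funext => y; exact: adjE.
have c := continuous_rliou b01 (proj1 sr) (fun x => hM (T - x)) (supported_source sr).
move=> y; apply: (@continuous_cvg _ R R (nbhs y) _ (fun y => T - y) (rliou b (fun z => phi (T - z)))).
  exact: c.
by apply: cvgB; [exact: cvg_cst|exact: cvg_id].
Qed.

Lemma measurable_adj phi : supported phi -> measurable_fun setT (adj phi).
Proof. by move=> sphi; apply: continuous_measurable_fun; exact: continuous_adj. Qed.

Lemma adj_ge0 phi y : (forall x, 0 <= phi x) -> 0 <= adj phi y.
Proof. by move=> p0; apply: Rintegral_ge0 => x _; rewrite mulr_ge0 ?riesz_ge0. Qed.

Lemma adj_bounded phi : supported phi -> exists C, forall y, 0 <= y <= T -> `|adj phi y| <= C.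
Proof.
move=> sphi.
have := @EVT_max _ (fun y => `|adj phi y|) 0 T (ltW T0) _.
case.
  apply: continuous_subspaceT => y; apply: continuous_comp; last exact: norm_continuous.
  exact: continuous_adj.
move=> y _ hy; exists `|adj phi y| => z z0T; apply: hy; by rewrite in_itv.
Qed.

Lemma adj_fubini (phi v : R -> R) (Mv : R) : supported phi -> measurable_fun setT v -> (forall y, `|v y| <= Mv) ->
  (forall y, y <= 0 -> v y = 0) ->
  \int[mu]_x (phi x * rliou b v x) = \int[mu]_(y in `]0, T[) (v y * adj phi y).
Proof.
move=> sphi mv hMv v0; have [mphi [[M hM] s]] := sphi.
have M0 : 0 <= M by exact: le_trans (hM 0).
have Mv0 : 0 <= Mv by exact: le_trans (hMv 0).
pose K (z : R * R) := phi z.1 * (riesz b (z.1 - z.2) * v z.2).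
have mK : measurable_fun setT K.
  apply: measurable_funM; first exact: (measurableT_comp mphi).
  by apply: measurable_funM; [exact: measurable_riesz_conv2|exact: (measurableT_comp mv)].
have mD : measurable (`]0, T[%classic : set R) by exact: measurable_itv.
have fin : (\int[mu]_x \int[mu]_y `|K (x, y)|%:E < +oo)%E.
  pose C := M * (Mv * (T `^ b / b)).
  have C0 : 0 <= C by rewrite !mulr_ge0 ?powR_ge0// invr_ge0 ltW.
  apply: (@le_lt_trans _ _ (\int[mu]_x (C * \1_`]0, T[ x)%:E)%E); last first.
    rewrite -(integral_EFin_indic `]0, T[%classic (fun => C)) integral_cst//.
    by rewrite lte_mul_pinfty// ?lee_fin//; exact: muoo.
  apply: ge0_le_integral => //.
  - by move=> x _; apply: integral_ge0 => y _; rewrite lee_fin.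
  - apply: (@measurable_lebesgue_integral2 R (fun x y => `|K (x, y)|%:E)) => [|x y]; last by rewrite lee_fin.
    by apply/measurable_EFinP; apply: measurableT_comp.
  - by apply/measurable_EFinP; apply: measurable_funM.
  move=> x _.
  rewrite (_ : (\int[mu]_y _)%E = \int[mu]_y `| `|phi x| * (riesz b (x - y) * v y)|%:E)%E; last first.
    by apply: eq_integral => y _; rewrite /K/= normrM [in RHS]normrM normr_id.
  apply: (le_trans (le_abs_integral_rliou b01 mv hMv v0 x (normr_ge0 (phi x)))).
  rewrite lee_fin indic_itv in_itv/=; case: ifPn => x0; case: (ltP x T) => xT /=; rewrite ?mulr0 ?mulr1.
  - apply: ler_pM => //; first by rewrite mulr_ge0// divr_ge0 ?powR_ge0// ltW.
    apply: ler_wpM2l => //; apply: ler_wpM2r; first by rewrite invr_ge0 ltW.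
    by apply: ge0_ler_powR; rewrite ?nnegrE ?(ltW b0) ?(ltW x0) ?(ltW T0)// ltW.
  - by rewrite s ?normr0 ?mul0r// x0/= -leNgt.
  - by rewrite ?andbF.
  - by [].
have h := Rintegral_fubini mK fin.
transitivity (\int[mu]_x \int[mu]_y K (x, y)).
  apply: eq_Rintegral => x _; rewrite /rliou/K/= RintegralZl//.
  exact: (integrable_rliou b01 mv hMv v0).
rewrite h [RHS]Rintegral_indic; apply: eq_Rintegral => y _; rewrite indic_itv in_itv/=.
have -> : \int[mu]_x K (x, y) = v y * adj phi y.
  rewrite /adj -RintegralZl//; last exact: integrable_adj.
  by apply: eq_Rintegral => x _; rewrite /K/=; ring.
case: ltP => y0 /=; last by rewrite v0// !mul0r.
have [yT|Ty] := ltP y T; first by rewrite mulr1.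
rewrite mulr0 /adj (_ : (fun x => _) = cst 0) ?Rintegral_cst ?mul0r ?mulr0//.
apply/funext => x /=; have [xT|xT] := boolP (0 < x < T); last by rewrite s ?mulr0.
by rewrite riesz_le0 ?mul0r// subr_le0 (le_trans _ Ty)// ltW//; case/andP: xT.
Qed.

End fractional_adjoint.

(** * Integration by parts for the Marchaud derivative against nonnegative test functions *)

Section weak_form.
Context {R : realType}.
Notation mu := (@lebesgue_measure R).
Variables (b T : R).
Hypotheses (b01 : 0 < b < 1) (T0 : 0 < T).
Let b0 : 0 < b. Proof. by case/andP: b01. Qed.
Let mD : measurable (`]0, T[%classic : set R). Proof. exact: measurable_itv. Qed.
Let Gb : R := gamma_fun b.

Let integrable_indic_cst M : mu.-integrable setT (EFin \o (fun x => M * \1_`]0, T[ x)).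
Proof.
apply: (integrable_scaler mu measurableT); apply/integrableP; split; first exact/measurable_EFinP.
rewrite (_ : (\int[mu]_x _)%E = mu `]0%R, T[); first exact: muoo.
transitivity (\int[mu]_x (\1_`]0, T[ x)%:E)%E; last by rewrite integral_indic// setIT.
by apply: eq_integral => x _; rewrite /= ger0_norm.
Qed.

(** The relation is demanded at every point of the interval and not almost everywhere: the maximum
    principle evaluates it at a point that cannot be chosen in advance. *)
Definition marchaud (p h : R -> R) : Prop :=
  (forall x, 0 < x < T -> mu.-integrable `]0, x[ (EFin \o (fun u => (p x - p u) / (x - u) `^ (1 + b)))) /\
  (forall x, 0 < x < T -> gamma_fun (1 - b) * h x =
     p x / x `^ b + b * \int[mu]_(u in `]0, x[) ((p x - p u) / (x - u) `^ (1 + b))).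

Lemma marchaud_scale c p h : marchaud p h -> marchaud (fun x => c * p x) (fun x => c * h x).
Proof.
move=> [ip hE]; have E x u : (c * p x - c * p u) / (x - u) `^ (1 + b) = c * ((p x - p u) / (x - u) `^ (1 + b)).
  by rewrite -mulrBr mulrA.
split=> x xT.
  apply: (@eq_integrable _ _ _ mu _ _ (EFin \o (fun u => c * ((p x - p u) / (x - u) `^ (1 + b))))) => //.
    by move=> u _; rewrite /= E.
  by apply: integrable_scaler => //; exact: ip.
rewrite mulrCA hE// mulrDr mulrA; congr (_ + _); rewrite mulrCA; congr (_ * _).
rewrite -RintegralZl//; last exact: ip.
by apply: eq_Rintegral => u _; rewrite E.
Qed.

Lemma integrable_mul_bounded (f g : R -> R) C : mu.-integrable `]0, T[ (EFin \o f) ->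
  measurable_fun `]0, T[ g -> (forall y, 0 < y < T -> `|g y| <= C) ->
  mu.-integrable `]0, T[ (EFin \o (fun y => f y * g y)).
Proof.
move=> iF mg gC.
have mf : measurable_fun `]0, T[ f by apply/measurable_EFinP; exact: measurable_int iF.
apply: (integrable_ler mu mD _ (fun y => C * `|f y|)).
- exact: measurable_funM.
- move=> y; rewrite /= in_itv/= => yT; rewrite normrM mulrC.
  by apply: ler_wpM2r => //; exact: gC.
- by apply: (integrable_scaler mu mD); exact: (integrable_normr mu).
Qed.

Section nonnegative.
Variables (phi : R -> R).
Hypotheses (sphi : supported T phi) (phi0 : forall x, 0 <= phi x).

(** By the maximum principle [Gb * p] is at most the supremum of the fractional integrals of the
    [v k]. These are tested against [phi] by Fubini, and the excess of [v k] over [h] costs at most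
    C e / (C + 1), where [C] bounds [adj b phi]. *)
Lemma weak_marchaud_le (p h : R -> R) Mp : continuous p -> (forall x, `|p x| <= Mp) -> p 0 = 0 ->
  mu.-integrable `]0, T[ (EFin \o h) -> marchaud p h ->
  Gb * \int[mu]_x (p x * phi x) <= \int[mu]_(y in `]0, T[) (h y * adj b phi y).
Proof.
move=> cp pM p0 ih [ip hE].
have [mphi [[M hM] sup]] := sphi.
have [C hC] := adj_bounded b01 T0 sphi.
have C0 : 0 <= C by apply: le_trans (hC 0 _) => //; rewrite lexx ltW.
have madj := measurable_adj b01 sphi.
have iadj f : mu.-integrable `]0, T[ (EFin \o f) -> mu.-integrable `]0, T[ (EFin \o (fun y => f y * adj b phi y)).
  move=> iF; apply: (integrable_mul_bounded (C := C)) => //; first exact: measurable_funTS.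
  by move=> y /andP[y0 yT]; apply: hC; rewrite !ltW.
apply/ler_addgt0Pr => e e0.
have eC : 0 < e / (C + 1) by rewrite divr_gt0// ltr_wpDl.
have [n [v [[n0 mv] vM [v0 [vmono vn]] vh vint]]] := vitali_caratheodory T0 eC ih.
have key x : 0 < x < T -> forall c, (forall k, rliou b (v k) x <= c) -> Gb * p x <= c.
  move=> /andP[x0 xT].
  have lt z : 0 < z <= x -> 0 < z < T by move=> /andP[z0 zx]; rewrite z0 (le_lt_trans zx).
  have hmax := (@max_principle R b p h x Mp b01 cp pM p0 x0 (fun z hz => ip z (lt z hz)) (fun z hz => hE z (lt z hz))
    n v n0 mv vM v0 vmono vn (fun z hz => vh z (lt z hz))).
  by move=> c hc; exact: (hmax c hc).
have [M0 hM0] := vM 0%N.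
have lev j k x : (j <= k)%N -> rliou b (v j) x <= rliou b (v k) x.
  move=> /subnKC <-; elim: (k - j)%N => [|i IH]; first by rewrite addn0.
  rewrite addnS (le_trans IH)//; have [M1 h1] := vM (j + i)%N; have [M2 h2] := vM (j + i).+1.
  by apply: (@le_rliou _ b _ _ M1 M2) => // y; first [exact: v0 | exact: vmono].
have mrl k : measurable_fun setT (rliou b (v k)).
  by have [M1 h1] := vM k; apply: continuous_measurable_fun; exact: (continuous_rliou b01 (mv k) h1 (v0 k)).
have mp : measurable_fun setT p by exact: continuous_measurable_fun.
(* The fractional integrals of the [v k] have no common upper bound. The minimum with [Gb * p x]
   supplies one, and the first of them bounds the sequence from below. *)
pose f k x := Num.min (Gb * p x) (rliou b (v k) x) * phi x.
pose U x := (`|Gb| * Mp + 2 * M0 / b * T `^ b) * (M * \1_`]0, T[ x).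
have phiM x : `|phi x| <= M * \1_`]0, T[ x.
  rewrite indic_itv in_itv/=; have [xT|xT] := boolP (0 < x < T); first by rewrite mulr1.
  by rewrite sup// normr0 mulr0.
have MM0 : 0 <= M by exact: le_trans (hM 0).
have M00 : 0 <= M0 by exact: le_trans (hM0 0).
have iU : mu.-integrable setT (EFin \o U).
  by apply: (integrable_scaler mu measurableT); exact: integrable_indic_cst.
have rl0 x : 0 < x < T -> `|rliou b (v 0%N) x| <= 2 * M0 / b * T `^ b.
  move=> /andP[x0 xT]; have := rliou_hoelder_ge0 b01 (mv 0%N) hM0 (v0 0%N) (lexx 0) (ltW x0).
  rewrite [rliou b (v 0%N) 0]rliou_le0//; last exact: v0.
  rewrite !subr0 => h1; apply: (le_trans h1); apply: ler_wpM2l.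
    by rewrite divr_ge0 ?mulr_ge0// ltW.
  by apply: ge0_ler_powR; rewrite ?nnegrE ?(ltW b0) ?(ltW x0) ?(ltW T0)// ltW.
have fU x k : `|f k x| <= U x.
  rewrite /f /U normrM; have [xT|xT] := boolP (0 < x < T); last first.
    by rewrite (sup x xT) normr0 mulr0 indic_itv in_itv/= (negbTE xT) !mulr0.
  apply: ler_pM => //.
  have h1 : `|Gb * p x| <= `|Gb| * Mp by rewrite normrM ler_wpM2l.
  have h2 := rl0 _ xT.
  have A0 : 0 <= `|Gb| * Mp by exact: le_trans h1.
  have B0 : 0 <= 2 * M0 / b * T `^ b by exact: le_trans h2.
  have h3 := lev 0%N k x (leq0n k).
  rewrite ler_norml; apply/andP; split.
    rewrite le_min; apply/andP; split.
      by move: h1; rewrite ler_norml => /andP[h1 _]; lra.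
    by apply: le_trans h3; move: h2; rewrite ler_norml => /andP[h2 _]; lra.
  rewrite ge_min; apply/orP; left.
  by move: h1; rewrite ler_norml => /andP[_ h1]; lra.
have mGp : measurable_fun setT (fun x : R => Gb * p x) by exact: measurable_funM.
have mf k : measurable_fun setT (f k) by apply: measurable_funM => //; exact: measurable_minr.
have cvg : \int[mu]_x f k x @[k --> \oo] --> \int[mu]_x (Gb * p x * phi x).
  have mg : measurable_fun setT (fun x : R => Gb * p x * phi x) by exact: measurable_funM.
  refine (dominated_cvg_Rintegral mu measurableT f _ U mf mg _ iU _).
  - apply: aeW => x _; have [xT|xT] := boolP (0 < x < T); last first.
      rewrite (sup x xT) mulr0; apply: cvg_near_cst; apply: nearW => k.
      by rewrite /f (sup x xT) mulr0.
    apply: cvgMl; apply/cvgrPdist_lt => d d0.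
    have [j hj] : exists j, Gb * p x - d < rliou b (v j) x.
      apply: contrapT => /forallNP hn.
      have : Gb * p x <= Gb * p x - d.
        by apply: key => // k; rewrite leNgt; apply/negP; exact: hn.
      by rewrite lerBrDl gerDr leNgt d0.
    exists j => // k /= jk; have h3 := lev _ _ x jk.
    rewrite ger0_norm; last by rewrite subr_ge0 ge_min lexx.
    by rewrite ltrBlDl -ltrBlDr lt_min (lt_le_trans hj h3) andbT ltrBlDr ltrDl.
  - by apply: aeW => x k _; exact: fU.
have -> : Gb * \int[mu]_x (p x * phi x) = \int[mu]_x (Gb * p x * phi x).
  rewrite -RintegralZl//; first by apply: eq_Rintegral => x _; rewrite mulrA.
  apply: (integrable_ler mu measurableT _ (fun x => Mp * (M * \1_`]0, T[ x))).
  - exact: measurable_funM.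
  - by move=> x _; rewrite normrM; apply: ler_pM.
  - by apply: (integrable_scaler mu measurableT); exact: integrable_indic_cst.
apply: (cvgr_to_le cvg); apply: nearW => k.
have [Mk hMk] := vM k.
have [imax vk] := vint k.
apply: (@le_trans _ _ (\int[mu]_x (phi x * rliou b (v k) x))).
  have ifk : mu.-integrable setT (EFin \o f k).
    by apply: (integrable_ler mu measurableT _ U); [exact: mf|move=> y _; exact: fU|exact: iU].
  have irk : mu.-integrable setT (EFin \o (fun x => phi x * rliou b (v k) x)).
    apply: (integrable_ler mu measurableT _ (fun x => (2 * Mk / b * T `^ b) * (M * \1_`]0, T[ x))).
    - exact: (measurable_funM mphi (mrl k)).
    - move=> x _; rewrite normrM mulrC; have [xT|xT] := boolP (0 < x < T); last first.
        by rewrite (sup x xT) normr0 mulr0 indic_itv in_itv/= (negbTE xT) !mulr0.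
      apply: ler_pM => //; move: xT => /andP[x0 xT].
      have := rliou_hoelder_ge0 b01 (mv k) hMk (v0 k) (lexx 0) (ltW x0).
      rewrite [rliou b (v k) 0]rliou_le0//; last exact: v0.
      rewrite !subr0 => h1; apply: (le_trans h1); apply: ler_wpM2l.
        by rewrite divr_ge0 ?mulr_ge0 ?(le_trans _ (hMk 0))// ltW.
      by apply: ge0_ler_powR; rewrite ?nnegrE ?(ltW b0) ?(ltW x0) ?(ltW T0)// ltW.
    - by apply: (integrable_scaler mu measurableT); exact: integrable_indic_cst.
  apply: le_Rintegral => // x _; rewrite /f mulrC; apply: ler_wpM2l => //.
  by rewrite ge_min lexx orbT.
rewrite (adj_fubini b01 T0 sphi (mv k) hMk (v0 k)).
have ivk : mu.-integrable `]0, T[ (EFin \o v k).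
  apply: (integrable_boundedr mu mD _ Mk) => //; first exact: muoo.
  by apply: measurable_funTS; exact: mv.
have i1 := iadj _ ih.
have i2 := iadj _ imax.
apply: (@le_trans _ _ (\int[mu]_(y in `]0, T[) (h y * adj b phi y + Num.max (v k y - h y) 0 * adj b phi y))).
  apply: le_Rintegral => //; [exact: iadj|exact: (integrable_addr mu mD)|].
  move=> y _; rewrite -mulrDl; apply: ler_wpM2r; first exact: adj_ge0.
  by rewrite -lerBlDl le_max lexx.
rewrite RintegralD// lerD2l.
apply: (@le_trans _ _ (\int[mu]_(y in `]0, T[) (C * Num.max (v k y - h y) 0))).
  apply: le_Rintegral => //; first exact: (integrable_scaler mu mD).
  move=> y; rewrite /= in_itv/= => /andP[y0 yT]; rewrite mulrC.
  apply: ler_wpM2r; first by rewrite le_max lexx orbT.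
  by apply: le_trans (ler_norm _) (hC _ _); rewrite !ltW.
rewrite RintegralZl//; apply: (@le_trans _ _ (C * (e / (C + 1)))); first exact: ler_wpM2l.
by rewrite mulrA ler_pdivrMr ?ltr_wpDl// mulrC ler_pM2l// lerDl.
Qed.

(** The missing inequality is [weak_marchaud_le] for the negatives of [p] and [h]. *)
Lemma weak_marchaud_ge0 (p h : R -> R) Mp : continuous p -> (forall x, `|p x| <= Mp) -> p 0 = 0 ->
  mu.-integrable `]0, T[ (EFin \o h) -> marchaud p h ->
  Gb * \int[mu]_x (p x * phi x) = \int[mu]_(y in `]0, T[) (h y * adj b phi y).
Proof.
move=> cp pM p0 ih hp; apply/eqP; rewrite eq_le; apply/andP; split.
  exact: (weak_marchaud_le (Mp := Mp)).
have [mphi [[M hM] sup]] := sphi.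
have [C hC] := adj_bounded b01 T0 sphi.
have mp : measurable_fun setT p by exact: continuous_measurable_fun.
have iad : mu.-integrable `]0, T[ (EFin \o (fun y => h y * adj b phi y)).
  apply: (integrable_mul_bounded (C := C)) => //.
    by apply: measurable_funTS; exact: (measurable_adj b01 sphi).
  by move=> y /andP[y0 yT]; apply: hC; rewrite !ltW.
have ipp : mu.-integrable setT (EFin \o (fun x => p x * phi x)).
  apply: (integrable_ler mu measurableT _ (fun x => Mp * (M * \1_`]0, T[ x))).
  - exact: (measurable_funM mp mphi).
  - move=> x _; rewrite normrM; apply: ler_pM => //.
    rewrite indic_itv in_itv/=; have [xT|xT] := boolP (0 < x < T); first by rewrite mulr1.
    by rewrite sup// normr0 mulr0.
  - by apply: (integrable_scaler mu measurableT); exact: integrable_indic_cst.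
have := @weak_marchaud_le (fun x => -1 * p x) (fun x => -1 * h x) Mp.
have -> : \int[mu]_x (-1 * p x * phi x) = -1 * \int[mu]_x (p x * phi x).
  by rewrite -RintegralZl//; apply: eq_Rintegral => x _; rewrite mulrA.
have -> : \int[mu]_(y in `]0, T[) (-1 * h y * adj b phi y) = -1 * \int[mu]_(y in `]0, T[) (h y * adj b phi y).
  by rewrite -RintegralZl//; apply: eq_Rintegral => x _; rewrite mulrA.
rewrite !mulN1r mulrN lerN2; apply.
- by move=> x; apply: cvgMr; exact: cp.
- by move=> x; rewrite mulN1r normrN.
- by rewrite p0 oppr0.
- exact: (integrable_scaler mu mD (-1) h ih).
- exact: marchaud_scale.
Qed.

End nonnegative.
End weak_form.

Lemma integrable_riesz {R : realType} (b x : R) : 0 < b -> 0 <= x ->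
  (@lebesgue_measure R).-integrable `]0, x[ (EFin \o riesz b).
Proof.
move=> b0 x0; apply/integrableP; split.
  by apply/measurable_EFinP; apply: measurable_funTS; exact: measurable_riesz.
have -> : (\int[@lebesgue_measure R]_(s in `]0%R, x[) `|(EFin \o riesz b) s| =
    \int[@lebesgue_measure R]_(s in `]0%R, x[) (s `^ (b - 1))%:E)%E.
  apply: eq_integral => s; rewrite inE/= in_itv/= => /andP[s0 _].
  by rewrite ger0_norm ?riesz_ge0// rieszE.
by rewrite integral_riesz// ltry.
Qed.

(** * Adjoints of complementary orders compose to a primitive *)

Section adjoint_composition.
Context {R : realType}.
Notation mu := (@lebesgue_measure R).
Variables (b T : R).
Hypotheses (b01 : 0 < b < 1) (T0 : 0 < T).

Lemma supportedD (phi psi : R -> R) : supported T phi -> supported T psi ->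
  supported T (fun x => phi x + psi x).
Proof.
move=> [m1 [[M1 h1] s1]] [m2 [[M2 h2] s2]]; split; first exact: (measurable_funD m1 m2).
split; first by exists (M1 + M2) => x; apply: le_trans (ler_normD _ _) _; exact: lerD.
by move=> x xT; rewrite s1// s2// addr0.
Qed.

Lemma supportedB (phi psi : R -> R) : supported T phi -> supported T psi ->
  supported T (fun x => phi x - psi x).
Proof.
move=> [m1 [[M1 h1] s1]] [m2 [[M2 h2] s2]]; split; first exact: (measurable_funB m1 m2).
split; first by exists (M1 + M2) => x; apply: le_trans (ler_normB _ _) _; exact: lerD.
by move=> x xT; rewrite s1// s2// subrr.
Qed.

Lemma supported_continuous (f : R -> R) : continuous f ->
  supported T (fun x => f x * \1_`]0, T[ x).
Proof.
move=> cf; split.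
  by apply: measurable_funM => //; exact: continuous_measurable_fun.
have [c cT hc] : exists2 c, c \in `[0, T] & forall y, y \in `[0, T] -> `|f y| <= `|f c|.
  apply: (@EVT_max _ (fun y => `|f y|) 0 T (ltW T0)).
  apply: continuous_subspaceT => y; apply: continuous_comp; last exact: norm_continuous.
  exact: cf.
split; last by move=> x xT; rewrite indic_itv in_itv/= (negbTE xT) mulr0.
exists `|f c| => x; rewrite indic_itv in_itv/=.
have [/andP[x0 xT]|_] := boolP (0 < x < T); last by rewrite mulr0 normr0.
by rewrite mulr1; apply: hc; rewrite in_itv/= !ltW.
Qed.

Lemma adjD (phi psi : R -> R) y : supported T phi -> supported T psi ->
  adj b (fun x => phi x + psi x) y = adj b phi y + adj b psi y.
Proof.
move=> s1 s2; rewrite /adj -RintegralD//; [|exact: (integrable_adj b01 y s1)|exact: (integrable_adj b01 y s2)].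
by apply: eq_Rintegral => x _; rewrite mulrDr.
Qed.

Lemma adjB (phi psi : R -> R) y : supported T phi -> supported T psi ->
  adj b (fun x => phi x - psi x) y = adj b phi y - adj b psi y.
Proof.
move=> s1 s2; rewrite /adj -RintegralB//; [|exact: (integrable_adj b01 y s1)|exact: (integrable_adj b01 y s2)].
by apply: eq_Rintegral => x _; rewrite mulrBr.
Qed.

Lemma adj_geT (phi : R -> R) y : supported T phi -> T <= y -> adj b phi y = 0.
Proof.
move=> [_ [_ s]] Ty; transitivity (\int[mu]_(x in setT) (0 : R)); last by rewrite Rintegral_cst ?mul0r.
apply: eq_Rintegral => x _.
have [xy|yx] := leP x y; first by rewrite riesz_le0 ?mul0r// subr_le0.
by rewrite s ?mulr0//; apply/negP => /andP[_]; rewrite ltNge (le_trans Ty)// ltW.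
Qed.

(** Fubini, the inner integral being the kernel convolution of [integral_riesz_riesz_shift]: a
    constant times the indicator of u > y. *)
Lemma integral_riesz_adj (G : R -> R) y : supported T G ->
  \int[mu]_x (riesz b (x - y) * adj (1 - b) G x) =
  gamma_fun b * gamma_fun (1 - b) * \int[mu]_u (G u * \1_`]y, +oo[ u).
Proof.
move=> sG; have [mG [[M hM] sup]] := sG.
have b01' : 0 < 1 - b < 1 by move: b01 => /andP[? ?]; apply/andP; split; lra.
have M0 : 0 <= M by exact: le_trans (hM 0).
pose B := gamma_fun b * gamma_fun (1 - b).
have B0 : 0 <= B by rewrite mulr_ge0// ltW// gamma_fun_gt0.
pose k u x := riesz b (x - y) * riesz (1 - b) (u - x).
have kE u : (\int[mu]_x (k u x)%:E = (B * \1_`]y, +oo[ u)%:E)%E.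
  rewrite integral_riesz_riesz_shift// ebeta_gamma// indic_itv in_itv/= andbT.
  by case: ifP => _; rewrite ?mulr1 ?mulr0.
have mk2 : measurable_fun setT (fun z : R * R => k z.1 z.2).
  apply: measurable_funM; apply: (measurableT_comp (@measurable_riesz _ _)); exact: measurable_funB.
have mk u : measurable_fun setT (k u).
  by apply: measurable_funM; [exact: measurable_riesz_adj|exact: measurable_riesz_conv].
have k0 u x : 0 <= k u x by rewrite mulr_ge0 ?riesz_ge0.
have ik u : mu.-integrable setT (EFin \o k u).
  apply/integrableP; split; first by apply/measurable_EFinP; exact: mk.
  have -> : (\int[mu]_x `|(EFin \o k u) x| = \int[mu]_x (k u x)%:E)%E.
    by apply: eq_integral => x _; rewrite /= ger0_norm.
  by rewrite kE ltry.
pose h (z : R * R) := k z.1 z.2 * G z.1.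
have mh : measurable_fun setT h.
  by apply: measurable_funM => //; exact: measurableT_comp.
have iG : mu.-integrable setT (EFin \o (fun u => M * \1_`]0, T[ u)).
  apply: (integrable_scaler mu measurableT); apply/integrableP; split; first exact/measurable_EFinP.
  have -> : (\int[mu]_u `|(EFin \o \1_`]0%R, T[) u| = \int[mu]_u (\1_`]0%R, T[ u : R)%:E)%E.
    by apply: eq_integral => x _; rewrite /= ger0_norm.
  by rewrite integral_indic_itvoo ?ltry// ltW.
have GM u : `|G u| <= M * \1_`]0, T[ u.
  rewrite indic_itv in_itv/=; have [xT|xT] := boolP (0 < u < T); first by rewrite mulr1.
  by rewrite sup// normr0 mulr0.
have hfin : (\int[mu]_u \int[mu]_x `|h (u, x)|%:E < +oo)%E.
  have E u : (\int[mu]_x `|h (u, x)|%:E = (`|G u| * (B * \1_`]y, +oo[ u))%:E)%E.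
    rewrite (@integral_EFinZ R `|G u| (k u))// ?kE ?EFinM// => x.
    by rewrite /h/= normrM (ger0_norm (k0 _ _)) mulrC.
  under eq_integral do rewrite E.
  have /integrableP[_] := integrable_scaler mu measurableT B _ iG; apply: le_lt_trans.
  apply: ge0_le_integral => //.
  - by move=> u _; rewrite lee_fin mulr_ge0// mulr_ge0// indicE ler0n.
  - apply/measurable_EFinP; apply: measurable_funM; first exact: measurableT_comp.
    exact: measurable_funM.
  - have /measurable_int m := integrable_scaler mu measurableT B _ iG.
    by apply: measurableT_comp.
  - move=> u _; rewrite /= lee_fin; apply: le_trans (ler_norm _); rewrite mulrCA; apply: ler_wpM2l => //.
    by apply: le_trans (GM u); rewrite indicE; case: (u \in _); rewrite ?mulr1 ?mulr0.
have F := Rintegral_fubini mh hfin.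
transitivity (\int[mu]_x \int[mu]_u h (u, x)).
  apply: eq_Rintegral => x _; rewrite /adj -RintegralZl//; last exact: (integrable_adj b01' x sG).
  by apply: eq_Rintegral => u _; rewrite /h /k mulrA.
rewrite -F -RintegralZl//; last first.
  apply: (integrable_ler mu measurableT _ _ _ _ iG); first exact: (measurable_funM mG).
  by move=> u _; apply: le_trans (GM u); rewrite normrM; rewrite indicE; case: (u \in _); rewrite ?normr1 ?mulr1 ?normr0 ?mulr0.
apply: eq_Rintegral => u _; transitivity (\int[mu]_x (k u x * G u)) => //.
rewrite RintegralZr//.
by rewrite /Rintegral kE/= mulrAC mulrA.
Qed.

End adjoint_composition.

(** * Integration by parts with general test functions and initial values, and inversion *)

Section weak_form_general.
Context {R : realType}.
Notation mu := (@lebesgue_measure R).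
Variables (b T : R).
Hypotheses (b01 : 0 < b < 1) (T0 : 0 < T).
Let b0 : 0 < b. Proof. by case/andP: b01. Qed.
Let b01' : 0 < 1 - b < 1. Proof. by move: b01 => /andP[? ?]; apply/andP; split; lra. Qed.
Let mD : measurable (`]0, T[%classic : set R). Proof. exact: measurable_itv. Qed.

Lemma integrable_indic_itvoo (M : R) :
  mu.-integrable setT (EFin \o (fun x => M * \1_`]0, T[ x)).
Proof.
apply: (integrable_scaler mu measurableT); apply/integrableP; split; first exact/measurable_EFinP.
have -> : (\int[mu]_u `|(EFin \o \1_`]0%R, T[) u| = \int[mu]_u (\1_`]0%R, T[ u : R)%:E)%E.
  by apply: eq_integral => x _; rewrite /= ger0_norm.
by rewrite integral_indic_itvoo ?ltry// ltW.
Qed.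

Lemma integrable_mul_supported (p phi : R -> R) Mp : measurable_fun setT p ->
  (forall x, 0 < x < T -> `|p x| <= Mp) ->
  supported T phi -> mu.-integrable setT (EFin \o (fun x => p x * phi x)).
Proof.
move=> mp pM [mphi [[M hM] sup]].
apply: (integrable_ler mu measurableT _ (fun x => (Mp * M) * \1_`]0, T[ x)).
- exact: (measurable_funM mp mphi).
- move=> x _; rewrite indic_itv in_itv/=; have [xT|xT] := boolP (0 < x < T).
    by rewrite mulr1 normrM; apply: ler_pM => //; exact: pM.
  by rewrite sup// !mulr0 normr0.
- exact: integrable_indic_itvoo.
Qed.

Lemma integrable_mul_adj (h phi : R -> R) : mu.-integrable `]0, T[ (EFin \o h) -> supported T phi ->
  mu.-integrable `]0, T[ (EFin \o (fun y => h y * adj b phi y)).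
Proof.
move=> ih sphi; have [C hC] := adj_bounded b01 T0 sphi.
apply: (integrable_mul_bounded (C := C)) => //.
  by apply: measurable_funTS; exact: (measurable_adj b01 sphi).
by move=> y /andP[y0 yT]; apply: hC; rewrite !ltW.
Qed.

(** A test function of any sign is the difference of the nonnegative functions [phi + c] and [c],
    with [c] a multiple of the indicator of the interval. *)
Lemma weak_marchaud_eq0 (p h phi : R -> R) Mp : continuous p -> (forall x, `|p x| <= Mp) -> p 0 = 0 ->
  mu.-integrable `]0, T[ (EFin \o h) -> marchaud b T p h -> supported T phi ->
  gamma_fun b * \int[mu]_x (p x * phi x) = \int[mu]_(y in `]0, T[) (h y * adj b phi y).
Proof.
move=> cp pM p0 ih hp sphi; have [mphi [[M hM] sup]] := sphi.
have M0 : 0 <= M by exact: le_trans (hM 0).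
have mp : measurable_fun setT p by exact: continuous_measurable_fun.
pose c (x : R) := M * \1_`]0, T[ x.
have sc : supported T c.
  split; first exact: measurable_funM.
  split; last by move=> x xT; rewrite /c indic_itv in_itv/= (negbTE xT) mulr0.
  by exists M => x; rewrite /c indicE; case: (x \in _); rewrite ?mulr1 ?mulr0 ?normr0// ger0_norm.
have c0 x : 0 <= c x by rewrite mulr_ge0// indicE ler0n.
have s1 := supportedD sphi sc.
have pc0 x : 0 <= phi x + c x.
  rewrite /c indic_itv in_itv/=; have [xT|xT] := boolP (0 < x < T).
    by rewrite mulr1 -lerBlDr sub0r; have := hM x; rewrite ler_norml => /andP[].
  by rewrite sup// mulr0 addr0.
have e1 := weak_marchaud_ge0 b01 T0 s1 pc0 cp pM p0 ih hp.
have e2 := weak_marchaud_ge0 b01 T0 sc c0 cp pM p0 ih hp.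
have -> : \int[mu]_x (p x * phi x) = \int[mu]_x (p x * (phi x + c x)) - \int[mu]_x (p x * c x).
  rewrite -RintegralB//.
  - by apply: eq_Rintegral => x _; ring.
  - by apply: (integrable_mul_supported (Mp := Mp)).
  - by apply: (integrable_mul_supported (Mp := Mp)).
have -> : \int[mu]_(y in `]0, T[) (h y * adj b phi y) =
    \int[mu]_(y in `]0, T[) (h y * adj b (fun x => phi x + c x) y) - \int[mu]_(y in `]0, T[) (h y * adj b c y).
  rewrite -RintegralB//.
  - by apply: eq_Rintegral => x _; rewrite (adjD b01 x sphi sc); ring.
  - exact: integrable_mul_adj.
  - exact: integrable_mul_adj.
by rewrite mulrBr e1 e2.
Qed.

(** The constant function [p 0] has the Marchaud derivative p(0) x^(-b) / gamma(1 - b), a multiple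
    of [riesz (1 - b)]. It is subtracted, and its contribution is [integral_riesz_adj] at y = 0 with
    [b] and [1 - b] exchanged. *)
Lemma weak_marchaud (p h phi : R -> R) Mp : continuous p -> (forall x, `|p x| <= Mp) ->
  mu.-integrable `]0, T[ (EFin \o h) -> marchaud b T p h -> supported T phi ->
  gamma_fun b * \int[mu]_x (p x * phi x) = \int[mu]_(y in `]0, T[) (h y * adj b phi y).
Proof.
move=> cp pM ih [ip hE] sphi; have [mphi [[M hM] sup]] := sphi.
have mp : measurable_fun setT p by exact: continuous_measurable_fun.
have G0 : gamma_fun (1 - b) != 0 by rewrite gt_eqF// gamma_fun_gt0.
pose k := p 0 / gamma_fun (1 - b).
pose h1 x := h x - k * riesz (1 - b) x.
have ir : mu.-integrable `]0, T[ (EFin \o riesz (1 - b)).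
  by apply: integrable_riesz; [case/andP: b01'|exact: ltW].
have ikr : mu.-integrable `]0, T[ (EFin \o (fun x => k * riesz (1 - b) x)).
  exact: (integrable_scaler mu mD).
have ih1 : mu.-integrable `]0, T[ (EFin \o h1) by exact: (integrable_subr mu mD).
have E x u : (p x - p 0 - (p u - p 0)) = p x - p u by ring.
have hp1 : marchaud b T (fun x => p x - p 0) h1.
  split=> x xT.
    have -> : EFin \o (fun u => (p x - p 0 - (p u - p 0)) / (x - u) `^ (1 + b)) =
        EFin \o (fun u => (p x - p u) / (x - u) `^ (1 + b)).
      by apply/funext => u; rewrite /= E.
    exact: ip.
  rewrite /h1 mulrBr hE// rieszE; last by case/andP: xT.
  have -> : 1 - b - 1 = - b by ring.
  rewrite powRN /k mulrA mulrCA mulfV// mulr1 mulrBl -!addrA; congr (_ + _).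
  rewrite addrC; congr (_ + _); congr (_ * _).
  by apply: eq_Rintegral => u _; rewrite E.
have := @weak_marchaud_eq0 (fun x => p x - p 0) h1 phi (Mp + `|p 0|).
have -> : \int[mu]_x ((p x - p 0) * phi x) = \int[mu]_x (p x * phi x) - p 0 * \int[mu]_x phi x.
  have iphi : mu.-integrable setT (EFin \o phi).
    have := @integrable_mul_supported (fun=> 1) phi 1 _ _ sphi.
    rewrite (_ : (fun x => 1 * phi x) = phi); last by apply/funext => x; rewrite mul1r.
    by apply=> // x _; rewrite normr1.
  rewrite -RintegralZl// -RintegralB//.
  - by apply: eq_Rintegral => x _; ring.
  - by apply: (integrable_mul_supported (Mp := Mp)).
  - exact: (integrable_scaler mu measurableT).
have -> : \int[mu]_(y in `]0, T[) (h1 y * adj b phi y) =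
    \int[mu]_(y in `]0, T[) (h y * adj b phi y) - k * \int[mu]_(y in `]0, T[) (riesz (1 - b) y * adj b phi y).
  rewrite -RintegralZl//; last exact: integrable_mul_adj.
  rewrite -RintegralB//.
  - by apply: eq_Rintegral => x _; rewrite /h1; ring.
  - exact: integrable_mul_adj.
  - by apply: (integrable_scaler mu mD); exact: integrable_mul_adj.
have -> : \int[mu]_(y in `]0, T[) (riesz (1 - b) y * adj b phi y) =
    gamma_fun (1 - b) * gamma_fun b * \int[mu]_x phi x.
  have := @integral_riesz_adj R (1 - b) T b01' T0 phi 0 sphi.
  have -> : 1 - (1 - b) = b by ring.
  move=> e; transitivity (\int[mu]_x (riesz (1 - b) (x - 0) * adj b phi x)).
    rewrite [LHS]Rintegral_indic; apply: eq_Rintegral => x _.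
    rewrite subr0 indic_itv in_itv/=; have [xT|] := boolP (0 < x < T); first by rewrite mulr1.
    rewrite negb_and -!leNgt mulr0 => /orP[x0|xT]; first by rewrite riesz_le0// mul0r.
    by rewrite (adj_geT _ sphi)// mulr0.
  rewrite e; congr (_ * _); apply: eq_Rintegral => x _.
  rewrite indic_itv in_itv/= andbT; case: ltP => x0; rewrite ?mulr1//.
  by rewrite sup ?mul0r// ltNge x0.
set I := \int[mu]_x (p x * phi x); set J := \int[mu]_x phi x.
have -> : k * (gamma_fun (1 - b) * gamma_fun b * J) = gamma_fun b * (p 0 * J).
  by rewrite /k; field.
rewrite mulrBr => e0; apply: (addIr (- (gamma_fun b * (p 0 * J)))); apply: e0 => //.
- by move=> x; apply: cvgB; [exact: cp|exact: cvg_cst].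
- by move=> x; apply: le_trans (ler_normB _ _) _; rewrite lerD.
- by rewrite subrr.
Qed.

(** Both sides are continuous and have the same integral against every test function, by
    [weak_marchaud_eq0] and [adj_fubini]. Testing with their difference [D], cut to the interval,
    gives a vanishing integral of its square. *)
Lemma rliou_marchaud (p h hb : R -> R) Mp Mh : continuous p -> (forall x, `|p x| <= Mp) -> p 0 = 0 ->
  mu.-integrable `]0, T[ (EFin \o h) -> marchaud b T p h ->
  measurable_fun setT hb -> (forall y, `|hb y| <= Mh) -> (forall y, y <= 0 -> hb y = 0) ->
  {ae mu, forall y, 0 < y < T -> h y = hb y} ->
  forall x, 0 < x < T -> gamma_fun b * p x = rliou b hb x.
Proof.
move=> cp pM p0 ih hp mhb hbM hb0 hae x xT.
have crl := continuous_rliou b01 mhb hbM hb0.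
pose D x := gamma_fun b * p x - rliou b hb x.
have cD : continuous D.
  by move=> y; apply: cvgB; [apply: cvgMr; exact: cp|exact: crl].
have mp : measurable_fun setT p by exact: continuous_measurable_fun.
have mrl : measurable_fun setT (rliou b hb) by exact: continuous_measurable_fun.
have [c cT hc] : exists2 c, c \in `[0, T] & forall y, y \in `[0, T] -> `|rliou b hb y| <= `|rliou b hb c|.
  apply: (@EVT_max _ (fun y => `|rliou b hb y|) 0 T (ltW T0)).
  apply: continuous_subspaceT => y; apply: continuous_comp; last exact: norm_continuous.
  exact: crl.
have rlM y : 0 < y < T -> `|rliou b hb y| <= `|rliou b hb c|.
  by move=> /andP[y0 yT]; apply: hc; rewrite in_itv/= !ltW.
have w phi : supported T phi -> \int[mu]_y (D y * phi y) = 0.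
  move=> sphi; have [mphi _] := sphi.
  have -> : \int[mu]_y (D y * phi y) = gamma_fun b * \int[mu]_y (p y * phi y) - \int[mu]_y (rliou b hb y * phi y).
    rewrite -RintegralZl//; last exact: (integrable_mul_supported mp (fun y _ => pM y) sphi).
    rewrite -RintegralB//.
    - by apply: eq_Rintegral => y _; rewrite /D; ring.
    - by apply: (integrable_scaler mu measurableT); exact: (integrable_mul_supported mp (fun y _ => pM y) sphi).
    - exact: (integrable_mul_supported mrl rlM sphi).
  rewrite (weak_marchaud_eq0 cp pM p0 ih hp sphi).
  have -> : \int[mu]_y (rliou b hb y * phi y) = \int[mu]_y (phi y * rliou b hb y).
    by apply: eq_Rintegral => y _; rewrite mulrC.
  rewrite (adj_fubini b01 T0 sphi mhb hbM hb0).
  have madj := measurable_adj b01 sphi.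
  have mh : measurable_fun `]0, T[ h by apply/measurable_EFinP; exact: measurable_int ih.
  apply/eqP; rewrite subr_eq0; apply/eqP; rewrite /Rintegral; congr fine.
  apply: ae_eq_integral => //.
  - by apply/measurable_EFinP; apply: measurable_funM => //; exact: measurable_funTS.
  - by apply/measurable_EFinP; apply: measurable_funM; exact: measurable_funTS.
  - move: hae; apply: filterS; first exact: (ae_filter_ringOfSetsType mu).
    by move=> y hy; rewrite /= in_itv/= => yT; rewrite hy.
have w0 := w _ (supported_continuous T0 cD).
apply/eqP; rewrite -subr_eq0; apply: contraTT isT => Dx.
have d0 : 0 < `|D x| / 2 by rewrite divr_gt0// normr_gt0.
have /cvgrPdist_lt /(_ _ d0) := cD x.
move=> /nbhs_ballP[r /= r0 hr].
pose rr := Num.min r (Num.min x (T - x)).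
have /andP[x0 xT'] := xT.
have rr0 : 0 < rr by rewrite !lt_min r0 x0 subr_gt0 xT'.
have rx : rr <= x by rewrite /rr !ge_min lexx orbT.
have rT : rr <= T - x by rewrite /rr !ge_min lexx !orbT.
have half_norm (u v : R) : `|u - v| < `|u| / 2 -> `|u| / 2 <= `|v|.
  by move=> h1; have := ler_normD (u - v) v; rewrite subrK; lra.
have lb y : x - rr < y < x + rr -> (`|D x| / 2) ^+ 2 <= D y * (D y * \1_`]0, T[ y).
  move=> /andP[y1 y2].
  have -> : \1_`]0, T[ y = 1 :> R.
    by rewrite indic_itv in_itv/= (le_lt_trans _ y1) ?subr_ge0//= (lt_le_trans y2)//; lra.
  rewrite mulr1 -expr2 -[leRHS]real_normK ?num_real// lerXn2r ?nnegrE ?(ltW d0)//.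
  have : ball x r y.
    rewrite /ball/= ltr_distlC; apply/andP; split.
      by apply: le_lt_trans y1; rewrite lerD2l lerN2 ge_min lexx.
    by apply: lt_le_trans y2 _; rewrite lerD2l ge_min lexx.
  by move=> /hr; exact: half_norm.
have : 0 < \int[mu]_y (D y * (D y * \1_`]0, T[ y)).
  apply: (@lt_le_trans _ _ (\int[mu]_y ((`|D x| / 2) ^+ 2 * \1_`](x - rr), (x + rr)[ y))).
    have i1 : mu.-integrable setT (EFin \o (\1_`](x - rr), (x + rr)[ : R -> R)).
      apply/integrableP; split; first exact/measurable_EFinP.
      have -> : (\int[mu]_u `|(EFin \o \1_`](x - rr)%R, (x + rr)%R[) u| = \int[mu]_u (\1_`](x - rr)%R, (x + rr)%R[ u : R)%:E)%E.
        by apply: eq_integral => y _; rewrite /= ger0_norm.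
      by rewrite integral_indic_itvoo ?ltry//; lra.
    rewrite RintegralZl// mulr_gt0 ?exprn_gt0//.
    by rewrite /Rintegral integral_indic_itvoo/=; lra.
  apply: le_Rintegral => //.
  - apply: (integrable_scaler mu measurableT).
    apply/integrableP; split; first exact/measurable_EFinP.
    have -> : (\int[mu]_u `|(EFin \o \1_`](x - rr)%R, (x + rr)%R[) u| = \int[mu]_u (\1_`](x - rr)%R, (x + rr)%R[ u : R)%:E)%E.
      by apply: eq_integral => y _; rewrite /= ger0_norm.
    by rewrite integral_indic_itvoo ?ltry//; lra.
  - apply: (@integrable_mul_supported D _ (gamma_fun b * Mp + `|rliou b hb c|)).
    + by apply: continuous_measurable_fun.
    + move=> y yT; apply: le_trans (ler_normB _ _) _; rewrite lerD ?rlM//.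
      by rewrite normrM gtr0_norm ?gamma_fun_gt0// ler_wpM2l// ltW// gamma_fun_gt0.
    + exact: (supported_continuous T0 cD).
  - move=> y _; rewrite indic_itv in_itv/=; have [yr|yr] := boolP (x - rr < y < x + rr).
      by rewrite mulr1; exact: lb.
    by rewrite mulr0 mulrA mulr_ge0 ?sqr_ge0// ?indicE ?ler0n// -expr2 sqr_ge0.
by rewrite w0 ltxx.
Qed.

End weak_form_general.

(** * Reflection of the interval *)

Section reflection.
Context {R : realType}.
Notation mu := (@lebesgue_measure R).

Lemma ae_reflect (P : R -> Prop) (T : R) :
  {ae mu, forall x, P x} -> {ae mu, forall x, P (T - x)}.
Proof.
move=> [A [mA A0 sub]]; exists ((fun x : R => -1 * x + T) @^-1` A); split.
- by rewrite -[X in measurable X]setTI; apply: measurable_affine.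
- have := @lebesgue_measure_affine R (-1) T A; rewrite oppr_eq0 oner_eq0 A0 normrN1 mul1e.
  by move=> /(_ isT mA).
- move=> x /= hx; rewrite mulN1r addrC; exact: (sub (T - x)).
Qed.

Let restrictE (D : set R) (f : R -> R) : f \_ D = (fun x => f x * \1_D x).
Proof. by apply/funext => x; rewrite patchE indicE; case: ifPn; rewrite ?mulr1 ?mulr0. Qed.

Let norm_indic (D : set R) x : `|\1_D x : R| = \1_D x.
Proof. by rewrite ger0_norm. Qed.

Let indic_reflect (T x u : R) : \1_`](T - x), T[ (-1 * u + T) = \1_`]0, x[ u :> R.
Proof. by rewrite !indic_itv !in_itv/=; congr (_%:R); congr nat_of_bool; apply/idP/idP => /andP[? ?]; apply/andP; split; lra. Qed.

Lemma integrable_reflect (T x : R) (f : R -> R) : mu.-integrable `](T - x), T[ (EFin \o f) ->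
  mu.-integrable `]0, x[ (EFin \o (fun u => f (T - u))).
Proof.
move=> /integrableP[mf fi].
have mg : measurable_fun setT (fun u => f u * \1_`](T - x), T[ u).
  by rewrite -restrictE; apply/(measurable_restrictT _ _).1 => //; exact/measurable_EFinP.
apply/integrableP; split.
  apply/measurable_EFinP/(measurable_restrictT _ _).2 => //; rewrite restrictE.
  have -> : (fun u => f (T - u) * \1_`]0, x[ u) = (fun u => f u * \1_`](T - x), T[ u) \o (fun u => -1 * u + T).
    by apply/funext => u; rewrite /= indic_reflect mulN1r addrC.
  by apply: measurableT_comp => //; exact: measurable_affine.
have := @ge0_integral_affine R (-1) T (fun u => `|f u * \1_`](T - x)%R, T[ u|%:E).
rewrite oppr_eq0 oner_eq0 normrN1 invr1 mul1e => /(_ isT) e.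
apply: le_lt_trans fi; rewrite le_eqVlt; apply/orP; left; apply/eqP.
rewrite [LHS](integral_EFin_indic `]0%R, x[ (fun u => `|f (T - u)|)).
rewrite [RHS](integral_EFin_indic `](T - x)%R, T[ (fun u => `|f u|)).
transitivity (\int[mu]_u (`|f u * \1_`](T - x)%R, T[ u|)%:E)%E; last first.
  by apply: eq_integral => u _; rewrite normrM norm_indic.
rewrite -e//; last by apply/measurable_EFinP; apply: measurableT_comp.
by apply: eq_integral => u _; rewrite normrM indic_reflect mulN1r addrC norm_indic.
Qed.

Lemma Rintegral_reflect (T x : R) (f : R -> R) : measurable_fun `](T - x), T[ f ->
  \int[mu]_(u in `](T - x), T[) f u = \int[mu]_(u in `]0, x[) f (T - u).
Proof.
move=> mf.
have mg : measurable_fun setT (fun u => f u * \1_`](T - x), T[ u).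
  by rewrite -restrictE; apply/(measurable_restrictT _ _).1.
have := @Rintegral_affine R (-1) T _ _ mg; rewrite oppr_eq0 oner_eq0 normrN1 invr1 mul1r => /(_ isT) e.
rewrite [LHS]Rintegral_indic [RHS]Rintegral_indic -e.
by apply: eq_Rintegral => u _; rewrite indic_reflect mulN1r addrC.
Qed.

End reflection.

(** * The integral as a limit of forward difference quotients, whatever the order *)

Section forward_formula.
Context {R : realType}.
Notation mu := (@lebesgue_measure R).
Variables (b T : R).
Hypotheses (b01 : 0 < b < 1) (T0 : 0 < T).
Let b01' : 0 < 1 - b < 1. Proof. by move: b01 => /andP[? ?]; apply/andP; split; lra. Qed.
Let mD : measurable (`]0, T[%classic : set R). Proof. exact: measurable_itv. Qed.

Definition primitive (G : R -> R) (x : R) : R := \int[mu]_(u in `]-oo, x]) G u.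

Section primitive.
Variables (G : R -> R) (M : R).
Hypotheses (sG : supported T G) (GM : forall x, `|G x| <= M).

Let integrable_G (p : R -> R) : measurable_fun setT p -> (forall x, `|p x| <= 1) ->
  mu.-integrable setT (EFin \o (fun x => G x * p x)).
Proof.
move=> mp p1; rewrite (_ : (fun x => G x * p x) = (fun x => p x * G x)); last first.
  by apply/funext => x; rewrite mulrC.
exact: (integrable_mul_supported T0 mp (fun y _ => p1 y) sG).
Qed.

Let indic_le1 (D : set R) x : `|\1_D x : R| <= 1.
Proof. by rewrite indicE; case: (_ \in _); rewrite ?normr1 ?normr0. Qed.

Lemma increment_primitive (y e : R) : 0 <= e ->
  \int[mu]_u (G u * \1_`]y, +oo[ u) - \int[mu]_u (G u * \1_`](y + e), +oo[ u) = primitive G (y + e) - primitive G y.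
Proof.
move=> e0; have E z : \int[mu]_u (G u * \1_`]z, +oo[ u) = \int[mu]_u (G u * 1) - primitive G z.
  rewrite /primitive [X in _ - X]Rintegral_indic -RintegralB//.
  - apply: eq_Rintegral => u _; rewrite !indic_itv !in_itv/= andbT.
    by case: ltP; rewrite ?mulr1 ?mulr0 ?subrr ?subr0.
  - by apply: integrable_G => // x; rewrite normr1.
  - by apply: integrable_G.
by rewrite !E; ring.
Qed.

Lemma norm_increment_primitive (y e : R) : 0 <= e -> `|primitive G (y + e) - primitive G y| <= M * e.
Proof.
move=> e0; rewrite -increment_primitive//.
have -> : \int[mu]_u (G u * \1_`]y, +oo[ u) - \int[mu]_u (G u * \1_`](y + e), +oo[ u) =
    \int[mu]_(u in `]y, (y + e)]) G u.
  rewrite [RHS]Rintegral_indic -RintegralB//; [|exact: integrable_G|exact: integrable_G].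
  apply: eq_Rintegral => u _; rewrite !indic_itv !in_itv/= !andbT -mulrBr; congr (_ * _).
  case: (ltP y u) => yu; case: (ltP (y + e) u) => yeu /=; rewrite ?subrr ?subr0//.
  by move: yu; rewrite leNgt (le_lt_trans _ yeu)// lerDl.
have me : mu `]y, (y + e)] = e%:E.
  rewrite lebesgue_measure_itv/= lte_fin; case: ltP => [_|h].
    by rewrite -EFinD addrAC subrr add0r.
  have e1 : e <= 0 by move: h; rewrite gerDl.
  by congr EFin; apply/le_anti; rewrite e0 e1.
have mI : measurable (`]y, (y + e)]%classic : set R) by exact: measurable_itv.
have moo : (mu `]y, (y + e)%R] < +oo)%E by rewrite me ltry.
have iG : mu.-integrable `]y, (y + e)] (EFin \o G).
  apply: (integrable_boundedr mu mI _ M moo); last by move=> x _; exact: GM.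
  by apply: measurable_funTS; case: sG.
have n1 : `|\int[mu]_(u in `]y, (y + e)]) G u| <= \int[mu]_(u in `]y, (y + e)]) `|G u|.
  exact: le_normr_Rintegral.
apply: (le_trans n1).
apply: (@le_trans _ _ (\int[mu]_(u in `]y, (y + e)]) M)).
  apply: le_Rintegral => //; first exact: (integrable_normr mu).
  by apply: (integrable_boundedr mu mI _ `|M| moo).
rewrite Rintegral_cst; last exact: measurable_itv.
by rewrite (_ : fine _ = e)//; exact: (congr1 fine me).
Qed.

(** The Lebesgue differentiation theorem, along the sequence [harmonic] because dominated
    convergence will be applied to a sequence. *)
Lemma derivative_primitive : {ae mu, forall y, (fun i => (harmonic i)^-1 * (primitive G (y + harmonic i) - primitive G y)) @ \oo --> G y}.
Proof.
have iG : mu.-integrable setT (EFin \o G).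
  rewrite (_ : G = (fun x => G x * 1)); last by apply/funext => x; rewrite mulr1.
  by apply: integrable_G => // x; rewrite normr1.
have := @FTC1Ny R G _ (open_integrable_locally openT iG).
have iGy (y : R) : mu.-integrable `]-oo, y] (EFin \o G) by apply: integrableS iG.
move=> /(_ iGy); apply: filterS; first exact: (ae_filter_ringOfSetsType mu).
move=> y [dF <-]; rewrite derive1E.
have /cvgr_dnbhsP := dF; move=> /(_ (fun i => harmonic i)).
have h0 n : harmonic n != 0 :> R by rewrite gt_eqF// harmonic_gt0.
move=> /(_ (conj h0 cvg_harmonic)).
apply: cvg_trans; apply: near_eq_cvg; apply: nearW => i /=.
by rewrite /GRing.scale/= mulr1 [y + _]addrC.
Qed.

(** Cutting to ]0, T[ does not change the integrals: the kernel vanishes for x <= y with y >= 0, and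
    the adjoint of [G] vanishes beyond [T]. The shift by [e] moves to the argument by translation,
    and [integral_riesz_adj] evaluates both terms. *)
Lemma adj_increment (y e : R) : 0 <= y -> 0 <= e ->
  adj b (fun x => adj (1 - b) G x * \1_`]0, T[ x - adj (1 - b) G (x + e) * \1_`]0, T[ x) y =
  gamma_fun b * gamma_fun (1 - b) * (primitive G (y + e) - primitive G y).
Proof.
move=> y0 e0; have cA := continuous_adj b01' sG.
have s1 := supported_continuous T0 cA.
have cA2 : continuous (fun x => adj (1 - b) G (x + e)).
  move=> x; apply: (@continuous_cvg _ R R (nbhs x) _ (fun x => x + e) (adj (1 - b) G)).
    exact: cA.
  by apply: cvgD; [exact: cvg_id|exact: cvg_cst].
have s2 := supported_continuous T0 cA2.
rewrite (adjB b01 y s1 s2) -increment_primitive// mulrBr.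
have cut e' x : 0 <= e' -> riesz b (x - y) * (adj (1 - b) G (x + e') * \1_`]0, T[ x) =
    riesz b (x - y) * adj (1 - b) G (x + e').
  move=> e'0; rewrite indic_itv in_itv/=; have [xT|] := boolP (0 < x < T); first by rewrite mulr1.
  rewrite negb_and -!leNgt => /orP[x0|xT].
    by rewrite riesz_le0 ?mul0r// subr_le0 (le_trans x0).
  by rewrite (adj_geT _ sG) ?mul0r// (le_trans xT)// lerDl.
congr (_ - _).
  rewrite -(integral_riesz_adj b01 T0 y sG); apply: eq_Rintegral => x _.
  by have := cut 0 x (lexx 0); rewrite addr0.
rewrite -(integral_riesz_adj b01 T0 (y + e) sG).
have mg : measurable_fun setT (fun x : R => riesz b (x - (y + e)) * adj (1 - b) G x).
  by apply: measurable_funM; [exact: measurable_riesz_adj|exact: (measurable_adj b01' sG)].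
have := @Rintegral_affine R 1 e _ _ mg; rewrite normr1 invr1 mul1r => <-; last exact: oner_neq0.
rewrite {1}/adj; apply: eq_Rintegral => x _; rewrite (cut e x e0) mul1r.
by have -> : x + e - (y + e) = x - y by ring.
Qed.

End primitive.

Variables (p pc q qc : R -> R) (Mp Mq : R).
Hypotheses (cpc : continuous pc) (pcM : forall x, `|pc x| <= Mp) (pcE : forall x, 0 < x < T -> pc x = p x).
Hypotheses (cqc : continuous qc) (qcM : forall x, `|qc x| <= Mq) (qcE : forall x, 0 <= x <= T -> qc x = q x).

(** The path is frozen at its terminal value beyond [T] and normalised to vanish there, like the
    adjoint of a function supported in ]0, T[. *)
Let qt (y : R) : R := if y < T then q y - q T else 0.
Let h := left_fderiv b 0 p.
Let g := right_fderiv (1 - b) T (fun y => q y - q T).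

Lemma marchaud_left : left_fderivable b 0 T p -> marchaud b T pc h.
Proof.
move=> lp.
have E x u : 0 < x < T -> u \in `]0, x[ -> pc x - pc u = p x - p u.
  move=> xT; rewrite in_itv/= => /andP[u0 ux]; rewrite !pcE//.
  by rewrite u0 (lt_trans ux)//; case/andP: xT.
split=> x xT.
  apply: (eq_integrable _ _ _ _ (lp x xT)) => //.
  by move=> u; rewrite inE/= => uT; rewrite /= E.
have Gc0 : gamma_fun (1 - b) != 0 by rewrite gt_eqF// gamma_fun_gt0.
rewrite /h /left_fderiv mulrA mulfV// mul1r subr0 pcE//; congr (_ + _ * _).
by apply: eq_Rintegral => u; rewrite inE/= => uT; rewrite -(E _ _ xT uT) pcE.
Qed.

(** Reflection turns the right derivative of order 1 - b into a left one. Subtracting [q T] makes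
    the reflected function vanish at 0, as [rliou_marchaud] demands. *)
Lemma marchaud_right : right_fderivable (1 - b) 0 T (fun y => q y - q T) ->
  marchaud (1 - b) T (fun x => qc (T - x) - q T) (fun x => g (T - x)).
Proof.
move=> rq.
have E x u : 0 < x < T -> u \in `]0, x[ ->
    (qc (T - x) - q T - (qc (T - u) - q T)) / (x - u) `^ (1 + (1 - b)) =
    (q (T - x) - q T - (q (T - u) - q T)) / ((T - u) - (T - x)) `^ (1 + (1 - b)).
  move=> /andP[x0 xT]; rewrite in_itv/= => /andP[u0 ux].
  have -> : T - u - (T - x) = x - u by ring.
  by rewrite !qcE//; apply/andP; split; lra.
have iq x : 0 < x < T -> mu.-integrable `](T - x), T[ (EFin \o
    (fun u => (q (T - x) - q T - (q u - q T)) / (u - (T - x)) `^ (1 + (1 - b)))).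
  by move=> /andP[x0 xT]; apply: rq; apply/andP; split; lra.
split=> x xT.
  apply: (eq_integrable _ _ _ _ (integrable_reflect (iq x xT))) => //.
  by move=> u; rewrite inE/= => uT; rewrite /= E.
have Gc0 : gamma_fun (1 - (1 - b)) != 0 by rewrite gt_eqF// gamma_fun_gt0// opprB addrCA subrr addr0.
rewrite /g /right_fderiv mulrA mulfV// mul1r.
have -> : T - (T - x) = x by ring.
rewrite qcE; last by move: xT => /andP[? ?]; apply/andP; split; lra.
congr (_ + _ * _).
rewrite Rintegral_reflect; last by apply/measurable_EFinP; exact: measurable_int (iq x xT).
apply: eq_Rintegral => u; rewrite inE/= => uT; rewrite -(E _ _ xT uT) qcE//.
by move: xT => /andP[? ?]; apply/andP; split; lra.
Qed.

(** With [G] a bounded version of the right derivative, inversion makes [qt] a multiple of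
    [adj (1 - b) G], so the duality applies to the forward difference [phi e] of the latter. Its
    adjoint of order [b] is a multiple of an increment of the primitive of [G], whose quotient by
    the step tends to [G] almost everywhere. The point is that the converging sequence does not
    mention [b]. *)
Lemma frac_forward : frac_admissible 0 T p q b ->
  (fun i => (harmonic i)^-1 * \int[mu]_(x in `]0, T[) (pc x * (qt x - qt (x + harmonic i)))) @ \oo -->
  \int[mu]_(x in `[0, T]) (h x * g x).
Proof.
move=> [_ lp rq ih0 [mg [M gM]]].
have mg' : measurable_fun `]0, T[ g by apply: measurable_funS mg => //; exact: subset_itv_oo_cc.
have ih : mu.-integrable `]0, T[ (EFin \o h).
  by apply: integrableS ih0 => //; exact: subset_itv_oo_cc.
pose M' := `|M|; have M'0 : 0 <= M' by rewrite /M' normr_ge0.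
(* The right derivative is essentially bounded; clipping it gives a test function that is bounded
   everywhere and agrees with [g] almost everywhere on the interval. *)
pose G u := Num.max (- M') (Num.min M' (g u * \1_`]0, T[ u)).
have GM u : `|G u| <= M'.
  by rewrite ler_norml le_max lexx/= ge_max ge0_cp//= ge_min lexx.
have G0 u : ~~ (0 < u < T) -> G u = 0.
  move=> uT; rewrite /G indic_itv in_itv/= (negbTE uT) mulr0 (min_idPr _)// (max_idPr _)//.
  by rewrite oppr_le0.
have mG : measurable_fun setT G.
  have mg1 : measurable_fun setT (fun u => g u * \1_`]0, T[ u).
    rewrite (_ : (fun u => _) = g \_ `]0, T[); first exact/(measurable_restrictT _ _).1.
    by apply/funext => u; rewrite patchE indicE; case: ifPn; rewrite ?mulr1 ?mulr0.
  by apply: measurable_maxr => //; exact: measurable_minr.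
have sG : supported T G by split => //; split => //; exists M'.
have gG : {ae mu, forall u, 0 < u < T -> g u = G u}.
  move: gM; apply: filterS; first exact: (ae_filter_ringOfSetsType mu).
  move=> u gu uT; rewrite /G indic_itv in_itv/= uT mulr1.
  have : `|g u| <= M' by apply: le_trans (ler_norm M); apply: gu; case/andP: uT => u1 u2; rewrite /= in_itv/= !ltW.
  by rewrite ler_norml => /andP[g1 g2]; rewrite (min_idPr g2) (max_idPr g1).
have ig : mu.-integrable `]0, T[ (EFin \o g).
  apply/integrableP; split; first exact/measurable_EFinP.
  apply: (@le_lt_trans _ _ (\int[mu]_(x in `]0%R, T[) (M'%:E))%E).
    apply: ae_ge0_le_integral => //.
    - by apply/measurable_EFinP; exact: measurableT_comp.
    - move: gG; apply: filterS; first exact: (ae_filter_ringOfSetsType mu).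
      by move=> u gu; rewrite /= in_itv/= => uT; rewrite lee_fin gu.
  by rewrite integral_cst// lte_mul_pinfty// muoo.
have ig' : mu.-integrable `]0, T[ (EFin \o (fun x => g (T - x))).
  by apply: integrable_reflect; rewrite subrr.
have sr := supported_reflect sG.
have cp' : continuous (fun x => qc (T - x) - q T).
  move=> y; apply: cvgB; last exact: cvg_cst.
  apply: (@continuous_cvg _ R R (nbhs y) _ (fun y => T - y) qc); first exact: cqc.
  by apply: cvgB; [exact: cvg_cst|exact: cvg_id].
have pM' x : `|qc (T - x) - q T| <= Mq + `|q T|.
  by apply: le_trans (ler_normB _ _) _; rewrite lerD2r.
have p'0 : qc (T - 0) - q T = 0 by rewrite subr0 qcE ?subrr// lexx ltW.
have hae : {ae mu, forall y, 0 < y < T -> g (T - y) = G (T - y)}.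
  have := @ae_reflect R (fun u => 0 < u < T -> g u = G u) T gG.
  apply: filterS; first exact: (ae_filter_ringOfSetsType mu).
  by move=> y gy /andP[y0 yT]; apply: gy; apply/andP; split; lra.
have Gq := rliou_marchaud b01' T0 cp' pM' p'0 ig' (marchaud_right rq) (proj1 sr) (fun x => GM (T - x)) (supported_source sr) hae.
set Gc := gamma_fun (1 - b) in Gq; set Gb := gamma_fun b.
have Gc0 : Gc != 0 by rewrite gt_eqF// gamma_fun_gt0.
have Gb0 : Gb != 0 by rewrite gt_eqF// gamma_fun_gt0.
have adj_qt x : 0 < x -> adj (1 - b) G x = Gc * qt x.
  move=> x0; rewrite /qt; case: ltP => xT; last by rewrite (adj_geT _ sG)// mulr0.
  rewrite (@adjE R (1 - b) T G x mG) -Gq; last by apply/andP; split; lra.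
  by rewrite (_ : T - (T - x) = x) ?qcE ?(ltW x0) ?(ltW xT)//; ring.
have cA := continuous_adj b01' sG.
pose phi (e x : R) := adj (1 - b) G x * \1_`]0, T[ x - adj (1 - b) G (x + e) * \1_`]0, T[ x.
have sphi e : supported T (phi e).
  apply: supportedB; first exact: supported_continuous.
  apply: (@supported_continuous R T T0 (fun x => adj (1 - b) G (x + e))) => x.
  apply: (@continuous_cvg _ R R (nbhs x) _ (fun x => x + e) (adj (1 - b) G)); first exact: cA.
  by apply: cvgD; [exact: cvg_id|exact: cvg_cst].
have mpc : measurable_fun setT pc by exact: continuous_measurable_fun.
have K e : 0 < e -> \int[mu]_(x in `]0, T[) (pc x * (qt x - qt (x + e))) =
    Gc^-1 * (Gb^-1 * \int[mu]_(y in `]0, T[) (h y * adj b (phi e) y)).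
  move=> e0; rewrite -(weak_marchaud b01 T0 cpc pcM ih (marchaud_left lp) (sphi e)) mulKf//.
  rewrite -RintegralZl//; last exact: (integrable_mul_supported T0 mpc (fun x _ => pcM x) (sphi e)).
  rewrite [LHS]Rintegral_indic; apply: eq_Rintegral => x _.
  rewrite /phi indic_itv in_itv/=; have [/andP[x0 xT]|_] := boolP (0 < x < T); last by rewrite !mulr0 subrr !mulr0.
  by rewrite !mulr1 !adj_qt ?addr_gt0//; field.
pose F := primitive G.
pose c (i : nat) : R := (harmonic i)^-1 * (Gc^-1 * Gb^-1).
have hn i : 0 < harmonic i :> R by exact: harmonic_gt0.
have adjF i y : 0 < y -> c i * (h y * adj b (phi (harmonic i)) y) =
    h y * ((harmonic i)^-1 * (F (y + harmonic i) - F y)).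
  move=> y0; have AF : adj b (phi (harmonic i)) y = Gb * Gc * (F (y + harmonic i) - F y).
    exact: (adj_increment sG (ltW y0) (ltW (hn i))).
  rewrite AF /c; move: (harmonic i)^-1 (F (y + harmonic i) - F y) (h y) => a1 a2 a3.
  by field; rewrite Gb0.
have E i : (harmonic i)^-1 * \int[mu]_(x in `]0, T[) (pc x * (qt x - qt (x + harmonic i))) =
    \int[mu]_(y in `]0, T[) (c i * (h y * adj b (phi (harmonic i)) y)).
  have im := integrable_mul_adj b01 T0 ih (sphi (harmonic i)).
  by rewrite K// RintegralZl// /c !mulrA.
have mh : measurable_fun `]0, T[ h by apply/measurable_EFinP; exact: measurable_int ih.
have -> : \int[mu]_(x in `[0, T]) (h x * g x) = \int[mu]_(x in `]0, T[) (h x * G x).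
  rewrite /Rintegral; congr fine; rewrite integral_itv_bndoo; last first.
    by apply/measurable_EFinP; exact: (measurable_funM mh mg').
  apply: ae_eq_integral => //.
  - by apply/measurable_EFinP; exact: (measurable_funM mh mg').
  - by apply/measurable_EFinP; apply: (measurable_funM mh); exact: measurable_funTS.
  - move: gG; apply: filterS; first exact: (ae_filter_ringOfSetsType mu).
    by move=> y hy; rewrite /= in_itv/= => yT; rewrite hy.
rewrite (_ : (fun i => _) = (fun i => \int[mu]_(y in `]0, T[) (c i * (h y * adj b (phi (harmonic i)) y)))); last first.
  by apply/funext => i; exact: E.
have mf i : measurable_fun `]0, T[ (fun y => c i * (h y * adj b (phi (harmonic i)) y)).
  apply: measurable_funM => //; apply: (measurable_funM mh).
  by apply: measurable_funTS; exact: (measurable_adj b01).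
have mhG : measurable_fun `]0, T[ (fun y => h y * G y).
  by apply: (measurable_funM mh); exact: measurable_funTS.
refine (dominated_cvg_Rintegral mu mD _ _ (fun y => M' * `|h y|) mf mhG _ _ _).
- have := derivative_primitive sG; apply: filterS; first exact: (ae_filter_ringOfSetsType mu).
  move=> y dy; rewrite /= in_itv/= => /andP[y0 _].
  rewrite (_ : (fun i => _) = (fun i => h y * ((harmonic i)^-1 * (F (y + harmonic i) - F y)))); last first.
    by apply/funext => i; exact: adjF.
  by apply: cvgMr.
- exact: (integrable_scaler mu mD M' _ (integrable_normr mu _ ih)).
- apply: aeW => y i; rewrite /= in_itv/= => /andP[y0 _].
  rewrite adjF// normrM mulrC; apply: ler_wpM2r => //.
  rewrite normrM gtr0_norm ?invr_gt0// mulrC ler_pdivrMr//.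
  exact: (norm_increment_primitive sG GM y (ltW (hn i))).
Qed.

End forward_formula.

(** * The heat kernel as a Gaussian density *)

Section heat_kernel_facts.
Context {R : realType}.
Notation mu := (@lebesgue_measure R).
Notation N := (@heat_kernel R 1).

Lemma heat_kernel_ge0 (t x : R) : 0 <= heat_kernel t x.
Proof. by rewrite mulr_ge0 ?powR_ge0 ?expR_ge0. Qed.

Lemma heat_kernel1E : N = normal_pdf 0 1.
Proof.
apply/funext => z; rewrite normal_pdfE ?oner_neq0// /heat_kernel /= /normal_peak /normal_fun.
rewrite powRN powR12_sqrt ?mulr_ge0 ?pi_ge0// subr0 !expr1n mul1r !mulr1 real_normK ?num_real//.
by rewrite (mulr_natl pi 2).
Qed.

Lemma heat_kernel_scale (r z : R) : 0 < r -> heat_kernel (r ^+ 2) (r * z) = r^-1 * N z.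
Proof.
move=> r0; rewrite /heat_kernel mulr1.
have pi0 : 0 <= 2 * pi :> R by rewrite mulr_ge0 ?pi_ge0.
rewrite powRM ?sqr_ge0//.
have -> : (r ^+ 2) `^ (- 2^-1) = r^-1.
  by rewrite powRN powR12_sqrt ?sqr_ge0// sqrtr_sqr gtr0_norm.
rewrite [_ / r]mulrC -mulrA; congr (_ * (_ * expR _)).
by rewrite normrM exprMn (gtr0_norm r0); field; rewrite gt_eqF.
Qed.

Lemma integrable_heat1 : mu.-integrable setT (EFin \o N).
Proof. by rewrite heat_kernel1E; exact: integrable_normal_pdf. Qed.

Lemma integral_heat1 : \int[mu]_z N z = 1.
Proof. by rewrite /Rintegral heat_kernel1E integral_normal_pdf. Qed.

Lemma measurable_heat (t : R) : measurable_fun setT (heat_kernel t).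
Proof.
apply: measurable_funM => //; apply: measurableT_comp => //.
apply: measurable_funM => //; apply: measurableT_comp => //.
by apply: measurable_funX; exact: normr_measurable.
Qed.

(* z^2 is dominated by a Gaussian of larger variance: z^2 e^{-z^2/4} <= 4. *)
Lemma integrable_heat1_sqr : mu.-integrable setT (EFin \o (fun z => N z * z ^+ 2)).
Proof.
pose s : R := Num.sqrt 2; have s2 : s ^+ 2 = 2 by rewrite sqr_sqrtr.
have s0 : s != 0 by rewrite gt_eqF// sqrtr_gt0.
have i2 := @integrable_normal_pdf R 0 s.
pose c := (2 * pi * 1 : R) `^ (- 2^-1) * 4 / normal_peak s.
apply: (integrable_ler mu measurableT _ (fun z => c * normal_pdf 0 s z)).
- by apply: measurable_funM; [exact: measurable_heat|exact: measurable_funX].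
- move=> z _; rewrite ger0_norm; last by rewrite mulr_ge0 ?heat_kernel_ge0 ?sqr_ge0.
  have pk : normal_peak s != 0 by rewrite gt_eqF ?normal_peak_gt0.
  have -> : c * normal_pdf 0 s z = (2 * pi * 1) `^ (- 2^-1) * (4 * normal_fun 0 s z).
    by rewrite normal_pdfE//= /c; field.
  rewrite /heat_kernel -!mulrA; apply: ler_wpM2l; first exact: powR_ge0.
  rewrite /normal_fun subr0 s2 real_normK ?num_real// mulr1.
  set a := z ^+ 2; have h := expR_ge1Dx (a / 4).
  have -> : - a / 2 = - a / (2 *+ 2) + - (a / 4) by field.
  rewrite expRD expRN mulrAC -mulrA mulrC ler_wpM2r ?expR_ge0//.
  rewrite ler_pdivrMr ?expR_gt0//; lra.
- exact: (integrable_scaler mu measurableT).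
Qed.

End heat_kernel_facts.

(** * Regularity in time of the mild integrand *)

Section mild_integrand.
Context {R : realType}.
Notation mu := (@lebesgue_measure R).
Notation N := (@heat_kernel R 1).
Variables (gamma C M : R) (sigma : R -> R -> R).
Hypothesis hgamma : 2^-1 < gamma < 1.
Hypothesis sigma_bounded : forall t x : R, 0 <= t -> `|sigma t x| <= M.
Hypothesis sigma_hoelder : forall t1 t2 x1 x2 : R, 0 <= t1 -> 0 <= t2 ->
  `|sigma t1 x1 - sigma t2 x2| <= C * (`|t1 - t2| `^ gamma + `|x1 - x2| `^ gamma).
Variables (t x : R).
Hypothesis t0 : 0 < t.

Let gamma0 : 0 < gamma. Proof. by case/andP: hgamma => h _; apply: lt_trans h; rewrite invr_gt0. Qed.

Lemma continuous_coefficient (s : R) : 0 <= s -> continuous (sigma s).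
Proof.
move=> s0 y; apply/cvgrPdist_lt => e e0.
have C0 : 0 <= `|C| by [].
pose d := (e / (`|C| + 1)) `^ gamma^-1.
have eC : 0 < e / (`|C| + 1) by rewrite divr_gt0// ltr_wpDl.
have d0 : 0 < d by exact: powR_gt0.
near=> z.
apply: le_lt_trans (sigma_hoelder _ _ s0 s0) _.
rewrite subrr normr0 powR0 ?gt_eqF// add0r.
have h1 : `|y - z| `^ gamma <= e / (`|C| + 1).
  have -> : e / (`|C| + 1) = d `^ gamma by rewrite /d -powRrM mulVf ?gt_eqF// powRr1// ltW.
  have yz : `|y - z| < d by near: z; exact: (nbhsx_ballx y d d0).
  by apply: ge0_ler_powR; rewrite ?nnegrE ?(ltW gamma0) ?(ltW d0) ?(ltW yz).
apply: (@le_lt_trans _ _ (`|C| * (e / (`|C| + 1)))).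
  apply: (@le_trans _ _ (`|C| * `|y - z| `^ gamma)); last exact: ler_wpM2l.
  by apply: ler_wpM2r; rewrite ?powR_ge0// ler_norm.
by rewrite mulrA ltr_pdivrMr ?ltr_wpDl// mulrC ltr_pM2l// ltrDl.
Unshelve. all: by end_near.
Qed.

(** Projection of time onto [0, t]. It extends the integrand to a bounded continuous function on the
    line, the form in which the formula for the fractional integral takes it. *)
Let clamp (s : R) := Num.max 0 (Num.min s t).

Let clamp_ge0 s : 0 <= clamp s. Proof. by rewrite le_max lexx. Qed.
Let clampE s : 0 <= s <= t -> clamp s = s.
Proof. by move=> /andP[s0 st]; rewrite /clamp (min_idPl st) (max_idPr s0). Qed.

(* Substituting y = x - sqrt(t - s) z puts all the dependence on s into sigma. *)
Definition mild_scaled (s : R) : R :=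
  \int[mu]_z (N z * sigma (clamp s) (x - Num.sqrt (t - clamp s) * z)).

Lemma measurable_mild_scaled_integrand (s r : R) : 0 <= s ->
  measurable_fun setT (fun z : R => N z * sigma s (x - r * z)).
Proof.
move=> s0; apply: measurable_funM; first exact: measurable_heat.
have ms : measurable_fun setT (sigma s) by apply: continuous_measurable_fun; exact: continuous_coefficient.
by apply: (measurableT_comp ms); apply: measurable_funB => //; exact: measurable_funM.
Qed.

Lemma integrable_mild_scaled_integrand (s r : R) : 0 <= s ->
  mu.-integrable setT (EFin \o (fun z => N z * sigma s (x - r * z))).
Proof.
move=> s0; apply: (integrable_ler mu measurableT _ (fun z => M * N z)).
- exact: measurable_mild_scaled_integrand.
- move=> z _; rewrite normrM (ger0_norm (heat_kernel_ge0 _ _)) mulrC.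
  by apply: ler_wpM2r; [exact: heat_kernel_ge0|exact: sigma_bounded].
- by apply: (integrable_scaler mu measurableT); exact: integrable_heat1.
Qed.

Lemma mild_scaledE (s : R) : 0 <= s <= t -> mild_integrand sigma t x s = mild_scaled s.
Proof.
move=> st; rewrite /mild_scaled clampE//; move: st => /andP[s0 st].
rewrite /mild_integrand; case: ltP => [st'|ts]; last first.
  have -> : s = t by apply/le_anti; rewrite st ts.
  rewrite subrr sqrtr0.
  transitivity (\int[mu]_z (sigma t x * N z)).
    by rewrite RintegralZl ?integral_heat1 ?mulr1//; exact: integrable_heat1.
  by apply: eq_Rintegral => z _; rewrite mul0r subr0 mulrC.
set r := Num.sqrt (t - s).
have r0 : 0 < r by rewrite sqrtr_gt0 subr_gt0.
have r2 : t - s = r ^+ 2 by rewrite sqr_sqrtr// subr_ge0.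
have mg : measurable_fun setT (fun y : R => heat_kernel (t - s) (x - y) * sigma s y).
  apply: measurable_funM.
    by apply: (measurableT_comp (measurable_heat _)); exact: measurable_funB.
  by apply: continuous_measurable_fun; exact: continuous_coefficient.
have := @Rintegral_affine R (- r) x _ _ mg; rewrite oppr_eq0 gt_eqF// normrN gtr0_norm// => /(_ isT) e.
have -> : \int[mu]_y (heat_kernel (t - s) (x - y) * sigma s y) =
    r * \int[mu]_z (heat_kernel (t - s) (x - (- r * z + x)) * sigma s (- r * z + x)).
  by rewrite e mulrA mulfV ?mul1r// gt_eqF.
have -> : \int[mu]_z (heat_kernel (t - s) (x - (- r * z + x)) * sigma s (- r * z + x)) =
    \int[mu]_z (r^-1 * (N z * sigma s (x - r * z))).
  apply: eq_Rintegral => z _; rewrite r2 (_ : x - (- r * z + x) = r * z); last by ring.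
  by rewrite heat_kernel_scale// (_ : - r * z + x = x - r * z) ?mulrA//; ring.
rewrite RintegralZl//; last exact: integrable_mild_scaled_integrand.
by rewrite mulrA mulfV ?mul1r// gt_eqF.
Qed.

Let K : R := \int[mu]_z (N z * (2 + z ^+ 2)).

Let iK : mu.-integrable setT (EFin \o (fun z => N z * (2 + z ^+ 2))).
Proof.
rewrite (_ : (fun z => _) = (fun z => 2 * N z + N z * z ^+ 2)); last first.
  by apply/funext => z; rewrite mulrDr mulrC.
apply: (integrable_addr mu measurableT); last exact: integrable_heat1_sqr.
by apply: (integrable_scaler mu measurableT); exact: integrable_heat1.
Qed.

Lemma powR_le_sqr (a : R) : 0 <= a -> a `^ gamma <= 1 + a ^+ 2.
Proof.
move=> a0; have [a1|a1] := leP a 1.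
  apply: (@le_trans _ _ (1 `^ gamma)); last by rewrite powR1 lerDl sqr_ge0.
  by apply: ge0_ler_powR; rewrite ?nnegrE// ltW.
apply: (@le_trans _ _ (a `^ 2)); last by rewrite powR_mulrn// lerDr.
by apply: ler_powR; [exact: ltW|case/andP: hgamma => _ g1; lra].
Qed.

(** The regularity of [sigma] gives A + B |z|^gamma at each z, and |z|^gamma <= 1 + z^2 bounds this
    by (A + B) (2 + z^2); hence the constant [K], a second Gaussian moment. *)
Lemma mild_scaled_hoelder (s u : R) :
  `|mild_scaled s - mild_scaled u| <= `|C| * K *
    (`|clamp s - clamp u| `^ gamma + `|Num.sqrt (t - clamp s) - Num.sqrt (t - clamp u)| `^ gamma).
Proof.
set r := Num.sqrt (t - clamp s); set v := Num.sqrt (t - clamp u).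
set A := `|clamp s - clamp u| `^ gamma; set B := `|r - v| `^ gamma.
have A0 : 0 <= A by exact: powR_ge0.
have B0 : 0 <= B by exact: powR_ge0.
have is_ := @integrable_mild_scaled_integrand _ r (clamp_ge0 s).
have iu := @integrable_mild_scaled_integrand _ v (clamp_ge0 u).
have id := integrable_subr mu measurableT _ _ is_ iu.
have E : mild_scaled s - mild_scaled u = \int[mu]_z (N z * sigma (clamp s) (x - r * z) - N z * sigma (clamp u) (x - v * z)).
  by rewrite RintegralB.
rewrite E; have h1 : `|\int[mu]_z (N z * sigma (clamp s) (x - r * z) - N z * sigma (clamp u) (x - v * z))| <=
    \int[mu]_z `|N z * sigma (clamp s) (x - r * z) - N z * sigma (clamp u) (x - v * z)|.
  exact: le_normr_Rintegral.
apply: (le_trans h1).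
have -> : `|C| * K * (A + B) = (`|C| * (A + B)) * K by ring.
rewrite /K -RintegralZl//.
apply: le_Rintegral => //.
- exact: (integrable_normr mu).
- exact: (integrable_scaler mu measurableT).
move=> z _; rewrite -mulrBr normrM (ger0_norm (heat_kernel_ge0 _ _)) [leRHS]mulrCA.
apply: ler_wpM2l; first exact: heat_kernel_ge0.
apply: le_trans (sigma_hoelder _ _ (clamp_ge0 s) (clamp_ge0 u)) _.
have -> : x - r * z - (x - v * z) = - ((r - v) * z) by ring.
rewrite normrN normrM powRM// -/A -/B.
have z1 : `|z| `^ gamma <= 1 + z ^+ 2 by rewrite -[z ^+ 2]real_normK ?num_real// powR_le_sqr.
have z0 : 0 <= z ^+ 2 by exact: sqr_ge0.
apply: (@le_trans _ _ (`|C| * (A + B * `|z| `^ gamma))).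
  by apply: ler_wpM2r; rewrite ?ler_norm// addr_ge0// mulr_ge0// powR_ge0.
rewrite -mulrA; apply: ler_wpM2l => //.
have Bz : B * `|z| `^ gamma <= B * (1 + z ^+ 2) by exact: ler_wpM2l.
have Az2 : 0 <= A * z ^+ 2 by exact: mulr_ge0.
move: (B * `|z| `^ gamma) (z ^+ 2) Bz Az2 => c1 c2 Bz Az2; move: A B A0 B0 Bz Az2 => A' B' *; lra.
Qed.

End mild_integrand.

Lemma clamp_dist {R : realType} (t u v : R) : 0 < t -> v <= u ->
  0 <= Num.max 0 (Num.min v t) <= Num.max 0 (Num.min u t) /\
  Num.max 0 (Num.min u t) <= t /\
  Num.max 0 (Num.min u t) - Num.max 0 (Num.min v t) <= Num.min (u - v) t.
Proof.
move=> t0 vu; have t0' := ltW t0.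
case: (leP v t) => vt; case: (leP u t) => ut; rewrite ?lexx;
  rewrite ?(max_idPr t0'); (try case: (leP 0 v) => v0); (try case: (leP 0 u) => u0);
  (split; [|split]); rewrite ?le_min; (try apply/andP; try split); lra.
Qed.

(** * Left derivatives of order 1/2 *)

Section half_order.
Context {R : realType}.
Notation mu := (@lebesgue_measure R).

Lemma integrable_itvcc (a b : R) (f : R -> R) : mu.-integrable `]a, b[ (EFin \o f) ->
  mu.-integrable `[a, b] (EFin \o f).
Proof.
move=> /integrableP[mf fi].
have mf' : measurable_fun `[a, b] f.
  have /measurable_EFinP := mf.
  by move=> /measurable_fun_itv_obnd_cbndP/measurable_fun_itv_bndo_bndcP.
apply/integrableP; split; first exact/measurable_EFinP.
rewrite integral_itv_bndoo//; exact: (measurableT_comp _ mf).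
Qed.

Lemma measurable_left_fderiv (b : R) (p : R -> R) : measurable_fun setT p ->
  measurable_fun setT (left_fderiv b 0 p).
Proof.
move=> mp; apply: measurable_funM => //; apply: measurable_funD.
  apply: measurable_funM => //; apply: measurable_invr.
  by apply: (measurableT_comp (measurable_powR _)); exact: measurable_funB.
apply: measurable_funM => //.
pose h (z : R * R) := (p z.1 - p z.2) / (z.1 - z.2) `^ (1 + b) * (if (0 < z.2) && (z.2 < z.1) then 1 else 0).
have mh : measurable_fun setT h.
  apply: measurable_funM.
    apply: measurable_funM.
      by apply: measurable_funB; exact: measurableT_comp.
    apply: measurable_invr; apply: (measurableT_comp (measurable_powR _)); exact: measurable_funB.
  apply: measurable_fun_ifT => //; apply: measurable_and; exact: measurable_fun_ltr.
have := measurable_fun_Rintegral2 mh; apply: eq_measurable_fun => x _.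
rewrite [RHS]Rintegral_indic; apply: eq_Rintegral => u _; rewrite /h indic_itv in_itv/=.
by case: ifP.
Qed.

(** The slope [e] is 1 or -1, so that one statement serves singularities at the left and at the
    right end. *)
Lemma integral_powR_affine (c e d X : R) (I : interval R) : 0 < c -> 0 <= X -> `|e| = 1 ->
  (forall u, (u \in I) = (0 < e * u + d < X)) ->
  mu.-integrable [set` I] (EFin \o (fun u => (e * u + d) `^ (c - 1))) /\
  \int[mu]_(u in [set` I]) ((e * u + d) `^ (c - 1)) = X `^ c / c.
Proof.
move=> c0 X0 e1 hI; have e0 : e != 0 by rewrite -normr_eq0 e1 oner_eq0.
have ir := integrable_riesz c0 X0.
have mr : measurable_fun setT (fun s : R => riesz c s * \1_`]0, X[ s).
  by apply: measurable_funM => //; exact: measurable_riesz.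
have E u : riesz c (e * u + d) * \1_`]0, X[ (e * u + d) = (e * u + d) `^ (c - 1) * \1_[set` I] u.
  rewrite (indic_itv I) hI indic_itv in_itv/=.
  by have [/andP[u0 ux]|] := boolP (0 < e * u + d < X); rewrite ?mulr0// !mulr1 rieszE.
have rE : \int[mu]_s (riesz c s * \1_`]0, X[ s) = X `^ c / c.
  rewrite -Rintegral_indic /Rintegral.
  have -> : (\int[mu]_(s in `]0%R, X[) (riesz c s)%:E = \int[mu]_(s in `]0%R, X[) (s `^ (c - 1))%:E)%E.
    by apply: eq_integral => s; rewrite inE/= in_itv/= => /andP[s0 _]; rewrite rieszE.
  by rewrite integral_riesz.
split; last first.
  rewrite -rE [LHS]Rintegral_indic.
  have := @Rintegral_affine R e d _ e0 mr; rewrite e1 invr1 mul1r => <-.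
  by apply: eq_Rintegral => u _; rewrite E.
apply/integrableP; split.
  apply/measurable_EFinP; apply: measurable_funTS; apply: (measurableT_comp (measurable_powR _)).
  exact: measurable_affine.
have := @ge0_integral_affine R e d (fun s => (riesz c s * \1_`]0%R, X[ s)%:E) e0.
rewrite e1 invr1 mul1e => h.
have /integrableP[_] := ir; apply: le_lt_trans; rewrite le_eqVlt; apply/orP; left; apply/eqP.
transitivity (\int[mu]_u ((e * u + d) `^ (c - 1) * \1_[set` I] u)%:E)%E.
  rewrite -integral_EFin_indic; apply: eq_integral => u _; by rewrite /= ger0_norm ?powR_ge0.
transitivity (\int[mu]_s (riesz c s * \1_`]0%R, X[ s)%:E)%E; last first.
  rewrite -integral_EFin_indic; apply: eq_integral => s _; by rewrite /= ger0_norm ?riesz_ge0.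
rewrite -h.
- by apply: eq_integral => u _; rewrite E.
- exact/measurable_EFinP.
- by move=> u; rewrite lee_fin mulr_ge0 ?riesz_ge0// indicE ler0n.
Qed.

Lemma measurable_right_fderiv (b T : R) (q : R -> R) : measurable_fun setT q ->
  measurable_fun setT (right_fderiv b T q).
Proof.
move=> mq; apply: measurable_funM => //; apply: measurable_funD.
  apply: measurable_funM => //; apply: measurable_invr.
  by apply: (measurableT_comp (measurable_powR _)); exact: measurable_funB.
apply: measurable_funM => //.
pose h (z : R * R) := (q z.1 - q z.2) / (z.2 - z.1) `^ (1 + b) * (if (z.1 < z.2) && (z.2 < T) then 1 else 0).
have mh : measurable_fun setT h.
  apply: measurable_funM.
    apply: measurable_funM.
      by apply: measurable_funB; exact: measurableT_comp.
    apply: measurable_invr; apply: (measurableT_comp (measurable_powR _)); exact: measurable_funB.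
  apply: measurable_fun_ifT => //; apply: measurable_and; exact: measurable_fun_ltr.
have := measurable_fun_Rintegral2 mh; apply: eq_measurable_fun => x _.
rewrite [RHS]Rintegral_indic; apply: eq_Rintegral => u _; rewrite /h indic_itv in_itv/=.
by case: ifP.
Qed.

Variables (gamma t : R) (p : R -> R) (L Mp : R).
Hypotheses (hgamma : 2^-1 < gamma < 1) (t0 : 0 < t).
Hypothesis mp : measurable_fun setT p.
Hypothesis pM : forall x, `|p x| <= Mp.
Hypothesis pL : forall u x, 0 < u -> u < x -> x < t ->
  `|p x - p u| <= L * (1 + (t - x) `^ (- (gamma / 2))) * (x - u) `^ gamma.

(** A local Hoelder constant that may blow up at [t] with the exponent gamma / 2 < 1, so that it
    remains integrable. *)
Let W (x : R) := L * (1 + (t - x) `^ (- (gamma / 2))).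

Let quotient_le u x : 0 < u -> u < x -> x < t ->
  `|(p x - p u) / (x - u) `^ (1 + 2^-1)| <= W x * (x - u) `^ (gamma - 2^-1 - 1).
Proof.
move=> u0 ux xt; have d0 : 0 < x - u by rewrite subr_gt0.
rewrite normrM normfV (ger0_norm (powR_ge0 _ _)) ler_pdivrMr ?powR_gt0//.
rewrite -mulrA -gt0_powRD//.
have -> : gamma - 2^-1 - 1 + (1 + 2^-1) = gamma by ring.
exact: pL.
Qed.

Let g0 : 0 < gamma - 2^-1. Proof. by rewrite subr_gt0; case/andP: hgamma. Qed.

Let kernel x := \int[mu]_(u in `]0, x[) ((x - u) `^ (gamma - 2^-1 - 1)).

Let integral_kernel x : 0 < x -> mu.-integrable `]0, x[ (EFin \o (fun u => (x - u) `^ (gamma - 2^-1 - 1))) /\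
  kernel x = x `^ (gamma - 2^-1) / (gamma - 2^-1).
Proof.
move=> x0; have e1 : `|-1 : R| = 1 by rewrite normrN1.
have hI u : (u \in `]0, x[) = (0 < -1 * u + x < x).
  by rewrite in_itv/=; apply/idP/idP => /andP[? ?]; apply/andP; split; lra.
have := integral_powR_affine g0 (ltW x0) e1 hI.
have -> : (fun u : R => (-1 * u + x) `^ (gamma - 2^-1 - 1)) = (fun u => (x - u) `^ (gamma - 2^-1 - 1)).
  by apply/funext => u; rewrite mulN1r addrC.
exact.
Qed.

Let iq x : 0 < x < t -> mu.-integrable `]0, x[ (EFin \o (fun u => (p x - p u) / (x - u) `^ (1 + 2^-1))).
Proof.
move=> /andP[x0 xt]; have [ik _] := integral_kernel x0.
apply: (integrable_ler mu (measurable_itv _) _ (fun u => W x * (x - u) `^ (gamma - 2^-1 - 1))).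
- apply: measurable_funTS; apply: measurable_funM; first exact: measurable_funB.
  apply: measurable_invr; apply: (measurableT_comp (measurable_powR _)); exact: measurable_funB.
- by move=> u; rewrite /= in_itv/= => /andP[u0 ux]; exact: quotient_le.
- exact: (integrable_scaler mu (measurable_itv _)).
Qed.

Lemma left_fderivable_half : left_fderivable 2^-1 0 t p.
Proof. exact: iq. Qed.

(** Two singularities appear: x^(-1/2) at 0 from the boundary term, and (t - x)^(-gamma/2) at [t]
    from the local Hoelder constant. Both are integrable. *)
Lemma left_fderiv_half_le x : 0 < x < t -> `|left_fderiv 2^-1 0 p x| <=
  (gamma_fun (1 - 2^-1))^-1 * (Mp * x `^ (- 2^-1) +
     2^-1 * (L * (1 + (t - x) `^ (- (gamma / 2))) * (t `^ (gamma - 2^-1) / (gamma - 2^-1)))).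
Proof.
move=> xt; have /andP[x0 xt'] := xt; have [ik kE] := integral_kernel x0.
have h01 : 0 < (1 - 2^-1 : R) < 1 by apply/andP; split; lra.
(* The sign is read off from the estimate of the difference quotient at u = x / 2. *)
have W0 : 0 <= W x.
  have := @quotient_le (x / 2) x; have x2 : 0 < x / 2 by rewrite divr_gt0.
  have xx : x / 2 < x by lra.
  move=> /(_ x2 xx xt') h1; have := le_trans (normr_ge0 _) h1.
  by rewrite pmulr_lge0// powR_gt0// subr_gt0.
rewrite /left_fderiv subr0 normrM ger0_norm ?invr_ge0 ?(ltW (gamma_fun_gt0 h01))//.
apply: ler_wpM2l; first by rewrite invr_ge0 ltW// gamma_fun_gt0.
apply: le_trans (ler_normD _ _) _; apply: lerD.
  by rewrite normrM normfV (ger0_norm (powR_ge0 _ _)) -powRN ler_wpM2r ?powR_ge0.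
rewrite normrM ger0_norm ?invr_ge0//; apply: ler_wpM2l; first by rewrite invr_ge0.
have h1 : `|\int[mu]_(u in `]0, x[) ((p x - p u) / (x - u) `^ (1 + 2^-1))| <=
    \int[mu]_(u in `]0, x[) `|(p x - p u) / (x - u) `^ (1 + 2^-1)|.
  by apply: le_normr_Rintegral => //; exact: iq.
apply: (le_trans h1); apply: (@le_trans _ _ (\int[mu]_(u in `]0, x[) (W x * (x - u) `^ (gamma - 2^-1 - 1)))).
  apply: le_Rintegral => //.
  - by apply: (integrable_normr mu); exact: iq.
  - exact: (integrable_scaler mu (measurable_itv _)).
  - by move=> u; rewrite /= in_itv/= => /andP[u0 ux]; exact: quotient_le.
rewrite RintegralZl// -/(kernel x) kE; apply: ler_wpM2l => //.
rewrite ler_wpM2r ?invr_ge0 ?(ltW g0)//.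
by apply: ge0_ler_powR; rewrite ?nnegrE ?(ltW g0) ?(ltW x0) ?(ltW t0) ?(ltW xt').
Qed.

Lemma integrable_left_fderiv_half : mu.-integrable `[0, t] (fun x => (left_fderiv 2^-1 0 p x)%:E).
Proof.
apply: integrable_itvcc.
have mt : measurable (`]0, t[%classic : set R) by exact: measurable_itv.
have h2 : 0 < (1 - 2^-1 : R) by lra.
have g2 : 0 < 1 - gamma / 2 by have /andP[_ ?] := hgamma; lra.
have i1 := @integrable_riesz R (1 - 2^-1) t h2 (ltW t0).
have i2 := @integrable_riesz R (1 - gamma / 2) t g2 (ltW t0).
have i2' : mu.-integrable `]0, t[ (EFin \o (fun x => riesz (1 - gamma / 2) (t - x))).
  have i3 : mu.-integrable `](t - t), t[ (EFin \o riesz (1 - gamma / 2)) by rewrite subrr.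
  exact: (integrable_reflect i3).
pose c1 : R := (gamma_fun (1 - 2^-1))^-1; pose c2 := t `^ (gamma - 2^-1) / (gamma - 2^-1).
apply: (integrable_ler mu mt _ (fun x => c1 * (Mp * riesz (1 - 2^-1) x + (2^-1 * (L * c2)) * (1 + riesz (1 - gamma / 2) (t - x))))).
- by apply: measurable_funTS; exact: measurable_left_fderiv.
- move=> x; rewrite /= in_itv/= => /andP[x0 xt].
  have xt' : 0 < x < t by rewrite x0.
  apply: le_trans (left_fderiv_half_le xt') _.
  rewrite !rieszE ?subr_gt0//.
  have -> : 1 - 2^-1 - 1 = - 2^-1 :> R by ring.
  have -> : 1 - gamma / 2 - 1 = - (gamma / 2) :> R by ring.
  rewrite le_eqVlt; apply/orP; left; apply/eqP; rewrite -/c1 -/c2; ring.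
- apply: (integrable_scaler mu mt); apply: (integrable_addr mu mt).
    exact: (integrable_scaler mu mt).
  apply: (integrable_scaler mu mt); apply: (integrable_addr mu mt) => //.
  by apply: (integrable_boundedr mu mt _ 1) => //; [exact: muoo|move=> x _; rewrite normr1].
Qed.

End half_order.

(** * The mild integrand has an integrable left derivative of order 1/2 *)

Section mild_integrand_half.
Context {R : realType}.
Notation mu := (@lebesgue_measure R).
Variables (gamma C M : R) (sigma : R -> R -> R).
Hypothesis hgamma : 2^-1 < gamma < 1.
Hypothesis sigma_bounded : forall t x : R, 0 <= t -> `|sigma t x| <= M.
Hypothesis sigma_hoelder : forall t1 t2 x1 x2 : R, 0 <= t1 -> 0 <= t2 ->
  `|sigma t1 x1 - sigma t2 x2| <= C * (`|t1 - t2| `^ gamma + `|x1 - x2| `^ gamma).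
Variables (t x : R).
Hypothesis t0 : 0 < t.
Let pc := mild_scaled sigma t x.
Let gamma0 : 0 < gamma. Proof. by case/andP: hgamma => h _; apply: lt_trans h; rewrite invr_gt0. Qed.
Let L := `|C| * \int[mu]_z (heat_kernel 1 z * (2 + z ^+ 2)).
Let L0 : 0 <= L.
Proof.
rewrite mulr_ge0//; apply: Rintegral_ge0 => z _.
by rewrite mulr_ge0 ?heat_kernel_ge0// addr_ge0// sqr_ge0.
Qed.

Lemma norm_sqrtB (a b : R) : 0 <= b -> b <= a -> `|Num.sqrt a - Num.sqrt b| <= Num.sqrt (a - b).
Proof.
move=> b0 ba; have sb := sqrtr_ge0 b; have sa : Num.sqrt b <= Num.sqrt a by rewrite ler_wsqrtr.
rewrite ger0_norm ?subr_ge0// -ler_sqr ?nnegrE ?subr_ge0 ?sqrtr_ge0//.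
rewrite sqr_sqrtr ?subr_ge0// sqrrB !sqr_sqrtr ?(le_trans b0)//.
have : b <= Num.sqrt a * Num.sqrt b by rewrite -{1}(sqr_sqrtr b0) expr2 ler_wpM2r.
lra.
Qed.

(** The square root of t - s lowers the exponent to gamma / 2 up to the endpoint. This yields
    continuity, but it lies below the order 1/2. *)
Lemma continuous_mild_scaled : continuous pc.
Proof.
have g2 : 0 < gamma / 2 by rewrite divr_gt0.
apply: (@hoelder_continuous R pc (L * (t `^ (gamma / 2) + 1)) (gamma / 2) g2) => v u vu.
have h := mild_scaled_hoelder hgamma sigma_bounded sigma_hoelder t x u v.
apply: (le_trans h); rewrite -[leRHS]mulrA; apply: (ler_wpM2l L0).
have [/andP[cv cu] [ct cuv]] := clamp_dist t0 vu.
set a := Num.max 0 (Num.min u t) in cu ct cuv *; set b := Num.max 0 (Num.min v t) in cv cu cuv *.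
move: cuv; rewrite le_min => /andP[d1 d2].
have d0 : 0 <= a - b by rewrite subr_ge0.
rewrite ger0_norm// mulrDl mul1r; apply: lerD.
  have [ab|ab] := eqVneq (a - b) 0.
    by rewrite ab [leLHS]powR0 ?gt_eqF// mulr_ge0 ?powR_ge0.
  have ab0 : 0 < a - b by rewrite lt_neqAle eq_sym ab.
  have -> : (a - b) `^ gamma = (a - b) `^ (gamma / 2) * (a - b) `^ (gamma / 2).
    by rewrite -gt0_powRD//; congr (_ `^ _); field.
  have uv0 : 0 <= u - v by rewrite subr_ge0.
  by apply: ler_pM; rewrite ?powR_ge0//; apply: ge0_ler_powR; rewrite ?nnegrE ?(ltW g2) ?(ltW t0).
have h2 : `|Num.sqrt (t - a) - Num.sqrt (t - b)| <= Num.sqrt (u - v).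
  have ta : 0 <= t - a by rewrite subr_ge0.
  have tab : t - a <= t - b by rewrite lerD2l lerN2.
  rewrite distrC; apply: le_trans (norm_sqrtB ta tab) _.
  by rewrite ler_wsqrtr//; lra.
apply: (@le_trans _ _ (Num.sqrt (u - v) `^ gamma)).
  by apply: ge0_ler_powR; rewrite ?nnegrE ?sqrtr_ge0 ?(ltW gamma0).
by rewrite -powR12_sqrt ?subr_ge0// -powRrM [2^-1 * _]mulrC.
Qed.

Let M0 : 0 <= M. Proof. exact: le_trans (normr_ge0 _) (sigma_bounded 0 (lexx 0)). Qed.

Lemma mild_scaled_bounded s : `|pc s| <= M.
Proof.
have c0 : 0 <= Num.max 0 (Num.min s t) by rewrite le_max lexx.
have i1 := integrable_mild_scaled_integrand hgamma sigma_bounded sigma_hoelder x (Num.sqrt (t - Num.max 0 (Num.min s t))) c0.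
have h1 : `|pc s| <= \int[mu]_z `|heat_kernel 1 z * sigma (Num.max 0 (Num.min s t)) (x - Num.sqrt (t - Num.max 0 (Num.min s t)) * z)|.
  exact: le_normr_Rintegral.
apply: (le_trans h1); apply: (@le_trans _ _ (\int[mu]_z (M * heat_kernel 1 z))).
  apply: le_Rintegral => //.
  - exact: (integrable_normr mu).
  - by apply: (integrable_scaler mu measurableT); exact: integrable_heat1.
  - move=> z _; rewrite normrM (ger0_norm (heat_kernel_ge0 _ _)) mulrC.
    by apply: ler_wpM2r; [exact: heat_kernel_ge0|exact: sigma_bounded].
by rewrite RintegralZl ?integral_heat1 ?mulr1//; exact: integrable_heat1.
Qed.

(** Away from [t] the full exponent gamma returns: the two square roots differ by at most (v - u) /
    sqrt(t - v), at the price of a factor that blows up at [t]. *)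
Lemma mild_scaled_left u v : 0 < u -> u < v -> v < t ->
  `|pc v - pc u| <= L * (1 + (t - v) `^ (- (gamma / 2))) * (v - u) `^ gamma.
Proof.
move=> u0 uv vt; have h := mild_scaled_hoelder hgamma sigma_bounded sigma_hoelder t x v u.
apply: (le_trans h); rewrite -[leRHS]mulrA; apply: (ler_wpM2l L0).
have cl s : 0 < s -> s < t -> Num.max 0 (Num.min s t) = s.
  by move=> s0 st; rewrite (min_idPl (ltW st)) (max_idPr (ltW s0)).
rewrite (cl v (lt_trans u0 uv) vt) (cl u u0 (lt_trans uv vt)).
have vu0 : 0 < v - u by rewrite subr_gt0.
rewrite (ger0_norm (ltW vu0)) mulrDl mul1r lerD2l.
have tv : 0 < t - v by rewrite subr_gt0.
have tu : 0 < t - u by lra.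
set a := Num.sqrt (t - v); set b := Num.sqrt (t - u).
have a0 : 0 < a by rewrite sqrtr_gt0.
have b0 : 0 < b by rewrite sqrtr_gt0.
have ab : a <= b by rewrite ler_wsqrtr//; lra.
have E : (b - a) * (b + a) = v - u.
  by rewrite -subr_sqr !sqr_sqrtr ?ltW//; ring.
have h2 : `|a - b| <= (v - u) / a.
  rewrite distrC ger0_norm ?subr_ge0// ler_pdivlMr// -E ler_wpM2l ?subr_ge0//; lra.
apply: (@le_trans _ _ (((v - u) / a) `^ gamma)).
  by apply: ge0_ler_powR; rewrite ?nnegrE ?(ltW gamma0)// divr_ge0 ?ltW.
rewrite powRM ?invr_ge0 ?(ltW vu0) ?(ltW a0)// [leLHS]mulrC.
suff -> : a^-1 `^ gamma = (t - v) `^ (- (gamma / 2)) by [].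
rewrite -(powR_inv1 (ltW a0)) /a -(powR12_sqrt (ltW tv)) -!powRrM.
by congr (_ `^ _); field.
Qed.

Let pE s : 0 <= s <= t -> mild_integrand sigma t x s = pc s.
Proof. by move=> st; exact: (mild_scaledE hgamma sigma_bounded sigma_hoelder). Qed.

Let mpc : measurable_fun setT pc.
Proof. by apply: continuous_measurable_fun; exact: continuous_mild_scaled. Qed.

Lemma mild_left_fderivable : left_fderivable 2^-1 0 t (mild_integrand sigma t x).
Proof.
move=> s st; have := left_fderivable_half hgamma mpc mild_scaled_left st => h.
apply: (eq_integrable _ _ _ _ h) => //.
move=> u; rewrite inE/= in_itv/= => /andP[u0 us]; have /andP[s0 st'] := st.
by rewrite !pE// ?(ltW u0) ?(ltW s0) ?(ltW st')//= ltW// (lt_trans us).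
Qed.

Lemma mild_integrable_left_fderiv :
  mu.-integrable `[0, t] (fun s => (left_fderiv 2^-1 0 (mild_integrand sigma t x) s)%:E).
Proof.
have h := integrable_left_fderiv_half hgamma t0 mpc mild_scaled_bounded mild_scaled_left.
apply: (eq_integrable _ _ _ _ h) => //.
move=> s; rewrite inE/= in_itv/= => st; congr EFin; rewrite /left_fderiv pE//.
congr (_ * (_ + _ * _)); apply: eq_Rintegral => u; rewrite inE/= in_itv/= => /andP[u0 us].
have /andP[s0 st'] := st; by rewrite (pE (s := u))// (ltW u0) (le_trans (ltW us)).
Qed.

End mild_integrand_half.

(** * Equality of integrals from equality on indicators *)

Section laws.
Context {R : realType}.
Notation mu := (@lebesgue_measure R).
Local Open Scope ereal_scope.

Lemma integral_indic_lt (r : R) : (0 <= r)%R ->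
  \int[mu]_t ((0 < t < r)%R%:R : R)%:E = r%:E.
Proof.
move=> r0; transitivity (\int[mu]_t (\1_`]0%R, r[ t)%:E).
  by apply: eq_integral => t _; rewrite indic_itv in_itv.
transitivity (mu `]0%R, r[%classic); first by rewrite integral_indic// setIT.
rewrite lebesgue_measure_itv/= lte_fin.
case: ltP => [_|r1]; first by rewrite oppr0 adde0.
by congr EFin; apply/eqP; rewrite eq_le r0.
Qed.

Section layer_cake.
Context d1 d (T : measurableType d1) (S : measurableType d)
  (m : {sigma_finite_measure set T -> \bar R}).
Variables (X : T -> S) (G : T -> \bar R) (f : S -> R).
Hypotheses (mX : measurable_fun setT X) (mG : measurable_fun setT G)
  (mf : measurable_fun setT f) (G0 : forall w, 0 <= G w) (f0 : forall x, (0 <= f x)%R).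

Lemma layer_cake :
  \int[m]_w (G w * (f (X w))%:E) =
  \int[mu]_t \int[m]_w (G w * (\1_[set x | (0 < t < f x)%R] (X w))%:E).
Proof.
pose F (z : T * R) := G z.1 * ((0 < z.2 < f (X z.1))%R%:R : R)%:E.
have mF : measurable_fun setT F.
  apply: emeasurable_funM; first exact: measurableT_comp.
  apply/measurable_EFinP.
  apply: (@measurableT_comp _ _ _ _ _ _ (fun b : bool => b%:R : R)) => //.
  apply: measurable_and; apply: measurable_fun_ltr => //.
  by apply: (measurableT_comp mf); exact: measurableT_comp.
have F0 z : 0 <= F z by rewrite mule_ge0// lee_fin ler0n.
transitivity (\int[m]_w \int[mu]_t F (w, t)).
  apply: eq_integral => w _; rewrite /F/=.
  rewrite ge0_integralZl//.
  - by rewrite integral_indic_lt.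
  - apply/measurable_EFinP.
    apply: (@measurableT_comp _ _ _ _ _ _ (fun b : bool => b%:R : R)) => //.
    by apply: measurable_and; apply: measurable_fun_ltr.
etransitivity; first exact: (fubini_tonelli (m2 := mu) F mF F0).
apply: eq_integral => t _; apply: eq_integral => w _.
by rewrite /F/= indicE; congr (_ * (nat_of_bool _)%:R%:E); apply/idP/idP; rewrite inE.
Qed.

End layer_cake.

(** The layer cake formula writes a nonnegative function as an integral of indicators. The weights
    [G1] and [G2] make room for a density, or for the remaining factors of a product. *)
Lemma eq_integral_law d1 d2 d (T1 : measurableType d1) (T2 : measurableType d2)
    (S : measurableType d)
    (m1 : {sigma_finite_measure set T1 -> \bar R})
    (m2 : {sigma_finite_measure set T2 -> \bar R})
    (X1 : T1 -> S) (X2 : T2 -> S) (G1 : T1 -> \bar R) (G2 : T2 -> \bar R)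
    (f : S -> R) :
  measurable_fun setT X1 -> measurable_fun setT X2 ->
  measurable_fun setT G1 -> measurable_fun setT G2 ->
  (forall w, 0 <= G1 w) -> (forall w, 0 <= G2 w) ->
  (forall A, measurable A ->
    \int[m1]_w (G1 w * (\1_A (X1 w))%:E) = \int[m2]_w (G2 w * (\1_A (X2 w))%:E)) ->
  measurable_fun setT f -> (forall x, (0 <= f x)%R) ->
  \int[m1]_w (G1 w * (f (X1 w))%:E) = \int[m2]_w (G2 w * (f (X2 w))%:E).
Proof.
move=> mX1 mX2 mG1 mG2 G10 G20 H mf f0.
rewrite layer_cake// layer_cake//; apply: eq_integral => t _; apply: H.
have mb : measurable_fun setT (fun x => (0 < t < f x)%R).
  by apply: measurable_and; apply: measurable_fun_ltr.
have := mb measurableT [set true]; rewrite setTI; exact.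
Qed.

End laws.

(** * Expectations of products of independent variables *)

Section independence.
Context {R : realType} d d' (T : measurableType d) (T' : measurableType d')
  (P : probability T R).
Local Open Scope ereal_scope.
Variable X : nat -> T -> T'.
Hypotheses (mX : forall i, measurable_fun setT (X i)) (iX : mutually_independent P X).

Lemma independent_prod_indic n (A : nat -> set T') : (forall i, measurable (A i)) ->
  \int[P]_w (\prod_(i < n) \1_(A i) (X i w))%R%:E =
  \prod_(i < n) \int[P]_w (\1_(A i) (X i w))%:E.
Proof.
move=> mA; pose J := seq_fset tt (iota 0 n).
have JE i : (i \in J) = (i < n)%N by rewrite seq_fsetE mem_iota add0n.
have mXA i : measurable (X i @^-1` A i) by rewrite -[X in measurable X]setTI; exact: mX.
have intA B : measurable B -> \int[P]_w (\1_B w)%:E = P B.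
  by move=> mB; rewrite integral_indic// setIT.
have Xi i : \int[P]_w (\1_(A i) (X i w))%:E = P (X i @^-1` A i).
  by rewrite -intA//; apply: eq_integral => w _; rewrite !indicE; congr (nat_of_bool _)%:R%:E; apply/idP/idP; rewrite !inE.
under [RHS]eq_bigr do rewrite Xi.
have mcap : measurable (\bigcap_(i in [set` J]) (X i @^-1` A i)).
  exact: fin_bigcap_measurable.
transitivity (P (\bigcap_(i in [set` J]) (X i @^-1` A i))).
  rewrite -intA//; apply: eq_integral => w _; congr EFin.
  rewrite indicE; case: (boolP (w \in _)) => [|wn].
    rewrite inE => wJ; rewrite big1// => i _.
    by rewrite indicE mem_set//; apply: wJ; rewrite /= JE.
  apply/eqP/prodf_eq0.
  have : exists2 i, (i < n)%N & ~ A i (X i w).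
    apply: contrapT => h; move: wn; rewrite notin_setE; apply => i; rewrite /= JE => ilt.
    by apply: contrapT => ?; apply: h; exists i.
  move=> [i ilt nA]; exists (Ordinal ilt) => //=.
  by rewrite indicE memNset.
rewrite iX//.
have pJ : perm_eq J (iota 0 n).
  by apply: uniq_perm; [exact: fset_uniq|exact: iota_uniq|move=> i; rewrite JE mem_iota add0n].
by rewrite (perm_big _ pJ)/= -(big_mkord xpredT (fun i => P (X i @^-1` A i))) /index_iota subn0.
Qed.

Lemma expectation_prod n (f : nat -> T' -> R) :
  (forall i, measurable_fun setT (f i)) -> (forall i x, (0 <= f i x)%R) ->
  \int[P]_w (\prod_(i < n) f i (X i w))%R%:E =
  \prod_(i < n) \int[P]_w (f i (X i w))%:E.
Proof.
move=> mf f0.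
(* Induction on the number [j] of leading factors that are arbitrary, the others being indicators.
   Each step frees one more factor by [eq_integral_law], with the remaining factors as weight. *)
suff H (j : nat) : forall f : nat -> T' -> R, (forall i, measurable_fun setT (f i)) ->
    (forall i x, (0 <= f i x)%R) ->
    (forall i, (j <= i < n)%N -> exists2 A, measurable A & f i = \1_A) ->
    \int[P]_w (\prod_(i < n) f i (X i w))%R%:E =
    \prod_(i < n) \int[P]_w (f i (X i w))%:E.
  by apply: (H n) => // i /andP[ni]; rewrite ltnNge ni.
elim: j => [|j IH] {mf f0}f mf f0 fA.
  (* A set is extracted for the indices below [n], where the hypothesis yields one; the others get
     the empty set, so that all are measurable. *)
  pose A i := if (i < n)%N =P true is ReflectT h then
    projT1 (cid2 (fA i h)) else set0.
  have AP i : (i < n)%N -> measurable (A i) /\ f i = \1_(A i).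
    by rewrite /A => ilt; case: eqP => // h; case: cid2.
  have mA i : measurable (A i).
    have [/AP[]//|ni] := boolP (i < n)%N.
    by rewrite /A; case: eqP => // h; rewrite h in ni.
  have := independent_prod_indic n mA.
  under [in RHS]eq_bigr => i _.
    have [_ e] := AP i (ltn_ord i).
    rewrite -e; over.
  move=> <-; apply: eq_integral => w _; congr EFin; apply: eq_bigr => i _.
  by have [_ ->] := AP i (ltn_ord i).
have [jn|nj] := ltnP j n; last first.
  by apply: IH => // i /andP[ji ilt]; move: (leq_ltn_trans nj (leq_ltn_trans ji ilt)); rewrite ltnn.
pose jo := Ordinal jn.
pose G w := (\prod_(i < n | i != jo) f i (X i w))%R%:E.
pose c := \prod_(i < n | i != jo) \int[P]_w (f i (X i w))%:E.
have c0 : 0 <= c by apply: prode_ge0 => i _; apply: integral_ge0 => w _; rewrite lee_fin.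
have mG : measurable_fun setT G.
  apply/measurable_EFinP; under eq_fun do rewrite big_mkcond.
  apply: measurable_prod => i _; case: (i != jo) => //.
  exact: (measurableT_comp (mf i) (mX i)).
have G0 w : 0 <= G w by rewrite lee_fin prodr_ge0.
rewrite [RHS](bigD1 jo)//= -/c muleC.
transitivity (\int[P]_w (G w * (f j (X j w))%:E)).
  by apply: eq_integral => w _; rewrite (bigD1 jo)//= -EFinM mulrC.
rewrite -ge0_integralZl//; last first.
- by move=> w _; rewrite lee_fin.
- by apply/measurable_EFinP; exact: measurableT_comp.
apply: eq_integral_law => // A mA.
rewrite ge0_integralZl//; last first.
- by apply/measurable_EFinP; apply: measurableT_comp => //; exact: measurable_indic.
pose f' i := if i == j then \1_A else f i.
have mf' i : measurable_fun setT (f' i) by rewrite /f'; case: eqP.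
have f'0 i x : (0 <= f' i x)%R by rewrite /f'; case: eqP.
have f'j : f' j = \1_A by rewrite /f' eqxx.
have f'i (i : 'I_n) : i != jo -> f' i = f i.
  by move=> ij; rewrite /f' ifF//; apply: contraNF ij => /eqP ij; apply/eqP/val_inj.
have f'A i : (j <= i < n)%N -> exists2 A, measurable A & f' i = \1_A.
  move=> /andP[]; rewrite leq_eqVlt => /predU1P[<-|ji] ilt; first by exists A.
  by rewrite /f' gtn_eqF//; apply: fA; rewrite ji.
have E1 := IH f' mf' f'0 f'A.
have E2 : \prod_(i < n) \int[P]_w (f' i (X i w))%:E = \int[P]_w (\1_A (X j w))%:E * c.
  rewrite (bigD1 jo)//= f'j; congr (_ * _); apply: eq_bigr => i ij.
  by rewrite f'i.
rewrite muleC -E2 -E1; apply: eq_integral => w _.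
rewrite (bigD1 jo)//= f'j -EFinM mulrC; congr (_ * _)%:E.
by apply: eq_bigr => i ij; rewrite f'i.
Qed.

End independence.

(** * Exponential and absolute moments of a normal law *)

Section normal_law.
Context {R : realType} d (T : measurableType d) (P : probability T R).
Notation mu := (@lebesgue_measure R).
Implicit Types (X : T -> R) (m s l : R).

Lemma integral_normal_law X m s (f : R -> R) : measurable_fun setT X ->
  (forall A : set R, measurable A -> P (X @^-1` A) = normal_prob m s A) ->
  measurable_fun setT f -> (forall x, 0 <= f x) ->
  (\int[P]_w (f (X w))%:E = \int[mu]_x (normal_pdf m s x * f x)%:E)%E.
Proof.
move=> mX XP mf f0.
transitivity (\int[P]_w (1%:E * (f (X w))%:E))%E.
  by apply: eq_integral => w _; rewrite mul1e.
transitivity (\int[mu]_x ((normal_pdf m s x)%:E * (f x)%:E))%E; last first.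
  by apply: eq_integral => x _.
have eql := @eq_integral_law R _ _ _ _ _ _ P mu X id (fun _ => 1%:E) (fun x => (normal_pdf m s x)%:E) f.
apply: eql => //.
- by apply/measurable_EFinP; exact: measurable_normal_pdf.
- by move=> w; rewrite lee_fin normal_pdf_ge0.
- move=> A mA; transitivity (P (X @^-1` A)).
    have mXA : measurable (X @^-1` A) by rewrite -[X in measurable X]setTI; exact: mX.
    rewrite -[X in P X]setIT -integral_indic//; apply: eq_integral => w _.
    by rewrite mul1e !indicE; congr (nat_of_bool _)%:R%:E; apply/idP/idP; rewrite !inE.
  rewrite XP// /normal_prob integral_EFin_indic.
  by apply: eq_integral => x _.
Qed.

Lemma normal_mgf X m s l : 0 < s -> measurable_fun setT X ->
  (forall A : set R, measurable A -> P (X @^-1` A) = normal_prob m s A) ->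
  (\int[P]_w (expR (l * X w))%:E = (expR (l * m + l ^+ 2 * s ^+ 2 / 2))%:E)%E.
Proof.
move=> s0 mX XP.
rewrite (@integral_normal_law X m s (fun x => expR (l * x)))//; last first.
  by apply: measurableT_comp => //; exact: measurable_funM.
rewrite (@integral_EFinZ _ (expR (l * m + l ^+ 2 * s ^+ 2 / 2)) (normal_pdf (m + l * s ^+ 2) s)).
- by rewrite integral_normal_pdf mule1.
- exact: expR_ge0.
- exact: measurable_normal_pdf.
- by move=> x; exact: normal_pdf_ge0.
- move=> x; rewrite !normal_pdfE ?gt_eqF// /normal_fun -[LHS]mulrA [RHS]mulrCA; congr (_ * _).
  rewrite -!expRD; congr expR; field.
  by rewrite gt_eqF.
Qed.

(** The density is at most its peak, and 2 pi >= 4 then gives an interval of length [s] a mass of at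
    most 1/2. So with probability at least 1/2 the variable exceeds s / 2 in absolute value,
    wherever its mean is. This is how a moment bound will control the variance. *)
Lemma normal_absolute_moment_ge X m s (alpha : R) : 0 < alpha -> 0 < s -> measurable_fun setT X ->
  (forall A : set R, measurable A -> P (X @^-1` A) = normal_prob m s A) ->
  (((s / 2) `^ alpha / 2)%:E <= \int[P]_w (`|X w| `^ alpha)%:E)%E.
Proof.
move=> a0 s0 mX XP.
pose I : set R := [set` `[- (s / 2), s / 2]].
have s2 : 0 < s / 2 by rewrite divr_gt0.
have mXI : measurable (X @^-1` I).
  by rewrite -[X in measurable X]setTI; apply: mX => //; exact: measurable_itv.
have PI : (P (X @^-1` I) <= (2^-1)%:E)%E.
  rewrite XP//; last exact: measurable_itv.
  rewrite /normal_prob.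
  apply: (@le_trans _ _ (\int[mu]_(x in I) (normal_peak s)%:E)%E).
    apply: ge0_le_integral => //.
    - exact: measurable_itv.
    - by move=> x _; rewrite lee_fin normal_pdf_ge0.
    - by apply/measurable_EFinP; apply: measurable_funTS; exact: measurable_normal_pdf.
    - by move=> x _; rewrite lee_fin normal_pdf_ub// gt_eqF.
  rewrite integral_cst; last exact: measurable_itv.
  have muI : mu I = s%:E.
    rewrite /I lebesgue_measure_itv/= lte_fin (_ : - (s / 2) < s / 2); last by lra.
    by rewrite -EFinD opprK -splitr.
  rewrite [X in (_ * X)%E](_ : _ = s%:E); last exact: muI.
  rewrite -EFinM lee_fin /normal_peak -mulrnAr sqrtrM ?sqr_ge0// sqrtr_sqr gtr0_norm//.
  rewrite invfM mulrAC mulVf ?gt_eqF// mul1r.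
  have pp : 4 <= pi *+ 2 :> R by have := pi_ge2 R; lra.
  rewrite lef_pV2 ?posrE ?sqrtr_gt0//; last by apply: lt_le_trans pp.
  by rewrite -[leLHS]ger0_norm// -sqrtr_sqr ler_sqrt; lra.
have PC : ((2^-1)%:E <= P (~` (X @^-1` I)))%E.
  rewrite probability_setC//; have := PI.
  rewrite -[P _]fineK ?fin_num_measure// -EFinB !lee_fin; lra.
apply: (@le_trans _ _ (((s / 2) `^ alpha)%:E * P (~` (X @^-1` I)))%E).
  by rewrite EFinM lee_wpmul2l// lee_fin powR_ge0.
rewrite -integral_cst//; last exact: measurableC.
apply: (@le_trans _ _ (\int[P]_(w in ~` (X @^-1` I)) (`|X w| `^ alpha)%:E)%E).
  apply: ge0_le_integral => //.
  - exact: measurableC.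
  - by move=> w _; rewrite lee_fin powR_ge0.
  - apply/measurable_EFinP; apply: measurable_funTS.
    by apply: (measurableT_comp (@measurable_powR _ _)); exact: measurableT_comp.
  - move=> w; rewrite /I/= in_itv/= => /negP; rewrite negb_and -!ltNge => wI.
    rewrite lee_fin; apply: ge0_ler_powR; rewrite ?nnegrE// ?(ltW a0)//; first exact: ltW.
    have [X0|X0] := ltP (X w) 0; first by rewrite ltr0_norm//; move/orP: wI => [?|?]; lra.
    by rewrite ger0_norm//; move/orP: wI => [?|?]; lra.
apply: ge0_subset_integral => //.
- exact: measurableC.
- apply/measurable_EFinP.
  by apply: (measurableT_comp (@measurable_powR _ _)); exact: measurableT_comp.
Qed.

End normal_law.

(** Half the square of 32, the bound found in [complex_gaussian_mgf] for the standard deviation of a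
    combination with a^2 + b^2 = 1. Only its finiteness matters later. *)
Definition gaussian_rate {R : realType} : R := 32 ^+ 2 / 2.

Lemma gaussian_rate_ge0 {R : realType} : 0 <= gaussian_rate :> R.
Proof. by rewrite divr_ge0// exprn_ge0. Qed.

(** * Linear forms in the parts of a rotationally invariant Gaussian variable *)

Section complex_gaussian_law.
Context {R : realType} d (T : measurableType d) (P : probability T R).
Variables (g : T -> R[i]) (alpha : R).
Hypotheses (alpha12 : 1 < alpha < 2) (grv : complex_rv g) (gG : complex_gaussian P g)
  (gR : rotationally_invariant P g)
  (gM : (\int[P]_w (`|complex.Re (g w)| `^ alpha)%:E = 1)%E).

Lemma measurable_Re : measurable_fun setT (fun w => complex.Re (g w)).
Proof. exact: (measurableT_comp (@measurable_fst _ _ _ _) grv). Qed.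

Lemma measurable_Im : measurable_fun setT (fun w => complex.Im (g w)).
Proof. exact: (measurableT_comp (@measurable_snd _ _ _ _) grv). Qed.

Lemma integral_rotation (theta : R) (f : R * R -> R) : measurable_fun setT f ->
  (forall z, 0 <= f z) ->
  (\int[P]_w (f (RtoR2 (cis theta * g w)))%:E = \int[P]_w (f (RtoR2 (g w)))%:E)%E.
Proof.
move=> mf f0.
have mrot : measurable_fun setT (fun w => RtoR2 (cis theta * g w)).
  rewrite [X in measurable_fun _ X](_ : _ = fun w =>
    (cos theta * complex.Re (g w) - sin theta * complex.Im (g w),
     cos theta * complex.Im (g w) + sin theta * complex.Re (g w))); last first.
    by apply/funext => w; rewrite /RtoR2 /cis; case: (g w).
  apply/measurable_fun_pairP; split => /=.
    apply: measurable_funB; apply: measurable_funM => //.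
      exact: measurable_Re.
    exact: measurable_Im.
  apply: measurable_funD; apply: measurable_funM => //.
    exact: measurable_Im.
  exact: measurable_Re.
have intA (Y : T -> R * R) A : measurable_fun setT Y -> measurable A ->
    (\int[P]_w (1%:E * (\1_A (Y w))%:E) = P (Y @^-1` A))%E.
  move=> mY mA.
  have mYA : measurable (Y @^-1` A) by rewrite -[X in measurable X]setTI; exact: mY.
  rewrite -[X in P X]setIT -integral_indic//; apply: eq_integral => w _.
  by rewrite mul1e !indicE; congr (nat_of_bool _)%:R%:E; apply/idP/idP; rewrite !inE.
have eql := @eq_integral_law R _ _ _ _ _ _ P P (fun w => RtoR2 (cis theta * g w))
   (fun w => RtoR2 (g w)) (fun _ => 1%:E) (fun _ => 1%:E) f.
transitivity (\int[P]_w (1%:E * (f (RtoR2 (cis theta * g w)))%:E))%E.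
  by apply: eq_integral => w _; rewrite mul1e.
rewrite eql//; first by apply: eq_integral => w _; rewrite mul1e.
by move=> A mA; rewrite !intA// gR.
Qed.

Lemma measurable_linear_R2 (a b : R) : measurable_fun setT (fun z : R * R => a * z.1 + b * z.2).
Proof.
by apply: measurable_funD; apply: measurable_funM => //.
Qed.

(** Rotation by pi changes the sign. This symmetry is what centres the linear combinations. *)
Lemma integral_opp_rotation (a b : R) (f : R -> R) : measurable_fun setT f -> (forall x, 0 <= f x) ->
  (\int[P]_w (f (- (a * complex.Re (g w) + b * complex.Im (g w))))%:E =
   \int[P]_w (f (a * complex.Re (g w) + b * complex.Im (g w)))%:E)%E.
Proof.
move=> mf f0.
have mfl := measurableT_comp mf (measurable_linear_R2 a b).
have E := @integral_rotation pi _ mfl (fun z => f0 _).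
transitivity (\int[P]_w (f (a * (RtoR2 (cis pi * g w)).1 + b * (RtoR2 (cis pi * g w)).2))%:E)%E; last exact: E.
apply: eq_integral => w _; congr (f _)%:E; rewrite /RtoR2 /cis cospi sinpi.
by case: (g w) => x y /=; ring.
Qed.

(** A quarter turn replaces the real part by minus the imaginary part. *)
Lemma integral_Im_moment : (\int[P]_w (`|complex.Im (g w)| `^ alpha)%:E = 1)%E.
Proof.
rewrite -gM.
have mf : measurable_fun setT (fun z : R * R => `|z.1| `^ alpha).
  by apply: (measurableT_comp (@measurable_powR _ _)); exact: measurableT_comp.
have E := @integral_rotation (pi / 2) (fun z => `|z.1| `^ alpha) mf (fun z => powR_ge0 _ _).
transitivity (\int[P]_w (`|(RtoR2 (cis (pi / 2) * g w)).1| `^ alpha)%:E)%E; last exact: E.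
apply: eq_integral => w _; congr (_ `^ _)%:E; rewrite /RtoR2 /cis cos_pihalf sin_pihalf.
by case: (g w) => x y /=; rewrite mul0r sub0r mul1r normrN.
Qed.

(** Pointwise |a x + b y| is at most 2 rho max(|x|, |y|), and 2^alpha <= 4. The power of the maximum
    is at most the sum of the powers, and each of the two moments is 1. *)
Lemma complex_gaussian_moment_le (a b rho : R) : `|a| <= rho -> `|b| <= rho ->
  (\int[P]_w (`|a * complex.Re (g w) + b * complex.Im (g w)| `^ alpha)%:E <=
    (8 * rho `^ alpha)%:E)%E.
Proof.
move=> ar br; have rho0 : 0 <= rho by exact: le_trans ar.
have [a1 a2] : 1 < alpha /\ alpha < 2 by apply/andP.
have a0 : 0 <= alpha by lra.
have mp (h : T -> R) : measurable_fun setT h -> measurable_fun setT (fun w => `|h w| `^ alpha).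
  by move=> mh; apply: (measurableT_comp (@measurable_powR _ _)); exact: measurableT_comp.
have -> : (8 * rho `^ alpha)%:E = ((4 * rho `^ alpha)%:E *
    (\int[P]_w (`|complex.Re (g w)| `^ alpha + `|complex.Im (g w)| `^ alpha)%:E))%E.
  under eq_integral do rewrite EFinD.
  rewrite ge0_integralD//; last 2 first.
  - by apply/measurable_EFinP; apply: mp; exact: measurable_Re.
  - by apply/measurable_EFinP; apply: mp; exact: measurable_Im.
  by rewrite gM integral_Im_moment -EFinD -EFinM; congr EFin; ring.
rewrite -ge0_integralZl_EFin//; last 2 first.
- apply/measurable_EFinP; apply: measurable_funD; apply: mp.
    exact: measurable_Re.
  exact: measurable_Im.
- by rewrite mulr_ge0 ?powR_ge0.
apply: ge0_le_integral => //.
- apply/measurable_EFinP; apply: mp.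
  exact: (measurableT_comp (measurable_linear_R2 a b) grv).
- apply: measurable_funeM; apply/measurable_EFinP; apply: measurable_funD; apply: mp.
    exact: measurable_Re.
  exact: measurable_Im.
- move=> w _; rewrite -EFinM lee_fin.
  set x := complex.Re _; set y := complex.Im _.
  have step (m : R) : `|x| <= m -> `|y| <= m ->
      `|a * x + b * y| `^ alpha <= 4 * rho `^ alpha * m `^ alpha.
    move=> xm ym; have m0 : 0 <= m by exact: le_trans xm.
    have h1 : `|a * x + b * y| <= 2 * (rho * m).
      apply: (le_trans (ler_normD _ _)); rewrite !normrM mulr2n mulrDl !mul1r.
      by apply: lerD; apply: ler_pM.
    apply: (@le_trans _ _ ((2 * (rho * m)) `^ alpha)).
      by apply: ge0_ler_powR; rewrite ?nnegrE// !mulr_ge0.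
    rewrite powRM ?mulr_ge0// powRM// -mulrA ler_wpM2r ?mulr_ge0 ?powR_ge0//.
    apply: (@le_trans _ _ (2 `^ 2%:R)); first by apply: ler_powR; lra.
    by rewrite powR_mulrn//; lra.
  have c0 : 0 <= 4 * rho `^ alpha by rewrite mulr_ge0 ?powR_ge0.
  have [xy|yx] := leP `|x| `|y|.
    apply: (le_trans (step _ xy (lexx _))).
    by rewrite ler_wpM2l// lerDr powR_ge0.
  apply: (le_trans (step _ (lexx _) (ltW yx))).
  by rewrite ler_wpM2l// lerDl powR_ge0.
Qed.

(** Symmetry forces the mean to be 0, in the degenerate case too, by comparing the exponential
    moments at 1 and -1. The variance is controlled by confronting the lower and the upper bound for
    the moment of order alpha. *)
Lemma complex_gaussian_mgf (a b : R) :
  (\int[P]_w (expR (a * complex.Re (g w) + b * complex.Im (g w)))%:E <=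
    (expR (gaussian_rate * (a ^+ 2 + b ^+ 2)))%:E)%E.
Proof.
have [a1 a2] : 1 < alpha /\ alpha < 2 by apply/andP.
pose Y w := a * complex.Re (g w) + b * complex.Im (g w).
have mY : measurable_fun setT Y by exact: (measurableT_comp (measurable_linear_R2 a b) grv).
have symY := @integral_opp_rotation a b expR (@measurable_expR R) (@expR_ge0 R).
have rhs1 : (1 <= (expR (gaussian_rate * (a ^+ 2 + b ^+ 2)))%:E)%E.
  by rewrite lee_fin -[X in X <= _]expR0 ler_expR mulr_ge0 ?gaussian_rate_ge0// addr_ge0 ?sqr_ge0.
have [m [Ym|[s s0 Ys]]] := gG a b.
  have E1 : (\int[P]_w (expR (Y w))%:E = (expR m)%:E)%E.
    rewrite (ae_eq_integral (fun _ => (expR m)%:E))//.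
    - by rewrite integral_cst// [X in (_ * X)%E](_ : _ = 1%E) ?mule1//; exact: probability_setT.
    - by apply/measurable_EFinP; exact: measurableT_comp.
    - by apply: filterS Ym => w Yw _; rewrite /Y Yw.
  have E2 : (\int[P]_w (expR (- Y w))%:E = (expR (- m))%:E)%E.
    rewrite (ae_eq_integral (fun _ => (expR (- m))%:E))//.
    - by rewrite integral_cst// [X in (_ * X)%E](_ : _ = 1%E) ?mule1//; exact: probability_setT.
    - by apply/measurable_EFinP; apply: measurableT_comp => //; exact: measurableT_comp.
    - by apply: filterS Ym => w Yw _; rewrite /Y Yw.
  have m0 : m = 0.
    move: symY; rewrite -/Y E1 E2 => -[] /expR_inj; lra.
  by rewrite -/Y E1 m0 expR0.
have mgf l := normal_mgf l s0 mY Ys.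
have m0 : m = 0.
  have h1 := mgf 1; have h2 := mgf (- 1).
  move: symY; rewrite -/Y.
  rewrite (_ : (\int[P]_w (expR (- Y w))%:E = \int[P]_w (expR (- 1 * Y w))%:E)%E); last first.
    by apply: eq_integral => w _; rewrite mulN1r.
  rewrite (_ : (\int[P]_w (expR (Y w))%:E = \int[P]_w (expR (1 * Y w))%:E)%E); last first.
    by apply: eq_integral => w _; rewrite mul1r.
  by rewrite h1 h2 => -[] /expR_inj; lra.
have E : (\int[P]_w (expR (Y w))%:E = (expR (s ^+ 2 / 2))%:E)%E.
  transitivity (\int[P]_w (expR (1 * Y w))%:E)%E.
    by apply: eq_integral => w _; rewrite mul1r.
  by rewrite mgf m0; congr (expR _)%:E; ring.
rewrite -/Y E lee_fin ler_expR.
pose rho := Num.sqrt (a ^+ 2 + b ^+ 2).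
have ab0 : 0 <= a ^+ 2 + b ^+ 2 by rewrite addr_ge0 ?sqr_ge0.
have rho2 : rho ^+ 2 = a ^+ 2 + b ^+ 2 by rewrite sqr_sqrtr.
have rho0 : 0 <= rho by rewrite sqrtr_ge0.
have ar : `|a| <= rho by rewrite -sqrtr_sqr ler_sqrt// lerDl sqr_ge0.
have br : `|b| <= rho by rewrite -sqrtr_sqr ler_sqrt// lerDr sqr_ge0.
have := le_trans (normal_absolute_moment_ge (lt_trans ltr01 a1) s0 mY Ys) (complex_gaussian_moment_le ar br).
rewrite lee_fin => mom.
(* The two moment bounds give (s / 2)^alpha <= 16 rho^alpha, and 16 <= 16^alpha because alpha >
   1. *)
have sr : s <= 32 * rho.
  rewrite leNgt; apply/negP => sr.
  have s16 : 16 * rho < s / 2 by lra.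
  have : (s / 2) `^ alpha <= 16 * rho `^ alpha by lra.
  apply/negP; rewrite -ltNge.
  apply: (@le_lt_trans _ _ ((16 * rho) `^ alpha)).
    rewrite powRM// ler_wpM2r ?powR_ge0//.
    by apply: le1r_powR; lra.
  by apply: gt0_ltr_powR; rewrite ?nnegrE; lra.
have s2 : s ^+ 2 <= (32 * rho) ^+ 2.
  by rewrite lerXn2r// ?nnegrE ?(ltW s0)// mulr_ge0.
rewrite -rho2 /gaussian_rate [leRHS]mulrAC -exprMn.
by apply: ler_wpM2r.
Qed.

End complex_gaussian_law.

(** * Moments of sums of independent Gaussian terms *)

Section gaussian_sums.
Context {R : realType} d (T : measurableType d) (P : probability T R).
Variables (g : nat -> T -> R[i]) (alpha : R).
Hypotheses (alpha12 : 1 < alpha < 2) (grv : forall k, complex_rv (g k))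
  (gI : mutually_independent P (fun k w => RtoR2 (g k w)))
  (gG : forall k, complex_gaussian P (g k))
  (gR : forall k, rotationally_invariant P (g k))
  (gM : forall k, (\int[P]_w (`|complex.Re (g k w)| `^ alpha)%:E = 1)%E).

Definition gaussian_sum (a b : nat -> R) (n : nat) (w : T) : R :=
  \sum_(k < n) (a k * complex.Re (g k w) + b k * complex.Im (g k w)).

Lemma measurable_gaussian_sum a b n : measurable_fun setT (gaussian_sum a b n).
Proof.
apply: measurable_sum => k.
exact: (measurableT_comp (measurable_linear_R2 (a k) (b k)) (grv k)).
Qed.

Lemma gaussian_sum_mgf a b n :
  (\int[P]_w (expR (gaussian_sum a b n w))%:E <=
    (expR (gaussian_rate * \sum_(k < n) (a k ^+ 2 + b k ^+ 2)))%:E)%E.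
Proof.
have mX i : measurable_fun setT (fun w => RtoR2 (g i w)) by exact: grv.
have me i : measurable_fun setT (fun z : R * R => expR (a i * z.1 + b i * z.2)).
  by apply: measurableT_comp => //; exact: measurable_linear_R2.
have := expectation_prod mX gI n me (fun i z => expR_ge0 _).
have -> : (\int[P]_w (\prod_(i < n) expR (a i * (RtoR2 (g i w)).1 + b i * (RtoR2 (g i w)).2))%R%:E =
   \int[P]_w (expR (gaussian_sum a b n w))%:E)%E.
  by apply: eq_integral => w _; rewrite /gaussian_sum expR_sum.
move=> ->; rewrite mulr_sumr expR_sum -prodEFin.
pose K (x y : \bar R) := (0 <= x)%E /\ (x <= y)%E.
suff : K (\prod_(i < n) \int[P]_w (expR (a i * (RtoR2 (g i w)).1 + b i * (RtoR2 (g i w)).2))%:E)%E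
  (\prod_(i < n) (expR (gaussian_rate * (a i ^+ 2 + b i ^+ 2)))%:E)%E by case.
apply: (big_ind2 K).
- by split.
- move=> x1 x2 y1 y2 [x10 x12] [y10 y12]; split; first exact: mule_ge0.
  exact: lee_pmul.
- move=> i _; split; first by apply: integral_ge0 => w _; rewrite lee_fin expR_ge0.
  exact: (complex_gaussian_mgf alpha12 (grv i) (gG i) (gR i) (gM i)).
Qed.

(** With k = 2 m, the inequality |x| / k <= exp(|x| / k) is raised to the power k. *)
Lemma exprn_le_expR (m : nat) (x : R) : (0 < m)%N ->
  x ^+ m.*2 <= m.*2%:R ^+ m.*2 * (expR x + expR (- x)).
Proof.
move=> m0; have k0 : 0 < m.*2%:R :> R by rewrite ltr0n double_gt0.
have -> : x ^+ m.*2 = `|x| ^+ m.*2 by rewrite -normrX ger0_norm// exprn_even_ge0// odd_double.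
apply: (@le_trans _ _ (m.*2%:R ^+ m.*2 * expR `|x|)).
  have -> : `|x| = m.*2%:R * (`|x| / m.*2%:R) by rewrite mulrC divfK// gt_eqF.
  rewrite exprMn ler_wpM2l ?exprn_ge0 ?(ltW k0)//.
  rewrite expRM_natl lerXn2r// ?nnegrE ?expR_ge0 ?divr_ge0 ?(ltW k0)//.
  by apply: le_trans (expR_ge1Dx _); rewrite lerDr.
rewrite ler_wpM2l ?exprn_ge0 ?(ltW k0)//.
have [x0|x0] := leP 0 x; first by rewrite ger0_norm// lerDl expR_ge0.
by rewrite ltr0_norm// lerDr expR_ge0.
Qed.

Definition gaussian_moment (m : nat) : R := m.*2%:R ^+ m.*2 * (2 * expR gaussian_rate).

Lemma gaussian_moment_ge0 m : 0 <= gaussian_moment m.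
Proof. by rewrite mulr_ge0 ?exprn_ge0// mulr_ge0 ?expR_ge0. Qed.

(** After division by the square root of [V] the exponential moments at 1 and -1 are bounded by a
    constant, and they bound the even moments. If V = 0 all coefficients vanish. *)
Lemma gaussian_sum_moment a b n m : (0 < m)%N ->
  (\int[P]_w (gaussian_sum a b n w ^+ m.*2)%:E <=
    (gaussian_moment m * (\sum_(k < n) (a k ^+ 2 + b k ^+ 2)) ^+ m)%:E)%E.
Proof.
move=> m0; set V := \sum_(k < n) _.
have V0 : 0 <= V by apply: sumr_ge0 => k _; rewrite addr_ge0 ?sqr_ge0.
have mS a' b' := measurable_gaussian_sum a' b' n.
have [Vz|Vnz] := eqVneq V 0.
  have Sz w : gaussian_sum a b n w = 0.
    apply: big1 => k _.
    have : a k ^+ 2 + b k ^+ 2 = 0.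
      move/eqP : Vz; rewrite psumr_eq0; last by move=> i _; rewrite addr_ge0 ?sqr_ge0.
      by move/allP => /(_ k); rewrite mem_index_enum => /(_ isT)/eqP.
    move/eqP; rewrite paddr_eq0 ?sqr_ge0// !sqrf_eq0 => /andP[/eqP -> /eqP ->].
    by rewrite !mul0r addr0.
  under eq_integral do rewrite Sz expr0n double_eq0 gtn_eqF//.
  by rewrite integral0 Vz expr0n gtn_eqF// mulr0.
have Vp : 0 < V by rewrite lt_def Vnz.
pose c := (Num.sqrt V)^-1.
have c2 : c ^+ 2 = V^-1 by rewrite exprVn sqr_sqrtr.
pose sc (e : R) (f : nat -> R) k := e * c * f k.
have scE e w : gaussian_sum (sc e a) (sc e b) n w = e * c * gaussian_sum a b n w.
  by rewrite /gaussian_sum mulr_sumr; apply: eq_bigr => k _; rewrite /sc; ring.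
have mgf e : e ^+ 2 = 1 ->
    (\int[P]_w (expR (e * c * gaussian_sum a b n w))%:E <= (expR gaussian_rate)%:E)%E.
  move=> e2; have := gaussian_sum_mgf (sc e a) (sc e b) n.
  have -> : \sum_(k < n) (sc e a k ^+ 2 + sc e b k ^+ 2) = 1.
    transitivity (c ^+ 2 * V); last by rewrite c2 mulVf.
    rewrite /V mulr_sumr; apply: eq_bigr => k _.
    by rewrite /sc !exprMn e2 mul1r mulrDr.
  rewrite mulr1; apply: le_trans.
  by rewrite le_eqVlt; apply/orP; left; apply/eqP; apply: eq_integral => w _; rewrite scE.
have me e : measurable_fun setT (fun w => expR (e * c * gaussian_sum a b n w)).
  by apply: measurableT_comp => //; exact: measurable_funM.
apply: (@le_trans _ _ ((V ^+ m * m.*2%:R ^+ m.*2)%:E *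
   (\int[P]_w (expR (1 * c * gaussian_sum a b n w))%:E +
    \int[P]_w (expR (- 1 * c * gaussian_sum a b n w))%:E))%E); last first.
  have -> : (gaussian_moment m * V ^+ m)%:E =
     ((V ^+ m * m.*2%:R ^+ m.*2)%:E * ((expR gaussian_rate)%:E + (expR gaussian_rate)%:E))%E.
    by rewrite -EFinD -EFinM /gaussian_moment; congr EFin; ring.
  apply: lee_wpmul2l; first by rewrite lee_fin mulr_ge0 ?exprn_ge0.
  by apply: leeD; apply: mgf; rewrite ?sqrrN expr1n.
rewrite -ge0_integralD//; last 2 first.
- by apply/measurable_EFinP; exact: me.
- by apply/measurable_EFinP; exact: me.
rewrite -ge0_integralZl_EFin//; last 2 first.
- by apply: emeasurable_funD; apply/measurable_EFinP; exact: me.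
- by rewrite mulr_ge0 ?exprn_ge0.
apply: ge0_le_integral => //.
- by move=> w _; rewrite lee_fin exprn_even_ge0// odd_double.
- by apply/measurable_EFinP; apply: measurable_funX.
- apply: measurable_funeM; apply: emeasurable_funD; apply/measurable_EFinP; exact: me.
- move=> w _; rewrite -EFinD -EFinM lee_fin -[leRHS]mulrA.
  have cE : c ^+ m.*2 = (V ^+ m)^-1 by rewrite -mul2n exprM c2 exprVn.
  have -> : gaussian_sum a b n w ^+ m.*2 = V ^+ m * (1 * c * gaussian_sum a b n w) ^+ m.*2.
    by rewrite mul1r exprMn cE mulrA divff ?mul1r// expf_neq0.
  rewrite ler_wpM2l ?exprn_ge0//.
  by apply: (le_trans (exprn_le_expR _ m0)); rewrite !mulNr.
- by move=> w _; rewrite -EFinD lee_fin addr_ge0 ?expR_ge0.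
Qed.

End gaussian_sums.

(** * Moricz's maximal inequality for even moments *)

Section moricz.
Context {R : realType} d (T : measurableType d) (P : {measure set T -> \bar R}).
Variables (X : nat -> T -> R) (u : nat -> R) (m : nat) (C : R).
Hypotheses (mX : forall k, measurable_fun setT (X k)) (u0 : forall k, 0 <= u k)
  (m2 : (2 <= m)%N) (C0 : 0 <= C).

Definition block_sum (i j : nat) (w : T) : R := \sum_(i <= k < j) X k w.

Definition block_max (i j : nat) (w : T) : R :=
  \big[Num.max/0]_(i <= k < j.+1) `|block_sum i k w|.

Lemma measurable_block_sum i j : measurable_fun setT (block_sum i j).
Proof. exact: measurable_sum. Qed.

Lemma block_max_ge0 i j w : 0 <= block_max i j w.
Proof. by apply: bigmax_ge_id. Qed.

Lemma le_block_max i j k w : (i <= k <= j)%N -> `|block_sum i k w| <= block_max i j w.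
Proof.
move=> /andP[ik kj]; rewrite /block_max.
have : k \in index_iota i j.+1 by rewrite mem_index_iota ik ltnS.
elim: (index_iota i j.+1) => // l s IH; rewrite inE big_cons le_max => /predU1P[->|/IH ->].
  by rewrite lexx.
by rewrite orbT.
Qed.

Lemma block_max_le i j w (x : R) : 0 <= x -> (forall k, (i <= k <= j)%N -> `|block_sum i k w| <= x) ->
  block_max i j w <= x.
Proof.
move=> x0 h; rewrite /block_max big_nat; elim/big_rec : _ => // k y /andP[ik kj] yx.
by rewrite ge_max yx andbT; apply: h; rewrite ik.
Qed.

Lemma measurable_block_max i j : measurable_fun setT (block_max i j).
Proof.
rewrite /block_max; elim: (index_iota i j.+1) => [|k s IH].
  by rewrite (_ : (fun w => _) = cst 0)//; apply/funext => w; rewrite big_nil.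
rewrite (_ : (fun w => _) = (fun w => Num.max `|block_sum i k w| (\big[Num.max/0]_(k <- s) `|block_sum i k w|))); last first.
  by apply/funext => w; rewrite big_cons.
apply: measurable_maxr => //; apply: measurableT_comp => //; exact: measurable_block_sum.
Qed.

Let moricz_ratio : R := (4 * m%:R + 1) ^+ m.*2.

(** If 4 m y <= x, then (1 + 1 / (4 m))^(2 m) <= exp(1/2) <= 2; otherwise x + y <= (4 m + 1) y. The
    small factor 2 in front of the first power is what lets the recursion of [moricz_maximal]
    close. *)
Lemma exprD_le_moricz (x y : R) : 0 <= x -> 0 <= y ->
  (x + y) ^+ m.*2 <= 2 * x ^+ m.*2 + moricz_ratio * y ^+ m.*2.
Proof.
move=> x0 y0; have m0 : 0 < m%:R :> R by rewrite ltr0n (leq_trans _ m2).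
have [yx|xy] := leP (4 * m%:R * y) x.
  apply: ler_wpDr; first by rewrite mulr_ge0 ?exprn_ge0// addr_ge0// mulr_ge0.
  have c0 : 0 < 4 * m%:R :> R by rewrite mulr_gt0.
  have h : x + y <= (1 + (4 * m%:R)^-1) * x.
    rewrite mulrDl mul1r lerD2l mulrC ler_pdivlMr//; lra.
  apply: (@le_trans _ _ (((1 + (4 * m%:R)^-1) * x) ^+ m.*2)).
    by rewrite lerXn2r// nnegrE ?addr_ge0// mulr_ge0// addr_ge0// invr_ge0 ltW.
  rewrite exprMn ler_wpM2r ?exprn_ge0//.
  apply: (@le_trans _ _ (expR (4 * m%:R)^-1 ^+ m.*2)).
    by rewrite lerXn2r ?nnegrE ?expR_ge0 ?expR_ge1Dx// addr_ge0// invr_ge0 ltW.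
  rewrite -expRM_natl.
  have -> : m.*2%:R * (4 * m%:R)^-1 = 2^-1 :> R.
    rewrite -muln2 natrM; field; rewrite gt_eqF//.
  have h' := expR_ge1Dx (- 2^-1 : R); rewrite expRN in h'.
  have e0 : 0 < expR (2^-1) :> R by exact: expR_gt0.
  rewrite -(ler_pM2r e0) mulVf ?gt_eqF// in h'; lra.
apply: ler_wpDl; first by rewrite mulr_ge0 ?exprn_ge0.
rewrite -exprMn lerXn2r ?nnegrE ?addr_ge0 ?mulr_ge0//.
by rewrite mulrDl mul1r lerD2r ltW.
Qed.

Hypothesis SX : forall i j, (i <= j)%N ->
  (\int[P]_w (block_sum i j w ^+ m.*2)%:E <= (C * (\sum_(i <= k < j) u k) ^+ m)%:E)%E.

Lemma balanced_split i j : (i < j)%N -> exists2 p, (i <= p < j)%N &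
  \sum_(i <= k < p) u k <= (\sum_(i <= k < j) u k) / 2 /\
  \sum_(p.+1 <= k < j) u k <= (\sum_(i <= k < j) u k) / 2.
Proof.
move=> ij; set U := \sum_(i <= k < j) u k.
have U0 a c : 0 <= \sum_(a <= k < c) u k by apply: sumr_ge0.
pose Q k := (i <= k)%N && ((U / 2 < \sum_(i <= l < k.+1) u l) || (j <= k.+1)%N).
have jj : j.-1.+1 = j by exact: ltn_predK ij.
have ij1 : (i <= j.-1)%N by rewrite -ltnS jj.
have exQ : exists k, Q k by exists j.-1; rewrite /Q jj leqnn orbT andbT.
case: (ex_minnP exQ) => p /andP[ip Hp] pmin.
have pj : (p < j)%N.
  by have := pmin j.-1; rewrite /Q jj leqnn orbT andbT => /(_ ij1); rewrite -ltnS jj.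
exists p; first by rewrite ip.
split.
  move: ip; rewrite leq_eqVlt => /predU1P[<-|ip].
    by rewrite big_geq// divr_ge0// U0.
  have pp : p.-1.+1 = p by exact: ltn_predK ip.
  rewrite leNgt; apply/negP => h.
  have := pmin p.-1; rewrite /Q pp h/= andbT -ltnS pp => /(_ ip).
  by move=> h2; move: (leqnn p); rewrite -{1}pp ltnNge h2.
have split : U = \sum_(i <= k < p.+1) u k + \sum_(p.+1 <= k < j) u k.
  by rewrite /U (@big_cat_nat _ _ _ p.+1)// leqW.
case/orP : Hp => [h|h]; last by rewrite big_geq// divr_ge0// U0.
by move: h split; generalize U => U'; lra.
Qed.

(** A partial sum either ends in the left block or is the sum through [p] plus a partial sum of the
    right block. By induction the blocks contribute at most (1 + 2) K (U / 2)^m, which is at most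
    3/4 of K U^m because m >= 2; the choice K = 4 [moricz_ratio] C leaves exactly the last quarter
    for the sum through [p]. *)
Lemma moricz_maximal i j : (i <= j)%N ->
  (\int[P]_w (block_max i j w ^+ m.*2)%:E <=
    (4 * moricz_ratio * C * (\sum_(i <= k < j) u k) ^+ m)%:E)%E.
Proof.
have [l] := ubnP (j - i); elim: l => // l IH in i j *; rewrite ltnS => jil ij.
have K0 : 0 <= moricz_ratio by rewrite exprn_ge0// addr_ge0// mulr_ge0.
have mm2 : (0 < m)%N by exact: leq_trans m2.
move: ij; rewrite leq_eqVlt => /predU1P[<-|ij].
  rewrite (_ : (\int[P]_w _)%E = 0%E); last first.
    apply: integral0_eq => w _; rewrite (_ : block_max i i w = 0) ?expr0n ?double_eq0 ?gtn_eqF//.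
    apply/eqP; rewrite eq_le block_max_ge0 andbT; apply: block_max_le => // k.
    by rewrite -eqn_leq => /eqP <-; rewrite /block_sum big_geq// normr0.
  by rewrite lee_fin mulr_ge0 ?exprn_ge0 ?mulr_ge0// big_geq.
have [p /andP[ip pj] [U1 U2]] := balanced_split ij.
set U := \sum_(i <= k < j) u k in U1 U2 *.
have U0 a c : 0 <= \sum_(a <= k < c) u k by apply: sumr_ge0.
pose K := 4 * moricz_ratio * C.
have KK : 0 <= K by rewrite !mulr_ge0.
have I1 : (\int[P]_w (block_max i p w ^+ m.*2)%:E <= (K * (U / 2) ^+ m)%:E)%E.
  apply: (le_trans (IH i p _ ip)).
    by apply: leq_trans jil; rewrite ltn_sub2r.
  by rewrite lee_fin ler_wpM2l// lerXn2r ?nnegrE ?U0// divr_ge0 ?U0.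
have I2 : (\int[P]_w (block_max p.+1 j w ^+ m.*2)%:E <= (K * (U / 2) ^+ m)%:E)%E.
  apply: (le_trans (IH p.+1 j _ pj)).
    apply: leq_trans jil; rewrite subnS prednK ?subn_gt0//; exact: leq_sub2l.
  by rewrite lee_fin ler_wpM2l// lerXn2r ?nnegrE ?U0// divr_ge0 ?U0.
have I3 : (\int[P]_w (block_sum i p.+1 w ^+ m.*2)%:E <= (C * U ^+ m)%:E)%E.
  apply: (le_trans (SX (leqW ip))).
  rewrite lee_fin ler_wpM2l// lerXn2r ?nnegrE ?U0//.
  by rewrite /U [leRHS](@big_cat_nat _ _ _ p.+1) ?(leqW ip)//= lerDl U0.
have mb a c : measurable_fun setT (fun w => block_max a c w ^+ m.*2).
  by apply: measurable_funX; exact: measurable_block_max.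
have ms a c : measurable_fun setT (fun w => block_sum a c w ^+ m.*2).
  by apply: measurable_funX; exact: measurable_block_sum.
have b0 a c w : 0 <= block_max a c w ^+ m.*2 by rewrite exprn_ge0// block_max_ge0.
have s0 a c w : 0 <= block_sum a c w ^+ m.*2 by rewrite exprn_even_ge0// odd_double.
have le1 w : block_max i j w ^+ m.*2 <= block_max i p w ^+ m.*2 +
     (2 * block_max p.+1 j w ^+ m.*2 + moricz_ratio * block_sum i p.+1 w ^+ m.*2).
  set a := block_max i p w; set c := block_max p.+1 j w; set s := block_sum i p.+1 w.
  have h : block_max i j w <= Num.max a (c + `|s|).
    apply: block_max_le; first by rewrite le_max block_max_ge0.
    move=> k /andP[ik kj]; rewrite le_max; have [kp|pk] := leqP k p.
      by rewrite le_block_max// ik.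
    apply/orP; right; rewrite /block_sum (@big_cat_nat _ _ _ p.+1) ?(leqW ip)//= addrC.
    by apply: (le_trans (ler_normD _ _)); rewrite lerD2r le_block_max// pk.
  have sE : s ^+ m.*2 = `|s| ^+ m.*2 by rewrite -normrX ger0_norm// s0.
  apply: (@le_trans _ _ (Num.max a (c + `|s|) ^+ m.*2)).
    by rewrite lerXn2r// nnegrE ?block_max_ge0// le_max block_max_ge0.
  have [|_] := leP a (c + `|s|).
    move=> _; apply: ler_wpDl; first exact: b0.
    by rewrite sE; apply: exprD_le_moricz => //; exact: block_max_ge0.
  by rewrite lerDl; apply: addr_ge0; apply: mulr_ge0 => //; [exact: b0|exact: s0].
have I4 : (\int[P]_w (block_max i j w ^+ m.*2)%:E <=
   \int[P]_w (block_max i p w ^+ m.*2)%:E + (2%:E * \int[P]_w (block_max p.+1 j w ^+ m.*2)%:E +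
     moricz_ratio%:E * \int[P]_w (block_sum i p.+1 w ^+ m.*2)%:E))%E.
  rewrite -(ge0_integral_scaler P measurableT 2)// -(ge0_integral_scaler P measurableT _ _ K0)//.
  have n1 w : [set: T] w -> 0 <= 2 * block_max p.+1 j w ^+ m.*2 by move=> _; apply: mulr_ge0.
  have n2 w : [set: T] w -> 0 <= moricz_ratio * block_sum i p.+1 w ^+ m.*2 by move=> _; apply: mulr_ge0.
  have m1 : measurable_fun setT (fun w => 2 * block_max p.+1 j w ^+ m.*2) by exact: measurable_funM.
  have m2' : measurable_fun setT (fun w => moricz_ratio * block_sum i p.+1 w ^+ m.*2) by exact: measurable_funM.
  have m3 := measurable_funD m1 m2'.
  have n3 w : [set: T] w -> 0 <= 2 * block_max p.+1 j w ^+ m.*2 + moricz_ratio * block_sum i p.+1 w ^+ m.*2.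
    by move=> wT; apply: addr_ge0; [exact: n1|exact: n2].
  rewrite -(ge0_integral_addr P measurableT)// -(ge0_integral_addr P measurableT)//.
  by apply: (ge0_le_integralr P measurableT) => //; exact: measurable_funD.
apply: (le_trans I4); apply: (@le_trans _ _ ((K * (U / 2) ^+ m)%:E +
  (2%:E * (K * (U / 2) ^+ m)%:E + moricz_ratio%:E * (C * U ^+ m)%:E))%E).
  apply: leeD => //; apply: leeD; first by rewrite lee_wpmul2l// lee_fin.
  by rewrite lee_wpmul2l// lee_fin.
rewrite -!EFinM -!EFinD lee_fin -/K.
have hU : K * (U / 2) ^+ m <= K * U ^+ m / 4.
  rewrite -mulrA ler_wpM2l// exprMn ler_wpM2l ?exprn_ge0 ?U0// exprVn lef_pV2 ?posrE ?exprn_gt0//.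
  apply: (@le_trans _ _ (2 ^+ 2)); first by rewrite expr2 -natrM.
  by rewrite ler_eXn2l// ltr1n.
have -> : moricz_ratio * (C * U ^+ m) = K * U ^+ m / 4 by rewrite /K; field.
lra.
Qed.

End moricz.

(** * Variance of the increments of the noise kernel *)

Section kernel_bound.
Context {R : realType}.

Lemma sin_sqr_le (y : R) : sin y ^+ 2 <= y ^+ 2.
Proof.
have pos (z : R) : 0 < z -> sin z ^+ 2 <= z ^+ 2.
  move=> z0; have [c _] : exists2 c, c \in `]0, z[ & sin z - sin 0 = cos c * (z - 0).
    by apply: MVT => //; apply: continuous_subspaceT; exact: continuous_sin.
  rewrite sin0 !subr0 => ->; rewrite exprMn ler_piMl ?sqr_ge0//.
have [y0|y0|->] := ltgtP y 0; last by rewrite sin0.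
  by rewrite -(sqrrN y) -[X in X <= _]sqrrN -sinN; apply: pos; rewrite oppr_gt0.
exact: pos.
Qed.

Lemma versine_le (x : R) : 2 - 2 * cos x <= x ^+ 2.
Proof.
have := cos_mulr2n (x / 2); rewrite (_ : x / 2 *+ 2 = x); last by rewrite -mulr_natr divfK.
move=> ->; have := sin_sqr_le (x / 2); have := cos2Dsin2 (x / 2).
lra.
Qed.

Lemma versine_le4 (x : R) : 2 - 2 * cos x <= 4.
Proof. by have := cos_geN1 x; lra. Qed.

(** Here 2 - 2 cos x is the square of |exp(i x) - 1|. The bounds x^2 and 4 are interpolated,
    according to whether |x| is below or above 1. *)
Lemma versine_le_powR (c x : R) : 0 <= c <= 1 -> 2 - 2 * cos x <= 4 * `|x| `^ (2 * c).
Proof.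
move=> /andP[c0 c1]; have [->|x0] := eqVneq x 0.
  by rewrite cos0 mulr1 subrr mulr_ge0// powR_ge0.
have nx : 0 < `|x| by rewrite normr_gt0.
have [x1|x1] := leP 1 `|x|.
  apply: (le_trans (versine_le4 x)); rewrite ler_peMr//.
  by rewrite -[leLHS](powRr0 `|x|) ler_powR// mulr_ge0.
apply: (le_trans (versine_le x)).
apply: (@le_trans _ _ (`|x| `^ (2 * c))); last by rewrite ler_peMl ?powR_ge0// ler1n.
rewrite -real_normK ?num_real// -powR_mulrn//.
rewrite [X in `|x| `^ X <= _](_ : _ = 2 * c + (2 - 2 * c)); last by ring.
rewrite gt0_powRD// ler_piMr ?powR_ge0//.
rewrite [leRHS](_ : _ = 1 `^ (2 - 2 * c)); last by rewrite powR1.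
apply: ge0_ler_powR; rewrite ?nnegrE ?(ltW x1)//; lra.
Qed.

(** Used with u = |log |x||, this absorbs powers of a logarithm into arbitrarily small powers of
    |x|. It rests on 1 + y <= exp(y) at y = delta u / c. *)
Lemma powR_log_growth (c delta : R) : 0 <= c -> 0 < delta ->
  exists2 M, 0 <= M & forall u, 0 <= u -> (u + 1) `^ c <= M * expR (delta * u).
Proof.
rewrite le_eqVlt => /predU1P[<-|c0] d0.
  exists 1 => // u u0; rewrite powRr0 mul1r -expR0 ler_expR mulr_ge0//; exact: ltW.
pose m := 1 + c / delta; have m0 : 0 < m by rewrite addr_gt0// divr_gt0.
exists (m `^ c); first exact: powR_ge0.
move=> u u0; have -> : expR (delta * u) = expR (delta * u / c) `^ c.
  by rewrite -expRM divfK ?gt_eqF.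
rewrite -powRM ?expR_ge0 ?(ltW m0)//; apply: ge0_ler_powR; rewrite ?nnegrE ?(ltW c0) ?addr_ge0//.
  by rewrite mulr_ge0 ?expR_ge0 ?(ltW m0).
apply: (@le_trans _ _ (m * (1 + delta * u / c))).
  rewrite /m mulrDl mul1r mulrDr mulr1.
  have -> : c / delta * (delta * u / c) = u by field; rewrite !gt_eqF.
  have h1 : 0 <= delta * u / c by rewrite divr_ge0 ?(ltW c0)// mulr_ge0// ltW.
  have h2 : 0 <= c / delta by rewrite divr_ge0 ?(ltW c0)// ltW.
  by lra.
by rewrite ler_pM2l// expR_ge1Dx.
Qed.

(** The factor 1 / |x| of the density cancels |x|^(2 / alpha), so |x|^(-2 H) times a power of the
    logarithm remains. For |x| >= 1 the loss from H to H' pays for the logarithm; for |x| < 1 the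
    bound d^2 x^2 leaves room 2 (1 - H) for it, and d^2 is at most T^(2 - 2 H') d^(2 H'). *)
Lemma lepage_kernel_bound (alpha H H' eta T : R) : 0 < alpha -> 0 < eta ->
  0 < H' < H -> H < 1 -> 0 < T ->
  exists2 L, 0 <= L & forall x d, 0 <= d <= T ->
    phi eta x `^ (- (2 / alpha)) / `|x| `^ (2 / alpha + 2 * H) * (2 - 2 * cos (d * x)) <= L * d `^ (2 * H').
Proof.
move=> al0 eta0 /andP[H'0 HH'] H1 T0.
pose e := 2 / alpha; have e0 : 0 < e by rewrite divr_gt0.
pose c := (1 + eta) * e; have c0 : 0 <= c by rewrite mulr_ge0 ?(ltW e0)// addr_ge0// ltW.
have dH : 0 < 2 * (H - H') by rewrite mulr_gt0// subr_gt0.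
have dH1 : 0 < 2 * (1 - H) by rewrite mulr_gt0// subr_gt0.
have H0 : 0 < H by exact: lt_trans HH'.
have [M M0 hM] := powR_log_growth c0 dH.
have [M' M'0 hM'] := powR_log_growth c0 dH1.
pose K := K_norm eta `^ (- e).
have K0 : 0 <= K by exact: powR_ge0.
have TH0 : 0 <= T `^ (2 * (1 - H')) by exact: powR_ge0.
exists (K * (4 * M + M' * T `^ (2 * (1 - H')))).
  by rewrite mulr_ge0// addr_ge0 ?mulr_ge0.
move=> x d /andP[d0 dT].
have [->|x0] := eqVneq x 0.
  by rewrite mulr0 cos0 mulr1 subrr mulr0 !mulr_ge0 ?powR_ge0// addr_ge0 ?mulr_ge0.
have nx : 0 < `|x| by rewrite normr_gt0.
set l := `|ln `|x| |; have l0 : 0 <= l by rewrite /l.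
have l1 : 0 < l + 1 by rewrite ltr_wpDl.
have phiE : phi eta x `^ (- e) / `|x| `^ (e + 2 * H) = K * (`|x| `^ (- (2 * H)) * (l + 1) `^ c).
  rewrite /phi /phi_unnormalized -/l !powRM ?mulr_ge0 ?invr_ge0 ?powR_ge0//; last first.
    by rewrite Rintegral_ge0// => y _; rewrite mulr_ge0 ?invr_ge0 ?powR_ge0.
  rewrite -/K -mulrA; congr (_ * _).
  rewrite -[(`|x|^-1)]powR_inv1// -!powRrM mulrAC -powRN -gt0_powRD//.
  by congr (_ `^ _ * _ `^ _); rewrite /c; ring.
rewrite phiE -!mulrA; apply: ler_wpM2l => //.
rewrite [X in _ <= X]mulrDl.
have [x1|x1] := leP 1 `|x|.
  apply: ler_wpDr; first by rewrite !mulr_ge0 ?powR_ge0.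
  have lE : l = ln `|x| by rewrite /l ger0_norm// ln_ge0.
  have h1 := hM l l0.
  have h2 : 2 - 2 * cos (d * x) <= 4 * (d `^ (2 * H') * `|x| `^ (2 * H')).
    rewrite -powRM//; have := @versine_le_powR H' (d * x).
    by rewrite normrM (ger0_norm d0); apply; rewrite ltW//= ltW// (lt_trans HH').
  have v0 : 0 <= 2 - 2 * cos (d * x) by have := cos_le1 (d * x); lra.
  have -> : 4 * M * d `^ (2 * H') = `|x| `^ (- (2 * H)) * ((M * expR (2 * (H - H') * l)) * (4 * (d `^ (2 * H') * `|x| `^ (2 * H')))).
    have -> : expR (2 * (H - H') * l) = `|x| `^ (2 * (H - H')).
      by rewrite /powR gt_eqF// lE.
    rewrite (_ : `|x| `^ (- (2 * H)) * _ = 4 * M * d `^ (2 * H') * (`|x| `^ (- (2 * H)) * (`|x| `^ (2 * (H - H')) * `|x| `^ (2 * H')))); last by ring.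
    by rewrite -!gt0_powRD// (_ : - (2 * H) + (2 * (H - H') + 2 * H') = 0) ?powRr0 ?mulr1//; ring.
  by apply: ler_wpM2l; [exact: powR_ge0|apply: ler_pM => //; exact: powR_ge0].
apply: ler_wpDl; first by rewrite !mulr_ge0 ?powR_ge0.
have lE : l = - ln `|x| by rewrite /l ler0_norm// ln_le0// ltW.
have h1 := hM' l l0.
have v0 : 0 <= 2 - 2 * cos (d * x) by have := cos_le1 (d * x); lra.
have h2 : 2 - 2 * cos (d * x) <= d ^+ 2 * `|x| ^+ 2.
  by apply: (le_trans (versine_le _)); rewrite exprMn real_normK ?num_real.
apply: (@le_trans _ _ (`|x| `^ (- (2 * H)) * ((M' * expR (2 * (1 - H) * l)) * (d ^+ 2 * `|x| ^+ 2)))).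
  by apply: ler_wpM2l; [exact: powR_ge0|apply: ler_pM => //; exact: powR_ge0].
have -> : expR (2 * (1 - H) * l) = `|x| `^ (- (2 * (1 - H))).
  by rewrite /powR gt_eqF// lE mulrN mulNr.
rewrite (_ : `|x| `^ (- (2 * H)) * _ = M' * d ^+ 2 * (`|x| `^ (- (2 * H)) * (`|x| `^ (- (2 * (1 - H))) * `|x| ^+ 2))); last by ring.
rewrite -(powR_mulrn 2 (ltW nx)) -!gt0_powRD// (_ : - (2 * H) + (- (2 * (1 - H)) + 2%:R) = 0) ?powRr0 ?mulr1; last by ring.
rewrite -mulrA; apply: ler_wpM2l => //.
move: d0; rewrite le_eqVlt => /predU1P[<-|d0].
  by rewrite expr0n/= mulr_ge0// powR_ge0.
rewrite -(powR_mulrn 2 (ltW d0)) [leLHS](_ : _ = d `^ (2 * (1 - H')) * d `^ (2 * H')); last first.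
  by rewrite -gt0_powRD//; congr (_ `^ _); ring.
apply: ler_wpM2r; first exact: powR_ge0.
apply: ge0_ler_powR; rewrite ?nnegrE ?(ltW d0) ?(ltW T0)//.
by rewrite mulr_ge0// subr_ge0 ltW// (lt_trans HH').
Qed.

End kernel_bound.

(** With c = a - 1 the terms are bounded by telescoping differences of k^(-c) / c, through (1 - 1 /
    x)^c <= exp(- c / x) <= 1 / (1 + c / x). *)
Lemma p_series_bounded {R : realType} (a : R) : 1 < a -> forall n,
  \sum_(k < n) k.+1%:R `^ (- a) <= 1 + (a - 1)^-1.
Proof.
move=> a1; pose c := a - 1; have c0 : 0 < c by rewrite subr_gt0.
have step (k : nat) : (0 < k)%N -> c * k.+1%:R `^ (- a) <= k%:R `^ (- c) - k.+1%:R `^ (- c).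
  move=> k0; have kp : 0 < k%:R :> R by rewrite ltr0n.
  set x : R := k.+1%:R; have x0 : 0 < x by rewrite ltr0n.
  have xE : k%:R = x * (1 - x^-1) by rewrite mulrBr mulr1 mulfV ?gt_eqF// /x -natr1 addrK.
  have y0 : 0 < 1 - x^-1 by rewrite -(pmulr_rgt0 _ x0) -xE.
  have h1 : (1 - x^-1) `^ c <= expR (- (c / x)).
    rewrite (_ : - (c / x) = - x^-1 * c) ?expRM; last by rewrite mulNr mulrC.
    apply: ge0_ler_powR; rewrite ?nnegrE ?(ltW c0) ?(ltW y0) ?expR_ge0//.
    exact: expR_ge1Dx.
  have h2 : 1 + c / x <= (1 - x^-1) `^ (- c).
    have cx : 0 < 1 + c / x by rewrite addr_gt0// divr_gt0.
    rewrite powRN -[leLHS]invrK lef_pV2 ?posrE ?invr_gt0//; last exact: powR_gt0.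
    apply: (le_trans h1); rewrite expRN lef_pV2 ?posrE ?expR_gt0//.
    exact: expR_ge1Dx.
  rewrite {1}xE powRM ?(ltW x0) ?(ltW y0)//.
  have -> : x `^ (- a) = x `^ (- c) / x.
    have -> : - a = - c + - 1 by rewrite /c; ring.
    by rewrite powRD ?powR_inv1 ?(ltW x0)//; apply/implyP => _; rewrite gt_eqF.
  rewrite lerBrDl mulrCA -[X in X + _]mulr1 -mulrDr.
  by apply: ler_wpM2l; [exact: powR_ge0|exact: h2].
(* The telescoping starts at n = 1, where the bound is c. The case n = 0 holds because 0 to the
   power - c is 0. *)
have main n : c * \sum_(k < n) k.+1%:R `^ (- a) <= c + 1 - n%:R `^ (- c).
  elim: n => [|n IH]; first by rewrite big_ord0 mulr0 powR0 ?oppr_eq0 ?gt_eqF//; lra.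
  rewrite big_ord_recr/= mulrDr; case: n => [|n] in IH *.
    by rewrite big_ord0 mulr0 add0r !powR1; lra.
  have := step n.+1 isT; lra.
move=> n; rewrite -(ler_pM2l c0) mulrDr mulr1 mulfV ?gt_eqF//.
by apply: (le_trans (main n)); rewrite gerBl powR_ge0.
Qed.

(** * Growth of the arrival times *)

Section poisson_arrivals.
Context {R : realType} d (T : measurableType d) (P : probability T R).
Variables (N : R -> T -> nat) (G : nat -> T -> R).
Hypothesis Npois : poisson_process P 1 N.

(** Markov's inequality for 2^(N s), whose mean is exp(s). *)
Lemma poisson_tail (s : R) (k : nat) : 0 < s ->
  (P [set w | (k < N s w)%N] <= (expR s / 2 ^+ k.+1)%:E)%E.
Proof.
move=> s0; have [mN N0 Nmon _ Nlaw] := Npois.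
have law j : P [set w | N s w = j] = (poisson_pmf s j)%:E.
  have := Nlaw 0 s; rewrite lexx s0 => /(_ isT isT j); rewrite subr0 mul1r => <-.
  by congr (P _); apply/seteqP; split => w /=; rewrite N0 subn0.
have mj j : measurable [set w | N s w = j].
  by rewrite -[X in measurable X]setTI; apply: (mN s (ltW s0) _ [set j]).
have -> : [set w | (k < N s w)%N] = \bigcup_(j in [set j | (k < j)%N]) [set w | N s w = j].
  by apply/seteqP; split => w /=; [move=> kN; exists (N s w)|case=> j /= kj ->].
rewrite measure_bigcup//; last by move=> i j _ _ [w [/= -> ->]].
rewrite eseries_mkcond.
apply: (@le_trans _ _ (\sum_(j <oo) ((2 * s) ^+ j / j`!%:R * (expR (- s) / 2 ^+ k.+1))%:E)%E).
  apply: lee_nneseries => [j _ _|j _]; first by case: ifP.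
  case: ifPn => [|_]; last by rewrite lee_fin mulr_ge0 ?divr_ge0 ?exprn_ge0 ?expR_ge0// mulr_ge0// ltW.
  rewrite inE/= => kj; rewrite [leLHS](law j) lee_fin /poisson_pmf s0 exprMn.
  have -> : 2 ^+ j * s ^+ j / j`!%:R * (expR (- s) / 2 ^+ k.+1) =
     s ^+ j / j`!%:R * expR (- s) * (2 ^+ j / 2 ^+ k.+1) by ring.
  rewrite ler_peMr ?mulr_ge0 ?exprn_ge0 ?invr_ge0 ?expR_ge0 ?(ltW s0)//.
  by rewrite ler_pdivlMr ?exprn_gt0// mul1r ler_eXn2l// ltr1n.
apply: lime_le; first by apply: is_cvg_nneseries => j _ _; rewrite lee_fin mulr_ge0 ?divr_ge0 ?exprn_ge0 ?expR_ge0// mulr_ge0// ltW.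
apply: nearW => n; rewrite sumEFin lee_fin -big_distrl/=.
have -> : expR s / 2 ^+ k.+1 = expR (2 * s) * (expR (- s) / 2 ^+ k.+1).
  by rewrite mulrA -expRD; congr (expR _ / _); ring.
rewrite ler_wpM2r ?divr_ge0 ?expR_ge0 ?exprn_ge0//.
apply: (@nondecreasing_cvgn_le _ (series (exp_coeff (2 * s)))); last exact: is_cvg_series_exp_coeff.
by apply: nondecreasing_series => j _ _; apply: exp_coeff_ge0; rewrite mulr_ge0// ltW.
Qed.

Hypothesis GN : {ae P, forall w, forall k, G k w = inf [set t : R | 0 <= t /\ (k < N t w)%N]}.

(** If the process never exceeds [k], the infimum is over the empty set and is 0 by default;
    assuming that the arrival time is not 0 excludes this. *)
Lemma arrival_lt (w : T) (k : nat) (s : R) : 0 <= s ->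
  G k w = inf [set t : R | 0 <= t /\ (k < N t w)%N] ->
  G k w != 0 -> G k w < s -> (k < N s w)%N.
Proof.
move=> s0 GE G0 Gs; have [_ _ Nmon _ _] := Npois.
have [mon _] := Nmon w.
have [[t0 St0]|E] := pselect ([set t : R | 0 <= t /\ (k < N t w)%N] !=set0); last first.
  by move: G0; rewrite GE inf_out ?eqxx// => -[].
have hi : has_inf [set t : R | 0 <= t /\ (k < N t w)%N].
  by split; [exists t0|exists 0 => t []].
have sG : 0 < s - G k w by rewrite subr_gt0.
have [t [t00 kt] ts] := inf_adherent sG hi.
apply: (leq_trans kt); apply: mon => //; apply: ltW.
by rewrite GE addrC subrK in ts.
Qed.

(** Borel-Cantelli for the events of more than [k] arrivals up to time k / 2, whose probabilities
    are at most (exp(1/2) / 2)^k. The alternative 0 covers the default of an empty infimum; it does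
    no harm in the sums to come, since negative powers of 0 are 0. *)
Lemma arrival_rate_ae : {ae P, forall w, \forall k \near \oo, G k w = 0 \/ k%:R / 2 <= G k w}.
Proof.
have [mN _ _ _ _] := Npois.
pose F k := [set w | (k < N (k%:R / 2) w)%N].
have mF k : measurable (F k).
  have -> : F k = N (k%:R / 2) @^-1` [set j | (k < j)%N] by [].
  rewrite -[X in measurable X]setTI; apply: (mN (k%:R / 2) _ _ [set j | (k < j)%N]) => //; rewrite divr_ge0.
have PF k : (P (F k) <= ((expR 2^-1 / 2) ^+ k)%:E)%E.
  have [->|k0] := eqVneq k 0%N; first by rewrite expr0 probability_le1.
  apply: (le_trans (poisson_tail k _)); first by rewrite divr_gt0// ltr0n lt0n.
  rewrite lee_fin expRM_natl exprMn exprVn ler_pM2l ?exprn_gt0 ?expR_gt0//.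
  by rewrite lef_pV2 ?posrE ?exprn_gt0// ler_eXn2l// ltr1n.
have q1 : expR 2^-1 / 2 < 1 :> R.
  rewrite ltr_pdivrMr// mul1r.
  have e0 : 0 < expR (2^-1) :> R by exact: expR_gt0.
  have h : 1 - 2^-1 < expR (- 2^-1) :> R.
    by rewrite expR_gt1Dx// oppr_eq0 invr_eq0.
  by rewrite expRN -(ltr_pM2r e0) mulVf ?gt_eqF// in h; lra.
have q0 : 0 < expR 2^-1 / 2 :> R by rewrite divr_gt0// expR_gt0.
have sumF : (\sum_(k <oo) P (F k) < +oo)%E.
  apply: (@le_lt_trans _ _ (1 * (1 - expR 2^-1 / 2)^-1)%:E); last by rewrite ltry.
  apply: (@le_trans _ _ (\sum_(k <oo) ((expR 2^-1 / 2) ^+ k)%:E)%E).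
    by apply: lee_nneseries => // k _; exact: PF.
  apply: lime_le; first by apply: is_cvg_nneseries => j _ _; rewrite lee_fin exprn_ge0// ltW.
  apply: nearW => n; rewrite sumEFin lee_fin.
  have := @geometric_le_lim R n 1 _ ler01 q0; rewrite gtr0_norm// => /(_ q1).
  by apply: le_trans; rewrite /series/=; apply: ler_sum => i _; rewrite /geometric/= mul1r.
have null := lim_sup_set_cvg0 mF sumF.
have h1 : {ae P, forall w, ~ lim_sup_set F w}.
  exists (lim_sup_set F); split => //.
    by apply: bigcap_measurable => // k _; exact: bigcup_measurable.
  by move=> w /= /contrapT.
apply: filterS2 h1 GN => w h1 h2.
move: h1; rewrite /lim_sup_set /bigcap/= => /existsNP[n /not_implyP[_ hn]].
exists n => // k /= nk; have [->|G0] := eqVneq (G k w) 0; first by left.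
right; rewrite leNgt; apply/negP => Gk; apply: hn; exists k => //=.
by rewrite /F/=; apply: (arrival_lt _ (h2 k)) => //; rewrite divr_ge0.
Qed.

Lemma arrival_sum_ae (a : R) : 1 < a -> {ae P, forall w, exists B : R, forall n,
  \sum_(k < n) G k w `^ (- a) <= B}.
Proof.
move=> a1; apply: filterS arrival_rate_ae => w [m _ hm].
have hC := p_series_bounded a1.
have a0 : 0 < a by exact: lt_trans a1.
set C := 1 + (a - 1)^-1 in hC.
exists (\sum_(k < m.+1) G k w `^ (- a) + 2 `^ a * C) => n.
have hj j : \sum_(k < m.+1 + j) G k w `^ (- a) <=
    \sum_(k < m.+1) G k w `^ (- a) + 2 `^ a * \sum_(k < m + j) k.+1%:R `^ (- a).
  elim: j => [|j IH].
    by rewrite !addn0 lerDl mulr_ge0 ?powR_ge0// sumr_ge0// => i _; exact: powR_ge0.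
  rewrite !addnS [X in X <= _]big_ord_recr [X in _ <= _ + _ * X]big_ord_recr mulrDr addrA.
  apply: lerD; first exact: IH.
  change (G (m.+1 + j)%N w `^ (- a) <= 2 `^ a * (m + j).+1%:R `^ (- a)).
  have [->|hk] := hm (m.+1 + j)%N (leq_trans (leqnSn m) (leq_addr _ _)).
    by rewrite powR0 ?mulr_ge0 ?powR_ge0// oppr_eq0 gt_eqF.
  have kp : 0 < (m + j).+1%:R :> R by rewrite ltr0n.
  have k2 : 0 < (m + j).+1%:R / 2 :> R by rewrite divr_gt0.
  apply: (@le_trans _ _ (((m + j).+1%:R / 2) `^ (- a))).
    rewrite !powRN lef_pV2 ?posrE ?powR_gt0//; last exact: lt_le_trans hk.
    by apply: ge0_ler_powR; rewrite ?nnegrE ?(ltW a0) ?(ltW k2)// (le_trans (ltW k2)).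
  by rewrite powRM ?invr_ge0// mulrC -powR_inv1// -powRrM mulN1r opprK.
apply: (@le_trans _ _ (\sum_(k < m.+1 + n) G k w `^ (- a))).
  rewrite addnC; elim: (m.+1) => [|l IH]; first by rewrite addn0.
  by rewrite addnS big_ord_recr/= (le_trans IH)// lerDl powR_ge0.
by apply: (le_trans (hj n)); rewrite lerD2l ler_wpM2l ?powR_ge0.
Qed.

End poisson_arrivals.

(** * From dyadic increments to a Hoelder bound *)

Section dyadic_chaining.
Context {R : realType}.
Variables (F : R -> R) (T B theta : R).
Hypotheses (T0 : 0 < T) (B0 : 0 <= B) (theta0 : 0 < theta)
  (cF : {within `[0, T], continuous F})
  (inc : forall l i : nat, (i < 2 ^ l)%N ->
    `|F (T * (i.+1%:R / 2 ^+ l)) - F (T * (i%:R / 2 ^+ l))| <= B * (2 `^ (- theta)) ^+ l).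

Let rho : R := 2 `^ (- theta).
Let rho0 : 0 < rho. Proof. exact: powR_gt0. Qed.
Let rho1 : rho < 1.
Proof.
rewrite /rho powRN invf_lt1 ?powR_gt0// [X in X < _](_ : 1 = 1 `^ theta); last by rewrite powR1.
by apply: (gt0_ltr_powR theta0); rewrite ?nnegrE// ltr1n.
Qed.

Let dy (l : nat) (s : R) : R := (Num.truncn (2 ^+ l * s))%:R / 2 ^+ l.
Let p2 (l : nat) : 0 < 2 ^+ l :> R. Proof. exact: exprn_gt0. Qed.

Let dy_le l s : 0 <= s -> dy l s <= s.
Proof. by move=> s0; rewrite /dy ler_pdivrMr// mulrC truncn_le// mulr_ge0// ltW. Qed.

Let dy_gt l s : s < dy l s + (2 ^+ l)^-1.
Proof.
rewrite /dy -[X in _ + X]mul1r -mulrDl ltr_pdivlMr// mulrC natr1.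
exact: truncnS_gt.
Qed.

Let dy_ge0 l s : 0 <= dy l s. Proof. by rewrite divr_ge0// ltW. Qed.

Let step (s : R) l : 0 <= s <= 1 -> `|F (T * dy l.+1 s) - F (T * dy l s)| <= B * rho ^+ l.+1.
Proof.
move=> /andP[s0 s1].
have Br : 0 <= B * rho ^+ l.+1 by rewrite mulr_ge0// exprn_ge0// ltW.
set i := Num.truncn (2 ^+ l * s).
have dyE : dy l s = (i * 2)%N%:R / 2 ^+ l.+1.
  rewrite /dy -/i natrM exprS; field; rewrite gt_eqF//.
(* Refining the floor by one level keeps it or adds one dyadic step, so at most one increment of
   level l + 1 is spent. *)
have : Num.truncn (2 ^+ l.+1 * s) = (i * 2)%N \/ Num.truncn (2 ^+ l.+1 * s) = (i * 2).+1.
  have h1 : i%:R <= 2 ^+ l * s by rewrite truncn_le// mulr_ge0// ltW.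
  have h2 : 2 ^+ l * s < i.+1%:R by exact: truncnS_gt.
  set j := Num.truncn _.
  have h3 : j%:R <= 2 ^+ l.+1 * s by rewrite truncn_le// mulr_ge0// ltW.
  have h4 : 2 ^+ l.+1 * s < j.+1%:R by exact: truncnS_gt.
  have j1 : (i * 2 < j.+1)%N by rewrite -(ltr_nat R) natrM; move: h4; rewrite exprS; lra.
  have j2 : (j < (i.+1) * 2)%N by rewrite -(ltr_nat R) natrM; move: h3; rewrite exprS; lra.
  move: j1 j2; rewrite ltnS leq_eqVlt => /predU1P[->|h5]; first by left.
  by rewrite mulSn add2n ltnS leq_eqVlt ltnS => /predU1P[->|]; [right|rewrite leqNgt h5].
case=> h; rewrite {1}/dy h dyE; first by rewrite subrr normr0.
apply: inc; rewrite -(ltr_nat R) natrX.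
have : (i * 2).+1%:R <= 2 ^+ l.+1 * s by rewrite -h truncn_le// mulr_ge0// ltW.
rewrite -natr1 => h6; apply: (@lt_le_trans _ _ (2 ^+ l.+1 * s)); first by lra.
by rewrite ler_piMr// ltW.
Qed.

Let telescope s l n : 0 <= s <= 1 ->
  `|F (T * dy (l + n)%N s) - F (T * dy l s)| <= B * rho ^+ l * (rho / (1 - rho)) * (1 - rho ^+ n).
Proof.
move=> s01; elim: n => [|n IH]; first by rewrite addn0 subrr normr0 expr0 subrr mulr0.
rewrite addnS (le_trans (ler_distD (F (T * dy (l + n) s)) _ _))//.
apply: (le_trans (lerD (step (l + n) s01) IH)).
have r1 : 1 - rho != 0 by rewrite gt_eqF// subr_gt0.
rewrite le_eqVlt; apply/orP; left; apply/eqP.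
by rewrite -addnS exprD !exprS; field.
Qed.

(** Continuity along the dyadic floors of [s] closes the geometric telescoping sum. *)
Let tail s l : 0 <= s <= 1 ->
  `|F (T * s) - F (T * dy l s)| <= B * rho ^+ l * (rho / (1 - rho)).
Proof.
move=> s01; have /andP[s0 s1] := s01.
have r1 : 0 < 1 - rho by rewrite subr_gt0.
apply/ler_addgt0Pr => e e0.
have Ts : `[0, T]%classic (T * s).
  by rewrite /= in_itv/= mulr_ge0 ?(ltW T0)//= ler_piMr// ltW.
have /subspace_continuousP/(_ _ Ts)/cvgrPdist_lt/(_ e e0) := cF.
rewrite near_withinE => /nbhs_ballP[d /= d0 hd].
have [n hn] : exists n : nat, T * (2 ^+ (l + n))^-1 < d.
  pose n := Num.truncn (T / d); exists n.+1.
  rewrite ltr_pdivrMr// mulrC -ltr_pdivrMr//; apply: lt_le_trans (truncnS_gt _) _.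
  rewrite -natrX ler_nat (leq_trans (ltnW (ltn_expl _ (isT : 1 < 2)%N)))//.
  by rewrite leq_exp2l// leq_addl.
have dyT : T * s - T * dy (l + n) s < d /\ 0 <= T * s - T * dy (l + n) s.
  rewrite -mulrBr; split; last by rewrite mulr_ge0 ?(ltW T0)// subr_ge0 dy_le.
  by apply: le_lt_trans hn; rewrite ler_pM2l// lerBlDl; exact: ltW (dy_gt _ _).
have : `|F (T * s) - F (T * dy (l + n) s)| < e.
  apply: (hd (T * dy (l + n) s)); first by rewrite /ball/= ger0_norm; case: dyT.
  rewrite in_itv/= mulr_ge0 ?(ltW T0) ?dy_ge0//= ler_piMr ?(ltW T0)//.
  exact: le_trans (dy_le _ s0) s1.
move=> /ltW h1; apply: (le_trans (ler_distD (F (T * dy (l + n) s)) _ _)).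
rewrite addrC lerD//; apply: (le_trans (telescope l n s01)).
rewrite ler_piMr ?gerBl ?exprn_ge0 ?(ltW rho0)//.
by rewrite !mulr_ge0 ?exprn_ge0 ?invr_ge0 ?(ltW rho0) ?(ltW r1).
Qed.

Lemma dyadic_chaining s r : 0 <= r -> r <= s -> s <= T ->
  `|F s - F r| <= (2 * (rho / (1 - rho)) + 1) * 2 `^ theta / T `^ theta * B * (s - r) `^ theta.
Proof.
set c := rho / (1 - rho).
have c0 : 0 <= c by rewrite divr_ge0 ?(ltW rho0)// subr_ge0 ltW.
move=> r0; rewrite le_eqVlt => /predU1P[->|rs] sT.
  rewrite subrr normr0 mulr_ge0 ?powR_ge0// mulr_ge0// divr_ge0 ?powR_ge0//.
  by rewrite mulr_ge0 ?powR_ge0// addr_ge0// mulr_ge0.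
pose s' := s / T; pose r' := r / T.
have s'1 : s' <= 1 by rewrite /s' ler_pdivrMr// mul1r.
have r'0 : 0 <= r' by rewrite divr_ge0// ltW.
have rs' : r' < s' by rewrite ltr_pM2r// invr_gt0.
have s'01 : 0 <= s' <= 1 by rewrite s'1 (le_trans r'0 (ltW rs')).
have r'01 : 0 <= r' <= 1 by rewrite r'0 (le_trans (ltW rs') s'1).
have sE : s = T * s' by rewrite /s' mulrC divfK// gt_eqF.
have rE : r = T * r' by rewrite /r' mulrC divfK// gt_eqF.
have d0 : 0 < s' - r' by rewrite subr_gt0.
(* For the least such [l] the floors of the two points differ by at most one step, while rho^l is
   still at most 2^theta (s' - r')^theta. *)
have ex : exists l : nat, 2^-1 ^+ l.+1 < s' - r'.
  exists (Num.truncn (s' - r')^-1).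
  rewrite -[ltRHS]invrK exprVn ltf_pV2 ?posrE ?invr_gt0//.
  apply: lt_le_trans (truncnS_gt _) _.
  by rewrite -natrX ler_nat ltnW// ltn_expl.
case: (ex_minnP ex) => l hl lmin.
have hl' : s' - r' <= 2^-1 ^+ l.
  case: l lmin {hl} => [|l] lmin; first by rewrite expr0; lra.
  by rewrite leNgt; apply/negP => /lmin; rewrite ltnn.
have mid : `|F (T * dy l s') - F (T * dy l r')| <= B * rho ^+ l.
  have Br : 0 <= B * rho ^+ l by rewrite mulr_ge0// exprn_ge0// ltW.
  set j := Num.truncn (2 ^+ l * s'); set i := Num.truncn (2 ^+ l * r').
  have s'0 : 0 <= s' by case/andP : s'01.
  have h1 : i%:R <= 2 ^+ l * r' by rewrite truncn_le// mulr_ge0// ltW.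
  have h2 : 2 ^+ l * r' < i.+1%:R by exact: truncnS_gt.
  have h3 : j%:R <= 2 ^+ l * s' by rewrite truncn_le// mulr_ge0// ltW.
  have h4 : 2 ^+ l * s' < j.+1%:R by exact: truncnS_gt.
  have h5 : 2 ^+ l * s' <= 2 ^+ l * r' + 1.
    have : 2 ^+ l * (s' - r') <= 1 by rewrite mulrC -ler_pdivlMr// div1r -exprVn.
    by rewrite mulrBr; lra.
  have h6 : 2 ^+ l * r' < 2 ^+ l * s' by rewrite ltr_pM2l.
  have ij : (i < j.+1)%N by rewrite -(ltr_nat R); lra.
  have ji : (j < i.+2)%N by rewrite -(ltr_nat R) -natr1; move: h3 h5 h2; generalize (2 ^+ l * s') (2 ^+ l * r') => *; lra.
  have : j = i \/ j = i.+1.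
    move: ij ji; rewrite ltnS leq_eqVlt => /predU1P[->|ij]; first by left.
    by rewrite ltnS leq_eqVlt ltnS => /predU1P[->|]; [right|rewrite leqNgt ij].
  rewrite /dy -/i -/j => -[jE|jE]; rewrite jE; first by rewrite subrr normr0.
  apply: inc; rewrite -(ltr_nat R) natrX.
  have : i.+1%:R <= 2 ^+ l * s' by rewrite -jE.
  rewrite -natr1 => h7; apply: (@lt_le_trans _ _ (2 ^+ l * s')); first by lra.
  by rewrite ler_piMr// ltW.
(* One middle increment and two tails give the factor 2 c + 1. *)
have main : `|F s - F r| <= (2 * c + 1) * (B * rho ^+ l).
  rewrite sE rE (le_trans (ler_distD (F (T * dy l s')) _ _))//.
  have h1 := tail l s'01; have h2 := tail l r'01.
  have h3 : `|F (T * dy l s') - F (T * r')| <= B * rho ^+ l + B * rho ^+ l * c.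
    by rewrite (le_trans (ler_distD (F (T * dy l r')) _ _))// lerD// distrC.
  by move: h1 h3; rewrite -/c; lra.
apply: (le_trans main).
have hr : rho ^+ l <= 2 `^ theta / T `^ theta * (s - r) `^ theta.
  have -> : s - r = T * (s' - r') by rewrite mulrBr -sE -rE.
  rewrite powRM ?(ltW T0) ?(ltW d0)// mulrA divfK ?gt_eqF ?powR_gt0//.
  rewrite -powRM ?(ltW d0)//.
  have -> : rho ^+ l = (2^-1 ^+ l) `^ theta.
    elim: (l) => [|j IH]; first by rewrite !expr0 powR1.
    by rewrite !exprS IH powRM ?exprn_ge0 ?invr_ge0// /rho -powR_inv1// -powRrM mulN1r.
  apply: ge0_ler_powR; rewrite ?nnegrE ?(ltW theta0) ?exprn_ge0 ?invr_ge0 ?mulr_ge0 ?(ltW d0)//.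
  by move: hl; rewrite exprS; lra.
rewrite [leRHS](_ : _ = (2 * c + 1) * (B * (2 `^ theta / T `^ theta * (s - r) `^ theta))); last by ring.
by apply: ler_wpM2l; [apply: addr_ge0 => //; exact: mulr_ge0|exact: ler_wpM2l].
Qed.

End dyadic_chaining.

(** * The partial sums as linear forms in the Gaussian variables *)

Section lepage_expansion.
Context {R : realType} (T1 T2 T3 : Type) (alpha H eta : R)
  (G : nat -> T1 -> R) (xi : nat -> T2 -> R) (g : nat -> T3 -> R[i]).

(** The real factor common to both parts of the k-th term. It depends on the first two coordinates
    only, so that with these fixed the partial sums are linear in the parts of the [g k]. *)
Definition lepage_amplitude (k : nat) (w : T1 * T2) : R :=
  C_stable alpha * (G k w.1 `^ (- alpha^-1) * phi eta (xi k w.2) `^ (- alpha^-1))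
    / `|xi k w.2| `^ (alpha^-1 + H).

Definition lepage_term (t : R) (k : nat) (w : T1 * T2 * T3) : R :=
  lepage_amplitude k w.1 * (cos (t * xi k w.1.2) - 1) * complex.Re (g k w.2)
  - lepage_amplitude k w.1 * sin (t * xi k w.1.2) * complex.Im (g k w.2).

Lemma lepage_sumE n t w : lepage_sum alpha H eta G xi g n t w = \sum_(k < n) lepage_term t k w.
Proof.
rewrite /lepage_sum; have ReD : {morph (@complex.Re R) : x y / x + y >-> x + y} by move=> [a b] [c d].
rewrite (big_morph _ ReD (erefl : complex.Re 0 = 0)) mulr_sumr; apply: eq_bigr => k _.
rewrite /lepage_term /lepage_amplitude /noise_kernel.
set q := `|_| `^ _; set c := _ * (phi _ _ `^ _).
rewrite -fmorphV /cis; case: (g k w.2) => a b /=.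
ring.
Qed.

Definition lepage_increment (s r : R) (k : nat) (w : T1 * T2 * T3) : R :=
  lepage_amplitude k w.1 * (cos (s * xi k w.1.2) - cos (r * xi k w.1.2)) * complex.Re (g k w.2)
  - lepage_amplitude k w.1 * (sin (s * xi k w.1.2) - sin (r * xi k w.1.2)) * complex.Im (g k w.2).

Lemma lepage_sum_increment n s r w : lepage_sum alpha H eta G xi g n s w -
    lepage_sum alpha H eta G xi g n r w = \sum_(k < n) lepage_increment s r k w.
Proof.
rewrite !lepage_sumE -sumrB; apply: eq_bigr => k _.
by rewrite /lepage_term /lepage_increment; ring.
Qed.

Lemma continuous_lepage_sum n w : continuous (fun t => lepage_sum alpha H eta G xi g n t w).
Proof.
rewrite (_ : (fun t => _) = (fun t => \sum_(k < n) lepage_term t k w)); last first.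
  by apply/funext => t; exact: lepage_sumE.
elim: n => [|n IH].
  rewrite (_ : (fun t => _) = cst 0); first by move=> t; exact: cvg_cst.
  by apply/funext => t; rewrite big_ord0.
rewrite (_ : (fun t => _) = (fun t => \sum_(k < n) lepage_term t k w + lepage_term t n w)); last first.
  by apply/funext => t; rewrite big_ord_recr.
move=> t; apply: cvgD; first exact: IH.
have cl : (fun t : R => t * xi n w.1.2) x @[x --> t] --> t * xi n w.1.2.
  by apply: cvgMl; exact: cvg_id.
apply: cvgB; apply: cvgMl; apply: cvgMr.
  apply: cvgB; last exact: cvg_cst.
  by apply: (continuous_cvg _ _ cl); exact: continuous_cos.
by apply: (continuous_cvg _ _ cl); exact: continuous_sin.
Qed.

(** Up to a constant factor, the conditional variance of the k-th increment: the squared amplitude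
    times |exp(i s xi) - exp(i r xi)|^2. *)
Definition lepage_variance (s r : R) (w : T1 * T2) (k : nat) : R :=
  lepage_amplitude k w ^+ 2 * (2 - 2 * cos ((s - r) * xi k w.2)).

Lemma lepage_varianceE s r w k :
  (lepage_amplitude k w * (cos (s * xi k w.2) - cos (r * xi k w.2))) ^+ 2 +
  (- (lepage_amplitude k w * (sin (s * xi k w.2) - sin (r * xi k w.2)))) ^+ 2 =
  lepage_variance s r w k.
Proof.
rewrite /lepage_variance mulrBl cosD cosN sinN.
have := cos2Dsin2 (s * xi k w.2); have := cos2Dsin2 (r * xi k w.2).
move: (cos _) (sin _) (cos _) (sin _) (lepage_amplitude k w) => cr sr cs ss A hr hs.
transitivity (A ^+ 2 * ((cs ^+ 2 + ss ^+ 2) + (cr ^+ 2 + sr ^+ 2) - 2 * (cr * cs - sr * - ss))).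
  by ring.
by rewrite hr hs; congr (_ * (_ - _)); ring.
Qed.

Lemma lepage_variance_ge0 s r w k : 0 <= lepage_variance s r w k.
Proof. by rewrite -lepage_varianceE addr_ge0 ?sqr_ge0. Qed.

Lemma lepage_variance_le H' T : 1 < alpha -> 0 < eta -> 0 < H' < H -> H < 1 -> 0 < T ->
  exists2 L, 0 <= L & forall s r w k, 0 <= r -> r <= s -> s <= T ->
    lepage_variance s r w k <= L * G k w.1 `^ (- (2 / alpha)) * (s - r) `^ (2 * H').
Proof.
move=> a1 eta0 HH H1 T0; have a0 : 0 < alpha by exact: lt_trans a1.
have [L L0 hL] := lepage_kernel_bound a0 eta0 HH H1 T0.
exists (C_stable alpha ^+ 2 * L); first by rewrite mulr_ge0 ?sqr_ge0.
move=> s r w k r0 rs sT; rewrite /lepage_variance /lepage_amplitude.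
move: (C_stable alpha) => Cs.
have sq (x a : R) : (x `^ a) ^+ 2 = x `^ (2 * a).
  by rewrite -powR_mulrn ?powR_ge0// -powRrM mulrC.
rewrite !exprMn exprVn !sq.
rewrite (_ : 2 * - alpha^-1 = - (2 / alpha)); last by rewrite mulrN.
rewrite (_ : 2 * (alpha^-1 + H) = 2 / alpha + 2 * H); last by rewrite mulrDr.
have d0 : 0 <= s - r <= T by apply/andP; split; lra.
have := hL (xi k w.2) _ d0; set K := _ * (2 - _) => hK.
rewrite [leLHS](_ : _ = Cs ^+ 2 * G k w.1 `^ (- (2 / alpha)) * K); last by rewrite /K; ring.
rewrite [leRHS](_ : _ = Cs ^+ 2 * G k w.1 `^ (- (2 / alpha)) * (L * (s - r) `^ (2 * H'))); last by ring.
by apply: ler_wpM2l => //; rewrite mulr_ge0 ?sqr_ge0 ?powR_ge0.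
Qed.

End lepage_expansion.

(** * Almost sure bounds on a product space from conditional expectations *)

Lemma ae_fst {R : realType} d1 d2 (T1 : measurableType d1) (T2 : measurableType d2)
  (m1 : probability T1 R) (m2 : probability T2 R) (Q : T1 -> Prop) :
  {ae m1, forall x, Q x} -> {ae (m1 \x m2)%E, forall z, Q z.1}.
Proof.
move=> [N [mN N0 QN]]; exists (N `*` setT); split.
- exact: measurableX.
- transitivity (m1 N * m2 setT)%E; first exact: product_measure1E.
  by rewrite N0 mul0e.
- by move=> z /= nQ; split => //; exact: QN.
Qed.

Lemma measurable_gt_set {R : realType} d (T : measurableType d) (f : T -> R) (c : R) :
  measurable_fun setT f -> measurable [set z | c < f z].
Proof.
move=> mf; rewrite (_ : [set z | c < f z] = setT `&` (fun z => c < f z) @^-1` [set true]).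
  by apply: measurable_fun_ltr.
by rewrite setTI.
Qed.

Section supremum_bound.
Context {R : realType} d1 d2 d3 (T1 : measurableType d1) (T2 : measurableType d2) (T3 : measurableType d3)
  (P1 : probability T1 R) (P2 : probability T2 R) (P3 : probability T3 R).

(* Fubini plus Markov: a monotone family of functionals whose conditional
   expectations are bounded is almost surely bounded. *)
Lemma ae_bounded_sections (J : nat -> T1 * T2 -> R) (Q : T1 -> Prop) :
  (forall n, measurable_fun setT (J n)) -> (forall n z, 0 <= J n z) ->
  (forall n z, J n z <= J n.+1 z) -> {ae P1, forall x, Q x} ->
  (forall x, Q x -> exists2 K, 0 <= K & forall n, (\int[P2]_y (J n (x, y))%:E <= K%:E)%E) ->
  {ae (P1 \x P2)%E, forall z, exists B, forall n, J n z <= B}.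
Proof.
move=> mJ J0 Jmono aeQ JK.
have Jmono' m n z : (m <= n)%N -> J m z <= J n z.
  by move=> /subnKC <-; elim: (n - m)%N => [|i IH]; rewrite ?addn0// addnS (le_trans IH).
pose U j := \bigcup_n [set z | j%:R < J n z].
pose Bad := \bigcap_j U j.
have mU' j n : measurable [set z | j%:R < J n z] by exact: measurable_gt_set.
have mU j : measurable (U j) by apply: bigcup_measurable => n _; exact: mU'.
have mBad : measurable Bad by apply: bigcap_measurable => // j _; exact: mU.
exists Bad; split => //; last first.
  move=> z /= nB j _; apply: contrapT => hj; apply: nB; exists j%:R => n.
  by rewrite leNgt; apply/negP => h; apply: hj; exists n.
rewrite /product_measure1.
have h0 : {ae P1, forall x, setT x -> (P2 \o xsection Bad) x = 0%E}.
  apply: filterS aeQ => x Qx _; have [K K0 hK] := JK x Qx.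
  have mJx n : measurable_fun setT (fun y => J n (x, y)).
    by apply: (measurableT_comp (mJ n)); exact: pair1_measurable.
  have bnd j : (P2 (xsection Bad x) <= (K / j.+1%:R)%:E)%E.
    pose V n := [set y | j.+1%:R < J n (x, y)].
    have mV n : measurable (V n) by exact: measurable_gt_set.
    have PV n : (P2 (V n) <= (K / j.+1%:R)%:E)%E.
      have : (j.+1%:R%:E * P2 (V n) <= K%:E)%E.
        apply: le_trans (hK n).
        have mI : measurable_fun setT (\1_(V n) : T2 -> R) by exact: measurable_indic.
        have PVE : (P2 (V n) = \int[P2]_y (\1_(V n) y)%:E)%E by rewrite integral_indic// setIT.
        rewrite PVE -(ge0_integral_scaler P2 measurableT j.+1%:R)//.
        apply: (ge0_le_integralr P2 measurableT) => //; first exact: measurable_funM.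
        move=> y _; rewrite indicE; have [yV|yV] := boolP (y \in V n).
            by rewrite mulr1; move: yV; rewrite inE => /ltW.
          by rewrite mulr0.
      have fV : P2 (V n) \is a fin_num by exact: fin_num_measure.
      rewrite -(fineK fV) -EFinM !lee_fin => h.
      by rewrite ler_pdivlMr// mulrC.
    have Vcup : xsection Bad x `<=` \bigcup_n V n.
      move=> y; rewrite /xsection/= inE => /(_ j.+1 I) [n _ hn]; exists n => //.
    apply: (@le_trans _ _ (P2 (\bigcup_n V n))).
      by apply: le_measure; rewrite ?inE//; [exact: measurable_xsection|exact: bigcup_measurable].
    have cv := @nondecreasing_cvg_mu _ _ _ P2 V mV (bigcup_measurable (fun n _ => mV n)) _.
    have ndV : {homo V : n m / (n <= m)%N >-> (n <= m)%O}.
      by move=> m n mn; apply/subsetPset => y /= h; apply: (lt_le_trans h); exact: Jmono'.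
    apply: (cvge_to_le (cv ndV)); apply: nearW => n; exact: PV.
  apply/eqP; rewrite eq_le measure_ge0 andbT /=.
  have lim : ((K / j.+1%:R)%:E @[j --> \oo] --> 0%:E)%E.
    apply: cvg_EFin; first exact: nearW.
    by rewrite -[X in _ --> X](mulr0 K); apply: cvgMr; exact: cvg_harmonic.
  by apply: (cvge_to_ge lim); apply: nearW => j; exact: bnd.
have mx : measurable_fun setT (P2 \o xsection Bad) by exact: measurable_fun_xsection.
rewrite (ae_eq_integral (cst 0%E))//; first by rewrite integral0.
Qed.

End supremum_bound.

Lemma powR_exprn {R : realType} (a x : R) (k : nat) : (a `^ x) ^+ k = a `^ (x * k%:R).
Proof. by rewrite -powR_mulrn ?powR_ge0// powRrM. Qed.

Lemma powR_lt1_exp {R : realType} (a x : R) : 1 < a -> x < 0 -> a `^ x < 1.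
Proof.
move=> a1 x0; have a0 : 0 < a by exact: lt_trans a1.
by rewrite /powR gt_eqF// expR_lt1 nmulr_rlt0// ln_gt0.
Qed.

(** * A Hoelder bound for the partial sums, uniform in their length *)

Section lepage_paths.
Context {R : realType} (alpha H eta : R) d1 d2 d3 (T1 : measurableType d1)
  (T2 : measurableType d2) (T3 : measurableType d3)
  (P1 : probability T1 R) (P2 : probability T2 R) (P3 : probability T3 R)
  (G : nat -> {RV P1 >-> R}) (xi : nat -> {RV P2 >-> R}) (g : nat -> T3 -> R[i]).
Hypotheses (halpha : 1 < alpha < 2) (hH : 2^-1 < H < 1) (heta : 0 < eta)
  (G_arrival : poisson_arrival_times P1 1 (fun k => G k : T1 -> R))
  (g_rv : forall k, complex_rv (g k))
  (g_indep : mutually_independent P3 (fun k w => RtoR2 (g k w)))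
  (g_gaussian : forall k, complex_gaussian P3 (g k))
  (g_rotinv : forall k, rotationally_invariant P3 (g k))
  (g_moment : forall k, (\int[P3]_w (`|complex.Re (g k w)| `^ alpha)%:E = 1)%E).

Let inc (s r : R) (k : nat) (w : T1 * T2 * T3) : R := lepage_increment alpha H eta (fun k => G k : T1 -> R) (fun k => xi k : T2 -> R) g s r k w.
Let amp (k : nat) (w : T1 * T2) : R := lepage_amplitude alpha H eta (fun k => G k : T1 -> R) (fun k => xi k : T2 -> R) k w.
Let var (s r : R) (w : T1 * T2) (k : nat) : R := lepage_variance alpha H eta (fun k => G k : T1 -> R) (fun k => xi k : T2 -> R) s r w k.

Lemma measurable_lepage_amplitude k : measurable_fun setT (amp k).
Proof.
have mG : measurable_fun setT (fun w : T1 * T2 => G k w.1) by exact: measurableT_comp.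
have mx : measurable_fun setT (fun w : T1 * T2 => xi k w.2) by exact: measurableT_comp.
have mpow (f : T1 * T2 -> R) a : measurable_fun setT f -> measurable_fun setT (fun w => f w `^ a).
  by move=> mf; apply: (measurableT_comp (@measurable_powR _ _)).
have mabs : measurable_fun setT (fun w : T1 * T2 => `|xi k w.2|) by exact: measurableT_comp.
rewrite /amp /lepage_amplitude /phi /phi_unnormalized.
apply: measurable_funM; last by apply: measurable_invr; exact: mpow.
apply: measurable_funM => //; apply: measurable_funM; first exact: mpow.
apply: (mpow _ _); apply: measurable_funM => //; apply: measurable_funM; first exact: measurable_invr.
apply: (mpow _ _); apply: measurable_funD => //; apply: measurableT_comp => //.
by apply: (measurableT_comp (@measurable_ln R)).
Qed.

Lemma measurable_lepage_increment s r k : measurable_fun setT (inc s r k).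
Proof.
have ma : measurable_fun setT (fun w : T1 * T2 * T3 => amp k w.1).
  by apply: (measurableT_comp (measurable_lepage_amplitude k)).
have mx : measurable_fun setT (fun w : T1 * T2 * T3 => xi k w.1.2).
  by do 2 apply: measurableT_comp => //.
have mre : measurable_fun setT (fun w : T1 * T2 * T3 => complex.Re (g k w.2)).
  by apply: (measurableT_comp (measurable_Re (g_rv k))).
have mim : measurable_fun setT (fun w : T1 * T2 * T3 => complex.Im (g k w.2)).
  by apply: (measurableT_comp (measurable_Im (g_rv k))).
have mc t : measurable_fun setT (fun w : T1 * T2 * T3 => cos (t * xi k w.1.2)).
  by apply: (measurableT_comp (continuous_measurable_fun (@continuous_cos R))); exact: measurable_funM.
have ms t : measurable_fun setT (fun w : T1 * T2 * T3 => sin (t * xi k w.1.2)).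
  by apply: (measurableT_comp (continuous_measurable_fun (@continuous_sin R))); exact: measurable_funM.
apply: measurable_funB; (apply: measurable_funM => //); (apply: measurable_funM => //);
  exact: measurable_funB.
Qed.

Let mXs s r (w : T1 * T2) k : measurable_fun setT (fun w3 : T3 => inc s r k (w, w3)).
Proof. by apply: (measurableT_comp (measurable_lepage_increment s r k)); exact: pair1_measurable. Qed.

Lemma lepage_block_moment m s r w i j : (0 < m)%N -> (i <= j)%N ->
  (\int[P3]_w3 (block_sum (fun k w3 => inc s r k (w, w3)) i j w3 ^+ m.*2)%:E <=
   (gaussian_moment m * (\sum_(i <= k < j) var s r w k) ^+ m)%:E)%E.
Proof.
move=> m0 ij.
(* Coefficients below [i] are set to 0, so that a block becomes a sum of [j] terms as in
   [gaussian_sum_moment]. *)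
pose a k : R := if (i <= k)%N then amp k w * (cos (s * xi k w.2) - cos (r * xi k w.2)) else 0.
pose b k : R := if (i <= k)%N then - (amp k w * (sin (s * xi k w.2) - sin (r * xi k w.2))) else 0.
have := gaussian_sum_moment halpha g_rv g_indep g_gaussian g_rotinv g_moment a b j m0.
have -> : \sum_(k < j) (a k ^+ 2 + b k ^+ 2) = \sum_(i <= k < j) var s r w k.
  rewrite [RHS]big_geq_mkord [RHS]big_mkcond; apply: eq_bigr => k _; rewrite /a /b /=.
  by case: ifP => _; [exact: lepage_varianceE|rewrite expr0n/= addr0].
apply: le_trans; rewrite le_eqVlt; apply/orP; left; apply/eqP.
apply: eq_integral => w3 _; congr ((_ ^+ _)%:E).
rewrite /block_sum /gaussian_sum [LHS]big_geq_mkord [LHS]big_mkcond; apply: eq_bigr => k _.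
rewrite /a /b /=; case: ifP => _; last by rewrite !mul0r addr0.
by rewrite /inc /lepage_increment mulNr.
Qed.

Definition moricz_constant (m : nat) : R := 4 * (4 * m%:R + 1) ^+ m.*2 * gaussian_moment m.

Lemma lepage_block_max_moment m s r w n : (2 <= m)%N ->
  (\int[P3]_w3 (block_max (inc s r) 0 n (w, w3) ^+ m.*2)%:E <=
   (moricz_constant m * (\sum_(k < n) var s r w k) ^+ m)%:E)%E.
Proof.
move=> m2; have := @moricz_maximal R _ T3 P3 (fun k w3 => inc s r k (w, w3)) (var s r w) m (gaussian_moment m)
  (mXs s r w) (lepage_variance_ge0 _ _ _ _ _ _ _ _) m2 (gaussian_moment_ge0 _)
  (fun i j ij => lepage_block_moment s r w (ltnW m2) ij) 0%N n (leq0n n).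
by rewrite big_mkord.
Qed.

(* [level_sum n] collects the maximal increments, over all truncations of the
   series below [n], at the dyadic levels below [n]. *)
Definition level_sum (T theta : R) (m n : nat) (w : T1 * T2 * T3) : R :=
  \sum_(l < n) (2 `^ theta) ^+ (l * m.*2) *
    \sum_(i < 2 ^ l) block_max (inc (T * (i.+1%:R / 2 ^+ l)) (T * (i%:R / 2 ^+ l))) 0 n w ^+ m.*2.

Lemma measurable_level_sum T theta m n : measurable_fun setT (level_sum T theta m n).
Proof.
apply: measurable_sum => l; apply: measurable_funM => //.
apply: measurable_sum => i; apply: measurable_funX.
by apply: measurable_block_max => k; exact: measurable_lepage_increment.
Qed.

Lemma level_term_ge0 T theta m n w l : 0 <= (2 `^ theta) ^+ (l * m.*2) *
    \sum_(i < 2 ^ l) block_max (inc (T * (i.+1%:R / 2 ^+ l)) (T * (i%:R / 2 ^+ l))) 0 n w ^+ m.*2.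
Proof.
rewrite mulr_ge0 ?exprn_ge0 ?powR_ge0// sumr_ge0// => i _.
by rewrite exprn_ge0// block_max_ge0.
Qed.

Lemma level_sum_ge0 T theta m n w : 0 <= level_sum T theta m n w.
Proof. by apply: sumr_ge0 => l _; exact: level_term_ge0. Qed.

Lemma le_block_max_r s r n w : block_max (inc s r) 0 n w <= block_max (inc s r) 0 n.+1 w.
Proof.
apply: block_max_le; first exact: block_max_ge0.
by move=> k /andP[_ kn]; apply: le_block_max; rewrite leq0n/= ltnW.
Qed.

Lemma level_sum_mono T theta m n w : level_sum T theta m n w <= level_sum T theta m n.+1 w.
Proof.
rewrite {2}/level_sum big_ord_recr/=; apply: ler_wpDr; first exact: level_term_ge0.
apply: ler_sum => l _; apply: ler_wpM2l; first by rewrite exprn_ge0 ?powR_ge0.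
apply: ler_sum => i _; rewrite lerXn2r ?nnegrE ?block_max_ge0//.
exact: le_block_max_r.
Qed.

(** Level l has 2^l increments, each with maximal moment at most D 2^(-2 H' m l) and weight 2^(2 m
    theta l); the product is D q^l, and q < 1 makes the sum over the levels geometric. The bound
    sees the arrival times through [B] alone, and it is uniform in the second coordinate. *)
Lemma integral_level_sum_le T theta H' m : 0 < T -> (2 <= m)%N -> 0 < H' < H ->
  2 `^ (m.*2%:R * (theta - H') + 1) < 1 ->
  forall w1 : T1, (exists B, forall n, \sum_(k < n) G k w1 `^ (- (2 / alpha)) <= B) ->
  exists2 K, 0 <= K & forall n w2, (\int[P3]_w3 (level_sum T theta m n (w1, w2, w3))%:E <= K%:E)%E.
Proof.
move=> T0 m2 HH q1 w1 [B hB].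
set q : R := 2 `^ _ in q1; have q0 : 0 < q by exact: powR_gt0.
have a1 : 1 < alpha by case/andP: halpha.
have H1 : H < 1 by case/andP: hH.
have H'0 : 0 < H' by case/andP: HH.
have [L L0 hL] := lepage_variance_le (fun k => G k : T1 -> R) (fun k => xi k : T2 -> R) a1 heta HH H1 T0.
have B0 : 0 <= B by have := hB 0%N; rewrite big_ord0.
have C0 : 0 <= moricz_constant m.
  by rewrite !mulr_ge0 ?exprn_ge0 ?gaussian_moment_ge0// addr_ge0// mulr_ge0.
pose D := moricz_constant m * (L * B * T `^ (2 * H')) ^+ m.
have D0 : 0 <= D by rewrite mulr_ge0// exprn_ge0// !mulr_ge0// powR_ge0.
exists (D * (1 - q)^-1); first by rewrite mulr_ge0// invr_ge0 subr_ge0 ltW.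
move=> n w2; rewrite /level_sum.
have mbm s r : measurable_fun setT (fun w3 => block_max (inc s r) 0 n (w1, w2, w3) ^+ m.*2).
  apply: measurable_funX; apply: (@measurableT_comp _ _ _ _ _ _ (block_max (inc s r) 0 n)) => //.
    by apply: measurable_block_max => k; exact: measurable_lepage_increment.
have step l i : (i < 2 ^ l)%N ->
   (\int[P3]_w3 (block_max (inc (T * (i.+1%:R / 2 ^+ l)) (T * (i%:R / 2 ^+ l))) 0 n (w1, w2, w3) ^+ m.*2)%:E
     <= (D * (2 `^ (- (2 * H' * m%:R))) ^+ l)%:E)%E.
  move=> il; have p2 : 0 < 2 ^+ l :> R by exact: exprn_gt0.
  apply: (le_trans (lepage_block_max_moment _ _ _ _ m2)); rewrite lee_fin /D -mulrA.
  apply: ler_wpM2l => //.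
  rewrite [leRHS](_ : _ = (L * B * (T / 2 ^+ l) `^ (2 * H')) ^+ m); last first.
    rewrite powRM ?invr_ge0 ?(ltW T0) ?(ltW p2)// mulrA [RHS]exprMn; congr (_ * _).
    have -> : 2 ^- l = 2 `^ (- l%:R) :> R by rewrite powRN powR_mulrn.
    by rewrite -powRrM !powR_exprn; congr (_ `^ _); ring.
  have v0 k : 0 <= var (T * (i.+1%:R / 2 ^+ l)) (T * (i%:R / 2 ^+ l)) (w1, w2) k by exact: lepage_variance_ge0.
  rewrite lerXn2r ?nnegrE//.
  - by apply: sumr_ge0.
  - by rewrite !mulr_ge0 ?powR_ge0.
  apply: (@le_trans _ _ (\sum_(k < n) L * G k w1 `^ (- (2 / alpha)) * (T / 2 ^+ l) `^ (2 * H'))).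
    apply: ler_sum => k _.
    have := hL (T * (i.+1%:R / 2 ^+ l)) (T * (i%:R / 2 ^+ l)) (w1, w2) k.
    rewrite -mulrBr -mulrBl -natrB// subSnn mul1r; apply.
    - by rewrite mulr_ge0 ?(ltW T0)// divr_ge0// ltW.
    - by rewrite ler_pM2l// ler_pM2r ?invr_gt0// ler_nat.
    - by rewrite ler_piMr ?(ltW T0)// ler_pdivrMr// mul1r -natrX ler_nat.
  rewrite -mulr_suml -mulr_sumr.
  by apply: ler_wpM2r; [exact: powR_ge0|apply: ler_wpM2l].
have b0 s r w3 : [set: T3] w3 -> 0 <= block_max (inc s r) 0 n (w1, w2, w3) ^+ m.*2.
  by move=> _; rewrite exprn_ge0// block_max_ge0.
have lev l : (\int[P3]_w3 ((2 `^ theta) ^+ (l * m.*2) * \sum_(i < 2 ^ l)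
    block_max (inc (T * (i.+1%:R / 2 ^+ l)) (T * (i%:R / 2 ^+ l))) 0 n (w1, w2, w3) ^+ m.*2)%:E <= (D * q ^+ l)%:E)%E.
  have c0 : 0 <= (2 `^ theta) ^+ (l * m.*2) :> R by rewrite exprn_ge0 ?powR_ge0.
  have msum N : measurable_fun setT (fun w3 => \sum_(i < N) block_max (inc (T * (i.+1%:R / 2 ^+ l)) (T * (i%:R / 2 ^+ l))) 0 n (w1, w2, w3) ^+ m.*2).
    by apply: measurable_sum => i; exact: mbm.
  have sum0 N w3 : [set: T3] w3 -> 0 <= \sum_(i < N) block_max (inc (T * (i.+1%:R / 2 ^+ l)) (T * (i%:R / 2 ^+ l))) 0 n (w1, w2, w3) ^+ m.*2.
    by move=> wT; apply: sumr_ge0 => i _; exact: b0.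
  rewrite (ge0_integral_scaler P3 measurableT _ _ c0)//; last exact: sum0.
  have sumle N : (N <= 2 ^ l)%N -> (\int[P3]_w3 (\sum_(i < N) block_max (inc (T * (i.+1%:R / 2 ^+ l)) (T * (i%:R / 2 ^+ l))) 0 n (w1, w2, w3) ^+ m.*2)%:E <= (N%:R * (D * (2 `^ (- (2 * H' * m%:R))) ^+ l))%:E)%E.
    elim: N => [|N IH] Nl.
      rewrite mul0r (_ : (\int[P3]_w3 _)%E = 0%E)//; apply: integral0_eq => w3 _.
      by rewrite big_ord0.
    rewrite (_ : (\int[P3]_w3 _)%E = (\int[P3]_w3 (\sum_(i < N) block_max (inc (T * (i.+1%:R / 2 ^+ l)) (T * (i%:R / 2 ^+ l))) 0 n (w1, w2, w3) ^+ m.*2)%:E + \int[P3]_w3 (block_max (inc (T * (N.+1%:R / 2 ^+ l)) (T * (N%:R / 2 ^+ l))) 0 n (w1, w2, w3) ^+ m.*2)%:E)%E); last first.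
      rewrite -(ge0_integral_addr P3 measurableT)//; last 2 first.
      - exact: sum0.
      - exact: b0.
      by apply: eq_integral => w3 _; rewrite big_ord_recr.
    set c := D * _ ^+ l in IH *.
    have -> : N.+1%:R * c = N%:R * c + c by rewrite -natr1 mulrDl mul1r.
    by rewrite EFinD; apply: leeD; [exact: IH (ltnW Nl)|exact: step].
  apply: (@le_trans _ _ (((2 `^ theta) ^+ (l * m.*2))%:E * ((2 ^ l)%N%:R * (D * (2 `^ (- (2 * H' * m%:R))) ^+ l))%:E)%E).
    by apply: lee_wpmul2l; [rewrite lee_fin|exact: sumle].
  rewrite -EFinM lee_fin le_eqVlt; apply/orP; left; apply/eqP.
  have -> : q = 2 `^ theta ^+ m.*2 * (2 * 2 `^ (- (2 * H' * m%:R))).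
    rewrite powR_exprn -[X in _ * (X * _)](powRr1 (ler0n R 2)) -!gt0_powRD//.
    rewrite /q; congr (_ `^ _); rewrite -muln2 natrM; ring.
  rewrite natrX [X in _ = D * X]exprMn -exprM mulnC [X in _ = D * (_ * X)]exprMn; ring.
have mlev l : measurable_fun setT (fun w3 => (2 `^ theta) ^+ (l * m.*2) * \sum_(i < 2 ^ l)
    block_max (inc (T * (i.+1%:R / 2 ^+ l)) (T * (i%:R / 2 ^+ l))) 0 n (w1, w2, w3) ^+ m.*2).
  by apply: measurable_funM => //; apply: measurable_sum => i; exact: mbm.
have lev0 l w3 : [set: T3] w3 -> 0 <= (2 `^ theta) ^+ (l * m.*2) * \sum_(i < 2 ^ l)
    block_max (inc (T * (i.+1%:R / 2 ^+ l)) (T * (i%:R / 2 ^+ l))) 0 n (w1, w2, w3) ^+ m.*2.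
  by move=> _; exact: level_term_ge0.
have tot N : (\int[P3]_w3 (\sum_(l < N) (2 `^ theta) ^+ (l * m.*2) * \sum_(i < 2 ^ l)
    block_max (inc (T * (i.+1%:R / 2 ^+ l)) (T * (i%:R / 2 ^+ l))) 0 n (w1, w2, w3) ^+ m.*2)%:E <= (\sum_(l < N) D * q ^+ l)%:E)%E.
  elim: N => [|N IH].
    rewrite big_ord0 (_ : (\int[P3]_w3 _)%E = 0%E)//; apply: integral0_eq => w3 _.
    by rewrite big_ord0.
  rewrite big_ord_recr EFinD; apply: le_trans (leeD IH (lev N)).
  rewrite -(ge0_integral_addr P3 measurableT)//; last 3 first.
  - by apply: measurable_sum => l; exact: mlev.
  - by move=> w3 wT; apply: sumr_ge0 => l _; exact: lev0.
  - exact: lev0.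
  rewrite le_eqVlt; apply/orP; left; apply/eqP.
  by apply: eq_integral => w3 _; rewrite big_ord_recr.
apply: (le_trans (tot n)); rewrite lee_fin.
have := @geometric_le_lim R n D q D0 q0; rewrite gtr0_norm// => /(_ q1).
by rewrite /series/= big_mkord.
Qed.

(** Once [level_sum] is bounded by [B], each of its terms bounds an increment of level l by B^(1 /
    (2 m)) 2^(- theta l), for all lengths of the partial sum at once, and [dyadic_chaining] applies
    path by path. *)
Lemma lepage_holder (T : R) : 0 < T -> exists2 theta, 2^-1 < theta < 1 &
  {ae ((P1 \x P2) \x P3)%E, forall w, exists2 K, 0 <= K & forall n s r, 0 <= r -> r <= s -> s <= T ->
    `|lepage_sum alpha H eta (fun k => G k : T1 -> R) (fun k => xi k : T2 -> R) g n s w -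
      lepage_sum alpha H eta (fun k => G k : T1 -> R) (fun k => xi k : T2 -> R) g n r w| <= K * (s - r) `^ theta}.
Proof.
move=> T0; have /andP[H2 H1] := hH.
(* Two midpoints, so that 1/2 < theta < H' < H. The gap H' - theta determines the moment: 2 m (H' -
   theta) has to exceed 1 to pay for the 2^l increments of a level. *)
pose H' := (2^-1 + H) / 2; pose theta := (2^-1 + H') / 2.
have H'H : 0 < H' < H by rewrite /H'; apply/andP; split; lra.
have th : 2^-1 < theta < 1 by rewrite /theta /H'; apply/andP; split; lra.
have thH : theta < H' by rewrite /theta /H'; lra.
exists theta => //.
pose m := (Num.truncn (H' - theta)^-1).+2.
have m2 : (2 <= m)%N by [].
have dH : 0 < H' - theta by rewrite subr_gt0.
have q1 : 2 `^ (m.*2%:R * (theta - H') + 1) < 1.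
  have hm : 1 < m%:R * (H' - theta).
    rewrite -ltr_pdivrMr// div1r; apply: (lt_le_trans (truncnS_gt _)).
    by rewrite ler_nat.
  apply: powR_lt1_exp; first by rewrite ltr1n.
  by rewrite -muln2 natrM; lra.
have th0 : 0 < theta by case/andP: th => th _; apply: lt_trans th; rewrite invr_gt0.
have a1 : 1 < alpha by case/andP: halpha.
have a2 : 1 < 2 / alpha by rewrite ltr_pdivlMr ?mul1r ?(lt_trans _ a1)//; case/andP: halpha.
have aeB : {ae P1, forall w, exists B, forall n, \sum_(k < n) G k w `^ (- (2 / alpha)) <= B}.
  have [N hN hG] := G_arrival.
  exact: (arrival_sum_ae hN hG a2).
have aeB2 := @ae_fst R _ _ T1 T2 P1 P2 _ aeB.
have bnd : {ae ((P1 \x P2) \x P3)%E, forall z, exists B, forall n, level_sum T theta m n z <= B}.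
  apply: (@ae_bounded_sections R _ _ (T1 * T2)%type T3 (P1 \x P2)%E P3 (level_sum T theta m)
    (fun w12 => exists B, forall n, \sum_(k < n) G k w12.1 `^ (- (2 / alpha)) <= B)).
  - by move=> n; exact: measurable_level_sum.
  - by move=> n z; exact: level_sum_ge0.
  - by move=> n z; exact: level_sum_mono.
  - exact: aeB2.
  - move=> [w1 w2] hB; have [K K0 hK] := integral_level_sum_le T0 m2 H'H q1 hB.
    by exists K => // n; exact: hK.
apply: filterS bnd => w [B hB].
have B0 : 0 <= B by apply: le_trans (hB 0%N); exact: level_sum_ge0.
pose m2R : R := m.*2%:R; have mm0 : m2R != 0 by rewrite pnatr_eq0 double_eq0.
pose b := B `^ m2R^-1; have b0 : 0 <= b by exact: powR_ge0.
pose rho : R := 2 `^ (- theta); have rho0 : 0 < rho by exact: powR_gt0.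
have rho1 : rho < 1.
  by apply: powR_lt1_exp; rewrite ?ltr1n// oppr_lt0.
exists ((2 * (rho / (1 - rho)) + 1) * 2 `^ theta / T `^ theta * b).
  rewrite mulr_ge0// divr_ge0 ?powR_ge0// mulr_ge0 ?powR_ge0// addr_ge0// mulr_ge0//.
  by rewrite divr_ge0 ?(ltW rho0)// subr_ge0 ltW.
move=> n s r; apply: (@dyadic_chaining R (fun t => lepage_sum alpha H eta (fun k => G k : T1 -> R) (fun k => xi k : T2 -> R) g n t w)) => //.
  by apply: continuous_subspaceT; exact: continuous_lepage_sum.
move=> l i il; rewrite lepage_sum_increment.
(* Large enough for [level_sum] at [N] to contain both the level [l] and the partial sum of length
   [n]. *)
pose N := maxn n l.+1.
set x := `|_|; have x0 : 0 <= x by rewrite /x normr_ge0.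
have h1 : (2 `^ theta) ^+ (l * m.*2) * x ^+ m.*2 <= B.
  apply: le_trans (hB N).
  have lN : (l < N)%N by exact: leq_maxr.
  rewrite /level_sum (bigD1 (Ordinal lN))//=.
  apply: ler_wpDr; first by apply: sumr_ge0 => j _; exact: level_term_ge0.
  apply: ler_wpM2l; first by rewrite exprn_ge0 ?powR_ge0.
  rewrite (bigD1 (Ordinal il))//=; apply: ler_wpDr.
    by apply: sumr_ge0 => j _; rewrite exprn_ge0// block_max_ge0.
  rewrite lerXn2r ?nnegrE ?block_max_ge0//.
  have := @le_block_max R _ _ (inc (T * (i.+1%:R / 2 ^+ l)) (T * (i%:R / 2 ^+ l))) 0 N n w.
  by rewrite leq0n leq_maxl /block_sum big_mkord => /(_ isT).
have h2 : (((2 `^ theta) ^+ l * x) ^+ m.*2) `^ m2R^-1 <= b.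
  apply: ge0_ler_powR; rewrite ?nnegrE ?invr_ge0 ?exprn_ge0 ?mulr_ge0 ?exprn_ge0 ?powR_ge0//.
  by rewrite exprMn -exprM.
have y0 : 0 <= (2 `^ theta) ^+ l * x by rewrite mulr_ge0 ?exprn_ge0 ?powR_ge0.
rewrite -powR_mulrn// -powRrM mulfV// powRr1// in h2.
rewrite -(ler_pM2l (exprn_gt0 l (powR_gt0 theta (ltr0n R 2)))).
apply: (le_trans h2); rewrite mulrCA -exprMn -gt0_powRD// subrr powRr0 expr1n mulr1.
exact: lexx.
Qed.

End lepage_paths.

(** * From convergence at dyadic times to convergence at all times *)

Section path_convergence.
Context {R : realType}.

Definition dyadic_floor (s : R) (j : nat) : R := (Num.truncn (s * 2 ^+ j))%:R / 2 ^+ j.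

Lemma dyadic_floor_bounds (s : R) j : 0 <= s -> 0 <= dyadic_floor s j <= s /\ s - dyadic_floor s j < (2 ^+ j)^-1.
Proof.
move=> s0; have p0 : 0 < 2 ^+ j :> R by rewrite exprn_gt0.
have sj : 0 <= s * 2 ^+ j by rewrite mulr_ge0 ?(ltW p0).
have /andP[h1 h2] := truncn_itv sj.
split; first by rewrite divr_ge0 ?(ltW p0)//= ler_pdivrMr.
rewrite ltrBlDr -[(2 ^+ j)^-1]mul1r -mulrDl ltr_pdivlMr//.
by rewrite nat1r.
Qed.

Lemma dyadic_floor_le (r s : R) j : 0 <= r -> r <= s -> dyadic_floor r j <= dyadic_floor s j.
Proof.
move=> r0 rs; have p0 : 0 < 2 ^+ j :> R by rewrite exprn_gt0.
apply: ler_wpM2r; first by rewrite invr_ge0 ltW.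
have rj : r * 2 ^+ j <= s * 2 ^+ j by rewrite ler_wpM2r// ltW.
have rj0 : 0 <= r * 2 ^+ j by rewrite mulr_ge0// ltW.
have /andP[h1 _] := truncn_itv rj0.
have /andP[_ h2] := truncn_itv (le_trans rj0 rj).
by rewrite ler_nat -ltnS -(ltr_nat R) (le_lt_trans h1)// (le_lt_trans rj).
Qed.

Lemma cvg_dyadic_floor (s : R) : 0 <= s -> dyadic_floor s @ \oo --> s.
Proof.
move=> s0; apply/cvgrPdist_lt => e e0; near=> j.
have [/andP[d0 ds] d1] := dyadic_floor_bounds j s0.
rewrite ger0_norm ?subr_ge0//; apply: (lt_trans d1).
rewrite invf_plt ?posrE ?exprn_gt0//.
apply: (@lt_le_trans _ _ j%:R); last by rewrite -natrX ler_nat ltnW// ltn_expl.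
by near: j; exact: nbhs_infty_gtr.
Unshelve. all: by end_near.
Qed.

(** Dyadic floors lie below the point and hence stay in [0, T], even if [T] is not dyadic. The bound
    passes to the limit in n at dyadic times, then to all times by continuity of [y]; a comparison
    through one dyadic time, in three parts, gives the convergence everywhere. *)
Lemma hoelder_path_limit (z : nat -> R -> R) (y : R -> R) (T K theta : R) : 0 < theta -> 0 <= K ->
  (forall n s r, 0 <= r -> r <= s -> s <= T -> `|z n s - z n r| <= K * (s - r) `^ theta) ->
  (forall k j, (fun n => z n (k%:R / 2 ^+ j)) @ \oo --> y (k%:R / 2 ^+ j)) ->
  {within `[0, +oo[, continuous y} ->
  (forall s r, 0 <= r -> r <= s -> s <= T -> `|y s - y r| <= K * (s - r) `^ theta) /\
  (forall s, 0 <= s <= T -> (fun n => z n s) @ \oo --> y s).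
Proof.
move=> th0 K0 zH zy cy.
have cvy s : 0 <= s -> (fun j => y (dyadic_floor s j)) @ \oo --> y s.
  move=> s0; apply/cvgrPdist_lt => e e0.
  have /subspace_continuousP /(_ s) := cy; rewrite /= in_itv/= s0 => /(_ isT).
  move=> /cvgrPdist_lt /(_ e e0); rewrite near_withinE => hn.
  have hn2 : \forall j \near \oo, `[0, +oo[%classic (dyadic_floor s j) -> `|y s - y (dyadic_floor s j)| < e.
    exact: (cvg_dyadic_floor s0 hn).
  move: hn2; apply: filterS => j; apply; rewrite /= in_itv/= andbT.
  by have [/andP[]] := dyadic_floor_bounds j s0.
have cvK (s r : R) : 0 <= r -> r <= s -> (fun j => K * (dyadic_floor s j - dyadic_floor r j) `^ theta) @ \oo --> K * (s - r) `^ theta.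
  move=> r0 rs; have s0 := le_trans r0 rs; apply: cvgMr.
  have cd : (fun j => dyadic_floor s j - dyadic_floor r j) @ \oo --> s - r.
    by apply: cvgB; exact: cvg_dyadic_floor.
  have [sr|sr] := eqVneq s r.
    by rewrite sr subrr; under eq_fun do rewrite subrr; exact: cvg_cst.
  have sr0 : 0 < s - r by rewrite subr_gt0 lt_neqAle eq_sym sr.
  apply: (@continuous_cvg _ R R (nbhs \oo) _ (fun j => dyadic_floor s j - dyadic_floor r j) (fun a => a `^ theta) (s - r)).
    exact: continuous_powR_gt0.
  exact: cd.
have yH s r : 0 <= r -> r <= s -> s <= T -> `|y s - y r| <= K * (s - r) `^ theta.
  move=> r0 rs sT; have s0 := le_trans r0 rs.
  have c1 : (fun j => `|y (dyadic_floor s j) - y (dyadic_floor r j)|) @ \oo --> `|y s - y r|.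
    by apply: cvg_norm; apply: cvgB; exact: cvy.
  have c2 := cvK s r r0 rs.
  apply: (ler_cvg_to c1 c2); apply: nearW => j.
  have [/andP[a1 a2] _] := dyadic_floor_bounds j s0.
  have [/andP[b1 b2] _] := dyadic_floor_bounds j r0.
  have c3 : (fun n => `|z n (dyadic_floor s j) - z n (dyadic_floor r j)|) @ \oo --> `|y (dyadic_floor s j) - y (dyadic_floor r j)|.
    by apply: cvg_norm; apply: cvgB; exact: zy.
  apply: (cvgr_to_le c3); apply: nearW => n; apply: zH => //; first exact: dyadic_floor_le.
  exact: le_trans sT.
split=> // s /andP[s0 sT]; apply/cvgrPdist_lt => e e0.
have e3 : 0 < e / 3 by rewrite divr_gt0.
have [/andP[z1 z2] _] := dyadic_floor_bounds 0%N s0.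
have cK : (fun j => K * (s - dyadic_floor s j) `^ theta) @ \oo --> (0 : R).
  rewrite -[X in _ --> X](mulr0 K); apply: cvgMr.
  apply/cvgrPdist_lt => d d0.
  have := cvg_dyadic_floor s0 => /cvgrPdist_lt /(_ (d `^ theta^-1) (powR_gt0 _ d0)).
  apply: filterS => j; have [/andP[a1 a2] _] := dyadic_floor_bounds j s0.
  rewrite ger0_norm ?subr_ge0// sub0r normrN ger0_norm ?powR_ge0// => h.
  have dE : d = (d `^ theta^-1) `^ theta by rewrite -powRrM mulVf ?gt_eqF// powRr1// ltW.
  by rewrite dE gt0_ltr_powR// ?nnegrE ?subr_ge0// powR_ge0.
move: cK => /cvgrPdist_lt /(_ _ e3) [j _ /(_ j (leqnn _))].
have [/andP[a1 a2] _] := dyadic_floor_bounds j s0.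
set r := dyadic_floor s j in a1 a2 *.
rewrite sub0r normrN ger0_norm ?mulr_ge0 ?powR_ge0// => hr.
have := zy (Num.truncn (s * 2 ^+ j)) j => /cvgrPdist_lt /(_ _ e3).
apply: filterS => n hn.
have h1 := yH s r a1 a2 sT; have h2 := zH n s r a1 a2 sT.
have -> : y s - z n s = (y s - y r) + (y r - z n r) - (z n s - z n r) by ring.
apply: le_lt_trans (ler_normB _ _) _.
have h3 := ler_normD (y s - y r) (y r - z n r).
have hn' : `|y r - z n r| < e / 3 by exact: hn.
lra.
Qed.

End path_convergence.

(** The order picked by [frac_integral] is admissible as soon as some order is, and by
    [frac_forward] the integrals of both orders are limits of the same sequence. *)
Lemma frac_integralE {R : realType} (T : R) (p pc q qc : R -> R) (Mp Mq b : R) : 0 < T ->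
  continuous pc -> (forall x, `|pc x| <= Mp) -> (forall x, 0 < x < T -> pc x = p x) ->
  continuous qc -> (forall x, `|qc x| <= Mq) -> (forall x, 0 <= x <= T -> qc x = q x) ->
  frac_admissible 0 T p q b ->
  frac_integral 0 T p q = - \int[@lebesgue_measure R]_(x in `[0, T])
    (left_fderiv b 0 p x * right_fderiv (1 - b) T (fun y => q y - q T) x).
Proof.
move=> T0 cpc pcM pcE cqc qcM qcE hb; rewrite /frac_integral.
set beta := xget _ _.
have hbeta : frac_admissible 0 T p q beta.
  exact: (@xgetPex _ 2^-1 [set beta | frac_admissible 0 T p q beta] (ex_intro _ b hb)).
have b01 : 0 < b < 1 by case: hb.
have beta01 : 0 < beta < 1 by case: hbeta.
have L1 := @frac_forward R beta T beta01 T0 p pc q qc Mp Mq cpc pcM pcE cqc qcM qcE hbeta.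
have L2 := @frac_forward R b T b01 T0 p pc q qc Mp Mq cpc pcM pcE cqc qcM qcE hb.
have uniq (u : nat -> R) (l l' : R) : u @ \oo --> l -> u @ \oo --> l' -> l = l'.
  by move=> /(cvg_lim (@Rhausdorff R)) <- /(cvg_lim (@Rhausdorff R)) <-.
exact: (congr1 -%R (uniq _ _ _ L1 L2)).
Qed.

(** * Fractional integrals of order 1/2 against Hoelder paths *)

Section hoelder_paths.
Context {R : realType}.
Notation mu := (@lebesgue_measure R).
Variables (T theta K : R).
Hypotheses (T0 : 0 < T) (hth : 2^-1 < theta < 1) (K0 : 0 <= K).

Definition hoelder_path (q : R -> R) : Prop :=
  forall s r, 0 <= r -> r <= s -> s <= T -> `|q s - q r| <= K * (s - r) `^ theta.

Let qb (q : R -> R) (y : R) := q y - q T.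
Let th0 : 0 < theta. Proof. by case/andP: hth => h _; apply: lt_trans h; rewrite invr_gt0. Qed.
Let g0 : 0 < theta - 2^-1. Proof. by rewrite subr_gt0; case/andP: hth. Qed.
Let mT : measurable (`]0, T[%classic : set R). Proof. exact: measurable_itv. Qed.
Let k (x u : R) : R := (u - x) `^ (theta - 2^-1 - 1).

Let integral_k x : x < T -> mu.-integrable `]x, T[ (EFin \o k x) /\
  \int[mu]_(u in `]x, T[) k x u = (T - x) `^ (theta - 2^-1) / (theta - 2^-1).
Proof.
move=> xT; have X0 : 0 <= T - x by rewrite subr_ge0 ltW.
have hI u : (u \in `]x, T[) = (0 < 1 * u + - x < T - x).
  by rewrite in_itv/=; apply/idP/idP => /andP[? ?]; apply/andP; split; lra.
have := integral_powR_affine g0 X0 (normr1 R) hI.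
have -> : (fun u : R => (1 * u + - x) `^ (theta - 2^-1 - 1)) = k x.
  by apply/funext => u; rewrite mul1r.
exact.
Qed.

(** Freezing the path outside [0, T] yields the bounded continuous extension that [frac_integralE]
    takes as input. *)
Lemma clamp_hoelder (q : R -> R) : hoelder_path q ->
  let qc s := q (Num.max 0 (Num.min s T)) in
  [/\ continuous qc, forall x, `|qc x| <= `|q 0| + K * T `^ theta & forall x, 0 <= x <= T -> qc x = q x].
Proof.
move=> hq qc.
have cl s : 0 <= Num.max 0 (Num.min s T) <= T.
  by rewrite le_max lexx/= ge_max (ltW T0)/= ge_min lexx orbT.
split.
- apply: (@hoelder_continuous R qc K theta th0) => v u vu.
  have [/andP[a1 a2] [a3 a4]] := clamp_dist T0 vu.
  apply: (le_trans (hq _ _ a1 a2 a3)); apply: ler_wpM2l => //.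
  apply: ge0_ler_powR; rewrite ?nnegrE ?subr_ge0 ?(ltW th0)//.
  by move: a4; rewrite le_min => /andP[].
- move=> s; have /andP[c0 cT] := cl s.
  have h := hq _ 0 (lexx 0) c0 cT.
  have h2 : K * (Num.max 0 (Num.min s T) - 0) `^ theta <= K * T `^ theta.
    by apply: ler_wpM2l => //; apply: ge0_ler_powR; rewrite ?nnegrE ?subr0 ?(ltW th0) ?(ltW T0).
  rewrite /qc; have := ler_normD (q (Num.max 0 (Num.min s T)) - q 0) (q 0).
  by rewrite subrK; lra.
- by move=> x /andP[x0 xT]; rewrite /qc (min_idPl xT) (max_idPr x0).
Qed.

Let quotient_le q x u : hoelder_path q -> 0 < x -> x < u -> u < T ->
  `|(qb q x - qb q u) / (u - x) `^ (1 + 2^-1)| <= K * k x u.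
Proof.
move=> hq x0 xu uT; have d0 : 0 < u - x by rewrite subr_gt0.
rewrite normrM normfV (ger0_norm (powR_ge0 _ _)) ler_pdivrMr ?powR_gt0//.
rewrite -mulrA -gt0_powRD//.
have -> : theta - 2^-1 - 1 + (1 + 2^-1) = theta by ring.
have -> : qb q x - qb q u = q x - q u by rewrite /qb; ring.
by rewrite distrC; apply: hq; rewrite ltW.
Qed.

(** A bound for the right derivatives that depends on the path through [K] and [theta] only, hence
    is common to all partial sums and their limit. *)
Let Bd : R := (gamma_fun (1 - 2^-1))^-1 * (K * T `^ (theta - 2^-1) +
  2^-1 * (K * (T `^ (theta - 2^-1) / (theta - 2^-1)))).

Let clampE (q : R -> R) x : 0 <= x <= T -> q (Num.max 0 (Num.min x T)) = q x.
Proof. by move=> /andP[x0 xT]; rewrite (min_idPl xT) (max_idPr x0). Qed.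

Let mquot q x : hoelder_path q -> 0 < x < T ->
  measurable_fun `]x, T[ (fun u : R => (qb q x - qb q u) / (u - x) `^ (1 + 2^-1)).
Proof.
move=> hq /andP[x0 xT]; have [cq _ qcE] := clamp_hoelder hq.
have mq : measurable_fun setT (fun s : R => q (Num.max 0 (Num.min s T))) by exact: continuous_measurable_fun.
have : measurable_fun `]x, T[ (fun u : R => (qb q x - (q (Num.max 0 (Num.min u T)) - q T)) / (u - x) `^ (1 + 2^-1)).
  apply: measurable_funTS; apply: measurable_funM.
    by apply: measurable_funB => //; exact: measurable_funB.
  apply: measurable_invr; apply: (measurableT_comp (measurable_powR _)); exact: measurable_funB.
apply: eq_measurable_fun => u; rewrite inE/= in_itv/= => /andP[u0 uT].
by rewrite clampE// (ltW uT) (le_trans (ltW x0) (ltW u0)).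
Qed.

Let iq q x : hoelder_path q -> 0 < x < T ->
  mu.-integrable `]x, T[ (EFin \o (fun u => (qb q x - qb q u) / (u - x) `^ (1 + 2^-1))).
Proof.
move=> hq xT; have /andP[x0 xT'] := xT; have [ik _] := integral_k xT'.
have mI : measurable (`]x, T[%classic : set R) by exact: measurable_itv.
apply: (integrable_ler mu mI _ (fun u => K * k x u)).
- exact: mquot.
- by move=> u; rewrite /= in_itv/= => /andP[u0 uT]; exact: quotient_le.
- exact: (integrable_scaler mu mI).
Qed.

Let half : 1 - 2^-1 = 2^-1 :> R. Proof. lra. Qed.

Lemma hoelder_right_fderivable q : hoelder_path q -> right_fderivable (1 - 2^-1) 0 T (fun y => q y - q T).
Proof. by rewrite half => hq x xT; exact: iq. Qed.

Lemma right_fderiv_le q x : hoelder_path q -> 0 < x < T ->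
  `|right_fderiv (1 - 2^-1) T (fun y => q y - q T) x| <= Bd.
Proof.
move=> hq xT; have /andP[x0 xT'] := xT; have [ik kE] := integral_k xT'.
have mI : measurable (`]x, T[%classic : set R) by exact: measurable_itv.
have h01 : 0 < (1 - 2^-1 : R) < 1 by apply/andP; split; lra.
have Gp := gamma_fun_gt0 h01.
have d0 : 0 < T - x by rewrite subr_gt0.
have dT : (T - x) `^ (theta - 2^-1) <= T `^ (theta - 2^-1).
  by apply: ge0_ler_powR; rewrite ?nnegrE ?(ltW g0) ?(ltW d0) ?(ltW T0)//; lra.
rewrite {1}half /right_fderiv /Bd normrM ger0_norm ?invr_ge0 ?(ltW Gp)//.
apply: ler_wpM2l; first by rewrite invr_ge0 ltW.
apply: le_trans (ler_normD _ _) _; apply: lerD.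
  rewrite normrM normfV (ger0_norm (powR_ge0 _ _)) ler_pdivrMr ?powR_gt0//.
  apply: (@le_trans _ _ (K * (T - x) `^ theta)).
    by rewrite distrC; apply: hq => //; exact: ltW.
  rewrite -mulrA; apply: ler_wpM2l => //.
  have -> : theta = (theta - 2^-1) + 2^-1 by ring.
  by rewrite gt0_powRD// addrK; apply: ler_wpM2r => //; exact: powR_ge0.
rewrite normrM ger0_norm ?invr_ge0//; apply: ler_wpM2l; first by rewrite invr_ge0.
have h1 : `|\int[mu]_(u in `]x, T[) ((qb q x - qb q u) / (u - x) `^ (1 + 2^-1))| <=
    \int[mu]_(u in `]x, T[) `|(qb q x - qb q u) / (u - x) `^ (1 + 2^-1)|.
  by apply: le_normr_Rintegral => //; exact: iq.
apply: (le_trans h1); apply: (@le_trans _ _ (\int[mu]_(u in `]x, T[) (K * k x u))).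
  apply: le_Rintegral => //.
  - by apply: (integrable_normr mu); exact: iq.
  - exact: (integrable_scaler mu mI).
  - by move=> u; rewrite /= in_itv/= => /andP[u0 uT]; exact: quotient_le.
rewrite RintegralZl// kE; apply: ler_wpM2l => //.
by rewrite ler_wpM2r ?invr_ge0 ?(ltW g0).
Qed.

Lemma measurable_right_fderiv_hoelder q : hoelder_path q ->
  measurable_fun `[0, T] (right_fderiv (1 - 2^-1) T (fun y => q y - q T)).
Proof.
move=> hq; have [cq _ qcE] := clamp_hoelder hq.
have mq : measurable_fun setT (fun s : R => q (Num.max 0 (Num.min s T)) - q T).
  by apply: measurable_funB => //; exact: continuous_measurable_fun.
have := measurable_funTS (D := `[0, T]%classic) (measurable_right_fderiv (1 - 2^-1) T mq).
apply: eq_measurable_fun => x; rewrite inE/= in_itv/= => /andP[x0 xT].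
rewrite /right_fderiv clampE ?x0//; congr (_ * (_ + _ * _)).
apply: eq_Rintegral => u; rewrite inE/= in_itv/= => /andP[u0 uT].
by rewrite clampE// (ltW uT) (le_trans x0 (ltW u0)).
Qed.

Lemma essentially_bounded_right_fderiv q : hoelder_path q ->
  essentially_bounded `[0, T] (right_fderiv (1 - 2^-1) T (fun y => q y - q T)).
Proof.
move=> hq; split; first exact: measurable_right_fderiv_hoelder.
exists Bd.
(* The estimate holds in the open interval; the two endpoints form a null set. *)
have ns (a : R) : mu.-negligible [set a] by exists [set a]; split => //; exact: lebesgue_measure_set1.
apply: (negligibleS _ (negligibleU (ns 0) (ns T))).
move=> x /= hx; apply: contrapT => /not_orP[x0 xT]; apply: hx; rewrite in_itv/= => /andP[h1 h2].
  by apply: right_fderiv_le => //; rewrite !lt_neqAle h1 h2 !andbT; apply/andP; split; apply/eqP => //; exact/nesym.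
Qed.

Lemma cvg_right_fderiv (q : nat -> R -> R) (q' : R -> R) x : (forall n, hoelder_path (q n)) -> hoelder_path q' ->
  (forall s, 0 <= s <= T -> q n s @[n --> \oo] --> q' s) -> 0 < x < T ->
  right_fderiv (1 - 2^-1) T (fun y => q n y - q n T) x @[n --> \oo] -->
  right_fderiv (1 - 2^-1) T (fun y => q' y - q' T) x.
Proof.
move=> hq hq' cq xT; have /andP[x0 xT'] := xT; have [ik _] := integral_k xT'.
have mI : measurable (`]x, T[%classic : set R) by exact: measurable_itv.
have cb s : 0 <= s <= T -> q n s - q n T @[n --> \oo] --> q' s - q' T.
  by move=> sT; apply: cvgB; apply: cq => //; rewrite lexx ltW.
have cx : q n x - q n T @[n --> \oo] --> q' x - q' T by apply: cb; rewrite !ltW.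
rewrite half /right_fderiv; apply: cvgMr; apply: cvgD; first by apply: cvgMl.
apply: cvgMr.
have mqn n := mquot (hq n) xT; have mq' := mquot hq' xT.
refine (dominated_cvg_Rintegral mu mI _ _ (fun u => K * k x u) mqn mq' _ (integrable_scaler mu mI _ _ ik) _).
- apply: aeW => u; rewrite /= in_itv/= => /andP[u0 uT].
  by apply: cvgMl; apply: cvgB => //; apply: cb; rewrite (ltW uT) (le_trans (ltW x0) (ltW u0)).
- by apply: aeW => u n; rewrite /= in_itv/= => /andP[u0 uT]; apply: quotient_le.
Qed.

Variables (p pc : R -> R) (Mp : R).
Hypotheses (cpc : continuous pc) (pcM : forall x, `|pc x| <= Mp) (pcE : forall x, 0 < x < T -> pc x = p x).
Hypotheses (lp : left_fderivable 2^-1 0 T p)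
  (ip : mu.-integrable `[0, T] (fun x => (left_fderiv 2^-1 0 p x)%:E)).

Lemma hoelder_frac_admissible q : hoelder_path q -> frac_admissible 0 T p q 2^-1.
Proof.
move=> hq; split => //.
- by apply/andP; split; lra.
- exact: hoelder_right_fderivable.
- exact: essentially_bounded_right_fderiv.
Qed.

(** Dominated convergence twice: inside the right derivatives, with the majorant K (u - x)^(theta -
    3/2), and in the outer integral, with [Bd] times the absolute left derivative. All integrals are
    first rewritten with the order 1/2. *)
Lemma cvg_frac_integral (q : nat -> R -> R) (q' : R -> R) : (forall n, hoelder_path (q n)) -> hoelder_path q' ->
  (forall s, 0 <= s <= T -> q n s @[n --> \oo] --> q' s) ->
  frac_integral 0 T p (q n) @[n --> \oo] --> frac_integral 0 T p q'.
Proof.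
move=> hq hq' cq.
have E q0 : hoelder_path q0 -> frac_integral 0 T p q0 = - \int[mu]_(x in `]0, T[)
    (left_fderiv 2^-1 0 p x * right_fderiv (1 - 2^-1) T (fun y => q0 y - q0 T) x).
  move=> h0; have [c1 c2 c3] := clamp_hoelder h0.
  rewrite (frac_integralE T0 cpc pcM pcE c1 c2 c3 (hoelder_frac_admissible h0)); congr (- _).
  rewrite /Rintegral; congr fine; apply: integral_itv_bndoo; apply/measurable_EFinP.
  have m1 : measurable_fun `[0, T] (left_fderiv 2^-1 0 p).
    by apply/measurable_EFinP; exact: measurable_int ip.
  have := measurable_funM m1 (measurable_right_fderiv_hoelder h0).
  by apply: measurable_funS => //; exact: subset_itv_oo_cc.
rewrite (E _ hq') (_ : (fun n => _) = (fun n => - \int[mu]_(x in `]0, T[)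
    (left_fderiv 2^-1 0 p x * right_fderiv (1 - 2^-1) T (fun y => q n y - q n T) x))); last first.
  by apply/funext => n; exact: E.
apply: cvgN.
have ip' : mu.-integrable `]0, T[ (EFin \o left_fderiv 2^-1 0 p).
  by apply: integrableS ip => //; exact: subset_itv_oo_cc.
have m1 : measurable_fun `]0, T[ (left_fderiv 2^-1 0 p) by apply/measurable_EFinP; exact: measurable_int ip'.
have m2 q0 : hoelder_path q0 -> measurable_fun `]0, T[ (right_fderiv (1 - 2^-1) T (fun y => q0 y - q0 T)).
  move=> h0; apply: measurable_funS (measurable_right_fderiv_hoelder h0) => //; exact: subset_itv_oo_cc.
have m3 n := measurable_funM m1 (m2 _ (hq n)).
have m4 := measurable_funM m1 (m2 _ hq').
refine (dominated_cvg_Rintegral mu mT _ _ (fun x => Bd * `|left_fderiv 2^-1 0 p x|) m3 m4 _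
  (integrable_scaler mu mT _ _ (integrable_normr mu _ ip')) _).
- by apply: aeW => x; rewrite /= in_itv/= => xT; apply: cvgMr; exact: cvg_right_fderiv.
- apply: aeW => x n; rewrite /= in_itv/= => xT; rewrite normrM mulrC.
  by apply: ler_wpM2r => //; exact: right_fderiv_le.
Qed.

End hoelder_paths.

(** * Almost sure convergence of the mild solutions *)

Theorem theorem4 (R : realType) (alpha H gamma eta : R)
    (halpha : 1 < alpha < 2) (hH : 2^-1 < H < 1) (hgamma : 2^-1 < gamma < 1)
    (heta : 0 < eta)
    (* coefficients *)
    (U0 : R -> R) (sigma : R -> R -> R)
    (U0_meas : measurable_fun [set: R] U0)
    (U0_bounded : exists M : R, forall x, `|U0 x| <= M)
    (sigma_bounded : exists M : R, forall t x : R, 0 <= t -> `|sigma t x| <= M)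
    (sigma_hoelder : exists C : R, forall t1 t2 x1 x2 : R, 0 <= t1 -> 0 <= t2 ->
       `|sigma t1 x1 - sigma t2 x2| <=
         C * (`|t1 - t2| `^ gamma + `|x1 - x2| `^ gamma))
    (* LePage data *)
    (d1 d2 d3 : measure_display) (T1 : measurableType d1)
    (T2 : measurableType d2) (T3 : measurableType d3)
    (P1 : probability T1 R) (P2 : probability T2 R) (P3 : probability T3 R)
    (G : nat -> {RV P1 >-> R}) (xi : nat -> {RV P2 >-> R})
    (g : nat -> T3 -> R[i])
    (G_arrival : poisson_arrival_times P1 1 (fun k => G k : T1 -> R))
    (xi_indep : mutually_independent P2 (fun k => xi k : T2 -> R))
    (xi_density : forall k, has_density (xi k) (phi eta))
    (g_rv : forall k, complex_rv (g k))
    (g_indep : mutually_independent P3 (fun k w => RtoR2 (g k w)))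
    (g_gaussian : forall k, complex_gaussian P3 (g k))
    (g_rotinv : forall k, rotationally_invariant P3 (g k))
    (g_moment : forall k,
       (\int[P3]_w (`|complex.Re (g k w)| `^ alpha)%:E = 1)%E)
    (* the process Z *)
    (Z : R -> T1 * T2 * T3 -> R)
    (Z_lepage : forall t : R, 0 <= t -> {ae ((P1 \x P2) \x P3)%E, forall w,
       (fun n => lepage_sum alpha H eta G xi g n t w) @ \oo --> Z t w})
    (Z_continuous : {ae ((P1 \x P2) \x P3)%E, forall w,
       {within `[0, +oo[, continuous (fun t => Z t w)}}) :
  forall t x : R, 0 <= t ->
  {ae ((P1 \x P2) \x P3)%E, forall w,
     let ZN n s := lepage_sum alpha H eta G xi g n s w in
     [/\ 0 < t -> frac_integrable 0 t (mild_integrand sigma t x) (Z ^~ w),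
         0 < t -> forall N, (0 < N)%N ->
           frac_integrable 0 t (mild_integrand sigma t x) (ZN N) &
         (fun N => mild_solution U0 sigma (ZN N) t x) @ \oo -->
           mild_solution U0 sigma (Z ^~ w) t x]}.
Proof.
move=> t x t0.
have [tz|t_neq0] := eqVneq t 0.
  apply: aeW => w /=; rewrite tz ltxx; split=> //.
  by rewrite /mild_solution eqxx; exact: cvg_cst.
have tp : 0 < t by rewrite lt_neqAle eq_sym t_neq0.
have [M sM] := sigma_bounded; have [C sC] := sigma_hoelder.
have [theta th aeH] := lepage_holder xi halpha hH heta G_arrival g_rv g_indep g_gaussian g_rotinv g_moment tp.
have th0 : 0 < theta by case/andP: th => h _; apply: lt_trans h; rewrite invr_gt0.
(* The exceptional set of [Z_lepage] depends on the time; the union over the countably many dyadic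
   times is still null. *)
have aeD : {ae ((P1 \x P2) \x P3)%E, forall w, forall k j : nat,
    (fun n => lepage_sum alpha H eta G xi g n (k%:R / 2 ^+ j) w) @ \oo --> Z (k%:R / 2 ^+ j) w}.
  apply/ae_foralln => k; apply/ae_foralln => j; apply: Z_lepage.
  by rewrite divr_ge0// exprn_ge0.
have aeF := ae_filter_ringOfSetsType ((P1 \x P2) \x P3)%E.
apply: (@filterS3 _ _ aeF _ _ _ _ _ aeH aeD Z_continuous) => w [K K0 hK] hD hC.
have [ZH Zcvg] := hoelder_path_limit th0 K0 hK hD hC.
have cpc : continuous (mild_scaled sigma t x) by exact: (continuous_mild_scaled hgamma sM sC).
have pcM y : `|mild_scaled sigma t x y| <= M by exact: (mild_scaled_bounded hgamma sM sC).
have pcE s : 0 < s < t -> mild_scaled sigma t x s = mild_integrand sigma t x s.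
  by move=> /andP[s0 st]; rewrite (mild_scaledE hgamma sM sC)// !ltW.
have lp : left_fderivable 2^-1 0 t (mild_integrand sigma t x).
  exact: (mild_left_fderivable hgamma sM sC).
have ip : (@lebesgue_measure R).-integrable `[0, t] (fun s => (left_fderiv 2^-1 0 (mild_integrand sigma t x) s)%:E).
  exact: (mild_integrable_left_fderiv hgamma sM sC).
split.
- by move=> _; exists 2^-1; exact: (hoelder_frac_admissible tp th K0 lp ip ZH).
- by move=> _ N _; exists 2^-1; exact: (hoelder_frac_admissible tp th K0 lp ip (hK N)).
rewrite /mild_solution (negbTE t_neq0); apply: cvgD; first exact: cvg_cst.
exact: (cvg_frac_integral tp th K0 cpc pcM pcE lp ip hK ZH Zcvg).
Qed.
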